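(* Let $T$ be a map with $\mathsf{d}_T(s)=\zeta(s)$, where $\zeta$ is the Riemann zeta function (that is, $T$ has exactly one closed orbit of each length $n\ge1$). Then the orbit Dirichlet series $\mathsf{d}_{T\times T\times T}(s)$ has abscissa of convergence at $3$, has a meromorphic extension to the half-plane $\Re(s)>1$, and has a natural boundary at $\Re(s)=1$.
   Context: A map means a map $T:X\to X$ of a set (e.g. a continuous map of a compact metric space). A closed orbit of length $n$ is a set $\{x,Tx,\dots,T^{n}x=x\}$ of cardinality $n$; $\mathsf{O}_T(n)$ is the number of closed orbits of length $n$, and it is always assumed that $\mathsf{O}_T(n)<\infty$ for all $n\ge1$. The orbit Dirichlet series of $T$ is $\mathsf{d}_T(s)=\sum_{n=1}^{\infty}\frac{\mathsf{O}_T(n)}{n^s}$. $T\times T\times T$ denotes the Cartesian product map $(x,y,z)\mapsto(Tx,Ty,Tz)$ on $X\times X\times X$. That the line $\Re(s)=1$ is a natural boundary means that the meromorphic extension to $\Re(s)>1$ cannot be continued meromorphically to a neighbourhood of any point of the line $\Re(s)=1$. *)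

(* Defs.v *)
From Stdlib Require Import Reals List ClassicalEpsilon.
From Coquelicot Require Import Coquelicot.
Open Scope R_scope.

(** * Closed orbits of a map *)

Definition has_card {A : Type} (P : A -> Prop) (n : nat) : Prop :=
  exists l : list A, NoDup l /\ length l = n /\ forall x, In x l <-> P x.

(** [T^i x] is [Nat.iter i T x]. *)
Definition closed_orbit {X : Type} (T : X -> X) (n : nat) (A : X -> Prop) : Prop :=
  (exists x : X, Nat.iter n T x = x /\
     forall y, A y <-> exists i : nat, (i <= n)%nat /\ y = Nat.iter i T x) /\
  has_card A n.

Definition finitely_many_orbits {X : Type} (T : X -> X) : Prop :=
  forall n : nat, (1 <= n)%nat -> exists k : nat, has_card (closed_orbit T n) k.

(** Arbitrary when there are infinitely many closed orbits of length [n]. *)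
Definition orbit_count {X : Type} (T : X -> X) (n : nat) : nat :=
  epsilon (inhabits 0%nat) (fun k => has_card (closed_orbit T n) k).

Definition cube_map {X : Type} (T : X -> X) (p : X * X * X) : X * X * X :=
  let '(x, y, z) := p in (T x, T y, T z).

(** * Dirichlet series *)

Definition Cexp (z : C) : C := (exp (Re z) * cos (Im z), exp (Re z) * sin (Im z)).

(** [a n / n^s], for [n >= 1]. *)
Definition dirichlet_term (a : nat -> R) (s : C) (n : nat) : C :=
  (RtoC (a n) * Cexp (- s * RtoC (ln (INR n))))%C.

(** The terms are indexed from [n = 1]; [a 0] is ignored. *)
Definition is_dirichlet (a : nat -> R) (s l : C) : Prop :=
  @is_series C_AbsRing C_NormedModule (fun k => dirichlet_term a s (S k)) l.

Definition ex_dirichlet (a : nat -> R) (s : C) : Prop :=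
  exists l : C, is_dirichlet a s l.

Definition is_abscissa_of_convergence (a : nat -> R) (sigma : R) : Prop :=
  (forall s : C, sigma < Re s -> ex_dirichlet a s) /\
  (forall s : C, Re s < sigma -> ~ ex_dirichlet a s).

Definition orbit_coeff {X : Type} (T : X -> X) (n : nat) : R :=
  INR (orbit_count T n).

(** The sum of [1 / n^s]: this is the Riemann zeta function only for [1 < Re s]. *)
Definition zeta (s : C) : C :=
  (Series (fun k => Re (dirichlet_term (fun _ => 1) s (S k))),
   Series (fun k => Im (dirichlet_term (fun _ => 1) s (S k)))).

(** * Meromorphic functions *)

(** A meromorphic function is represented by a total function whose values at
    its poles (more generally, on a discrete set) are irrelevant; accordingly,
    meromorphic functions are compared on punctured neighbourhoods. *)
Definition meromorphic_at (f : C -> C) (z0 : C) : Prop :=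
  exists (n : nat) (g : C -> C),
    locally z0 (fun z => @ex_derive C_AbsRing C_NormedModule g z) /\
    locally' z0 (fun z => f z = (g z / (z - z0) ^ n)%C).

Definition meromorphic_on (U : C -> Prop) (f : C -> C) : Prop :=
  forall z, U z -> meromorphic_at f z.

Definition meromorphic_eq_on (U : C -> Prop) (f g : C -> C) : Prop :=
  forall z, U z -> locally' z (fun w => f w = g w).

Definition half_plane (sigma : R) (s : C) : Prop := sigma < Re s.

(** The line [Re s = sigma] is a natural boundary of [F], meromorphic on
    [sigma < Re s]. *)
Definition natural_boundary_at (sigma : R) (F : C -> C) : Prop :=
  forall z0 : C, Re z0 = sigma ->
    ~ exists (V : C -> Prop) (G : C -> C),
        open V /\ V z0 /\ meromorphic_on V G /\
        meromorphic_eq_on (fun z => V z /\ half_plane sigma z) F G.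

(* Main.v *)
Require Import Defs.
From Stdlib Require Import Reals Lra Lia ZArith List Permutation.
From Stdlib Require Import ClassicalEpsilon FunctionalExtensionality PropExtensionality.
From mathcomp Require ssreflect ssrbool eqtype ssrnat seq div bigop prime binomial.
From Coquelicot Require Import Coquelicot.

(* Since [T] has one orbit of each length, [T^n] has [sigma(n)] fixed points, and the number [a n] of orbits of
   length [n] of the cube satisfies [sum_{d | n} d a(d) = sigma(n)^3].  With [X = p^(1-s)] this gives
   [d(s) = zeta(s) zeta(s-1) zeta(s-2) prod_p (1 + 2X + 2X/p + X^2/p)].

   Continuation: for each [K] there are integers [c_k] with [(1 + 2X) prod_{k<K} (1 - X^k)^(c_k) = 1 + O(X^K)], so
   the Euler product equals [prod_{k<K} zeta(k(s-1))^(c_k)] times a product converging for [Re s > 1 + 1/K].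

   Boundary: each Euler factor vanishes at points with real part about [1 + log 2 / log p], at distance
   [O(1 / log p)] from any given point of the line.  Such a zero can only be cancelled if some [k(s-1)], with [k = O(log p)], or
   one of [s], [s-1], [s-2] is a zero or pole of zeta.  A Jensen-type bound gives polynomially many of these,
   hence polylogarithmically many cancelled primes up to [x], while Chebyshev gives at least [c x / log x] primes.
   So infinitely many zeros survive near every point of the line, and a meromorphic continuation
   would vanish identically there. *)

Open Scope nat_scope.

(** The factor [zeta_c (s - 2)], at points whose real part is just above 1, forces a continuation of
    zeta to [Re s > -1] and a count of its zeros there. Neither a functional equation nor a
    zero-free region is used: Euler's transformation of the alternating series reaches [Re s > -7]
    with polynomial growth, which leaves room for the discs of the count. Zeros and poles are
    counted together, as zeros of the single function [Phi]. The index [K] cannot stay fixed: the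
    zero attached to [p] lies so close to the line that [K] must be of the order of [ln p]. Both the
    number of arguments of zeta and their heights grow with [K], but only like [ln p], so any
    polynomial bound in the height is good enough. The series and the Euler product are compared by
    sieving primes out of the series one at a time; every identity then involves finite products
    only, and the sieved series tends to its first coefficient. The last contradiction is a finite
    count: near the boundary point the numerator of a supposed continuation has a point where it
    does not vanish, hence boundedly many zeros around it. *)

Definition primeb : nat -> bool := prime.prime.

(** * Primes in terms of [Nat.divide], and a Chebyshev lower bound *)

Module PrimeFacts.
Import ssreflect ssrbool eqtype ssrnat seq div bigop prime binomial.

Lemma dvdnE d n : Nat.divide d n <-> d %| n.
Proof.
split; first by move=> [z ->]; rewrite -[(z * d)%coq_nat]/(z * d) dvdn_mull.
by move=> /dvdnP [k ->]; exists k.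
Qed.

Lemma primeb_ge2 p : primeb p = true -> Peano.le 2 p.
Proof. by move=> /prime_gt1 /leP. Qed.

Lemma primeb_factor n : Peano.le 2 n -> exists p, primeb p = true /\ Nat.divide p n.
Proof.
by move=> /leP Hn; exists (pdiv n); split; [exact: pdiv_prime | apply/dvdnE; exact: pdiv_dvd].
Qed.

Lemma primeb_mul p a b : primeb p = true -> Nat.divide p (Nat.mul a b) ->
  Nat.divide p a \/ Nat.divide p b.
Proof.
by move=> Hp /dvdnE; rewrite -[(a * b)%coq_nat]/(a * b) Euclid_dvdM // => /orP [] /dvdnE; auto.
Qed.

Lemma primeb_dvd_prime p q : primeb p = true -> primeb q = true -> Nat.divide p q -> p = q.
Proof. by move=> Hp Hq /dvdnE; rewrite dvdn_prime2 // => /eqP. Qed.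

(** By Legendre's formula the exponent is the sum over [k] of [2n %/ p^k - 2 (n %/ p^k)]. Each term
    is at most 1, and those with [p^k > 2n] vanish, so the exponent is at most
    [trunc_log p n.*2]. *)
Lemma logn_central_bin p n : prime p -> 0 < n -> p ^ logn p 'C(n.*2, n) <= n.*2.
Proof.
move=> pr_p n_gt0; have p_gt1 := prime_gt1 pr_p.
have n2_gt0 : 0 < n.*2 by rewrite double_gt0.
have nn : n <= n.*2 by rewrite -addnn leq_addr.
apply: leq_trans (trunc_logP p_gt1 n2_gt0).
rewrite leq_exp2l //.
have C_gt0 : 0 < 'C(n.*2, n) by rewrite bin_gt0.
have E : logn p 'C(n.*2, n) + (logn p n`! + logn p n`!) = logn p (n.*2)`!.
  have := bin_fact nn; rewrite -{2}addnn addnK => <-.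
  by rewrite !lognM ?muln_gt0 ?fact_gt0.
rewrite !logn_fact // in E.
have le_sum (k : nat) : n.*2 %/ k <= (n %/ k).*2 + 1.
  case: k => [|k]; first by rewrite !divn0.
  by rewrite addn1 -ltnS -doubleS ltn_divLR // -doubleMl ltn_double ltn_ceil.
set L := trunc_log p n.*2.
have LE : L <= n.*2.
  have := trunc_logP p_gt1 n2_gt0; apply: leq_trans.
  by apply: ltnW; exact: ltn_expl.
(* The terms beyond [L] vanish, so the Legendre sums for [2n] and for [n] can be cut at the same
   place. *)
have split_sum (F : nat -> nat) : (forall k, L < k -> F k = 0) ->
    \sum_(1 <= k < n.*2.+1) F k = \sum_(1 <= k < L.+1) F k.
  move=> F0; rewrite (big_cat_nat (n := L.+1)) //=.
  by rewrite [X in _ + X]big_nat_cond [X in _ + X]big1 ?addn0 // => i /andP [/andP [Hi _] _]; exact: F0.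
have pk k : L < k -> n.*2 < p ^ k.
  move=> Hk; apply: leq_trans (trunc_log_ltn n.*2 p_gt1) _.
  by rewrite leq_exp2l.
have E2 : \sum_(1 <= k < n.*2.+1) n.*2 %/ p ^ k = \sum_(1 <= k < L.+1) n.*2 %/ p ^ k.
  by apply: split_sum => k Hk; rewrite divn_small // pk.
have E1 : \sum_(1 <= k < n.+1) n %/ p ^ k = \sum_(1 <= k < L.+1) n %/ p ^ k.
  rewrite -(split_sum (fun k => n %/ p ^ k)).
    rewrite [RHS](big_cat_nat (n := n.+1)) //=.
    rewrite [X in _ + X]big_nat_cond [X in _ + X]big1 ?addn0 // => i /andP [/andP [Hi _] _].
    by rewrite divn_small //; apply: (leq_trans Hi); apply: ltnW; exact: ltn_expl.
  by move=> k Hk; rewrite divn_small //; apply: leq_ltn_trans nn (pk _ Hk).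
rewrite E1 E2 in E.
have : \sum_(1 <= k < L.+1) n.*2 %/ p ^ k <= \sum_(1 <= k < L.+1) ((n %/ p ^ k).*2 + 1).
  by apply: leq_sum => k _; exact: le_sum.
rewrite -E big_split /= sum_nat_const_nat muln1 subn1 /=.
have -> : \sum_(1 <= k < L.+1) (n %/ p ^ k).*2 =
    \sum_(1 <= k < L.+1) n %/ p ^ k + \sum_(1 <= k < L.+1) n %/ p ^ k.
  by rewrite -big_split /=; apply: eq_bigr => k _; rewrite addnn.
by rewrite addnC leq_add2l.
Qed.

(** Pascal's rule doubles the bound: ['C(2n+2, n+1)] is a sum of two coefficients, each at least
    ['C(2n, n)]. *)
Lemma central_bin_lower n : 2 ^ n <= 'C(n.*2, n).
Proof.
elim: n => [|n IHn]; first by rewrite bin0.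
rewrite expnS doubleS binS.
have H : 'C(n.*2, n) <= 'C(n.*2.+1, n) by rewrite leq_bin2l.
have H' : 'C(n.*2, n) <= 'C(n.*2.+1, n.+1) by rewrite binS leq_addl.
by rewrite mul2n -addnn leq_add //; apply: leq_trans IHn _.
Qed.

(** ['C(2n, n)] is at least [2^n], and it is a product over the primes up to [2n] of prime powers
    none of which exceeds [2n]. *)
Lemma chebyshev n : Peano.le 1 n ->
  Peano.le (Nat.pow 2 n) (Nat.pow (Nat.mul 2 n) (length (List.filter primeb (List.seq 1 (Nat.mul 2 n))))).
Proof.
move=> /leP n_gt0.
have EN a b : Nat.pow a b = a ^ b.
  by elim: b => [|b IHb] //=; rewrite IHb expnS.
have -> : Nat.mul 2 n = n.*2 by rewrite -mul2n.
rewrite !EN; apply/leP.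
have Eseq m k : List.seq m k = iota m k by elim: k m => [|k IHk] m //=; rewrite IHk.
have Efil (s : seq nat) : List.filter primeb s = filter prime s by elim: s => [|a s IHs] //=; rewrite IHs.
have Elen (s : seq nat) : length s = size s by elim: s => [|a s IHs] //=; rewrite IHs.
rewrite Elen Efil Eseq size_filter.
apply: (leq_trans (central_bin_lower n)).
have C_gt0 : 0 < 'C(n.*2, n) by rewrite bin_gt0 -addnn leq_addr.
have H : 'C(n.*2, n) = \prod_(i <- iota 1 n.*2 | prime i) i ^ logn i 'C(n.*2, n).
  have small i : n.*2 < i -> i ^ logn i 'C(n.*2, n) = 1.
    move=> Hi; case pr : (prime i); last by rewrite lognE pr.
    have := logn_central_bin i n pr n_gt0; case: (logn i _) => [|m] // Hm.
    have : i <= i ^ m.+1 by rewrite expnS leq_pmulr // expn_gt0 prime_gt0.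
    by move=> /leq_trans /(_ Hm); rewrite leqNgt Hi.
  have lo i : i ^ logn i 'C(n.*2, n) = if prime i then i ^ logn i 'C(n.*2, n) else 1.
    by case pr : (prime i) => //; rewrite lognE pr.
  (* The prime decomposition runs up to the number itself; widening the range to the maximum with
     [2n] allows the cut at [2n] in all cases. *)
  rewrite -[LHS](partnT C_gt0) (widen_partn _ (leq_maxl 'C(n.*2, n) n.*2)).
  rewrite (eq_bigl xpredT) //.
  rewrite (big_cat_nat (n := n.*2.+1)) //=; last by rewrite ltnS leq_maxr.
  rewrite [X in _ * X]big_nat_cond [X in _ * X]big1 ?muln1; last first.
    by move=> i /andP [/andP [Hi _] _]; exact: small.
  rewrite big_ltn // lognE /= mul1n /index_iota subn1 /= [RHS]big_mkcond /=.
  by apply: eq_bigr => i _; exact: lo.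
have -> : n.*2 ^ count prime (iota 1 n.*2) = \prod_(i <- iota 1 n.*2 | prime i) n.*2.
  by rewrite big_const_seq iter_muln_1.
rewrite H; apply: leq_prod => i pr; by apply: logn_central_bin.
Qed.
End PrimeFacts.

Import PrimeFacts.

(** * Counting periodic points *)

Lemma has_card_unique {A} (P : A -> Prop) n m : has_card P n -> has_card P m -> n = m.
Proof.
  intros [l [H1 [H2 H3]]] [l' [H1' [H2' H3']]]. subst.
  apply Nat.le_antisymm; apply NoDup_incl_length; auto; intros x Hx.
  - apply H3', H3, Hx.
  - apply H3, H3', Hx.
Qed.

Lemma has_card_ext {A} (P Q : A -> Prop) n : (forall x, P x <-> Q x) -> has_card P n -> has_card Q n.
Proof.
  intros H [l [H1 [H2 H3]]]. exists l. split; auto. split; auto. intros x. rewrite H3. apply H.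
Qed.

Lemma NoDup_prod {A B} (l : list A) (l' : list B) : NoDup l -> NoDup l' -> NoDup (list_prod l l').
Proof.
  intros H H'. induction H as [|a l Ha H IH]; simpl; [constructor|].
  apply NoDup_app; auto.
  - apply FinFun.Injective_map_NoDup; auto. intros x y E. congruence.
  - intros [x y] Hx Hy. apply in_map_iff in Hx. destruct Hx as [z [E Hz]]. injection E as -> ->.
    apply in_prod_iff in Hy. tauto.
Qed.

Lemma has_card_prod {A B} (P : A -> Prop) (Q : B -> Prop) n m : has_card P n -> has_card Q m ->
  has_card (fun z => P (fst z) /\ Q (snd z)) (n * m).
Proof.
  intros [l [H1 [H2 H3]]] [l' [H1' [H2' H3']]]. exists (list_prod l l'). split; [apply NoDup_prod; auto|].
  split; [rewrite length_prod; congruence|].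
  intros [x y]. rewrite in_prod_iff, H3, H3'. reflexivity.
Qed.

Definition pdec {A} (P : A -> Prop) (x : A) : bool := if excluded_middle_informative (P x) then true else false.

Lemma pdec_iff {A} (P : A -> Prop) x : pdec P x = true <-> P x.
Proof. unfold pdec. destruct (excluded_middle_informative (P x)); split; auto; discriminate. Qed.

Lemma has_card_subset {A} (P Q : A -> Prop) n : has_card P n -> (forall x, Q x -> P x) ->
  exists m, has_card Q m.
Proof.
  intros [l [H1 [H2 H3]]] H. exists (length (filter (pdec Q) l)), (filter (pdec Q) l).
  split; [apply NoDup_filter, H1|]. split; auto.
  intros x. rewrite filter_In, pdec_iff, H3. split; [tauto|]. auto.
Qed.

Lemma has_card_le {A} (P Q : A -> Prop) n m : has_card P n -> has_card Q m ->
  (forall x, Q x -> P x) -> m <= n.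
Proof.
  intros [l [H1 [H2 H3]]] [l' [H1' [H2' H3']]] H. subst.
  apply NoDup_incl_length; auto. intros x Hx. apply H3, H, H3', Hx.
Qed.

Lemma has_card_union {I A} (L : list I) (P : I -> A -> Prop) (c : I -> nat) : NoDup L ->
  (forall i, In i L -> has_card (P i) (c i)) ->
  (forall i j x, In i L -> In j L -> P i x -> P j x -> i = j) ->
  has_card (fun x => exists i, In i L /\ P i x) (list_sum (map c L)).
Proof.
  intros HL. induction HL as [|i L Hi HL IH]; intros Hc Hd.
  - exists nil. split; [constructor|]. split; auto. intros x. simpl. split; [tauto|]. intros [j [[] _]].
  - destruct (Hc i (or_introl eq_refl)) as [l1 [N1 [L1 E1]]].
    destruct IH as [l2 [N2 [L2 E2]]].
    { intros j Hj. apply Hc. right; auto. }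
    { intros j k x Hj Hk. apply Hd; right; auto. }
    exists (l1 ++ l2). split; [|split].
    + apply NoDup_app; auto. intros x H1 H2. apply E1 in H1. apply E2 in H2.
      destruct H2 as [j [Hj H2]]. apply Hi.
      rewrite (Hd i j x); auto; [left; auto|right; auto].
    + rewrite length_app. simpl. congruence.
    + intros x. rewrite in_app_iff, E1, E2. split.
      * intros [H|[j [Hj H]]]; [exists i|exists j]; simpl; auto.
      * intros [j [[<-|Hj] H]]; [left; auto|right; exists j; auto].
Qed.

Lemma has_card_image {A B} (P : A -> Prop) (f : A -> B) n : has_card P n ->
  exists k, has_card (fun y => exists x, P x /\ f x = y) k.
Proof.
  intros [l [H1 [H2 H3]]].
  set (dec := fun x y : B => excluded_middle_informative (x = y)).
  exists (length (nodup dec (map f l))), (nodup dec (map f l)).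
  split; [apply NoDup_nodup|]. split; auto.
  intros y. rewrite nodup_In, in_map_iff. split; intros [x Hx]; exists x; rewrite H3 in *; tauto.
Qed.

Section orbits.
Context {X : Type} (T : X -> X).

Definition fixed (n : nat) (x : X) : Prop := Nat.iter n T x = x.
Definition least_period (n : nat) (x : X) : Prop :=
  fixed n x /\ forall i, 0 < i < n -> Nat.iter i T x <> x.
Definition orb (n : nat) (x y : X) : Prop := exists i, i < n /\ y = Nat.iter i T x.

Lemma iter_add i j x : Nat.iter (i + j) T x = Nat.iter i T (Nat.iter j T x).
Proof. apply Nat.iter_add. Qed.

Lemma fixed_mul n k x : fixed n x -> fixed (k * n) x.
Proof.
  intros H. induction k as [|k IH]; [reflexivity|]. unfold fixed in *. simpl.
  rewrite iter_add, IH. exact H.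
Qed.

(** A coincidence [T^i x = T^j x] gives, after [n - j] more steps, a return to [x] at the time
    [n - j + i], which is less than [n]. *)
Lemma least_period_inj n x i j : least_period n x -> i < j < n -> Nat.iter i T x <> Nat.iter j T x.
Proof.
  intros [H1 H2] Hij E. apply (H2 (n - j + i)); [lia|].
  rewrite iter_add, E, <- iter_add. replace (n - j + j) with n by lia. exact H1.
Qed.

Lemma orb_card n x : least_period n x -> has_card (orb n x) n.
Proof.
  intros H. exists (map (fun i => Nat.iter i T x) (seq 0 n)). split; [|split].
  - apply NoDup_map_NoDup_ForallPairs; [|apply seq_NoDup].
    intros i j Hi Hj E. apply in_seq in Hi, Hj.
    destruct (lt_eq_lt_dec i j) as [[Hl|Hl]|Hl]; auto; exfalso.
    + apply (least_period_inj n x i j); auto. lia.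
    + apply (least_period_inj n x j i); auto. lia.
  - rewrite length_map, length_seq. reflexivity.
  - intros y. rewrite in_map_iff. split.
    + intros [i [<- Hi]]. apply in_seq in Hi. exists i. split; auto. lia.
    + intros [i [Hi ->]]. exists i. split; auto. apply in_seq. lia.
Qed.

Lemma orb_least_period n x y : least_period n x -> orb n x y -> least_period n y.
Proof.
  intros [H1 H2] [i [Hi ->]]. split.
  - unfold fixed. rewrite <- iter_add, Nat.add_comm, iter_add. f_equal. exact H1.
  - intros k Hk E. apply (H2 k Hk).
    (* Apply [T^(n-i)] to the supposed return of [T^i x] and use [T^n x = x]. *)
    rewrite <- H1 at 1. replace n with (n - i + i) by lia.
    rewrite iter_add, <- iter_add, Nat.add_comm, iter_add, <- (iter_add k i) .
    rewrite (iter_add k i), E, <- iter_add. replace (n - i + i) with n by lia. exact H1.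
Qed.

Lemma orb_sym_incl n x y z : least_period n x -> orb n x y -> orb n x z -> orb n y z.
Proof.
  intros [H1 H2] [i [Hi ->]] [j [Hj ->]]. unfold orb.
  destruct (le_lt_dec i j) as [H|H].
  - exists (j - i). split; [lia|]. rewrite <- iter_add. f_equal. lia.
  (* An earlier point of the cycle is reached by going round once. *)
  - exists (n - i + j). split; [lia|]. rewrite <- iter_add.
    replace (n - i + j + i) with (j + n) by lia. rewrite iter_add. f_equal. symmetry. exact H1.
Qed.

Lemma orb_refl n x : 1 <= n -> orb n x x.
Proof. intros H. exists 0. split; auto. Qed.

(** Orbits are counted as predicates in lists without repetition, so two descriptions of one orbit
    must be equal and not merely equivalent. *)
Lemma orb_eq n x y : 1 <= n -> least_period n x -> orb n x y -> orb n x = orb n y.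
Proof.
  intros Hn Hx Hy. apply functional_extensionality. intros z. apply propositional_extensionality.
  assert (Hy' : least_period n y) by (eapply orb_least_period; eauto).
  assert (Hyx : orb n y x) by (apply (orb_sym_incl n x y x); auto; apply orb_refl, Hn).
  split; intros Hz.
  - apply (orb_sym_incl n x y z); auto.
  - apply (orb_sym_incl n y x z); auto.
Qed.

Lemma closed_orbit_orb n A : 1 <= n -> closed_orbit T n A <-> exists x, least_period n x /\ orb n x = A.
Proof.
  intros Hn. split.
  - intros [[x [Hx HA]] Hc]. exists x.
    assert (EA : forall y, A y <-> orb n x y).
    { intros y. rewrite HA. split; intros [i [Hi ->]].
      - destruct (Nat.eq_dec i n) as [->|Hne].
        + exists 0. split; auto.
        + exists i. split; auto. lia.
      - exists i. split; auto. lia. }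
    split.
    + split; auto. intros i Hi E.
      (* The first [n] iterates exhaust a set of [n] elements, so they are distinct and no return
         happens before time [n]. *)
      destruct Hc as [l [N1 [L1 E1]]].
      assert (Hnd : NoDup (map (fun i => Nat.iter i T x) (seq 0 n))).
      { apply (NoDup_incl_NoDup N1).
        - rewrite length_map, length_seq. lia.
        - intros y Hy. apply E1, EA in Hy. destruct Hy as [k [Hk ->]].
          apply in_map_iff. exists k. split; auto. apply in_seq. lia. }
      assert (K : forall j, j < n -> nth j (map (fun i => Nat.iter i T x) (seq 0 n)) x = Nat.iter j T x).
      { intros j Hj. rewrite (nth_indep _ x (Nat.iter 0 T x)) by (rewrite length_map, length_seq; lia).
        rewrite (map_nth (fun i => Nat.iter i T x)), seq_nth by lia. reflexivity. }
      assert (0 = i); [|lia].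
      apply (proj1 (NoDup_nth _ x) Hnd); rewrite ?length_map, ?length_seq; try lia.
      rewrite !K by lia. symmetry. exact E.
    + apply functional_extensionality. intros y. apply propositional_extensionality. symmetry. apply EA.
  - intros [x [Hx <-]]. split; [|apply orb_card, Hx].
    exists x. split; [apply Hx|]. intros y. split; intros [i [Hi ->]].
    + exists i. split; auto. lia.
    + destruct (Nat.eq_dec i n) as [->|Hne].
      * exists 0. split; [lia|]. apply Hx.
      * exists i. split; auto. lia.
Qed.

(** The closed orbits of length [n] partition the points of least period [n], with [n] points in
    each. *)
Lemma least_period_card n k : 1 <= n -> has_card (closed_orbit T n) k -> has_card (least_period n) (n * k).
Proof.
  intros Hn [l [H1 [H2 H3]]].
  replace (n * k) with (list_sum (map (fun _ => n) l)).
  2: { rewrite <- H2. clear. induction l as [|a l IH]; simpl; [lia|]. rewrite IH. lia. }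
  apply (has_card_ext (fun x => exists A, In A l /\ A x)).
  - intros x. split.
    + intros [A [HA Hx]]. apply H3, closed_orbit_orb in HA; auto. destruct HA as [y [Hy <-]].
      eapply orb_least_period; eauto.
    + intros Hx. exists (orb n x). split; [|apply orb_refl, Hn]. apply H3, closed_orbit_orb; auto. eauto.
  - apply (has_card_union l (fun A x => A x)); auto.
    + intros A HA. apply H3 in HA. apply HA.
    + intros A B x HA HB HAx HBx. apply H3, closed_orbit_orb in HA, HB; auto.
      destruct HA as [y [Hy <-]]. destruct HB as [z [Hz <-]].
      rewrite (orb_eq n y x), (orb_eq n z x); auto.
Qed.

Lemma closed_orbit_finite n m : 1 <= n -> has_card (least_period n) m ->
  exists k, has_card (closed_orbit T n) k.
Proof.
  intros Hn Hm. destruct (has_card_image _ (orb n) m Hm) as [k Hk]. exists k.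
  revert Hk. apply has_card_ext. intros A. symmetry. apply closed_orbit_orb, Hn.
Qed.

Definition divs (n : nat) : list nat := filter (fun d => (n mod d =? 0)%nat) (seq 1 n).

Lemma divs_spec n d : 1 <= n -> In d (divs n) <-> Nat.divide d n /\ 1 <= d.
Proof.
  intros Hn. unfold divs. rewrite filter_In, in_seq, Nat.eqb_eq, Nat.Lcm0.mod_divide.
  split; [intros; split; [tauto|lia]|]. intros [H1 H2]. split; auto.
  apply Nat.divide_pos_le in H1; lia.
Qed.

Lemma divs_NoDup n : NoDup (divs n).
Proof. apply NoDup_filter, seq_NoDup. Qed.

Lemma least_period_exists n x : 1 <= n -> fixed n x -> exists d, 1 <= d /\ Nat.divide d n /\ least_period d x.
Proof.
  intros Hn Hx.
  assert (Hm : exists d, 1 <= d /\ fixed d x /\ forall i, 1 <= i -> fixed i x -> d <= i).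
  { destruct (dec_inh_nat_subset_has_unique_least_element (fun d => 1 <= d /\ fixed d x)) as [d [[[H1 H2] H3] _]].
    - intros; apply classic.
    - exists n. auto.
    - exists d. split; auto. }
  destruct Hm as [d [H1 [H2 H3]]]. exists d. split; auto. split.
  - apply Nat.Lcm0.mod_divide. destruct (Nat.eq_dec (n mod d) 0) as [E|E]; auto. exfalso.
    pose proof (Nat.mod_upper_bound n d ltac:(lia)).
    assert (K : fixed (n mod d) x).
    { unfold fixed in *. pose proof (fixed_mul d (n / d) x H2) as Q. unfold fixed in Q.
      rewrite <- Q at 1. rewrite <- iter_add. rewrite Nat.add_comm, (Nat.mul_comm (n / d)), <- Nat.div_mod_eq. exact Hx. }
    specialize (H3 (n mod d) ltac:(lia) K). lia.
  - split; auto. intros i Hi E. specialize (H3 i ltac:(lia) E). lia.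
Qed.

(** Each fixed point of [T^n] has exactly one least period, and that period divides [n]. *)
Lemma fixed_card (c : nat -> nat) n : 1 <= n -> (forall d, 1 <= d -> has_card (least_period d) (c d)) ->
  has_card (fixed n) (list_sum (map c (divs n))).
Proof.
  intros Hn Hc.
  apply (has_card_ext (fun x => exists d, In d (divs n) /\ least_period d x)).
  - intros x. split.
    + intros [d [Hd Hx]]. apply divs_spec in Hd; auto. destruct Hd as [[q ->] Hd]. apply fixed_mul, Hx.
    + intros Hx. destruct (least_period_exists n x Hn Hx) as [d [H1 [H2 H3]]].
      exists d. split; auto. apply divs_spec; auto.
  - apply has_card_union; [apply divs_NoDup| |].
    + intros d Hd. apply divs_spec in Hd; auto. apply Hc. lia.
    + intros i j x Hi Hj [Hi1 Hi2] [Hj1 Hj2]. apply divs_spec in Hi, Hj; auto.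
      destruct (lt_eq_lt_dec i j) as [[H|H]|H]; auto; exfalso.
      * apply (Hj2 i); auto. lia.
      * apply (Hi2 j); auto. lia.
Qed.

End orbits.

Lemma cube_iter {X} (T : X -> X) n x y z :
  Nat.iter n (cube_map T) (x, y, z) = (Nat.iter n T x, Nat.iter n T y, Nat.iter n T z).
Proof. induction n as [|n IH]; simpl; auto. rewrite IH. reflexivity. Qed.

(** Fixed points of iterates, unlike closed orbits, are counted multiplicatively in a Cartesian
    product; hence the passage from orbits to fixed points and back. *)
Lemma cube_fixed_card {X} (T : X -> X) n k : has_card (fixed T n) k -> has_card (fixed (cube_map T) n) (k * k * k).
Proof.
  intros H. pose proof (has_card_prod _ _ _ _ (has_card_prod _ _ _ _ H H) H) as H3.
  revert H3. apply has_card_ext. intros [[x y] z]. simpl. unfold fixed. rewrite cube_iter.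
  split; [intros [[-> ->] ->]; auto|]. intros E. injection E as -> -> ->. auto.
Qed.

Lemma orbit_count_spec {X} (T : X -> X) n k : has_card (closed_orbit T n) k -> has_card (closed_orbit T n) (orbit_count T n).
Proof. intros H. unfold orbit_count. apply epsilon_spec. exists k. exact H. Qed.

Section cube.
Context {X : Type} (T : X -> X).
Hypothesis Tfin : finitely_many_orbits T.
Hypothesis Tone : forall n, 1 <= n -> orbit_count T n = 1.

Lemma T_least_period_card n : 1 <= n -> has_card (least_period T n) n.
Proof.
  intros Hn. destruct (Tfin n Hn) as [k Hk]. apply orbit_count_spec in Hk. rewrite Tone in Hk by auto.
  apply least_period_card in Hk; auto. rewrite Nat.mul_1_r in Hk. exact Hk.
Qed.

Lemma T_fixed_card n : 1 <= n -> has_card (fixed T n) (list_sum (divs n)).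
Proof.
  intros Hn. rewrite <- (map_id (divs n)). apply (fixed_card T (fun d => d)); auto.
  exact T_least_period_card.
Qed.

(** [orbit_count] has a meaning for the cube only once its orbits are known to be finite in number;
    this follows from the finitely many fixed points of the iterate. *)
Lemma cube_least_period_card n : 1 <= n -> has_card (least_period (cube_map T) n) (n * orbit_count (cube_map T) n).
Proof.
  intros Hn. pose proof (cube_fixed_card T n _ (T_fixed_card n Hn)) as H.
  destruct (has_card_subset _ (least_period (cube_map T) n) _ H) as [m Hm]; [intros x Hx; apply Hx|].
  destruct (closed_orbit_finite (cube_map T) n m Hn Hm) as [k Hk].
  apply least_period_card; auto. eapply orbit_count_spec, Hk.
Qed.

Lemma cube_orbit_count_sum n : 1 <= n ->
  list_sum (map (fun d => d * orbit_count (cube_map T) d) (divs n)) = list_sum (divs n) ^ 3.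
Proof.
  intros Hn. pose proof (cube_fixed_card T n _ (T_fixed_card n Hn)) as H.
  pose proof (fixed_card (cube_map T) _ n Hn cube_least_period_card) as H'.
  rewrite (has_card_unique _ _ _ H' H). simpl. lia.
Qed.

(** A triple of points of least period [n] has least period [n], and there are [n^3] such triples.
    The bound serves for the divergence to the left of 3. *)
Lemma cube_orbit_count_lower n : 1 <= n -> n * n <= orbit_count (cube_map T) n.
Proof.
  intros Hn. pose proof (T_least_period_card n Hn) as H.
  pose proof (has_card_prod _ _ _ _ (has_card_prod _ _ _ _ H H) H) as H3.
  assert (n * n * n <= n * orbit_count (cube_map T) n); [|nia].
  eapply has_card_le; [apply cube_least_period_card, Hn|apply H3|].
  intros [[x y] z] [[[Hx Hx'] [Hy _]] [Hz _]]. simpl in *. unfold fixed in *. split.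
  - unfold fixed. rewrite cube_iter. congruence.
  - intros i Hi E. rewrite cube_iter in E. injection E as E1 E2 E3. apply (Hx' i Hi E1).
Qed.

End cube.

Open Scope R_scope.

(** * Continuity of complex-valued functions *)

Notation Ccont f x := (@continuous _ C_UniformSpace f x).

Lemma Cball_of_Cmod (x y : C) (e : R) : Cmod (y - x) < e -> @ball C_UniformSpace x e y.
Proof. exact (C_NormedModule_mixin_compat1 x y e). Qed.

(** Balls of the product uniform structure are squares, whence a factor [sqrt 2], rounded up to
    2. *)
Lemma Cmod_of_Cball (x y : C) (e : posreal) :
  @ball C_UniformSpace x e y -> Cmod (y - x) < 2 * e.
Proof.
  intros H. apply Rlt_le_trans with (sqrt 2 * e).
  - exact (C_NormedModule_mixin_compat2 x y e H).
  - apply Rmult_le_compat_r; [apply Rlt_le, cond_pos|].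
    rewrite <- (sqrt_square 2) at 2 by lra. apply sqrt_le_1_alt. lra.
Qed.

Lemma locally_C_eps (z : C) (P : C -> Prop) :
  @locally C_UniformSpace z P <-> exists d, 0 < d /\ forall w, Cmod (w - z) < d -> P w.
Proof.
  split.
  - intros [d H]. exists d. split; [apply cond_pos|].
    intros w Hw. apply H, Cball_of_Cmod, Hw.
  - intros [d [Hd H]].
    assert (Hd2 : 0 < d / 2) by lra.
    exists (mkposreal _ Hd2). intros w Hw. apply H.
    apply Cmod_of_Cball in Hw. simpl in Hw. lra.
Qed.

(* [ring] and [field] need variables of type [C], not [UniformSpace.sort C_UniformSpace]. *)
Lemma locally_C_forall (z : C) (P : C -> Prop) :
  (forall w : C, P w) -> @locally C_UniformSpace z P.
Proof. exact (@filter_forall _ _ _ P). Qed.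

Lemma locally_C_imp (z : C) (P Q : C -> Prop) :
  (forall w : C, P w -> Q w) -> @locally C_UniformSpace z P -> @locally C_UniformSpace z Q.
Proof. exact (@filter_imp _ _ _ P Q). Qed.

Lemma Ccont_eps {U : UniformSpace} (f : U -> C) (x : U) :
  Ccont f x <-> forall e, 0 < e -> locally x (fun y => Cmod (f y - f x) < e).
Proof.
  split.
  - intros H e He. apply (H (fun z => Cmod (z - f x) < e)).
    apply locally_C_eps. exists e. split; auto.
  - intros H P HP. apply locally_C_eps in HP. destruct HP as [d [Hd HP]].
    unfold filtermap. generalize (H d Hd). apply filter_imp. intros y Hy. apply HP, Hy.
Qed.

Section continuity.
Context {U : UniformSpace}.
Implicit Types f g : U -> C.

Lemma Ccont_const (c : C) (x : U) : Ccont (fun _ : U => c) x.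
Proof. apply continuous_const. Qed.

Lemma Ccont_plus f g x : Ccont f x -> Ccont g x -> Ccont (fun y => (f y + g y)%C) x.
Proof. intros Hf Hg. exact (@continuous_plus U C_AbsRing C_NormedModule f g x Hf Hg). Qed.

Lemma Ccont_opp f x : Ccont f x -> Ccont (fun y => (- f y)%C) x.
Proof. intros Hf. exact (@continuous_opp U C_AbsRing C_NormedModule f x Hf). Qed.

Lemma Ccont_minus f g x : Ccont f x -> Ccont g x -> Ccont (fun y => (f y - g y)%C) x.
Proof. intros Hf Hg. exact (@continuous_minus U C_AbsRing C_NormedModule f g x Hf Hg). Qed.

Lemma Ccont_mult f g x : Ccont f x -> Ccont g x -> Ccont (fun y => (f y * g y)%C) x.
Proof.
  rewrite !Ccont_eps. intros Hf Hg e He.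
  set (m := Cmod (f x) + Cmod (g x) + 1).
  assert (Hm : 1 <= m) by (pose proof (Cmod_ge_0 (f x)); pose proof (Cmod_ge_0 (g x)); unfold m; lra).
  set (d := Rmin 1 (e / (2 * m))).
  assert (Hd : 0 < d).
  { apply Rmin_pos; [lra|]. apply Rdiv_lt_0_compat; lra. }
  generalize (filter_and _ _ (Hf d Hd) (Hg d Hd)). apply filter_imp.
  intros y [H1 H2].
  replace (f y * g y - f x * g x)%C
    with ((f y - f x) * g x + (g y - g x) * f x + (f y - f x) * (g y - g x))%C by ring.
  eapply Rle_lt_trans; [apply Cmod_triangle|].
  eapply Rle_lt_trans; [apply Rplus_le_compat_r, Cmod_triangle|].
  rewrite !Cmod_mult.
  assert (d <= 1) by apply Rmin_l.
  assert (Hdm : d * (2 * m) <= e).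
  { apply Rle_trans with (e / (2 * m) * (2 * m)).
    - apply Rmult_le_compat_r; [lra|apply Rmin_r].
    - right. field. lra. }
  pose proof (Cmod_ge_0 (f x)). pose proof (Cmod_ge_0 (g x)).
  pose proof (Cmod_ge_0 (f y - f x)). pose proof (Cmod_ge_0 (g y - g x)).
  assert (Cmod (f y - f x) * Cmod (g x) <= d * Cmod (g x)) by (apply Rmult_le_compat_r; lra).
  assert (Cmod (g y - g x) * Cmod (f x) <= d * Cmod (f x)) by (apply Rmult_le_compat_r; lra).
  assert (Cmod (f y - f x) * Cmod (g y - g x) <= d * 1) by (apply Rmult_le_compat; lra).
  unfold m in *. nra.
Qed.

Lemma Ccont_inv f x : Ccont f x -> f x <> 0 -> Ccont (fun y => (/ f y)%C) x.
Proof.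
  rewrite !Ccont_eps. intros Hf Hx e He.
  set (m := Cmod (f x)).
  assert (Hm : 0 < m) by (apply Cmod_gt_0, Hx).
  set (d := Rmin (m / 2) (e * (m * m) / 2)).
  assert (Hmm : 0 < m * m) by nra.
  assert (Hd : 0 < d) by (apply Rmin_pos; nra).
  generalize (Hf d Hd). apply filter_imp. intros y H1.
  assert (Hdm : d <= m / 2) by apply Rmin_l.
  assert (Hde : d <= e * (m * m) / 2) by apply Rmin_r.
  assert (Hy : m / 2 < Cmod (f y)).
  { assert (m <= Cmod (f y - f x) + Cmod (f y)).
    { unfold m. rewrite <- (Cmod_opp (f y - f x)).
      replace (f x) with (- (f y - f x) + f y)%C at 1 by ring. apply Cmod_triangle. }
    lra. }
  assert (Hy0 : f y <> 0).
  { apply Cmod_gt_0. lra. }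
  replace (/ f y - / f x)%C with (- (f y - f x) * (/ f y * / f x))%C by (field; auto).
  rewrite !Cmod_mult, Cmod_opp, !Cmod_inv by auto. fold m.
  apply Rlt_le_trans with (d * (/ Cmod (f y) * / m)).
  - apply Rmult_lt_compat_r; auto. apply Rmult_lt_0_compat; apply Rinv_0_lt_compat; lra.
  - apply Rle_trans with (e * (m * m) / 2 * (/ (m / 2) * / m)).
    + apply Rmult_le_compat; try lra.
      * apply Rmult_le_pos; left; apply Rinv_0_lt_compat; lra.
      * apply Rmult_le_compat_r; [left; apply Rinv_0_lt_compat; lra|].
        apply Rinv_le_contravar; lra.
    + right. field. lra.
Qed.

Lemma Ccont_div f g x : Ccont f x -> Ccont g x -> g x <> 0 -> Ccont (fun y => (f y / g y)%C) x.
Proof. intros Hf Hg H. apply Ccont_mult; auto. apply Ccont_inv; auto. Qed.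

Lemma Ccont_pow f n x : Ccont f x -> Ccont (fun y => (f y ^ n)%C) x.
Proof.
  intros Hf. induction n as [|n IH]; simpl.
  - apply Ccont_const.
  - apply Ccont_mult; auto.
Qed.

Lemma Ccont_pair (f g : U -> R) x :
  continuous f x -> continuous g x -> Ccont (fun y => (f y, g y) : C) x.
Proof.
  intros Hf Hg. apply (continuous_comp_2 f g (fun a b => (a, b) : C) x Hf Hg).
  intros P [e H]. exists e. intros [a b] Hab. apply H. exact Hab.
Qed.

Lemma Ccont_RtoC (f : U -> R) x : continuous f x -> Ccont (fun y => RtoC (f y)) x.
Proof. intros Hf. apply Ccont_pair; auto. apply continuous_const. Qed.

Lemma Ccont_ext_loc f g x : locally x (fun y => f y = g y) -> Ccont f x -> Ccont g x.
Proof. intros H. apply continuous_ext_loc, H. Qed.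

End continuity.

Lemma Ccont_id (z : C) : Ccont (fun w : C_UniformSpace => w) z.
Proof. apply continuous_id. Qed.

Lemma Ccont_comp {U : UniformSpace} (f : U -> C) (g : C -> C) (x : U) :
  Ccont f x -> @continuous C_UniformSpace C_UniformSpace g (f x) -> Ccont (fun y => g (f y)) x.
Proof. exact (@continuous_comp U C_UniformSpace C_UniformSpace f g x). Qed.

(** * Complex derivative *)

(** Carathéodory's form of differentiability: with a continuous slope [phi] the product and chain
    rules reduce to algebra and continuity. *)
Definition cderiv (f : C -> C) (z l : C) : Prop :=
  exists phi : C -> C, @continuous C_UniformSpace C_UniformSpace phi z /\ phi z = l /\
    @locally C_UniformSpace z (fun w => f w = (f z + phi w * (w - z))%C).

Definition hol (f : C -> C) (z : C) : Prop := exists l, cderiv f z l.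

Lemma cderiv_eps f z l : cderiv f z l <->
  forall e, 0 < e -> exists d, 0 < d /\
    forall w, Cmod (w - z) < d -> Cmod (f w - f z - l * (w - z)) <= e * Cmod (w - z).
Proof.
  split.
  - intros [phi [Hc [Hz Hl]]] e He.
    rewrite Ccont_eps in Hc. specialize (Hc e He).
    generalize (filter_and _ _ Hc Hl). intros H. apply locally_C_eps in H.
    destruct H as [d [Hd H]]. exists d. split; auto.
    intros w Hw. destruct (H w Hw) as [H1 H2]. rewrite H2.
    replace (f z + phi w * (w - z) - f z - l * (w - z))%C with ((phi w - l) * (w - z))%C by ring.
    rewrite Cmod_mult. apply Rmult_le_compat_r; [apply Cmod_ge_0|]. rewrite <- Hz. lra.
  - intros H.
    exists (fun w => if Ceq_dec w z then l else ((f w - f z) / (w - z))%C).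
    split; [|split].
    + apply Ccont_eps. intros e He. apply locally_C_eps.
      destruct (H (e / 2)) as [d [Hd H']]; [lra|].
      exists d. split; auto. intros w Hw.
      destruct (Ceq_dec z z) as [_|C]; [|congruence].
      destruct (Ceq_dec w z) as [->|Hne].
      * replace (l - l)%C with (RtoC 0) by ring. rewrite Cmod_0. lra.
      * assert (Hwz : (w - z <> 0)%C) by (apply Cminus_eq_contra, Hne).
        replace ((f w - f z) / (w - z) - l)%C
          with ((f w - f z - l * (w - z)) * / (w - z))%C by (field; auto).
        rewrite Cmod_mult, Cmod_inv by auto.
        assert (0 < Cmod (w - z)) by (apply Cmod_gt_0, Hwz).
        apply Rle_lt_trans with (e / 2 * Cmod (w - z) * / Cmod (w - z)).
        -- apply Rmult_le_compat_r; [left; apply Rinv_0_lt_compat; auto|]. auto.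
        -- rewrite Rmult_assoc, Rinv_r by lra. lra.
    + destruct (Ceq_dec z z); congruence.
    + apply locally_C_forall. intros w. destruct (Ceq_dec w z) as [->|Hne].
      * ring.
      * field. apply Cminus_eq_contra, Hne.
Qed.

Lemma is_derive_cderiv (f : C -> C) (z l : C) :
  @is_derive C_AbsRing C_NormedModule f z l <-> cderiv f z l.
Proof.
  rewrite cderiv_eps. split.
  - intros [_ H] e He.
    specialize (H z (fun P HP => HP) (mkposreal e He)).
    apply locally_C, locally_C_eps in H. destruct H as [d [Hd H]].
    exists d. split; auto. intros w Hw. specialize (H w Hw). simpl in H.
    replace (f w - f z - l * (w - z))%C with
     (@minus C_NormedModule (@minus C_NormedModule (f w) (f z)) (@scal C_AbsRing C_NormedModule (@minus (AbsRing_NormedModule C_AbsRing) w z) l)).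
    + exact H.
    + change ((f w + - f z) + - ((w + - z) * l) = f w - f z - l * (w - z))%C. ring.
  - intros H. split.
    + apply is_linear_scal_l.
    + intros x Hx.
      assert (x = z) as ->.
      { symmetry. apply (@is_filter_lim_locally_unique C_AbsRing (AbsRing_NormedModule C_AbsRing)), Hx. }
      intros eps. destruct (H eps (cond_pos eps)) as [d [Hd H']].
      apply locally_C, locally_C_eps. exists d. split; auto. intros w Hw.
      specialize (H' w Hw).
      replace (f w - f z - l * (w - z))%C with
     (@minus C_NormedModule (@minus C_NormedModule (f w) (f z)) (@scal C_AbsRing C_NormedModule (@minus (AbsRing_NormedModule C_AbsRing) w z) l)) in H'.
      * exact H'.
      * change ((f w + - f z) + - ((w + - z) * l) = f w - f z - l * (w - z))%C. ring.
Qed.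

Lemma ex_derive_hol (f : C -> C) (z : C) :
  @ex_derive C_AbsRing C_NormedModule f z <-> hol f z.
Proof. split; intros [l H]; exists l; apply is_derive_cderiv, H. Qed.

Lemma hol_cont f z : hol f z -> Ccont f z.
Proof.
  intros [l [phi [H1 [H2 H3]]]].
  apply Ccont_ext_loc with (fun w => (f z + phi w * (w - z))%C).
  - revert H3. apply locally_C_imp. intros w ->. reflexivity.
  - apply Ccont_plus; [apply Ccont_const|]. apply Ccont_mult; auto.
    apply Ccont_minus; [apply Ccont_id|apply Ccont_const].
Qed.

Lemma hol_ext_loc f g z : @locally C_UniformSpace z (fun w => f w = g w) -> hol f z -> hol g z.
Proof.
  intros He [l [phi [H1 [H2 H3]]]]. exists l, phi. split; [|split]; auto.
  pose proof (locally_singleton _ _ He) as Hz. simpl in Hz. rewrite <- Hz.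
  generalize (filter_and _ _ He H3). apply locally_C_imp. intros w [<- Hw]. exact Hw.
Qed.

Lemma hol_ext f g z : (forall w : C, f w = g w) -> hol f z -> hol g z.
Proof. intros H. apply hol_ext_loc. apply locally_C_forall, H. Qed.

Lemma hol_const c z : hol (fun _ => c) z.
Proof.
  exists (RtoC 0), (fun _ => RtoC 0). split; [apply Ccont_const|]. split; auto.
  apply locally_C_forall. intros w. ring.
Qed.

Lemma hol_id z : hol (fun w => w) z.
Proof.
  exists (RtoC 1), (fun _ => RtoC 1). split; [apply Ccont_const|]. split; auto.
  apply locally_C_forall. intros w. ring.
Qed.

Lemma hol_plus f g z : hol f z -> hol g z -> hol (fun w => (f w + g w)%C) z.
Proof.
  intros [l [p [H1 [H2 H3]]]] [m [q [G1 [G2 G3]]]].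
  exists (l + m)%C, (fun w => (p w + q w)%C). split; [apply Ccont_plus; auto|].
  split; [congruence|].
  generalize (filter_and _ _ H3 G3). apply locally_C_imp. intros w [-> ->]. ring.
Qed.

Lemma hol_mult f g z : hol f z -> hol g z -> hol (fun w => (f w * g w)%C) z.
Proof.
  intros Hf Hg. pose proof (hol_cont g z Hg) as Hgc.
  destruct Hf as [l [p [H1 [H2 H3]]]]. destruct Hg as [m [q [G1 [G2 G3]]]].
  eexists. exists (fun w => (p w * g w + f z * q w)%C).
  split; [|split; [reflexivity|]].
  - apply Ccont_plus; apply Ccont_mult; auto. apply Ccont_const.
  - generalize (filter_and _ _ H3 G3). apply locally_C_imp. intros w [-> Hw].
    replace ((f z + p w * (w - z)) * g w)%C
      with (f z * g w + p w * g w * (w - z))%C by ring.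
    rewrite Hw at 1. ring.
Qed.

Lemma hol_opp f z : hol f z -> hol (fun w => (- f w)%C) z.
Proof.
  intros H. apply hol_ext with (fun w => (- RtoC 1 * f w)%C).
  - intros w. ring.
  - apply hol_mult; auto. apply hol_const.
Qed.

Lemma hol_minus f g z : hol f z -> hol g z -> hol (fun w => (f w - g w)%C) z.
Proof. intros Hf Hg. apply hol_plus; auto. apply hol_opp; auto. Qed.

Lemma hol_comp f g z : hol f z -> hol g (f z) -> hol (fun w => g (f w)) z.
Proof.
  intros Hf [m [q [G1 [G2 G3]]]]. pose proof (hol_cont f z Hf) as Hfc.
  destruct Hf as [l [p [H1 [H2 H3]]]].
  eexists. exists (fun w => (q (f w) * p w)%C). split; [|split; [reflexivity|]].
  - apply Ccont_mult; auto. apply (Ccont_comp f q); auto.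
  - generalize (filter_and _ _ H3 (Hfc _ G3)). apply locally_C_imp. intros w [Hw ->].
    rewrite Hw at 2. ring.
Qed.

Lemma hol_inv f z : hol f z -> f z <> 0 -> hol (fun w => (/ f w)%C) z.
Proof.
  intros Hf Hz. apply (hol_comp f (fun w => / w)%C); auto.
  generalize (f z) Hz. clear. intros z Hz.
  eexists. exists (fun w => (- (/ w * / z))%C). split; [|split; [reflexivity|]].
  - apply Ccont_opp, Ccont_mult; [|apply Ccont_const]. apply Ccont_inv; auto. apply Ccont_id.
  - apply locally_C_eps. exists (Cmod z). split; [apply Cmod_gt_0, Hz|].
    intros w Hw. assert (w <> 0).
    { intros ->. revert Hw. replace (0 - z)%C with (- z)%C by ring. rewrite Cmod_opp. lra. }
    field; auto.
Qed.

Lemma hol_div f g z : hol f z -> hol g z -> g z <> 0 -> hol (fun w => (f w / g w)%C) z.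
Proof. intros Hf Hg Hz. apply hol_mult; auto. apply hol_inv; auto. Qed.

Lemma hol_pow f n z : hol f z -> hol (fun w => (f w ^ n)%C) z.
Proof.
  intros Hf. induction n as [|n IH]; simpl.
  - apply hol_const.
  - apply hol_mult; auto.
Qed.

(** * The complex exponential and its derivative *)

Lemma Cexp_plus a b : Cexp (a + b) = (Cexp a * Cexp b)%C.
Proof.
  unfold Cexp. rewrite re_plus, im_plus, exp_plus, cos_plus, sin_plus.
  unfold Cmult. simpl. f_equal; ring.
Qed.

Lemma Cexp_0 : Cexp 0 = 1.
Proof. unfold Cexp. simpl. rewrite exp_0, cos_0, sin_0. unfold RtoC. f_equal; ring. Qed.

Lemma Cmod_Cexp z : Cmod (Cexp z) = exp (Re z).
Proof.
  unfold Cmod, Cexp. simpl.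
  replace (exp (Re z) * cos (Im z) * (exp (Re z) * cos (Im z) * 1) +
    exp (Re z) * sin (Im z) * (exp (Re z) * sin (Im z) * 1))
    with ((exp (Re z))² * ((sin (Im z))² + (cos (Im z))²)) by (unfold Rsqr; ring).
  rewrite sin2_cos2, Rmult_1_r. apply sqrt_Rsqr. left; apply exp_pos.
Qed.

Lemma Cexp_neq_0 z : Cexp z <> 0.
Proof. apply Cmod_gt_0. rewrite Cmod_Cexp. apply exp_pos. Qed.

Lemma Cexp_RtoC x : Cexp (RtoC x) = RtoC (exp x).
Proof. unfold Cexp. simpl. rewrite cos_0, sin_0. unfold RtoC. f_equal; ring. Qed.

(** A second-order Taylor bound, by the mean value theorem applied twice. The constant 3 is dictated
    by [exp] on [[-1, 1]]. *)
Lemma sq_bound_aux (f f' f'' : R -> R) :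
  (forall x, derivable_pt_lim f x (f' x)) -> (forall x, derivable_pt_lim f' x (f'' x)) ->
  f 0 = 0 -> f' 0 = 0 -> (forall x, Rabs x <= 1 -> Rabs (f'' x) <= 3) ->
  forall x, Rabs x <= 1 -> Rabs (f x) <= 3 * x ^ 2.
Proof.
  intros H1 H2 H0 H0' Hb x Hx.
  assert (Hf' : forall y, Rabs y <= 1 -> Rabs (f' y) <= 3 * Rabs y).
  { intros y Hy. destruct (MVT_gen f' 0 y f'') as [c [Hc E]].
    - intros t Ht. apply is_derive_Reals, H2.
    - intros t Ht. apply derivable_continuous_pt. exists (f'' t). apply H2.
    - rewrite H0', !Rminus_0_r in E. rewrite E, Rabs_mult.
      apply Rmult_le_compat_r; [apply Rabs_pos|]. apply Hb.
      revert Hc Hy. unfold Rmin, Rmax, Rabs. repeat destruct Rle_dec; repeat destruct Rcase_abs; lra. }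
  destruct (MVT_gen f 0 x f') as [c [Hc E]].
  - intros t Ht. apply is_derive_Reals, H1.
  - intros t Ht. apply derivable_continuous_pt. exists (f' t). apply H1.
  - rewrite H0, !Rminus_0_r in E. rewrite E, Rabs_mult.
    replace (3 * x ^ 2) with (3 * Rabs x * Rabs x) by (rewrite <- (pow2_abs x); ring).
    assert (Rabs c <= Rabs x).
    { revert Hc. unfold Rmin, Rmax, Rabs. repeat destruct Rle_dec; repeat destruct Rcase_abs; lra. }
    apply Rmult_le_compat_r; [apply Rabs_pos|].
    eapply Rle_trans; [apply Hf'; lra|]. lra.
Qed.

Lemma exp_sq_bound x : Rabs x <= 1 -> Rabs (exp x - 1 - x) <= 3 * x ^ 2.
Proof.
  apply (sq_bound_aux (fun x => exp x - 1 - x) (fun x => exp x - 1) exp).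
  - intros y. apply is_derive_Reals. auto_derive; auto. ring.
  - intros y. apply is_derive_Reals. auto_derive; auto. ring.
  - rewrite exp_0. ring.
  - rewrite exp_0. ring.
  - intros y Hy. rewrite Rabs_pos_eq by (left; apply exp_pos).
    apply Rle_trans with (exp 1); [|apply exp_le_3].
    apply Rabs_le_between in Hy. destruct (Req_dec y 1) as [->|]; [lra|].
    left. apply exp_increasing. lra.
Qed.

Lemma cos_sq_bound x : Rabs x <= 1 -> Rabs (cos x - 1) <= 3 * x ^ 2.
Proof.
  apply (sq_bound_aux (fun x => cos x - 1) (fun x => - sin x) (fun x => - cos x)).
  - intros y. apply is_derive_Reals. auto_derive; auto. ring.
  - intros y. apply is_derive_Reals. auto_derive; auto. ring.
  - rewrite cos_0. ring.
  - rewrite sin_0. ring.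
  - intros y _. pose proof (COS_bound y). apply Rabs_le. lra.
Qed.

Lemma sin_sq_bound x : Rabs x <= 1 -> Rabs (sin x - x) <= 3 * x ^ 2.
Proof.
  apply (sq_bound_aux (fun x => sin x - x) (fun x => cos x - 1) (fun x => - sin x)).
  - intros y. apply is_derive_Reals. auto_derive; auto. ring.
  - intros y. apply is_derive_Reals. auto_derive; auto. ring.
  - rewrite sin_0. ring.
  - rewrite cos_0. ring.
  - intros y _. pose proof (SIN_bound y). apply Rabs_le. lra.
Qed.

Lemma Cmod_le_abs (x y : R) : Cmod (x, y) <= Rabs x + Rabs y.
Proof.
  replace ((x, y) : C) with (RtoC x + Ci * RtoC y)%C.
  - eapply Rle_trans; [apply Cmod_triangle|]. rewrite Cmod_mult, !Cmod_R, Cmod_Ci. lra.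
  - unfold RtoC, Ci, Cplus, Cmult; simpl. f_equal; ring.
Qed.

Lemma Im_le_Cmod z : Rabs (Im z) <= Cmod z.
Proof.
  rewrite <- (Rabs_Ropp (Im z)), <- re_mult_Ci.
  eapply Rle_trans; [apply re_le_Cmod|]. rewrite Cmod_mult, Cmod_Ci. lra.
Qed.

(** The real bounds on [exp], [cos] and [sin] add up to [25 |z|^2]; 40 leaves some room. *)
Lemma Cexp_sq_bound z : Cmod z <= 1 -> Cmod (Cexp z - 1 - z) <= 40 * Cmod z ^ 2.
Proof.
  intros H. pose proof (re_le_Cmod z) as H1. pose proof (Im_le_Cmod z) as H2.
  destruct z as [x y]. simpl in H1, H2. set (m := Cmod (x, y)) in *.
  assert (Hx : Rabs x <= 1) by lra. assert (Hy : Rabs y <= 1) by lra.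
  pose proof (exp_sq_bound x Hx) as E1. pose proof (cos_sq_bound y Hy) as E2.
  pose proof (sin_sq_bound y Hy) as E3.
  assert (Hm : 0 <= m) by apply Cmod_ge_0.
  assert (X2 : x ^ 2 <= m ^ 2) by (rewrite <- (pow2_abs x); apply pow_incr; split; [apply Rabs_pos|auto]).
  assert (Y2 : y ^ 2 <= m ^ 2) by (rewrite <- (pow2_abs y); apply pow_incr; split; [apply Rabs_pos|auto]).
  assert (E0 : 0 < exp x <= 3).
  { split; [apply exp_pos|]. apply Rle_trans with (exp 1); [|apply exp_le_3].
    apply Rabs_le_between in Hx. destruct (Req_dec x 1) as [->|]; [lra|].
    left. apply exp_increasing. lra. }
  replace (Cexp (x, y) - 1 - (x, y))%C with
    ((exp x * (cos y - 1) + (exp x - 1 - x),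
     exp x * (sin y - y) + y * (exp x - 1 - x) + x * y) : C).
  2: { unfold Cexp, Cminus, Cplus, Copp, RtoC; simpl. f_equal; ring. }
  eapply Rle_trans; [apply Cmod_le_abs|].
  assert (A1 : Rabs (exp x * (cos y - 1)) <= 9 * m ^ 2).
  { rewrite Rabs_mult, (Rabs_pos_eq (exp x)) by lra.
    replace (9 * m ^ 2) with (3 * (3 * m ^ 2)) by ring.
    apply Rmult_le_compat; try lra. apply Rabs_pos. }
  assert (A2 : Rabs (exp x * (sin y - y)) <= 9 * m ^ 2).
  { rewrite Rabs_mult, (Rabs_pos_eq (exp x)) by lra.
    replace (9 * m ^ 2) with (3 * (3 * m ^ 2)) by ring.
    apply Rmult_le_compat; try lra. apply Rabs_pos. }
  assert (A3 : Rabs (y * (exp x - 1 - x)) <= 3 * m ^ 2).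
  { rewrite Rabs_mult. replace (3 * m ^ 2) with (1 * (3 * m ^ 2)) by ring.
    apply Rmult_le_compat; try lra; apply Rabs_pos. }
  assert (A4 : Rabs (x * y) <= m ^ 2).
  { rewrite Rabs_mult. replace (m ^ 2) with (m * m) by ring.
    apply Rmult_le_compat; try lra; apply Rabs_pos. }
  pose proof (Rabs_triang (exp x * (cos y - 1)) (exp x - 1 - x)).
  pose proof (Rabs_triang (exp x * (sin y - y) + y * (exp x - 1 - x)) (x * y)).
  pose proof (Rabs_triang (exp x * (sin y - y)) (y * (exp x - 1 - x))).
  nra.
Qed.

Lemma cderiv_Cexp z : cderiv Cexp z (Cexp z).
Proof.
  apply cderiv_eps. intros e He. set (m := Cmod (Cexp z)).
  assert (Hm : 0 < m) by apply Cmod_gt_0, Cexp_neq_0.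
  exists (Rmin 1 (e / (40 * m))). split.
  { apply Rmin_pos; [lra|]. apply Rdiv_lt_0_compat; lra. }
  intros w Hw. pose proof (Rmin_l 1 (e / (40 * m))). pose proof (Rmin_r 1 (e / (40 * m))).
  replace (Cexp w - Cexp z - Cexp z * (w - z))%C
    with (Cexp z * (Cexp (w - z) - 1 - (w - z)))%C.
  2: { replace (Cexp w) with (Cexp z * Cexp (w - z))%C; [ring|].
       rewrite <- Cexp_plus. f_equal. ring. }
  rewrite Cmod_mult. fold m.
  pose proof (Cexp_sq_bound (w - z)). set (t := Cmod (w - z)) in *.
  assert (0 <= t) by apply Cmod_ge_0.
  apply Rle_trans with (m * (40 * t ^ 2)); [apply Rmult_le_compat_l; lra|].
  assert (t * (40 * m) <= e).
  { apply Rle_trans with (e / (40 * m) * (40 * m)); [apply Rmult_le_compat_r; lra|].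
    right. field. lra. }
  nra.
Qed.

Lemma hol_exp f z : hol f z -> hol (fun w => Cexp (f w)) z.
Proof. intros Hf. apply (hol_comp f Cexp); auto. eexists. apply cderiv_Cexp. Qed.

(** * Integrals of complex-valued functions *)

Definition CI (f : R -> C) (a b : R) : C := @RInt C_R_CompleteNormedModule f a b.

Lemma CI_ex (f : R -> C) a b : a <= b -> (forall t, a <= t <= b -> Ccont f t) ->
  @ex_RInt C_R_NormedModule f a b.
Proof.
  intros Hab H. apply (@ex_RInt_continuous C_R_CompleteNormedModule).
  rewrite Rmin_left, Rmax_right by auto. exact H.
Qed.

Lemma norm_C_R (z : C) : @norm R_AbsRing C_R_NormedModule z = Cmod z.
Proof.
  destruct z as [x y]. unfold norm, Cmod; simpl. unfold prod_norm, norm; simpl.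
  unfold abs; simpl. f_equal. rewrite !Rmult_1_r, <- !Rabs_mult.
  rewrite !Rabs_pos_eq by apply Rle_0_sqr. reflexivity.
Qed.

Lemma CI_norm (f : R -> C) a b M : a <= b -> (forall t, a <= t <= b -> Ccont f t) ->
  (forall t, a <= t <= b -> Cmod (f t) <= M) -> Cmod (CI f a b) <= (b - a) * M.
Proof.
  intros Hab H HM.
  rewrite <- norm_C_R.
  apply (@norm_RInt_le_const C_R_NormedModule f a b (CI f a b) M Hab).
  - intros t Ht. rewrite norm_C_R. exact (HM t Ht).
  - apply (@RInt_correct C_R_CompleteNormedModule). apply CI_ex; auto.
Qed.

Lemma CI_plus (f g : R -> C) a b : a <= b -> (forall t, a <= t <= b -> Ccont f t) ->
  (forall t, a <= t <= b -> Ccont g t) ->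
  CI (fun t => (f t + g t)%C) a b = (CI f a b + CI g a b)%C.
Proof.
  intros Hab Hf Hg. apply (@RInt_plus C_R_CompleteNormedModule f g); apply CI_ex; auto.
Qed.

Lemma CI_minus (f g : R -> C) a b : a <= b -> (forall t, a <= t <= b -> Ccont f t) ->
  (forall t, a <= t <= b -> Ccont g t) ->
  CI (fun t => (f t - g t)%C) a b = (CI f a b - CI g a b)%C.
Proof.
  intros Hab Hf Hg. apply (@RInt_minus C_R_CompleteNormedModule f g); apply CI_ex; auto.
Qed.

Lemma CI_chasles (f : R -> C) a b c : a <= b -> b <= c ->
  (forall t, a <= t <= c -> Ccont f t) ->
  CI f a c = (CI f a b + CI f b c)%C.
Proof.
  intros Hab Hbc Hf. symmetry.
  apply (@RInt_Chasles C_R_CompleteNormedModule f a b c); apply CI_ex; auto; intros t Ht; apply Hf; lra.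
Qed.

Lemma CI_ext (f g : R -> C) a b : a <= b -> (forall t, a <= t <= b -> f t = g t) ->
  CI f a b = CI g a b.
Proof.
  intros Hab H. apply (@RInt_ext C_R_CompleteNormedModule). rewrite Rmin_left, Rmax_right by auto.
  intros t Ht. apply H. lra.
Qed.

Lemma CI_const (c : C) a b : CI (fun _ => c) a b = (RtoC (b - a) * c)%C.
Proof. unfold CI. rewrite RInt_const. apply scal_R_Cmult. Qed.

Lemma CI_scal_R (r : R) (f : R -> C) a b : a <= b -> (forall t, a <= t <= b -> Ccont f t) ->
  CI (fun t => (RtoC r * f t)%C) a b = (RtoC r * CI f a b)%C.
Proof.
  intros Hab Hf. transitivity (@scal R_AbsRing C_R_CompleteNormedModule r (CI f a b)).
  2: apply scal_R_Cmult.
  transitivity (CI (fun t => @scal R_AbsRing C_R_CompleteNormedModule r (f t)) a b).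
  - apply (@RInt_ext C_R_CompleteNormedModule). intros t _. symmetry. apply scal_R_Cmult.
  - apply (@RInt_scal C_R_CompleteNormedModule f a b r). apply CI_ex; auto.
Qed.

(** The integral is taken in a normed module over the reals, where [Ci] is not a scalar;
    multiplication by [Ci] is therefore treated coordinatewise, and [CI_scal] follows by real
    linearity. *)
Lemma CI_Ci (f : R -> C) a b : a <= b -> (forall t, a <= t <= b -> Ccont f t) ->
  CI (fun t => (Ci * f t)%C) a b = (Ci * CI f a b)%C.
Proof.
  intros Hab Hf. pose proof (CI_ex f a b Hab Hf) as [l Hl].
  unfold CI. rewrite (@is_RInt_unique C_R_CompleteNormedModule f a b l Hl).
  apply (@is_RInt_unique C_R_CompleteNormedModule).
  replace (Ci * l)%C with ((- snd l, fst l) : C).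
  2: { destruct l as [x y]. unfold Ci, Cmult; simpl. f_equal; ring. }
  apply (@is_RInt_fct_extend_pair R_NormedModule R_NormedModule).
  - apply (@is_RInt_ext R_NormedModule (fun t => opp (snd (f t)))).
    + intros t _. unfold Ci, Cmult, opp; simpl. ring.
    + apply (@is_RInt_opp R_NormedModule). 
      exact (@is_RInt_fct_extend_snd R_NormedModule R_NormedModule f a b l Hl).
  - apply (@is_RInt_ext R_NormedModule (fun t => (fst (f t)))).
    + intros t _. unfold Ci, Cmult, opp; simpl. ring.
    + exact (@is_RInt_fct_extend_fst R_NormedModule R_NormedModule f a b l Hl).
Qed.

Lemma CI_scal (c : C) (f : R -> C) a b : a <= b -> (forall t, a <= t <= b -> Ccont f t) ->
  CI (fun t => (c * f t)%C) a b = (c * CI f a b)%C.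
Proof.
  intros Hab Hf. destruct c as [x y].
  assert (E : forall z : C, (((x, y) : C) * z = RtoC x * z + RtoC y * (Ci * z))%C).
  { intros [u v]. unfold RtoC, Ci, Cmult, Cplus; simpl. f_equal; ring. }
  rewrite E, <- CI_Ci, <- !CI_scal_R, <- CI_plus; auto.
  - apply CI_ext; auto.
  - intros t Ht. apply Ccont_mult; auto. apply Ccont_const.
  - intros t Ht. apply Ccont_mult, Ccont_mult; auto; apply Ccont_const.
  - intros t Ht. apply Ccont_mult; auto; apply Ccont_const.
Qed.

(** The analogue of [cderiv] for a real variable, so that composition with a holomorphic function is
    again plain algebra. *)
Definition rderiv (g : R -> C) (t : R) (l : C) : Prop :=
  exists phi : R -> C, Ccont phi t /\ phi t = l /\
    locally t (fun u => g u = (g t + phi u * RtoC (u - t))%C).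

Lemma is_derive_rderiv g t l : rderiv g t l -> @is_derive R_AbsRing C_R_NormedModule g t l.
Proof.
  intros [phi [H1 [H2 H3]]]. split.
  - apply is_linear_scal_l.
  - intros x Hx.
    assert (x = t) as ->.
    { symmetry. apply (@is_filter_lim_locally_unique R_AbsRing R_NormedModule), Hx. }
    intros [e He]. rewrite Ccont_eps in H1.
    generalize (filter_and _ _ (H1 e He) H3). apply filter_imp. intros u [K1 K2].
    simpl. rewrite K2. rewrite H2 in K1.
    replace (@minus C_R_NormedModule _ _) with ((phi u - l) * RtoC (u - t))%C.
    + rewrite norm_C_R. change (Cmod ((phi u - l) * RtoC (u - t)) <= e * Rabs (u - t)).
      rewrite Cmod_mult, Cmod_R. apply Rmult_le_compat_r; [apply Rabs_pos|]. lra.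
    + transitivity (g t + phi u * RtoC (u - t) - g t - RtoC (u - t) * l)%C; [ring|].
      rewrite <- (scal_R_Cmult (u - t) l). reflexivity.
Qed.

Lemma rderiv_cont g t l : rderiv g t l -> Ccont g t.
Proof.
  intros [phi [H1 [H2 H3]]].
  apply Ccont_ext_loc with (fun u => (g t + phi u * RtoC (u - t))%C).
  - revert H3. apply filter_imp. intros u ->. reflexivity.
  - apply Ccont_plus; [apply Ccont_const|]. apply Ccont_mult; auto.
    apply Ccont_RtoC. apply (@continuous_minus R_UniformSpace R_AbsRing R_NormedModule).
    + apply continuous_id.
    + apply continuous_const.
Qed.

Lemma CI_FTC (g dg : R -> C) a b : a <= b -> (forall t, a <= t <= b -> rderiv g t (dg t)) ->
  (forall t, a <= t <= b -> Ccont dg t) -> CI dg a b = (g b - g a)%C.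
Proof.
  intros Hab H1 H2. apply (@is_RInt_unique C_R_CompleteNormedModule).
  apply (@is_RInt_derive C_R_CompleteNormedModule g dg); rewrite Rmin_left, Rmax_right by auto.
  - intros t Ht. apply is_derive_rderiv, H1, Ht.
  - exact H2.
Qed.

Lemma rderiv_plus f g t l m : rderiv f t l -> rderiv g t m -> rderiv (fun u => (f u + g u)%C) t (l + m)%C.
Proof.
  intros [p [H1 [H2 H3]]] [q [G1 [G2 G3]]].
  exists (fun w => (p w + q w)%C). split; [apply Ccont_plus; auto|].
  split; [congruence|].
  generalize (filter_and _ _ H3 G3). apply filter_imp. intros w [-> ->]. ring.
Qed.

Lemma rderiv_comp (f : C -> C) (g : R -> C) t l m : cderiv f (g t) l -> rderiv g t m ->
  rderiv (fun u => f (g u)) t (l * m)%C.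
Proof.
  intros [q [G1 [G2 G3]]] Hg. pose proof (rderiv_cont g t m Hg) as Hgc.
  destruct Hg as [p [H1 [H2 H3]]].
  exists (fun w => (q (g w) * p w)%C). split; [|split; [congruence|]].
  - apply Ccont_mult; auto. apply (Ccont_comp g q); auto.
  - generalize (filter_and _ _ H3 (Hgc _ G3)). apply filter_imp. intros w [Hw ->].
    rewrite Hw at 2. ring.
Qed.

Lemma rderiv_eq f t l m : l = m -> rderiv f t l -> rderiv f t m.
Proof. intros ->. auto. Qed.

(** * Goursat's theorem for a homotopy *)

(** If [P] failed on the big square, quartering would give nested squares on which it fails,
    shrinking to a point [(x, y)]; this contradicts the local hypothesis there. *)
Lemma square_cousin (P : R -> R -> R -> Prop) (a0 c0 s0 : R) :
  0 < s0 ->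
  (forall a c s, a0 <= a -> a + s <= a0 + s0 -> c0 <= c -> c + s <= c0 + s0 -> 0 < s ->
    P a c (s / 2) -> P (a + s / 2) c (s / 2) ->
    P a (c + s / 2) (s / 2) -> P (a + s / 2) (c + s / 2) (s / 2) -> P a c s) ->
  (forall x y, a0 <= x <= a0 + s0 -> c0 <= y <= c0 + s0 ->
    exists d, 0 < d /\ forall a c s, a0 <= a -> a + s <= a0 + s0 -> c0 <= c -> c + s <= c0 + s0 ->
      0 < s < d -> a <= x <= a + s -> c <= y <= c + s -> P a c s) ->
  P a0 c0 s0.
Proof.
  intros Hs0 Hq Hloc. apply NNPP. intros Hn.
  set (sub := fun q : R * R * R => let '(a, c, s) := q in
     a0 <= a /\ a + s <= a0 + s0 /\ c0 <= c /\ c + s <= c0 + s0 /\ 0 < s /\ ~ P a c s).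
  assert (Hstep : forall q : {q | sub q}, exists q' : {q | sub q},
     let '(a, c, s) := proj1_sig q in let '(a', c', s') := proj1_sig q' in
     a <= a' /\ a' + s' <= a + s /\ c <= c' /\ c' + s' <= c + s /\ s' = s / 2).
  { intros [[[a c] s] [H1 [H2 [H3 [H4 [H5 H6]]]]]]. simpl.
    assert (E : ~ P a c (s / 2) \/ ~ P (a + s / 2) c (s / 2) \/
      ~ P a (c + s / 2) (s / 2) \/ ~ P (a + s / 2) (c + s / 2) (s / 2)).
    { apply NNPP. intros E. apply H6. apply Hq; auto; apply NNPP; intros E'; apply E; tauto. }
    destruct E as [E|[E|[E|E]]].
    - assert (K : sub (a, c, s / 2)) by (repeat split; auto; lra).
      exists (exist _ _ K). simpl. lra.
    - assert (K : sub (a + s / 2, c, s / 2)) by (repeat split; auto; lra).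
      exists (exist _ _ K). simpl. lra.
    - assert (K : sub (a, c + s / 2, s / 2)) by (repeat split; auto; lra).
      exists (exist _ _ K). simpl. lra.
    - assert (K : sub (a + s / 2, c + s / 2, s / 2)) by (repeat split; auto; lra).
      exists (exist _ _ K). simpl. lra. }
  destruct (choice _ Hstep) as [nxt Hnxt].
  assert (K0 : sub (a0, c0, s0)) by (repeat split; auto; lra).
  set (q := fix q n := match n with O => exist sub (a0, c0, s0) K0 | S n => nxt (q n) end).
  set (a := fun n => fst (fst (proj1_sig (q n)))).
  set (c := fun n => snd (fst (proj1_sig (q n)))).
  set (s := fun n => snd (proj1_sig (q n))).
  assert (Hsub : forall n, a0 <= a n /\ a n + s n <= a0 + s0 /\ c0 <= c n /\ c n + s n <= c0 + s0 /\
     0 < s n /\ ~ P (a n) (c n) (s n)).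
  { intros n. unfold a, c, s. destruct (q n) as [[[a' c'] s'] H]. exact H. }
  assert (Hn' : forall n, a n <= a (S n) /\ a (S n) + s (S n) <= a n + s n /\
     c n <= c (S n) /\ c (S n) + s (S n) <= c n + s n /\ s (S n) = s n / 2).
  { intros n. unfold a, c, s. simpl. specialize (Hnxt (q n)).
    destruct (q n) as [[[a' c'] s'] H]. simpl in *.
    destruct (nxt _) as [[[a'' c''] s''] H'']. simpl in *. exact Hnxt. }
  assert (Hmono : forall n m, (n <= m)%nat -> a n <= a m /\ a m + s m <= a n + s n /\
     c n <= c m /\ c m + s m <= c n + s n).
  { intros n m Hm. induction Hm as [|m Hm IH]; [lra|]. pose proof (Hn' m). lra. }
  assert (Hlim : forall u : nat -> R, (forall n, u n <= u (S n)) -> (forall n m, (n <= m)%nat -> u m <= u n + s n) ->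
     exists x, forall n, u n <= x <= u n + s n).
  { intros u Hu Hb.
    destruct (ex_finite_lim_seq_incr u (u 0%nat + s 0%nat) Hu) as [x Hx].
    { intros n. apply Hb. lia. }
    exists x. intros n. split.
    - apply (is_lim_seq_incr_compare u x Hx Hu).
    - apply (is_lim_seq_le_loc u (fun _ => u n + s n) x (u n + s n)); auto.
      + exists n. intros m Hm. apply Hb, Hm.
      + apply is_lim_seq_const. }
  destruct (Hlim a) as [x Hx]; [apply Hn'|intros n m Hm; pose proof (Hmono n m Hm); destruct (Hsub m); lra|].
  destruct (Hlim c) as [y Hy]; [apply Hn'|intros n m Hm; pose proof (Hmono n m Hm); destruct (Hsub m); lra|].
  destruct (Hloc x y) as [d [Hd HP]].
  { pose proof (Hx 0%nat). pose proof (Hsub 0%nat). lra. }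
  { pose proof (Hy 0%nat). pose proof (Hsub 0%nat). lra. }
  assert (Hsn : forall n, s n = s0 * (1 / 2) ^ n).
  { induction n as [|n IH]; [unfold s; simpl; ring|].
    destruct (Hn' n) as [_ [_ [_ [_ ->]]]]. rewrite IH. simpl. field. }
  destruct (pow_lt_1_zero (1 / 2)) with (y := d / s0) as [N HN].
  { rewrite Rabs_pos_eq; lra. }
  { apply Rdiv_lt_0_compat; auto. }
  specialize (HN N (Nat.le_refl N)).
  destruct (Hsub N) as [h1 [h2 [h3 [h4 [h5 h6]]]]]. apply h6, HP; auto.
  split; auto. rewrite Hsn. rewrite Rabs_pos_eq in HN by (apply pow_le; lra).
  apply Rmult_lt_compat_l with (r := s0) in HN; auto.
  replace (s0 * (d / s0)) with d in HN by (field; lra). exact HN.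
Qed.

Section goursat.
Variables (f : C -> C) (g g1 g2 : R -> R -> C) (L : R).
Hypothesis HL : 0 < L.
Hypothesis D1 : forall x y, rderiv (fun u => g u y) x (g1 x y).
Hypothesis D2 : forall x y, rderiv (fun v => g x v) y (g2 x y).
Hypothesis C1 : forall x y, Ccont (fun u => g1 u y) x.
Hypothesis C2 : forall x y, Ccont (fun v => g2 x v) y.
Hypothesis L1 : forall x y, 0 <= x <= 1 -> 0 <= y <= 1 -> Cmod (g1 x y) <= L.
Hypothesis L2 : forall x y, 0 <= x <= 1 -> 0 <= y <= 1 -> Cmod (g2 x y) <= L.
Hypothesis Hf : forall x y, 0 <= x <= 1 -> 0 <= y <= 1 -> hol f (g x y).

(** The integral of [F] along the image under [g] of the counterclockwise boundary of the square
    with lower left corner [(a, c)] and side [s]. *)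
Let bd (F : C -> C) (a c s : R) : C :=
  (CI (fun u => F (g u c) * g1 u c) a (a + s) + CI (fun v => F (g (a + s) v) * g2 (a + s) v) c (c + s)
  - CI (fun u => F (g u (c + s)) * g1 u (c + s)) a (a + s) - CI (fun v => F (g a v) * g2 a v) c (c + s))%C.

Let cont_g1 x y : Ccont (fun u => g u y) x.
Proof. eapply rderiv_cont, D1. Qed.
Let cont_g2 x y : Ccont (fun v => g x v) y.
Proof. eapply rderiv_cont, D2. Qed.

Lemma goursat_c1 F x y : Ccont F (g x y) -> Ccont (fun u => F (g u y) * g1 u y)%C x.
Proof. intros H. apply Ccont_mult; auto. apply (Ccont_comp (fun u => g u y) F); auto. Qed.
Lemma goursat_c2 F x y : Ccont F (g x y) -> Ccont (fun v => F (g x v) * g2 x v)%C y.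
Proof. intros H. apply Ccont_mult; auto. apply (Ccont_comp (fun v => g x v) F); auto. Qed.

(** An affine integrand has the primitive [G], so the four side integrals telescope around the
    closed boundary. *)
Lemma goursat_affine A B a c s : 0 <= s -> bd (fun z => A + B * z)%C a c s = 0.
Proof.
  intros Hs. unfold bd.
  set (G := fun z => (A * z + B / 2 * (z * z))%C).
  assert (HG : forall z, cderiv G z (A + B * z)).
  { intros z. exists (fun w => A + B / 2 * (w + z))%C. split; [|split].
    - apply Ccont_plus; [apply Ccont_const|]. apply Ccont_mult; [apply Ccont_const|].
      apply Ccont_plus; [apply Ccont_id|apply Ccont_const].
    - field.
    - apply locally_C_forall. intros w. unfold G. field. }
  assert (HcF : forall z, Ccont (fun z => A + B * z)%C z).
  { intros z. apply Ccont_plus; [apply Ccont_const|]. apply Ccont_mult; [apply Ccont_const|apply Ccont_id]. }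
  assert (E1 : forall y, CI (fun u => (A + B * g u y) * g1 u y)%C a (a + s) = (G (g (a + s) y) - G (g a y))%C).
  { intros y. apply (CI_FTC (fun u => G (g u y))); [lra| |].
    - intros t _. apply (rderiv_comp G (fun u => g u y)); auto.
    - intros t _. apply (goursat_c1 (fun z => A + B * z)%C). apply HcF. }
  assert (E2 : forall x, CI (fun v => (A + B * g x v) * g2 x v)%C c (c + s) = (G (g x (c + s)) - G (g x c))%C).
  { intros x. apply (CI_FTC (fun v => G (g x v))); [lra| |].
    - intros t _. apply (rderiv_comp G (fun v => g x v)); auto.
    - intros t _. apply (goursat_c2 (fun z => A + B * z)%C). apply HcF. }
  rewrite !E1, !E2. ring.
Qed.

Lemma goursat_lip x y x' y' : 0 <= x <= 1 -> 0 <= y <= 1 -> 0 <= x' <= 1 -> 0 <= y' <= 1 ->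
  Cmod (g x' y' - g x y) <= L * (Rabs (x' - x) + Rabs (y' - y)).
Proof.
  intros Hx Hy Hx' Hy'.
  assert (E1 : forall a b y, 0 <= a <= 1 -> 0 <= b <= 1 -> 0 <= y <= 1 -> a <= b -> Cmod (g b y - g a y) <= L * (b - a)).
  { intros a b z Ha Hb Hz Hab. rewrite <- (CI_FTC (fun u => g u z) (fun u => g1 u z) a b); auto.
    rewrite Rmult_comm. apply CI_norm; auto. intros t Ht. apply L1; lra. }
  assert (E2 : forall a b x, 0 <= a <= 1 -> 0 <= b <= 1 -> 0 <= x <= 1 -> a <= b -> Cmod (g x b - g x a) <= L * (b - a)).
  { intros a b z Ha Hb Hz Hab. rewrite <- (CI_FTC (fun u => g z u) (fun u => g2 z u) a b); auto.
    rewrite Rmult_comm. apply CI_norm; auto. intros t Ht. apply L2; lra. }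
  replace (g x' y' - g x y)%C with ((g x' y' - g x y') + (g x y' - g x y))%C by ring.
  eapply Rle_trans; [apply Cmod_triangle|]. rewrite Rmult_plus_distr_l.
  apply Rplus_le_compat.
  - destruct (Rle_dec x x').
    + rewrite Rabs_pos_eq by lra. apply E1; auto.
    + rewrite <- Cmod_opp, Copp_minus_distr, Rabs_left by lra.
      replace (- (x' - x)) with (x - x') by ring. apply E1; auto; lra.
  - destruct (Rle_dec y y').
    + rewrite Rabs_pos_eq by lra. apply E2; auto.
    + rewrite <- Cmod_opp, Copp_minus_distr, Rabs_left by lra.
      replace (- (y' - y)) with (y - y') by ring. apply E2; auto; lra.
Qed.

Let cont_f x y : 0 <= x <= 1 -> 0 <= y <= 1 -> Ccont f (g x y).
Proof. intros. apply hol_cont, Hf; auto. Qed.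

(** The bound [e * s^2] is stable under quartering. On small squares it holds because [f] may be
    replaced by its tangent, whose integral vanishes. *)
Lemma goursat_eps e : 0 < e -> Cmod (bd f 0 0 1) <= e.
Proof.
  intros He. replace e with (e * 1 ^ 2) by ring.
  apply (square_cousin (fun a c s => Cmod (bd f a c s) <= e * s ^ 2)); [lra| |].
  - intros a c s Ha Ha' Hc Hc' Hs P1 P2 P3 P4.
    assert (E : bd f a c s = (bd f a c (s / 2) + bd f (a + s / 2) c (s / 2) + bd f a (c + s / 2) (s / 2) +
       bd f (a + s / 2) (c + s / 2) (s / 2))%C).
    { unfold bd.
      replace (a + s / 2 + s / 2) with (a + s) by field.
      replace (c + s / 2 + s / 2) with (c + s) by field.
      rewrite (CI_chasles (fun u => (f (g u c) * g1 u c)%C) a (a + s / 2) (a + s)); try lra.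
      2: { intros t Ht. apply goursat_c1. apply cont_f; lra. }
      rewrite (CI_chasles (fun u => (f (g u (c + s)) * g1 u (c + s))%C) a (a + s / 2) (a + s)); try lra.
      2: { intros t Ht. apply goursat_c1. apply cont_f; lra. }
      rewrite (CI_chasles (fun v => (f (g a v) * g2 a v)%C) c (c + s / 2) (c + s)); try lra.
      2: { intros t Ht. apply goursat_c2. apply cont_f; lra. }
      rewrite (CI_chasles (fun v => (f (g (a + s) v) * g2 (a + s) v)%C) c (c + s / 2) (c + s)); try lra.
      2: { intros t Ht. apply goursat_c2. apply cont_f; lra. }
      ring. }
    rewrite E. eapply Rle_trans; [apply Cmod_triangle|].
    eapply Rle_trans; [apply Rplus_le_compat_r, Cmod_triangle|].
    eapply Rle_trans; [apply Rplus_le_compat_r, Rplus_le_compat_r, Cmod_triangle|].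
    replace (e * s ^ 2) with (e * (s / 2) ^ 2 + e * (s / 2) ^ 2 + e * (s / 2) ^ 2 + e * (s / 2) ^ 2) by field.
    lra.
  - intros x y Hx Hy.
    assert (Hx1 : 0 <= x <= 1) by lra. assert (Hy1 : 0 <= y <= 1) by lra.
    destruct (Hf x y Hx1 Hy1) as [l Hl]. rewrite cderiv_eps in Hl.
    (* Four sides of length [s], a remainder at most [eta * 2 L s] and a speed at most [L] give
       [8 eta L^2 s^2], which this [eta] makes equal to [e s^2]. *)
    set (z0 := g x y) in *. set (eta := e / (8 * L ^ 2)).
    assert (HL2 : 0 < L ^ 2) by (apply pow_lt; auto).
    assert (Heta : 0 < eta) by (apply Rdiv_lt_0_compat; lra).
    destruct (Hl eta Heta) as [d [Hd Hd']].
    exists (d / (2 * L)). split; [apply Rdiv_lt_0_compat; lra|].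
    intros a c s Ha Ha' Hc Hc' Hs Hax Hcy.
    set (A := (f z0 - l * z0)%C).
    set (E := fun z => (f z - (A + l * z))%C).
    assert (HsL : 2 * L * s < d).
    { destruct Hs as [_ Hs]. apply Rmult_lt_compat_l with (r := 2 * L) in Hs; [|lra].
      replace (2 * L * (d / (2 * L))) with d in Hs by (field; lra). exact Hs. }
    assert (HE : forall u v, a <= u <= a + s -> c <= v <= c + s -> Cmod (E (g u v)) <= eta * (2 * L * s)).
    { intros u v Hu Hv.
      assert (K : Cmod (g u v - z0) <= 2 * L * s).
      { eapply Rle_trans; [apply goursat_lip; lra|].
        assert (Rabs (u - x) <= s) by (apply Rabs_le; lra).
        assert (Rabs (v - y) <= s) by (apply Rabs_le; lra). nra. }
      unfold E, A.
      replace (f (g u v) - (f z0 - l * z0 + l * g u v))%C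
        with (f (g u v) - f z0 - l * (g u v - z0))%C by ring.
      eapply Rle_trans; [apply Hd'; lra|]. apply Rmult_le_compat_l; lra. }
    assert (HcA : forall z, Ccont (fun z => A + l * z)%C z).
    { intros z. apply Ccont_plus; [apply Ccont_const|]. apply Ccont_mult; [apply Ccont_const|apply Ccont_id]. }
    assert (HcE : forall u v, a <= u <= a + s -> c <= v <= c + s -> Ccont E (g u v)).
    { intros u v Hu Hv. apply Ccont_minus; auto. apply cont_f; lra. }
    assert (Esplit : bd f a c s = (bd E a c s + bd (fun z => A + l * z)%C a c s)%C).
    { unfold bd.
      assert (S1 : forall v, c <= v <= c + s ->
        CI (fun u => f (g u v) * g1 u v)%C a (a + s) =
        (CI (fun u => E (g u v) * g1 u v) a (a + s) + CI (fun u => (A + l * g u v) * g1 u v) a (a + s))%C).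
      { intros v Hv. rewrite <- CI_plus; try lra.
        - apply CI_ext; [lra|]. intros t Ht. unfold E. ring.
        - intros t Ht. apply goursat_c1. auto.
        - intros t Ht. apply (goursat_c1 (fun z => A + l * z)%C). auto. }
      assert (S2 : forall u, a <= u <= a + s ->
        CI (fun v => f (g u v) * g2 u v)%C c (c + s) =
        (CI (fun v => E (g u v) * g2 u v) c (c + s) + CI (fun v => (A + l * g u v) * g2 u v) c (c + s))%C).
      { intros u Hu. rewrite <- CI_plus; try lra.
        - apply CI_ext; [lra|]. intros t Ht. unfold E. ring.
        - intros t Ht. apply goursat_c2. auto.
        - intros t Ht. apply (goursat_c2 (fun z => A + l * z)%C). auto. }
      rewrite !S1, !S2 by lra. ring. }
    rewrite Esplit, goursat_affine by lra. rewrite Cplus_0_r.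
    set (M := eta * (2 * L * s) * L).
    assert (B1 : forall v, c <= v <= c + s -> Cmod (CI (fun u => E (g u v) * g1 u v)%C a (a + s)) <= s * M).
    { intros v Hv. replace s with (a + s - a) at 2 by ring. apply CI_norm; try lra.
      - intros t Ht. apply goursat_c1. auto.
      - intros t Ht. rewrite Cmod_mult. apply Rmult_le_compat; try apply Cmod_ge_0; auto. apply L1; lra. }
    assert (B2 : forall u, a <= u <= a + s -> Cmod (CI (fun v => E (g u v) * g2 u v)%C c (c + s)) <= s * M).
    { intros u Hu. replace s with (c + s - c) at 2 by ring. apply CI_norm; try lra.
      - intros t Ht. apply goursat_c2. auto.
      - intros t Ht. rewrite Cmod_mult. apply Rmult_le_compat; try apply Cmod_ge_0; auto. apply L2; lra. }
    unfold bd, Cminus.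
    eapply Rle_trans; [apply Cmod_triangle|]. rewrite Cmod_opp.
    eapply Rle_trans; [apply Rplus_le_compat_r, Cmod_triangle|]. rewrite Cmod_opp.
    eapply Rle_trans; [apply Rplus_le_compat_r, Rplus_le_compat_r, Cmod_triangle|].
    assert (Hfin : 4 * (s * M) = e * s ^ 2).
    { unfold M, eta. field. lra. }
    pose proof (B1 c ltac:(lra)). pose proof (B1 (c + s) ltac:(lra)).
    pose proof (B2 a ltac:(lra)). pose proof (B2 (a + s) ltac:(lra)). lra.
Qed.

Lemma goursat : 
  (CI (fun u => f (g u 0) * g1 u 0) 0 1 + CI (fun v => f (g 1 v) * g2 1 v) 0 1
  - CI (fun u => f (g u 1) * g1 u 1) 0 1 - CI (fun v => f (g 0 v) * g2 0 v) 0 1 = 0)%C.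
Proof.
  apply Cmod_eq_0. pose proof goursat_eps as H. unfold bd in H. rewrite Rplus_0_l in H.
  destruct (Req_dec (Cmod (CI (fun u => f (g u 0) * g1 u 0) 0 1 + CI (fun v => f (g 1 v) * g2 1 v) 0 1
  - CI (fun u => f (g u 1) * g1 u 1) 0 1 - CI (fun v => f (g 0 v) * g2 0 v) 0 1)%C) 0) as [E|E]; auto.
  exfalso.
  set (m := Cmod _) in *. assert (0 < m) by (pose proof (Cmod_ge_0 (CI (fun u => f (g u 0) * g1 u 0) 0 1 + CI (fun v => f (g 1 v) * g2 1 v) 0 1
  - CI (fun u => f (g u 1) * g1 u 1) 0 1 - CI (fun v => f (g 0 v) * g2 0 v) 0 1)%C); fold m in H0; lra).
  specialize (H (m / 2)). lra.
Qed.

End goursat.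

(** * Cauchy's formula *)

Definition unit_circ (v : R) : C := Cexp (RtoC v * (RtoC (2 * PI) * Ci)).

Lemma rderiv_ext f g t l : (forall u, f u = g u) -> rderiv f t l -> rderiv g t l.
Proof.
  intros E [p [H1 [H2 H3]]]. exists p. split; [|split]; auto.
  revert H3. apply filter_imp. intros u. rewrite !E. auto.
Qed.

Lemma rderiv_affine A B t : rderiv (fun u => A + RtoC u * B)%C t B.
Proof.
  exists (fun _ => B). split; [apply Ccont_const|]. split; auto.
  apply filter_forall. intros u. rewrite RtoC_minus. ring.
Qed.

Lemma rderiv_scal (A B : C) f t l : rderiv f t l -> rderiv (fun u => A + B * f u)%C t (B * l)%C.
Proof.
  intros [p [H1 [H2 H3]]]. exists (fun u => B * p u)%C. split; [|split; [congruence|]].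
  - apply Ccont_mult; auto. apply Ccont_const.
  - revert H3. apply filter_imp. intros u ->. ring.
Qed.

Lemma unit_circ_0 : unit_circ 0 = 1.
Proof. unfold unit_circ. rewrite Cmult_0_l. apply Cexp_0. Qed.

Lemma unit_circ_1 : unit_circ 1 = 1.
Proof.
  unfold unit_circ, Cexp, RtoC, Ci, Cmult; simpl.
  replace (1 * (2 * PI * 0 - 0 * 1) - 0 * (2 * PI * 1 + 0 * 0)) with 0 by ring.
  replace (1 * (2 * PI * 1 + 0 * 0) + 0 * (2 * PI * 0 - 0 * 1)) with (2 * PI) by ring.
  rewrite exp_0, cos_2PI, sin_2PI. f_equal; ring.
Qed.

Lemma Cmod_unit_circ v : Cmod (unit_circ v) = 1.
Proof.
  unfold unit_circ. rewrite Cmod_Cexp. rewrite re_scal_l, re_mult_Ci. simpl.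
  rewrite Ropp_0, Rmult_0_r. apply exp_0.
Qed.

Lemma rderiv_unit_circ v : rderiv unit_circ v (unit_circ v * (RtoC (2 * PI) * Ci)).
Proof.
  apply (rderiv_comp Cexp (fun v => RtoC v * (RtoC (2 * PI) * Ci))%C); [apply cderiv_Cexp|].
  apply rderiv_ext with (fun v => 0 + RtoC v * (RtoC (2 * PI) * Ci))%C; [intros; ring|].
  apply rderiv_affine.
Qed.

Lemma unit_circ_cont v : Ccont unit_circ v.
Proof. eapply rderiv_cont, rderiv_unit_circ. Qed.

Lemma C_nz (z : C) : 0 < Cmod z -> z <> 0.
Proof. apply Cmod_gt_0. Qed.

Lemma Ceq_mult_l (k a b : C) : k <> 0 -> (k * a)%C = (k * b)%C -> a = b.
Proof.
  intros Hk E. replace a with (/ k * (k * a))%C by (field; auto). rewrite E. field; auto.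
Qed.

Lemma Cmod_rev (x y : C) : Cmod x - Cmod y <= Cmod (x + y).
Proof.
  replace x with ((x + y) + - y)%C at 1 by ring.
  pose proof (Cmod_triangle (x + y) (- y)). rewrite Cmod_opp in H. lra.
Qed.

Lemma Cmod_minus_sym (x y : C) : Cmod (x - y) = Cmod (y - x).
Proof. rewrite <- Cmod_opp. f_equal. ring. Qed.

Lemma Cmod_R_pos r : 0 <= r -> Cmod (RtoC r) = r.
Proof. intros. rewrite Cmod_R. apply Rabs_pos_eq; auto. Qed.

Section cauchy.
Variables (F : C -> C) (c : C) (R' : R).
Hypothesis HF : forall z, Cmod (z - c) < R' -> hol F z.

(** Goursat for [F z / (z - w)] along the linear homotopy from the circle of radius [e] about [w] to
    that of radius [r] about [c]. The curves are closed, so two of the four sides cancel. *)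
Lemma cauchy_small (r e : R) (w : C) : 0 < e -> r < R' -> Cmod (w - c) + e < r ->
  CI (fun v => F (c + RtoC r * unit_circ v) * (RtoC r * unit_circ v) / (c + RtoC r * unit_circ v - w))%C 0 1
  = CI (fun v => F (w + RtoC e * unit_circ v)%C) 0 1.
Proof.
  intros He Hr Hw. pose proof (Cmod_ge_0 (w - c)) as Hwc.
  set (rho := fun x => (RtoC (1 - x) * RtoC e + RtoC x * RtoC r)%C).
  set (g := fun x v => (RtoC (1 - x) * w + RtoC x * c + rho x * unit_circ v)%C).
  set (g1 := fun (x v : R) => (c - w + (RtoC r - RtoC e) * unit_circ v)%C : C).
  set (g2 := fun x v => (rho x * (unit_circ v * (RtoC (2 * PI) * Ci)))%C).
  set (f := fun z => (F z / (z - w))%C).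
  (* The homotopy avoids [w]: the radius [(1-x) e + x r] exceeds the distance [x |w - c|] of its
     centre from [w]. *)
  assert (Hg : forall x v, 0 <= x <= 1 -> Cmod (g x v - c) < R' /\ 0 < Cmod (g x v - w)).
  { intros x v Hx.
    assert (Erho : rho x = RtoC ((1 - x) * e + x * r)).
    { unfold rho. rewrite RtoC_plus, !RtoC_mult. reflexivity. }
    assert (Hrho : 0 <= (1 - x) * e + x * r) by nra.
    assert (M : Cmod (rho x * unit_circ v) = (1 - x) * e + x * r).
    { rewrite Cmod_mult, Cmod_unit_circ, Erho, Cmod_R_pos; lra. }
    split.
    - replace (g x v - c)%C with (RtoC (1 - x) * (w - c) + rho x * unit_circ v)%C.
      2: { unfold g. rewrite !RtoC_minus. ring. }
      eapply Rle_lt_trans; [apply Cmod_triangle|]. rewrite M, Cmod_mult, Cmod_R_pos by lra. nra.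
    - replace (g x v - w)%C with (rho x * unit_circ v + - (RtoC x * (w - c)))%C.
      2: { unfold g. rewrite !RtoC_minus. ring. }
      eapply Rlt_le_trans; [|apply Cmod_rev].
      rewrite M, Cmod_opp, Cmod_mult, Cmod_R_pos by lra. nra. }
  assert (E := goursat f g g1 g2 (Cmod (c - w) + r + 2 * PI * r + 1)).
  pose proof PI_RGT_0 as Hpi.
  assert (Hre : 0 <= r - e) by lra.
  assert (Ha : Cmod (RtoC r - RtoC e) = r - e) by (rewrite <- RtoC_minus; apply Cmod_R_pos; lra).
  pose proof (Cmod_ge_0 (c - w)) as Hcw.
  assert (Hpr : 0 < 2 * PI * r) by nra.
  lapply E; [clear E; intros E|lra].
  lapply E; [clear E; intros E|].
  2: { intros x y.
    apply rderiv_ext with (fun u => (w + RtoC e * unit_circ y) + RtoC u * g1 x y)%C.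
    - intros u. unfold g, g1, rho. rewrite !RtoC_minus. ring.
    - apply rderiv_affine. }
  lapply E; [clear E; intros E|].
  2: { intros x y. unfold g, g2.
    apply (rderiv_scal (RtoC (1 - x) * w + RtoC x * c)%C (rho x) unit_circ).
    apply rderiv_unit_circ. }
  lapply E; [clear E; intros E|].
  2: { intros x y. apply Ccont_const. }
  lapply E; [clear E; intros E|].
  2: { intros x y. unfold g2. apply Ccont_mult; [apply Ccont_const|].
    apply Ccont_mult; [apply unit_circ_cont|apply Ccont_const]. }
  lapply E; [clear E; intros E|].
  2: { intros x y Hx Hy. unfold g1. eapply Rle_trans; [apply Cmod_triangle|].
    rewrite Cmod_mult, Cmod_unit_circ, Ha. lra. }
  lapply E; [clear E; intros E|].
  2: { intros x y Hx Hy. unfold g2. rewrite !Cmod_mult, Cmod_unit_circ, Cmod_Ci.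
    unfold rho. rewrite <- !RtoC_mult, <- RtoC_plus, !Cmod_R_pos by nra.
    assert ((1 - x) * e + x * r <= r) by nra. nra. }
  lapply E; [clear E; intros E|].
  2: { intros x y Hx Hy. destruct (Hg x y Hx) as [G1 G2]. apply hol_div.
    - apply HF, G1.
    - apply hol_minus; [apply hol_id|apply hol_const].
    - apply C_nz, G2. }
  assert (E01 : CI (fun u => f (g u 0) * g1 u 0)%C 0 1 = CI (fun u => f (g u 1) * g1 u 1)%C 0 1).
  { apply CI_ext; [lra|]. intros t _. unfold g, g1. rewrite unit_circ_0, unit_circ_1. reflexivity. }
  rewrite E01 in E.
  assert (E2 : CI (fun v => f (g 1 v) * g2 1 v)%C 0 1 = CI (fun v => f (g 0 v) * g2 0 v)%C 0 1).
  { assert (K : forall a b d : C, (a + b - a - d = 0)%C -> b = d).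
    { intros a b d Hab. replace b with ((a + b - a - d) + d)%C by ring. rewrite Hab. ring. }
    exact (K _ _ _ E). }
  clear E E01.
  assert (Hpi2 : (RtoC (2 * PI) * Ci <> 0)%C).
  { apply Cmult_neq_0; [|apply Ci_nz]. intros H. apply RtoC_inj in H. lra. }
  assert (cF : forall x v, 0 <= x <= 1 -> Ccont (fun v => F (g x v)) v).
  { intros x v Hx. apply (Ccont_comp (fun v => g x v) F).
    - unfold g. apply Ccont_plus; [apply Ccont_const|]. apply Ccont_mult; [apply Ccont_const|apply unit_circ_cont].
    - apply hol_cont, HF, Hg, Hx. }
  assert (G1 : forall v, g 1 v = (c + RtoC r * unit_circ v)%C).
  { intros v. unfold g, rho. rewrite Rminus_diag_eq by reflexivity. ring. }
  assert (G0 : forall v, g 0 v = (w + RtoC e * unit_circ v)%C).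
  { intros v. unfold g, rho. rewrite Rminus_0_r. ring. }
  assert (R1 : rho 1 = RtoC r).
  { unfold rho. rewrite Rminus_diag_eq by reflexivity. ring. }
  assert (R0 : rho 0 = RtoC e).
  { unfold rho. rewrite Rminus_0_r. ring. }
  assert (X1 : CI (fun v => f (g 1 v) * g2 1 v)%C 0 1 = (RtoC (2 * PI) * Ci *
     CI (fun v => F (c + RtoC r * unit_circ v) * (RtoC r * unit_circ v) / (c + RtoC r * unit_circ v - w))%C 0 1)%C).
  { rewrite <- CI_scal; try lra.
    - apply CI_ext; [lra|]. intros t Ht. unfold f, g2. rewrite R1, G1. unfold Cdiv. ring.
    - intros t Ht. apply Ccont_div.
      + apply Ccont_mult.
        * apply Ccont_ext_loc with (fun v => F (g 1 v)); [|apply cF; lra].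
          apply filter_forall. intros v. rewrite G1. reflexivity.
        * apply Ccont_mult; [apply Ccont_const|apply unit_circ_cont].
      + apply Ccont_minus; [|apply Ccont_const]. apply Ccont_plus; [apply Ccont_const|].
        apply Ccont_mult; [apply Ccont_const|apply unit_circ_cont].
      + apply C_nz. rewrite <- G1. apply Hg. lra. }
  assert (X0 : CI (fun v => f (g 0 v) * g2 0 v)%C 0 1 = (RtoC (2 * PI) * Ci *
     CI (fun v => F (w + RtoC e * unit_circ v)%C) 0 1)%C).
  { rewrite <- CI_scal; try lra.
    - apply CI_ext; [lra|]. intros t Ht. unfold f, g2. rewrite R0, G0.
      assert (unit_circ t <> 0) by apply Cexp_neq_0.
      assert (RtoC e <> 0) by (intros H'; apply RtoC_inj in H'; lra).
      replace (w + RtoC e * unit_circ t - w)%C with (RtoC e * unit_circ t)%C by ring.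
      field. repeat split; auto.
    - intros t Ht. apply Ccont_ext_loc with (fun v => F (g 0 v)); [|apply cF; lra].
      apply filter_forall. intros v. rewrite G0. reflexivity. }
  rewrite X1, X0 in E2.
  exact (Ceq_mult_l _ _ _ Hpi2 E2).
Qed.

Lemma circ_cont (a : C) (r v : R) : Ccont (fun v => a + RtoC r * unit_circ v)%C v.
Proof. apply Ccont_plus; [apply Ccont_const|]. apply Ccont_mult; [apply Ccont_const|apply unit_circ_cont]. Qed.

(** The integral equals the mean of [F] over every small circle about [w], and by continuity these
    means are arbitrarily close to [F w]. *)
Lemma cauchy_formula (r : R) (w : C) : r < R' -> Cmod (w - c) < r ->
  F w = CI (fun v => F (c + RtoC r * unit_circ v) * (RtoC r * unit_circ v) / (c + RtoC r * unit_circ v - w))%C 0 1.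
Proof.
  intros Hr Hw. apply Ceq_minus, Cmod_eq_0.
  destruct (Req_dec (Cmod (F w - CI (fun v => F (c + RtoC r * unit_circ v) * (RtoC r * unit_circ v) / (c + RtoC r * unit_circ v - w))%C 0 1)%C) 0) as [E|E]; auto.
  exfalso. revert E. set (J := CI _ 0 1). intros E.
  set (m := Cmod (F w - J)) in *. assert (Hm : 0 < m) by (pose proof (Cmod_ge_0 (F w - J)); fold m in H; lra).
  assert (Hc : Ccont F w) by (apply hol_cont, HF; lra).
  rewrite Ccont_eps in Hc. specialize (Hc (m / 2) ltac:(lra)).
  apply locally_C_eps in Hc. destruct Hc as [d [Hd Hc]].
  set (e := Rmin (d / 2) ((r - Cmod (w - c)) / 2)).
  assert (He : 0 < e) by (apply Rmin_pos; lra).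
  assert (e <= d / 2) by apply Rmin_l. assert (e <= (r - Cmod (w - c)) / 2) by apply Rmin_r.
  assert (Hwe : forall v, Cmod (w + RtoC e * unit_circ v - w) = e).
  { intros v. replace (w + RtoC e * unit_circ v - w)%C with (RtoC e * unit_circ v)%C by ring.
    rewrite Cmod_mult, Cmod_unit_circ, Cmod_R_pos; lra. }
  assert (HJ : J = CI (fun v => F (w + RtoC e * unit_circ v)%C) 0 1).
  { apply cauchy_small; auto. lra. }
  assert (Hcv : forall t, Ccont (fun v => F (w + RtoC e * unit_circ v)%C) t).
  { intros t. apply (Ccont_comp (fun v => w + RtoC e * unit_circ v)%C F); [apply circ_cont|].
    apply hol_cont, HF.
    replace (w + RtoC e * unit_circ t - c)%C with ((w + RtoC e * unit_circ t - w) + (w - c))%C by ring.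
    eapply Rle_lt_trans; [apply Cmod_triangle|]. rewrite Hwe. lra. }
  assert (Hb : Cmod (J - F w) <= (1 - 0) * (m / 2)).
  { rewrite HJ. replace (F w) with (CI (fun _ => F w) 0 1).
    2: { rewrite CI_const. rewrite Rminus_0_r. ring. }
    rewrite <- CI_minus; try lra; auto.
    2: { intros; apply Ccont_const. }
    apply CI_norm; try lra.
    - intros t _. apply Ccont_minus; auto. apply Ccont_const.
    - intros t _. left. apply Hc. rewrite Hwe. lra. }
  rewrite Cmod_minus_sym in Hb. fold m in Hb. lra.
Qed.

Lemma max_center (r M : R) : 0 < r < R' ->
  (forall v, 0 <= v <= 1 -> Cmod (F (c + RtoC r * unit_circ v)%C) <= M) -> Cmod (F c) <= M.
Proof.
  intros Hr HM.
  assert (Hv : forall v, Cmod (c + RtoC r * unit_circ v - c) = r).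
  { intros v. replace (c + RtoC r * unit_circ v - c)%C with (RtoC r * unit_circ v)%C by ring.
    rewrite Cmod_mult, Cmod_unit_circ, Cmod_R_pos; lra. }
  rewrite (cauchy_formula r c); [|lra|].
  2: { replace (c - c)%C with (RtoC 0) by ring. rewrite Cmod_0. lra. }
  rewrite (CI_ext _ (fun v => F (c + RtoC r * unit_circ v)%C)); [|lra|].
  - replace M with ((1 - 0) * M) by ring. apply CI_norm; try lra.
    + intros t _. apply (Ccont_comp (fun v => c + RtoC r * unit_circ v)%C F); [apply circ_cont|].
      apply hol_cont, HF. rewrite Hv. lra.
    + exact HM.
  - intros t _. field. apply C_nz. rewrite Hv. lra.
Qed.

End cauchy.

Lemma CI_kernel_hol (phi zeta : R -> C) (M d : R) (w0 : C) :
  0 < d -> (forall v, 0 <= v <= 1 -> Ccont phi v /\ Ccont zeta v /\ Cmod (phi v) <= M /\ d <= Cmod (zeta v - w0)) ->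
  hol (fun w => CI (fun v => phi v / (zeta v - w))%C 0 1) w0.
Proof.
  intros Hd H.
  assert (HM : 0 <= M).
  { destruct (H 0 ltac:(lra)) as [_ [_ [K _]]]. pose proof (Cmod_ge_0 (phi 0)). lra. }
  exists (CI (fun v => phi v / ((zeta v - w0) * (zeta v - w0)))%C 0 1).
  apply cderiv_eps. intros e He.
  (* The remainder of the kernel is [(w - w0)^2 / ((zeta - w) (zeta - w0)^2)], and
     [|zeta - w| >= d / 2] once [w] is close to [w0]. *)
  set (K := 2 * M / (d * (d * d))).
  assert (Hd3 : 0 < d * (d * d)) by (apply Rmult_lt_0_compat; nra).
  assert (HK : 0 <= K) by (apply Rdiv_le_0_compat; lra).
  exists (Rmin (d / 2) (e / (K + 1))). split.
  { apply Rmin_pos; [lra|]. apply Rdiv_lt_0_compat; lra. }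
  intros w Hw.
  assert (Hw1 : Cmod (w - w0) < d / 2) by (eapply Rlt_le_trans; [apply Hw|apply Rmin_l]).
  assert (Hw2 : Cmod (w - w0) < e / (K + 1)) by (eapply Rlt_le_trans; [apply Hw|apply Rmin_r]).
  assert (Hz : forall v, 0 <= v <= 1 -> d / 2 <= Cmod (zeta v - w)).
  { intros v Hv. destruct (H v Hv) as [_ [_ [_ Hz]]].
    replace (zeta v - w)%C with ((zeta v - w0) + - (w - w0))%C by ring.
    pose proof (Cmod_rev (zeta v - w0) (- (w - w0))) as Q. rewrite Cmod_opp in Q. lra. }
  assert (Hc1 : forall u v, 0 <= v <= 1 -> 0 < Cmod (zeta v - u) -> Ccont (fun v => phi v / (zeta v - u))%C v).
  { intros u v Hv Hp. destruct (H v Hv) as [K1 [K2 _]]. apply Ccont_div; auto.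
    - apply Ccont_minus; auto. apply Ccont_const.
    - apply C_nz; auto. }
  assert (Hc2 : forall v, 0 <= v <= 1 -> Ccont (fun v => phi v / ((zeta v - w0) * (zeta v - w0)))%C v).
  { intros v Hv. destruct (H v Hv) as [K1 [K2 [_ K3]]].
    assert (Ccont (fun v => zeta v - w0)%C v) by (apply Ccont_minus; auto; apply Ccont_const).
    apply Ccont_div; auto.
    - apply Ccont_mult; auto.
    - apply Cmult_neq_0; apply C_nz; lra. }
  assert (E : (CI (fun v => phi v / (zeta v - w))%C 0 1 - CI (fun v => phi v / (zeta v - w0))%C 0 1 -
     CI (fun v => phi v / ((zeta v - w0) * (zeta v - w0)))%C 0 1 * (w - w0))%C =
     CI (fun v => phi v / (zeta v - w) - phi v / (zeta v - w0) - (w - w0) * (phi v / ((zeta v - w0) * (zeta v - w0))))%C 0 1).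
  { assert (Q1 : forall v, 0 <= v <= 1 -> Ccont (fun v => phi v / (zeta v - w))%C v).
    { intros v Hv. apply Hc1; auto. pose proof (Hz v Hv). lra. }
    assert (Q2 : forall v, 0 <= v <= 1 -> Ccont (fun v => phi v / (zeta v - w0))%C v).
    { intros v Hv. apply Hc1; auto. destruct (H v Hv) as [_ [_ [_ Q]]]. lra. }
    rewrite (CI_minus (fun v => phi v / (zeta v - w) - phi v / (zeta v - w0))%C); try lra.
    - rewrite CI_minus, CI_scal; auto; try lra. ring.
    - intros v Hv. apply Ccont_minus; auto.
    - intros v Hv. apply Ccont_mult; auto. apply Ccont_const. }
  rewrite E. set (t := Cmod (w - w0)) in *. assert (Ht : 0 <= t) by apply Cmod_ge_0.
  apply Rle_trans with ((1 - 0) * (K * t * t)).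
  - apply CI_norm; try lra.
    + intros v Hv. apply Ccont_minus; [apply Ccont_minus|apply Ccont_mult]; auto.
      * apply Hc1; auto. pose proof (Hz v Hv). lra.
      * apply Hc1; auto. destruct (H v Hv) as [_ [_ [_ Q]]]. lra.
      * apply Ccont_const.
    + intros v Hv. destruct (H v Hv) as [_ [_ [Q1 Q2]]]. pose proof (Hz v Hv) as Q3.
      assert (N1 : (zeta v - w0 <> 0)%C) by (apply C_nz; lra).
      assert (N2 : (zeta v - w <> 0)%C) by (apply C_nz; lra).
      replace (phi v / (zeta v - w) - phi v / (zeta v - w0) - (w - w0) * (phi v / ((zeta v - w0) * (zeta v - w0))))%C
        with (phi v * ((w - w0) * (w - w0)) * (/ (zeta v - w) * (/ (zeta v - w0) * / (zeta v - w0))))%C by (field; auto).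
      rewrite !Cmod_mult, !Cmod_inv by auto. fold t.
      replace (K * t * t) with (M * (t * t) * (/ (d / 2) * (/ d * / d))) by (unfold K; field; lra).
      assert (0 <= t * t) by nra.
      assert (I1 : / Cmod (zeta v - w) <= / (d / 2)) by (apply Rinv_le_contravar; lra).
      assert (I2 : / Cmod (zeta v - w0) <= / d) by (apply Rinv_le_contravar; lra).
      assert (I3 : 0 < / Cmod (zeta v - w)) by (apply Rinv_0_lt_compat; lra).
      assert (I4 : 0 < / Cmod (zeta v - w0)) by (apply Rinv_0_lt_compat; lra).
      assert (I5 : / Cmod (zeta v - w0) * / Cmod (zeta v - w0) <= / d * / d) by (apply Rmult_le_compat; lra).
      apply Rmult_le_compat.
      * apply Rmult_le_pos; auto. apply Cmod_ge_0.
      * apply Rmult_le_pos; [lra|]. apply Rmult_le_pos; lra.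
      * apply Rmult_le_compat_r; auto.
      * apply Rmult_le_compat; try lra. apply Rmult_le_pos; lra.
  - assert (K * t <= e).
    { apply Rle_trans with (K * (e / (K + 1))); [apply Rmult_le_compat_l; lra|].
      apply Rle_trans with ((K + 1) * (e / (K + 1))).
      - apply Rmult_le_compat_r; [|lra]. left. apply Rdiv_lt_0_compat; lra.
      - right. field. lra. }
    nra.
Qed.

Lemma Ccont_bounded (f : R -> C) : (forall v, 0 <= v <= 1 -> Ccont f v) ->
  exists M, 0 <= M /\ forall v, 0 <= v <= 1 -> Cmod (f v) <= M.
Proof.
  intros H.
  destruct (@bounded_continuity C_AbsRing C_NormedModule f 0 1) as [M HM].
  { intros x Hx. apply H, Hx. }
  exists M. split.
  - assert (K : Cmod (f 0) < M) by (apply HM; lra). pose proof (Cmod_ge_0 (f 0)). lra.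
  - intros v Hv. left. apply HM, Hv.
Qed.

Lemma Cmod_circ a r v : 0 <= r -> Cmod (a + RtoC r * unit_circ v - a) = r.
Proof.
  intros Hr. replace (a + RtoC r * unit_circ v - a)%C with (RtoC r * unit_circ v)%C by ring.
  rewrite Cmod_mult, Cmod_unit_circ, Cmod_R_pos; lra.
Qed.

(* A uniform limit of holomorphic functions inherits Cauchy's formula, and a Cauchy integral is holomorphic. *)
Lemma hol_unif_lim (F : nat -> C -> C) (S : C -> C) (c : C) (R0 : R) : 0 < R0 ->
  (forall n z, Cmod (z - c) < R0 -> hol (F n) z) ->
  (forall e, 0 < e -> exists n, forall z, Cmod (z - c) < R0 -> Cmod (S z - F n z) <= e) ->
  hol S c.
Proof.
  intros HR HF HS. set (r := R0 / 2).
  assert (Hr : 0 < r) by (unfold r; lra). assert (HrR : r < R0) by (unfold r; lra).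
  assert (SC : forall z, Cmod (z - c) < R0 -> Ccont S z).
  { intros z Hz. apply Ccont_eps. intros e He.
    destruct (HS (e / 4)) as [n Hn]; [lra|].
    pose proof (hol_cont _ _ (HF n z Hz)) as Hc. rewrite Ccont_eps in Hc.
    specialize (Hc (e / 4) ltac:(lra)). apply locally_C_eps in Hc. destruct Hc as [d [Hd Hc]].
    apply locally_C_eps. exists (Rmin d (R0 - Cmod (z - c))). split; [apply Rmin_pos; lra|].
    intros w Hw. pose proof (Rmin_l d (R0 - Cmod (z - c))). pose proof (Rmin_r d (R0 - Cmod (z - c))).
    assert (Hwc : Cmod (w - c) < R0).
    { replace (w - c)%C with ((w - z) + (z - c))%C by ring. eapply Rle_lt_trans; [apply Cmod_triangle|]. lra. }
    replace (S w - S z)%C with ((S w - F n w) + (F n w - F n z) + - (S z - F n z))%C by ring.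
    eapply Rle_lt_trans; [apply Cmod_triangle|]. rewrite Cmod_opp.
    eapply Rle_lt_trans; [apply Rplus_le_compat_r, Cmod_triangle|].
    pose proof (Hn w Hwc). pose proof (Hn z Hz). pose proof (Hc w ltac:(lra)). lra. }
  set (k := fun w v => ((RtoC r * unit_circ v) / (c + RtoC r * unit_circ v - w))%C).
  assert (Hden : forall w v, Cmod (w - c) < r / 2 -> r / 2 <= Cmod (c + RtoC r * unit_circ v - w)).
  { intros w v Hw. replace (c + RtoC r * unit_circ v - w)%C with ((c + RtoC r * unit_circ v - c) + - (w - c))%C by ring.
    pose proof (Cmod_rev (c + RtoC r * unit_circ v - c) (- (w - c))) as Q. rewrite Cmod_opp, Cmod_circ in Q; lra. }
  assert (kc : forall w v, Cmod (w - c) < r / 2 -> Ccont (k w) v).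
  { intros w v Hw. apply Ccont_div.
    - apply Ccont_mult; [apply Ccont_const|apply unit_circ_cont].
    - apply Ccont_minus; [apply circ_cont|apply Ccont_const].
    - apply C_nz. pose proof (Hden w v Hw). lra. }
  assert (kb : forall w v, Cmod (w - c) < r / 2 -> Cmod (k w v) <= 2).
  { intros w v Hw. pose proof (Hden w v Hw). unfold k. rewrite Cmod_div by (apply C_nz; lra).
    rewrite Cmod_mult, Cmod_unit_circ, Cmod_R_pos by lra.
    apply Rle_trans with (r * 1 / (r / 2)); [|right; field; lra].
    apply Rmult_le_compat_l; [lra|]. apply Rinv_le_contravar; lra. }
  assert (Scv : forall t, Ccont (fun v => S (c + RtoC r * unit_circ v)%C) t).
  { intros t. apply (Ccont_comp (fun v => c + RtoC r * unit_circ v)%C S); [apply circ_cont|].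
    apply SC. rewrite Cmod_circ; lra. }
  assert (Fcv : forall n t, Ccont (fun v => F n (c + RtoC r * unit_circ v)%C) t).
  { intros n t. apply (Ccont_comp (fun v => c + RtoC r * unit_circ v)%C (F n)); [apply circ_cont|].
    apply hol_cont, HF. rewrite Cmod_circ; lra. }
  set (phi := fun v => (S (c + RtoC r * unit_circ v) * (RtoC r * unit_circ v))%C).
  assert (ES : forall w, Cmod (w - c) < r / 2 -> S w = CI (fun v => phi v / (c + RtoC r * unit_circ v - w))%C 0 1).
  { intros w Hw. apply Ceq_minus, Cmod_eq_0.
    set (J := CI _ 0 1).
    destruct (Req_dec (Cmod (S w - J)) 0) as [E|E]; auto. exfalso.
    set (m := Cmod (S w - J)) in *. assert (Hm : 0 < m) by (pose proof (Cmod_ge_0 (S w - J)); fold m in H; lra).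
    destruct (HS (m / 4)) as [n Hn]; [lra|].
    assert (EF : F n w = CI (fun v => F n (c + RtoC r * unit_circ v) * k w v)%C 0 1).
    { rewrite (cauchy_formula (F n) c R0 (HF n) r w) by lra.
      apply CI_ext; [lra|]. intros t _. unfold k, Cdiv. ring. }
    assert (EJ : J = CI (fun v => S (c + RtoC r * unit_circ v) * k w v)%C 0 1).
    { apply CI_ext; [lra|]. intros t _. unfold phi, k, Cdiv. ring. }
    assert (B : Cmod (J - F n w) <= (1 - 0) * (m / 4 * 2)).
    { rewrite EJ, EF. rewrite <- CI_minus; try lra.
      - apply CI_norm; try lra.
        + intros t _. apply Ccont_minus; apply Ccont_mult; auto.
        + intros t _.
          replace (S (c + RtoC r * unit_circ t) * k w t - F n (c + RtoC r * unit_circ t) * k w t)%C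
            with ((S (c + RtoC r * unit_circ t) - F n (c + RtoC r * unit_circ t)) * k w t)%C by ring.
          rewrite Cmod_mult. apply Rmult_le_compat; try apply Cmod_ge_0; auto.
          apply Hn. rewrite Cmod_circ; lra.
      - intros t _. apply Ccont_mult; auto.
      - intros t _. apply Ccont_mult; auto. }
    assert (B2 : m <= Cmod (S w - F n w) + Cmod (J - F n w)).
    { unfold m. replace (S w - J)%C with ((S w - F n w) + - (J - F n w))%C by ring.
      eapply Rle_trans; [apply Cmod_triangle|]. rewrite Cmod_opp. lra. }
    pose proof (Hn w ltac:(lra)). lra. }
  apply hol_ext_loc with (fun w => CI (fun v => phi v / (c + RtoC r * unit_circ v - w))%C 0 1).
  - apply locally_C_eps. exists (r / 2). split; [lra|]. intros w Hw. symmetry. apply ES, Hw.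
  - destruct (Ccont_bounded phi) as [M [_ HM]].
    { intros v _. apply Ccont_mult; auto. apply Ccont_mult; [apply Ccont_const|apply unit_circ_cont]. }
    apply (CI_kernel_hol phi (fun v => c + RtoC r * unit_circ v)%C M r); auto.
    intros v Hv. split; [|split; [|split]]; auto.
    + apply Ccont_mult; auto. apply Ccont_mult; [apply Ccont_const|apply unit_circ_cont].
    + apply circ_cont.
    + rewrite Cmod_circ; lra.
Qed.

(** Near [a], subtracting Cauchy's formulas at [w] and at [a] pulls out the factor [w - a] and
    leaves a Cauchy integral, holomorphic at [a]. The factorisation is stated for all [z], so that
    it can be iterated. *)
Lemma hol_divide (F : C -> C) (c : C) (R0 : R) (a : C) :
  (forall z, Cmod (z - c) < R0 -> hol F z) -> Cmod (a - c) < R0 -> F a = 0 ->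
  exists G, (forall z, Cmod (z - c) < R0 -> hol G z) /\ forall z, F z = ((z - a) * G z)%C.
Proof.
  intros HF Ha Fa. set (r := (R0 - Cmod (a - c)) / 2).
  assert (Hr : 0 < r) by (unfold r; lra).
  assert (HFa : forall z, Cmod (z - a) < 2 * r -> hol F z).
  { intros z Hz. apply HF. replace (z - c)%C with ((z - a) + (a - c))%C by ring.
    eapply Rle_lt_trans; [apply Cmod_triangle|]. unfold r in Hz. lra. }
  set (K := fun w => CI (fun v => F (a + RtoC r * unit_circ v) / (a + RtoC r * unit_circ v - w))%C 0 1).
  assert (Fcv : forall t, Ccont (fun v => F (a + RtoC r * unit_circ v)%C) t).
  { intros t. apply (Ccont_comp (fun v => a + RtoC r * unit_circ v)%C F); [apply circ_cont|].
    apply hol_cont, HFa. rewrite Cmod_circ; lra. }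
  assert (HK : hol K a).
  { destruct (Ccont_bounded (fun v => F (a + RtoC r * unit_circ v)%C)) as [M [_ HM]]; auto.
    apply (CI_kernel_hol (fun v => F (a + RtoC r * unit_circ v)%C) (fun v => a + RtoC r * unit_circ v)%C M r); auto.
    intros v Hv. split; [|split; [|split]]; auto.
    + apply circ_cont.
    + rewrite Cmod_circ; lra. }
  assert (EK : forall w, Cmod (w - a) < r -> F w = ((w - a) * K w)%C).
  { intros w Hw.
    assert (Haa : Cmod (a - a) < r) by (replace (a - a)%C with (RtoC 0) by ring; rewrite Cmod_0; lra).
    assert (Hden : forall v u, Cmod (u - a) < r -> (a + RtoC r * unit_circ v - u <> 0)%C).
    { intros v u Hu. apply C_nz.
      replace (a + RtoC r * unit_circ v - u)%C with ((a + RtoC r * unit_circ v - a) + - (u - a))%C by ring.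
      pose proof (Cmod_rev (a + RtoC r * unit_circ v - a) (- (u - a))) as Q. rewrite Cmod_opp, Cmod_circ in Q; lra. }
    assert (cc : forall u t, Cmod (u - a) < r -> Ccont (fun v => F (a + RtoC r * unit_circ v) * (RtoC r * unit_circ v) / (a + RtoC r * unit_circ v - u))%C t).
    { intros u t Hu. apply Ccont_div; auto.
      - apply Ccont_mult; auto. apply Ccont_mult; [apply Ccont_const|apply unit_circ_cont].
      - apply Ccont_minus; [apply circ_cont|apply Ccont_const]. }
    assert (cc0 : forall t, Ccont (fun v => F (a + RtoC r * unit_circ v) / (a + RtoC r * unit_circ v - w))%C t).
    { intros t. apply Ccont_div; auto. apply Ccont_minus; [apply circ_cont|apply Ccont_const]. }
    replace (F w) with (F w - F a)%C by (rewrite Fa; ring).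
    rewrite (cauchy_formula F a (2 * r) HFa r w), (cauchy_formula F a (2 * r) HFa r a) by lra.
    unfold K. rewrite <- CI_scal by (auto; lra). rewrite <- CI_minus by (auto; lra).
    apply CI_ext; [lra|]. intros t _. field. split; apply Hden; auto. }
  exists (fun z => if Ceq_dec z a then K a else (F z / (z - a))%C). split.
  - intros z Hz. destruct (Ceq_dec z a) as [->|Hne].
    + apply hol_ext_loc with K; auto. apply locally_C_eps. exists r. split; auto.
      intros w Hw. destruct (Ceq_dec w a) as [->|Hwa]; auto.
      rewrite (EK w Hw). field. apply Cminus_eq_contra, Hwa.
    + apply hol_ext_loc with (fun w => F w / (w - a))%C.
      * apply locally_C_eps. exists (Cmod (z - a)). split; [apply Cmod_gt_0, Cminus_eq_contra, Hne|].
        intros w Hw. destruct (Ceq_dec w a) as [->|_]; auto.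
        rewrite Cmod_minus_sym in Hw. lra.
      * apply hol_div; auto.
        -- apply hol_minus; [apply hol_id|apply hol_const].
        -- apply Cminus_eq_contra, Hne.
  - intros z. destruct (Ceq_dec z a) as [->|Hne].
    + rewrite Fa. ring.
    + field. apply Cminus_eq_contra, Hne.
Qed.

(** * Counting zeros *)

Fixpoint lin_prod (l : list C) (z : C) : C :=
  match l with nil => RtoC 1 | a :: l => ((z - a) * lin_prod l z)%C end.

Lemma lin_prod_zero l z : lin_prod l z = 0 -> In z l.
Proof.
  induction l as [|a l IH]; simpl.
  - intros H. apply RtoC_inj in H. lra.
  - intros H. destruct (Ceq_dec z a) as [->|Hne]; auto.
    right. apply IH. apply NNPP. intros H'. apply (Cmult_neq_0 (z - a) (lin_prod l z)); auto.
    apply Cminus_eq_contra, Hne.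
Qed.

Lemma lin_prod_repeat a n z : lin_prod (repeat a n) z = ((z - a) ^ n)%C.
Proof. induction n as [|n IH]; simpl; auto. rewrite IH. reflexivity. Qed.

Section count.
Variables (f : C -> C) (c : C) (R0 R1 r M : R).
Hypothesis Hf : forall z, Cmod (z - c) < R1 -> hol f z.
Hypothesis HR : 0 < r /\ 2 * r < R0 /\ R0 < R1.
Hypothesis HM : forall v, 0 <= v <= 1 -> Cmod (f (c + RtoC R0 * unit_circ v)%C) <= M.

(** The maximum principle for [g]: on the circle of radius [R0] the linear factors are at least
    [R0 - r] in modulus, at the centre at most [r]. Repetitions in [l] are allowed, so
    multiplicities can be counted too. *)
Lemma count_factored (l : list C) (g : C -> C) :
  (forall z, Cmod (z - c) < R1 -> hol g z) -> (forall z, f z = (lin_prod l z * g z)%C) ->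
  (forall a, In a l -> Cmod (a - c) <= r) ->
  Cmod (f c) * (R0 - r) ^ length l <= M * r ^ length l.
Proof.
  intros Hg Hfg Hl.
  assert (HM0 : 0 <= M).
  { pose proof (HM 0 ltac:(lra)) as Q.
    pose proof (Cmod_ge_0 (f (c + RtoC R0 * unit_circ 0)%C)). lra. }
  assert (P1 : Cmod (lin_prod l c) <= r ^ length l).
  { clear -Hl HR. induction l as [|a l IH]; simpl.
    - rewrite Cmod_1. lra.
    - rewrite Cmod_mult. apply Rmult_le_compat; try apply Cmod_ge_0.
      + rewrite Cmod_minus_sym. apply Hl. left; auto.
      + apply IH. intros b Hb. apply Hl. right; auto. }
  assert (P2 : forall z, Cmod (z - c) = R0 -> (R0 - r) ^ length l <= Cmod (lin_prod l z)).
  { intros z Hz. clear -Hl HR Hz. induction l as [|a l IH]; simpl.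
    - rewrite Cmod_1. lra.
    - rewrite Cmod_mult. apply Rmult_le_compat; try lra.
      + apply pow_le. lra.
      + replace (z - a)%C with ((z - c) + - (a - c))%C by ring.
        pose proof (Cmod_rev (z - c) (- (a - c))) as Q. rewrite Cmod_opp in Q.
        pose proof (Hl a (or_introl eq_refl)). lra.
      + apply IH. intros b Hb. apply Hl. right; auto. }
  assert (Hp : 0 < (R0 - r) ^ length l) by (apply pow_lt; lra).
  assert (P3 : Cmod (g c) <= M / (R0 - r) ^ length l).
  { apply (max_center g c R1 Hg R0); [lra|]. intros v Hv.
    pose proof (HM v Hv) as Q. set (z := (c + RtoC R0 * unit_circ v)%C) in *.
    assert (Hz : Cmod (z - c) = R0) by (apply Cmod_circ; lra). rewrite Hfg, Cmod_mult in Q.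
    pose proof (P2 z Hz) as Q2. apply Rmult_le_reg_r with ((R0 - r) ^ length l); auto.
    replace (M / (R0 - r) ^ length l * (R0 - r) ^ length l) with M by (field; lra).
    eapply Rle_trans; [|apply Q]. rewrite Rmult_comm. apply Rmult_le_compat_r; auto. apply Cmod_ge_0. }
  rewrite Hfg, Cmod_mult.
  apply Rle_trans with (r ^ length l * (M / (R0 - r) ^ length l) * (R0 - r) ^ length l).
  - apply Rmult_le_compat_r; [lra|]. apply Rmult_le_compat; auto; apply Cmod_ge_0.
  - right. field. lra.
Qed.

Lemma factor_zeros (l : list C) : NoDup l -> (forall a, In a l -> Cmod (a - c) <= r /\ f a = 0) ->
  exists g, (forall z, Cmod (z - c) < R1 -> hol g z) /\ forall z, f z = (lin_prod l z * g z)%C.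
Proof.
  induction l as [|a l IH]; intros Hnd Hl.
  - exists f. split; auto. intros z. simpl. ring.
  - inversion Hnd as [|? ? Ha Hnd']; subst.
    destruct IH as [g [Hg Hfg]]; auto.
    { intros b Hb. apply Hl. right; auto. }
    destruct (Hl a (or_introl eq_refl)) as [H1 H2].
    destruct (hol_divide g c R1 a) as [G [HG HgG]]; auto; [lra| |].
    { apply NNPP. intros Hn. apply (Cmult_neq_0 (lin_prod l a) (g a)); auto.
      - intros H. apply Ha, lin_prod_zero, H.
      - rewrite <- Hfg. exact H2. }
    exists G. split; auto. intros z. rewrite Hfg, HgG. simpl. ring.
Qed.

Lemma count_zeros (l : list C) : NoDup l -> (forall a, In a l -> Cmod (a - c) <= r /\ f a = 0) ->
  Cmod (f c) * (R0 - r) ^ length l <= M * r ^ length l.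
Proof.
  intros Hnd Hl. destruct (factor_zeros l Hnd Hl) as [g [Hg Hfg]].
  apply (count_factored l g); auto. intros a Ha. apply Hl, Ha.
Qed.

(** As [2 r < R0], the ratio [(R0 - r) / r] exceeds 1 and its powers outgrow any bound. *)
Lemma pow_ratio_unbounded : f c <> 0 -> exists N, forall n,
  Cmod (f c) * (R0 - r) ^ n <= M * r ^ n -> (n <= N)%nat.
Proof.
  intros Hc. assert (Hm : 0 < Cmod (f c)) by (apply Cmod_gt_0, Hc).
  destruct (Pow_x_infinity ((R0 - r) / r)) with (b := Rabs M / Cmod (f c) + 1) as [N HN].
  { assert (1 < (R0 - r) / r); [|rewrite Rabs_pos_eq; lra].
    apply Rmult_lt_reg_r with r; [lra|]. unfold Rdiv. rewrite Rmult_assoc, Rinv_l; lra. }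
  exists N. intros n Hn. destruct (Compare_dec.le_lt_dec n N) as [|Hlt]; auto. exfalso.
  specialize (HN n ltac:(lia)).
  assert (Hq : 0 < (R0 - r) / r) by (apply Rdiv_lt_0_compat; lra).
  rewrite Rabs_pos_eq in HN by (apply pow_le; lra).
  assert (Hrn : 0 < r ^ n) by (apply pow_lt; lra).
  assert (E : (R0 - r) ^ n = ((R0 - r) / r) ^ n * r ^ n).
  { rewrite <- Rpow_mult_distr. f_equal. field. lra. }
  rewrite E, <- Rmult_assoc in Hn. apply Rmult_le_reg_r in Hn; auto.
  pose proof (Rle_abs M).
  assert (Cmod (f c) * (Rabs M / Cmod (f c) + 1) <= Cmod (f c) * ((R0 - r) / r) ^ n).
  { apply Rmult_le_compat_l; lra. }
  replace (Cmod (f c) * (Rabs M / Cmod (f c) + 1)) with (Rabs M + Cmod (f c)) in H0 by (field; lra).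
  lra.
Qed.

End count.

Lemma circle_bounded (f : C -> C) (c : C) (R0 : R) : 0 <= R0 ->
  (forall z, Cmod (z - c) = R0 -> Ccont f z) ->
  exists M, forall v, 0 <= v <= 1 -> Cmod (f (c + RtoC R0 * unit_circ v)%C) <= M.
Proof.
  intros HR Hc.
  destruct (Ccont_bounded (fun v => f (c + RtoC R0 * unit_circ v)%C)) as [M [_ HM]].
  - intros v _. apply (Ccont_comp (fun v => c + RtoC R0 * unit_circ v)%C f); [apply circ_cont|].
    apply Hc, Cmod_circ, HR.
  - exists M. exact HM.
Qed.

Section finiteness.
Variables (f : C -> C) (c : C) (r R1 : R).
Hypothesis Hf : forall z, Cmod (z - c) < R1 -> hol f z.
Hypothesis HR : 0 < r /\ 2 * r < R1.
Hypothesis Hc : f c <> 0.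

Lemma zeros_finite : exists N, forall l, NoDup l ->
  (forall a, In a l -> Cmod (a - c) <= r /\ f a = 0) -> (length l <= N)%nat.
Proof.
  set (R0 := (2 * r + R1) / 2).
  assert (HR0 : 0 < r /\ 2 * r < R0 /\ R0 < R1) by (unfold R0; lra).
  destruct (circle_bounded f c R0) as [M HM]; [lra| |].
  { intros z Hz. apply hol_cont, Hf. lra. }
  destruct (pow_ratio_unbounded f c R0 R1 r M HR0 Hc) as [N HN].
  exists N. intros l Hnd Hl. apply HN. apply (count_zeros f c R0 R1 r M); auto.
Qed.

(** A zero of infinite order would allow division by [(z - a)^n] for every [n], against
    [count_factored] for the list of [n] copies of [a]. *)
Lemma zero_order (a : C) : Cmod (a - c) <= r -> exists n g,
  (forall z, Cmod (z - c) < R1 -> hol g z) /\ (forall z, f z = ((z - a) ^ n * g z)%C) /\ g a <> 0.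
Proof.
  intros Ha. apply NNPP. intros Hn.
  assert (Hall : forall n, exists g, (forall z, Cmod (z - c) < R1 -> hol g z) /\
    (forall z, f z = ((z - a) ^ n * g z)%C)).
  { induction n as [|n [g [Hg E]]].
    - exists f. split; auto. intros z. simpl. ring.
    - destruct (Ceq_dec (g a) 0) as [E0|E0].
      2: { exfalso. apply Hn. exists n, g. auto. }
      destruct (hol_divide g c R1 a) as [G [HG HgG]]; auto; [lra|].
      exists G. split; auto. intros z. rewrite E, HgG. simpl. ring. }
  set (R0 := (2 * r + R1) / 2).
  assert (HR0 : 0 < r /\ 2 * r < R0 /\ R0 < R1) by (unfold R0; lra).
  destruct (circle_bounded f c R0) as [M HM]; [lra| |].
  { intros z Hz. apply hol_cont, Hf. lra. }
  destruct (pow_ratio_unbounded f c R0 R1 r M HR0 Hc) as [N HN].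
  destruct (Hall (S N)) as [g [Hg E]].
  assert (S N <= N)%nat; [|lia]. apply HN.
  pose proof (count_factored f c R0 R1 r M HR0 HM (repeat a (S N)) g Hg) as Q.
  rewrite repeat_length in Q. apply Q.
  - intros z. rewrite lin_prod_repeat. apply E.
  - intros b Hb. apply repeat_spec in Hb. subst. exact Ha.
Qed.

End finiteness.

(** * Limits, series and products of complex numbers *)

Definition is_clim (u : nat -> C) (l : C) : Prop :=
  forall e, 0 < e -> exists N, forall n, (N <= n)%nat -> Cmod (u n - l) < e.

Lemma is_clim_unique u l m : is_clim u l -> is_clim u m -> l = m.
Proof.
  intros Hl Hm. apply Ceq_minus, Cmod_eq_0.
  destruct (Req_dec (Cmod (l - m)) 0) as [E|E]; auto. exfalso.
  pose proof (Cmod_ge_0 (l - m)).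
  destruct (Hl (Cmod (l - m) / 2)) as [N1 H1]; [lra|].
  destruct (Hm (Cmod (l - m) / 2)) as [N2 H2]; [lra|].
  specialize (H1 (max N1 N2) ltac:(lia)). specialize (H2 (max N1 N2) ltac:(lia)).
  set (x := u (max N1 N2)) in *.
  assert (Cmod (l - m) <= Cmod (x - l) + Cmod (x - m)); [|lra].
  replace (l - m)%C with (- (x - l) + (x - m))%C by ring.
  eapply Rle_trans; [apply Cmod_triangle|]. rewrite Cmod_opp. lra.
Qed.

Lemma is_clim_eq u l m : l = m -> is_clim u l -> is_clim u m.
Proof. intros ->. auto. Qed.

Lemma is_clim_const c : is_clim (fun _ => c) c.
Proof.
  intros e He. exists O. intros n _. replace (c - c)%C with (RtoC 0) by ring. rewrite Cmod_0. auto.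
Qed.

Lemma is_clim_ext_ev u v l : (exists N, forall n, (N <= n)%nat -> u n = v n) -> is_clim u l -> is_clim v l.
Proof.
  intros [N0 H] Hu e He. destruct (Hu e He) as [N HN]. exists (max N N0).
  intros n Hn. rewrite <- H by lia. apply HN. lia.
Qed.

Lemma is_clim_ext u v l : (forall n, u n = v n) -> is_clim u l -> is_clim v l.
Proof. intros H. apply is_clim_ext_ev. exists O. auto. Qed.

Lemma is_clim_filterlim u l : is_clim u l <-> filterlim u eventually (@locally C_UniformSpace l).
Proof.
  split.
  - intros H P HP. apply locally_C_eps in HP. destruct HP as [d [Hd HP]].
    destruct (H d Hd) as [N HN]. exists N. intros n Hn. apply HP, HN, Hn.
  - intros H e He. destruct (H (fun z => Cmod (z - l) < e)) as [N HN].
    + apply locally_C_eps. exists e. split; auto.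
    + exists N. exact HN.
Qed.

Lemma is_clim_cont (f : C -> C) u l : Ccont f l -> is_clim u l -> is_clim (fun n => f (u n)) (f l).
Proof.
  intros Hf Hu e He. rewrite Ccont_eps in Hf. specialize (Hf e He).
  apply locally_C_eps in Hf. destruct Hf as [d [Hd Hf]].
  destruct (Hu d Hd) as [N HN]. exists N. intros n Hn. apply Hf, HN, Hn.
Qed.

Lemma is_clim_plus u v l m : is_clim u l -> is_clim v m -> is_clim (fun n => (u n + v n)%C) (l + m)%C.
Proof.
  intros Hu Hv e He. destruct (Hu (e / 2)) as [N1 H1]; [lra|]. destruct (Hv (e / 2)) as [N2 H2]; [lra|].
  exists (max N1 N2). intros n Hn. specialize (H1 n ltac:(lia)). specialize (H2 n ltac:(lia)).
  replace (u n + v n - (l + m))%C with ((u n - l) + (v n - m))%C by ring.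
  eapply Rle_lt_trans; [apply Cmod_triangle|]. lra.
Qed.

Lemma is_clim_scal c u l : is_clim u l -> is_clim (fun n => (c * u n)%C) (c * l)%C.
Proof.
  apply (is_clim_cont (fun z => c * z)%C). apply Ccont_mult; [apply Ccont_const|apply Ccont_id].
Qed.

Lemma is_clim_bounded u l : is_clim u l -> exists M N, 0 < M /\ forall n, (N <= n)%nat -> Cmod (u n) <= M.
Proof.
  intros H. destruct (H 1) as [N HN]; [lra|]. exists (Cmod l + 1), N.
  split; [pose proof (Cmod_ge_0 l); lra|]. intros n Hn. specialize (HN n Hn).
  replace (u n) with ((u n - l) + l)%C by ring. eapply Rle_trans; [apply Cmod_triangle|]. lra.
Qed.

Lemma is_clim_mult u v l m : is_clim u l -> is_clim v m -> is_clim (fun n => (u n * v n)%C) (l * m)%C.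
Proof.
  intros Hu Hv. destruct (is_clim_bounded u l Hu) as [M [N0 [HM HN0]]].
  intros e He. pose proof (Cmod_ge_0 m).
  destruct (Hv (e / (2 * M))) as [N1 H1]; [apply Rdiv_lt_0_compat; lra|].
  destruct (Hu (e / (2 * (Cmod m + 1)))) as [N2 H2]; [apply Rdiv_lt_0_compat; lra|].
  exists (max N0 (max N1 N2)). intros n Hn.
  specialize (HN0 n ltac:(lia)). specialize (H1 n ltac:(lia)). specialize (H2 n ltac:(lia)).
  replace (u n * v n - l * m)%C with (u n * (v n - m) + (u n - l) * m)%C by ring.
  eapply Rle_lt_trans; [apply Cmod_triangle|]. rewrite !Cmod_mult.
  assert (Cmod (u n) * Cmod (v n - m) <= M * Cmod (v n - m)).
  { apply Rmult_le_compat_r; auto. apply Cmod_ge_0. }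
  assert (M * Cmod (v n - m) < M * (e / (2 * M))) by (apply Rmult_lt_compat_l; auto).
  replace (M * (e / (2 * M))) with (e / 2) in H3 by (field; lra).
  assert (Cmod (u n - l) * Cmod m <= e / (2 * (Cmod m + 1)) * (Cmod m + 1)).
  { apply Rmult_le_compat; try lra; apply Cmod_ge_0. }
  replace (e / (2 * (Cmod m + 1)) * (Cmod m + 1)) with (e / 2) in H4 by (field; lra). lra.
Qed.

Lemma is_clim_inv u (l : C) : l <> 0 -> is_clim u l -> is_clim (fun n => (/ u n)%C) (/ l)%C.
Proof. intros Hl. apply (is_clim_cont (fun z => / z)%C). apply Ccont_inv; [apply Ccont_id|exact Hl]. Qed.

Lemma is_clim_pow u l k : is_clim u l -> is_clim (fun n => (u n ^ k)%C) (l ^ k)%C.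
Proof. apply (is_clim_cont (fun z => z ^ k)%C). apply Ccont_pow, Ccont_id. Qed.

Lemma is_clim_incr_n u l k : is_clim u l <-> is_clim (fun n => u (n + k)%nat) l.
Proof.
  split; intros H e He; destruct (H e He) as [N HN].
  - exists N. intros n Hn. apply HN. lia.
  - exists (N + k)%nat. intros n Hn. replace n with ((n - k) + k)%nat by lia. apply HN. lia.
Qed.

Lemma is_clim_le u l (M : R) : is_clim u l -> (exists N, forall n, (N <= n)%nat -> Cmod (u n) <= M) -> Cmod l <= M.
Proof.
  intros H [N0 HM]. apply Rnot_lt_le. intros Hlt.
  destruct (H (Cmod l - M)) as [N HN]; [lra|]. specialize (HN (max N N0) ltac:(lia)). specialize (HM (max N N0) ltac:(lia)).
  pose proof (Cmod_rev l (u (max N N0) - l)%C) as Q.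
  replace (l + (u (max N N0) - l))%C with (u (max N N0)) in Q by ring. lra.
Qed.

Definition Clim (u : nat -> C) : C := epsilon (inhabits (RtoC 0)) (is_clim u).

Lemma is_clim_Clim u l : is_clim u l -> Clim u = l.
Proof.
  intros H. apply (is_clim_unique u); auto. unfold Clim.
  apply epsilon_spec. exists l. exact H.
Qed.

Fixpoint rsum (b : nat -> R) (N : nat) : R := match N with O => 0 | S n => rsum b n + b n end.
Fixpoint csum (f : nat -> C) (N : nat) : C := match N with O => RtoC 0 | S n => (csum f n + f n)%C end.
Fixpoint cprod (u : nat -> C) (N : nat) : C := match N with O => RtoC 1 | S n => (cprod u n * u n)%C end.

Definition summable (b : nat -> R) (S : R) : Prop :=
  (forall n, 0 <= b n) /\ is_lim_seq (rsum b) S.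

Lemma rsum_sum_n b N : rsum b (S N) = sum_n b N.
Proof.
  induction N as [|N IH].
  - simpl. rewrite sum_O. ring.
  - rewrite sum_Sn. change (rsum b (S N) + b (S N) = plus (sum_n b N) (b (S N))). rewrite IH. reflexivity.
Qed.

Lemma csum_sum_n f N : csum f (S N) = @sum_n C_AbelianMonoid f N.
Proof.
  induction N as [|N IH].
  - simpl. rewrite sum_O. ring.
  - rewrite sum_Sn, <- IH. reflexivity.
Qed.

Lemma is_lim_rsum_series b (S : R) : is_lim_seq (rsum b) S <-> is_series b S.
Proof.
  rewrite is_lim_seq_incr_1. unfold is_series. split; intros H.
  - exact (is_lim_seq_ext _ (sum_n b) _ (rsum_sum_n b) H).
  - apply (is_lim_seq_ext (sum_n b)); [intros n; symmetry; apply rsum_sum_n|]. exact H.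
Qed.

Lemma is_clim_csum_series (f : nat -> C) (l : C) :
  is_clim (csum f) l <-> @is_series C_AbsRing C_NormedModule f l.
Proof.
  rewrite (is_clim_incr_n _ _ 1), is_clim_filterlim. unfold is_series.
  split; apply filterlim_ext; intros n; rewrite Nat.add_1_r, csum_sum_n; reflexivity.
Qed.

Lemma summable_le b S N : summable b S -> rsum b N <= S.
Proof.
  intros [H0 H]. apply (is_lim_seq_incr_compare (rsum b) S); auto.
  intros n. simpl. pose proof (H0 n). lra.
Qed.

Lemma rsum_mono b N M : (forall n, 0 <= b n) -> (N <= M)%nat -> rsum b N <= rsum b M.
Proof. intros H0 H. induction H; [lra|]. simpl. pose proof (H0 m). lra. Qed.

Lemma summable_comparison a b S : summable b S -> (forall n, 0 <= a n <= b n) -> exists S', summable a S'.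
Proof.
  intros [H0 H] Ha. destruct (@ex_series_le R_AbsRing R_CompleteNormedModule a b) as [S' HS'].
  - intros n. change (Rabs (a n) <= b n). rewrite Rabs_pos_eq; apply Ha.
  - exists S. apply is_lim_rsum_series, H.
  - exists S'. split; [apply Ha|]. apply is_lim_rsum_series, HS'.
Qed.

Lemma summable_scal c b S : 0 <= c -> summable b S -> summable (fun n => c * b n) (c * S).
Proof.
  intros Hc [H0 H]. split.
  - intros n. apply Rmult_le_pos; auto.
  - apply is_lim_rsum_series. apply is_lim_rsum_series in H. apply (is_series_scal_l c b S H).
Qed.

Lemma summable_plus a b S S' : summable a S -> summable b S' -> summable (fun n => a n + b n) (S + S').
Proof.
  intros [H0 H] [H0' H']. split.
  - intros n. apply Rplus_le_le_0_compat; auto.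
  - apply is_lim_rsum_series. apply is_lim_rsum_series in H, H'. apply (is_series_plus a b S S' H H').
Qed.

Lemma csum_diff_bound f b N M : (forall n, Cmod (f n) <= b n) -> (N <= M)%nat ->
  Cmod (csum f M - csum f N) <= rsum b M - rsum b N.
Proof.
  intros Hb H. induction H as [|M H IH].
  - replace (csum f N - csum f N)%C with (RtoC 0) by ring. rewrite Cmod_0. lra.
  - simpl. replace (csum f M + f M - csum f N)%C with ((csum f M - csum f N) + f M)%C by ring.
    eapply Rle_trans; [apply Cmod_triangle|]. pose proof (Hb M). lra.
Qed.

(** The error bound depends on [b] only, which makes the convergence uniform when [f] has a
    parameter. *)
Lemma series_Mtest f b S : summable b S -> (forall n, Cmod (f n) <= b n) ->
  exists l, is_clim (csum f) l /\ forall N, Cmod (l - csum f N) <= S - rsum b N.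
Proof.
  intros HS Hb. destruct HS as [H0 H].
  destruct (@ex_series_le C_AbsRing C_CompleteNormedModule f b) as [l Hl].
  - intros n. exact (Hb n).
  - exists S. apply is_lim_rsum_series, H.
  - exists l. assert (Hc : is_clim (csum f) l) by (apply is_clim_csum_series, Hl).
    split; auto. intros N.
    apply (is_clim_le (fun M => (csum f M - csum f N)%C)).
    + apply is_clim_plus; auto. apply is_clim_const.
    + exists N. intros M HM. eapply Rle_trans; [apply (csum_diff_bound f b); auto|].
      pose proof (summable_le b S M (conj H0 H)). lra.
Qed.

Lemma cprod_bound u b N : (forall n, Cmod (u n) <= b n) ->
  Cmod (cprod (fun n => (1 + u n)%C) N) <= exp (rsum b N).
Proof.
  intros Hb. induction N as [|N IH]; simpl.
  - rewrite Cmod_1, exp_0. lra.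
  - rewrite Cmod_mult, exp_plus. apply Rmult_le_compat; try apply Cmod_ge_0; auto.
    eapply Rle_trans; [apply Cmod_triangle|]. rewrite Cmod_1.
    pose proof (exp_ineq1_le (b N)). pose proof (Hb N). lra.
Qed.

(** Turns a product into a series, so that products inherit convergence and explicit tails from
    [series_Mtest]. *)
Lemma cprod_telescope u N :
  cprod (fun n => (1 + u n)%C) N = (1 + csum (fun n => cprod (fun n => (1 + u n)%C) n * u n) N)%C.
Proof. 
  induction N as [|N IH]; simpl; [ring|].
  transitivity (cprod (fun n => 1 + u n) N + cprod (fun n => 1 + u n) N * u N)%C; [ring|].
  rewrite IH at 1. ring.
Qed.

Lemma cprod_add u N M : cprod u (N + M) = (cprod u N * cprod (fun n => u (N + n)%nat) M)%C.
Proof.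
  induction M as [|M IH].
  - rewrite Nat.add_0_r. simpl. ring.
  - rewrite Nat.add_succ_r. simpl. rewrite IH. ring.
Qed.

Lemma cprod_mult u v N : cprod (fun n => (u n * v n)%C) N = (cprod u N * cprod v N)%C.
Proof. induction N as [|N IH]; simpl; [ring|]. rewrite IH. ring. Qed.

Lemma cprod_ext u v N : (forall n, (n < N)%nat -> u n = v n) -> cprod u N = cprod v N.
Proof. induction N as [|N IH]; simpl; intros H; auto. rewrite IH, H; auto. Qed.

Lemma cprod_pow u k N : cprod (fun n => (u n ^ k)%C) N = (cprod u N ^ k)%C.
Proof. induction N as [|N IH]; simpl; [rewrite Cpow_1_l; auto|]. rewrite IH, Cpow_mult_l. auto. Qed.

Lemma cprod_neq_0 (u : nat -> C) N : (forall n, (n < N)%nat -> u n <> 0) -> cprod u N <> 0.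
Proof.
  induction N as [|N IH]; simpl; intros H.
  - intros E. apply RtoC_inj in E. lra.
  - apply Cmult_neq_0; [apply IH; auto|apply H; lia].
Qed.

Lemma cprod_eq_0 (u : nat -> C) N n : (n < N)%nat -> u n = 0 -> cprod u N = 0.
Proof.
  intros Hn E. induction N as [|N IH]; [lia|]. simpl.
  destruct (Nat.eq_dec n N) as [<-|]; [rewrite E; ring|]. rewrite IH by lia. ring.
Qed.

Lemma product_converges u b S : summable b S -> (forall n, Cmod (u n) <= b n) ->
  exists l, is_clim (cprod (fun n => (1 + u n)%C)) l /\
    forall N, Cmod (l - cprod (fun n => (1 + u n)%C) N) <= exp S * (S - rsum b N).
Proof.
  intros HS Hb.
  destruct (series_Mtest (fun n => cprod (fun n => (1 + u n)%C) n * u n)%C (fun n => exp S * b n) (exp S * S)) as [l [Hl Hl']].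
  - apply summable_scal; auto. left; apply exp_pos.
  - intros n. rewrite Cmod_mult. apply Rmult_le_compat; try apply Cmod_ge_0; auto.
    eapply Rle_trans; [apply cprod_bound, Hb|].
    destruct (summable_le b S n HS) as [H| ->]; [left; apply exp_increasing; auto|lra].
  - exists (1 + l)%C. split.
    + apply is_clim_ext with (fun N => 1 + csum (fun n => cprod (fun n => (1 + u n)%C) n * u n) N)%C.
      * intros n. symmetry. apply cprod_telescope.
      * apply is_clim_plus; auto. apply is_clim_const.
    + intros N. rewrite cprod_telescope.
      replace (1 + l - (1 + csum (fun n => cprod (fun n => 1 + u n) n * u n) N))%C
        with (l - csum (fun n => cprod (fun n => 1 + u n) n * u n) N)%C by ring.
      eapply Rle_trans; [apply Hl'|]. right. clear. induction N as [|N IH]; simpl; [ring|]. lra.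
Qed.

Lemma summable_shift b S N : summable b S -> summable (fun n => b (N + n)%nat) (S - rsum b N).
Proof.
  intros [H0 H]. split; [auto|].
  assert (E : forall n, rsum (fun n => b (N + n)%nat) n = rsum b (n + N) - rsum b N).
  { induction n as [|n IH]; simpl; [ring|]. rewrite IH. rewrite (Nat.add_comm N n). ring. }
  apply (is_lim_seq_ext (fun n => rsum b (n + N) - rsum b N)); [intros n; symmetry; apply E|].
  apply (is_lim_seq_minus' _ _ S (rsum b N)); [|apply is_lim_seq_const].
  apply (is_lim_seq_incr_n (rsum b) N). exact H.
Qed.

(** After finitely many nonzero factors the remaining sum of bounds is below 1/4; the tail product
    is then within 3/4 of 1. *)
Lemma product_neq_0 (u : nat -> C) b S (l : C) : summable b S -> (forall n, Cmod (u n) <= b n) ->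
  is_clim (cprod (fun n => (1 + u n)%C)) l -> (forall n, (1 + u n <> 0)%C) -> l <> 0.
Proof.
  intros HS Hb Hl Hn.
  assert (HN : exists N, S - rsum b N < 1 / 4).
  { destruct HS as [_ H]. apply is_lim_seq_spec in H. destruct (H (mkposreal (1/4) ltac:(lra))) as [N HN].
    exists N. specialize (HN N (Nat.le_refl N)). simpl in HN. apply Rabs_def2 in HN. lra. }
  destruct HN as [N HN].
  pose proof (summable_shift b S N HS) as HS'. set (S' := S - rsum b N) in *.
  destruct (product_converges (fun n => u (N + n)%nat) _ S' HS') as [l' [Hl' Hb']].
  { intros n. apply Hb. }
  assert (El : l = (cprod (fun n => (1 + u n)%C) N * l')%C).
  { apply (is_clim_unique (cprod (fun n => (1 + u n)%C))); auto.
    apply (is_clim_incr_n _ _ N).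
    apply is_clim_ext with (fun n => cprod (fun n => (1 + u n)%C) N * cprod (fun n => (1 + u (N + n)%nat)%C) n)%C.
    - intros n. rewrite Nat.add_comm, cprod_add. reflexivity.
    - apply is_clim_scal, Hl'. }
  rewrite El. apply Cmult_neq_0; [apply cprod_neq_0; auto|].
  intros E. specialize (Hb' 0%nat). rewrite E in Hb'. simpl in Hb'.
  replace (0 - 1)%C with (- RtoC 1)%C in Hb' by ring. rewrite Cmod_opp, Cmod_1 in Hb'.
  assert (exp S' <= 3).
  { apply Rle_trans with (exp 1); [left; apply exp_increasing; lra|apply exp_le_3]. }
  assert (0 <= S') by (unfold S'; pose proof (summable_le b S N HS); lra).
  pose proof (exp_pos S'). nra.
Qed.

Lemma hol_csum (f : nat -> C -> C) N z : (forall n, hol (f n) z) -> hol (fun w => csum (fun n => f n w) N) z.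
Proof.
  intros H. induction N as [|N IH]; simpl; [apply hol_const|]. apply hol_plus; auto.
Qed.

Lemma hol_cprod (f : nat -> C -> C) N z : (forall n, hol (f n) z) -> hol (fun w => cprod (fun n => f n w) N) z.
Proof.
  intros H. induction N as [|N IH]; simpl; [apply hol_const|]. apply hol_mult; auto.
Qed.

Lemma summable_tail_small b S e : summable b S -> 0 < e -> exists N, S - rsum b N <= e.
Proof.
  intros [_ H] He. apply is_lim_seq_spec in H. destruct (H (mkposreal e He)) as [N HN].
  exists N. specialize (HN N (Nat.le_refl N)). simpl in HN. apply Rabs_def2 in HN. lra.
Qed.

Lemma hol_series (f : nat -> C -> C) (S : C -> C) b B c r : 0 < r -> summable b B ->
  (forall n z, Cmod (z - c) < r -> hol (f n) z /\ Cmod (f n z) <= b n) ->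
  (forall z, Cmod (z - c) < r -> is_clim (csum (fun n => f n z)) (S z)) -> hol S c.
Proof.
  intros Hr HB Hf HS. apply (hol_unif_lim (fun N z => csum (fun n => f n z) N) S c r Hr).
  - intros N z Hz. apply hol_csum. intros n. apply Hf, Hz.
  - intros e He. destruct (summable_tail_small b B e HB He) as [N HN]. exists N. intros z Hz.
    destruct (series_Mtest (fun n => f n z) b B HB) as [l [Hl Hl']].
    { intros n. apply Hf, Hz. }
    rewrite (is_clim_unique _ _ _ (HS z Hz) Hl). eapply Rle_trans; [apply Hl'|auto].
Qed.

Lemma hol_product (u : nat -> C -> C) (P : C -> C) b B c r : 0 < r -> summable b B ->
  (forall n z, Cmod (z - c) < r -> hol (u n) z /\ Cmod (u n z) <= b n) ->
  (forall z, Cmod (z - c) < r -> is_clim (cprod (fun n => (1 + u n z)%C)) (P z)) -> hol P c.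
Proof.
  intros Hr HB Hf HP. apply (hol_unif_lim (fun N z => cprod (fun n => (1 + u n z)%C) N) P c r Hr).
  - intros N z Hz. apply (hol_cprod (fun n z => 1 + u n z)%C). intros n. apply hol_plus; [apply hol_const|]. apply Hf, Hz.
  - intros e He. pose proof (exp_pos B).
    destruct (summable_tail_small b B (e / exp B) HB) as [N HN]; [apply Rdiv_lt_0_compat; auto|].
    exists N. intros z Hz.
    destruct (product_converges (fun n => u n z) b B HB) as [l [Hl Hl']].
    { intros n. apply Hf, Hz. }
    rewrite (is_clim_unique _ _ _ (HP z Hz) Hl). eapply Rle_trans; [apply Hl'|].
    apply Rle_trans with (exp B * (e / exp B)); [apply Rmult_le_compat_l; lra|]. right. field. lra.
Qed.

(** * Meromorphic functions *)

Definition mero (f : C -> C) (z0 : C) : Prop :=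
  exists (n : nat) (g : C -> C) (d : R), 0 < d /\ (forall z, Cmod (z - z0) < d -> hol g z) /\
    forall z, Cmod (z - z0) < d -> z <> z0 -> f z = (g z / (z - z0) ^ n)%C.

Lemma locally'_C_eps (z0 : C) (P : C -> Prop) :
  @locally' C_UniformSpace z0 P <-> exists d, 0 < d /\ forall w, Cmod (w - z0) < d -> w <> z0 -> P w.
Proof. unfold locally', within. apply (locally_C_eps z0 (fun w => w <> z0 -> P w)). Qed.

Lemma meromorphic_at_mero f z0 : meromorphic_at f z0 <-> mero f z0.
Proof.
  split.
  - intros [n [g [H1 H2]]]. apply locally_C_eps in H1. apply locally'_C_eps in H2.
    destruct H1 as [d1 [Hd1 H1]]. destruct H2 as [d2 [Hd2 H2]].
    exists n, g, (Rmin d1 d2). pose proof (Rmin_l d1 d2). pose proof (Rmin_r d1 d2).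
    split; [apply Rmin_pos; auto|]. split.
    + intros z Hz. apply ex_derive_hol, H1. lra.
    + intros z Hz Hne. apply H2; auto. lra.
  - intros [n [g [d [Hd [H1 H2]]]]]. exists n, g. split.
    + apply locally_C_eps. exists d. split; auto. intros w Hw. apply ex_derive_hol, H1, Hw.
    + apply locally'_C_eps. exists d. split; auto.
Qed.

Lemma mero_hol f z0 d : 0 < d -> (forall z, Cmod (z - z0) < d -> hol f z) -> mero f z0.
Proof.
  intros Hd H. exists O, f, d. split; auto. split; auto.
  intros z _ _. simpl. field.
Qed.

Lemma mero_ext f g z0 d : 0 < d -> (forall z, Cmod (z - z0) < d -> f z = g z) -> mero f z0 -> mero g z0.
Proof.
  intros Hd He [n [h [d' [Hd' [H1 H2]]]]]. exists n, h, (Rmin d d').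
  pose proof (Rmin_l d d'). pose proof (Rmin_r d d').
  split; [apply Rmin_pos; auto|]. split.
  - intros z Hz. apply H1. lra.
  - intros z Hz Hne. rewrite <- He by lra. apply H2; auto. lra.
Qed.

Lemma mero_mult f g z0 : mero f z0 -> mero g z0 -> mero (fun z => (f z * g z)%C) z0.
Proof.
  intros [n [h [d [Hd [H1 H2]]]]] [m [k [e [He [G1 G2]]]]].
  exists (n + m)%nat, (fun z => h z * k z)%C, (Rmin d e).
  pose proof (Rmin_l d e). pose proof (Rmin_r d e).
  split; [apply Rmin_pos; auto|]. split.
  - intros z Hz. apply hol_mult; [apply H1|apply G1]; lra.
  - intros z Hz Hne. rewrite H2, G2, Cpow_add_r by (auto; lra).
    assert (z - z0 <> 0)%C by (apply Cminus_eq_contra, Hne).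
    field. split; apply Cpow_nz; auto.
Qed.

Lemma mero_const c z0 : mero (fun _ => c) z0.
Proof. apply (mero_hol _ z0 1); [lra|]. intros; apply hol_const. Qed.

Lemma mero_pow f k z0 : mero f z0 -> mero (fun z => (f z ^ k)%C) z0.
Proof.
  intros H. induction k as [|k IH]; simpl; [apply mero_const|]. apply mero_mult; auto.
Qed.

Lemma hol_neq_0_near (g : C -> C) (a : C) : Ccont g a -> g a <> 0 -> exists d, 0 < d /\ forall z, Cmod (z - a) < d -> g z <> 0.
Proof.
  intros Hg Ha. rewrite Ccont_eps in Hg. specialize (Hg (Cmod (g a)) ltac:(apply Cmod_gt_0, Ha)).
  apply locally_C_eps in Hg. destruct Hg as [d [Hd H]]. exists d. split; auto.
  intros z Hz E. specialize (H z Hz). rewrite E in H.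
  replace (0 - g a)%C with (- g a)%C in H by ring. rewrite Cmod_opp in H. lra.
Qed.

(** The centre [c], where [f] does not vanish, guarantees that a zero of [f] at [a] has finite
    order. *)
Lemma mero_inv (f : C -> C) (c : C) r R1 a : (forall z, Cmod (z - c) < R1 -> hol f z) -> 0 < r /\ 2 * r < R1 -> f c <> 0 ->
  Cmod (a - c) <= r -> mero (fun z => (/ f z)%C) a.
Proof.
  intros Hf HR Hc Ha. destruct (zero_order f c r R1 Hf HR Hc a Ha) as [n [g [Hg [E Hga]]]].
  assert (Hac : Cmod (a - c) < R1) by lra.
  destruct (hol_neq_0_near g a) as [d [Hd Hd']]; auto.
  { apply hol_cont, Hg, Hac. }
  exists n, (fun z => / g z)%C, (Rmin d (R1 - r)).
  pose proof (Rmin_l d (R1 - r)). pose proof (Rmin_r d (R1 - r)).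
  split; [apply Rmin_pos; lra|]. split.
  - intros z Hz. apply hol_inv.
    + apply Hg. replace (z - c)%C with ((z - a) + (a - c))%C by ring.
      eapply Rle_lt_trans; [apply Cmod_triangle|]. lra.
    + apply Hd'. lra.
  - intros z Hz Hne. rewrite E.
    assert (z - a <> 0)%C by (apply Cminus_eq_contra, Hne).
    assert (g z <> 0) by (apply Hd'; lra). pose proof (Cpow_nz _ n H1). field. auto.
Qed.

Lemma mero_comp_affine f (k b : C) z0 : k <> 0 -> mero f (k * z0 + b)%C -> mero (fun z => f (k * z + b)%C) z0.
Proof.
  intros Hk [n [g [d [Hd [H1 H2]]]]].
  assert (Hm : 0 < Cmod k) by (apply Cmod_gt_0, Hk).
  assert (Hn : forall z, Cmod (z - z0) < d / Cmod k -> Cmod (k * z + b - (k * z0 + b)) < d).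
  { intros z Hz. replace (k * z + b - (k * z0 + b))%C with (k * (z - z0))%C by ring.
    rewrite Cmod_mult. apply Rmult_lt_compat_l with (r := Cmod k) in Hz; auto.
    replace (Cmod k * (d / Cmod k)) with d in Hz by (field; lra). exact Hz. }
  exists n, (fun z => / (k ^ n) * g (k * z + b))%C, (d / Cmod k).
  split; [apply Rdiv_lt_0_compat; auto|]. split.
  - intros z Hz. apply hol_mult; [apply hol_const|].
    apply (hol_comp (fun z => k * z + b)%C g).
    + apply hol_plus; [|apply hol_const]. apply hol_mult; [apply hol_const|apply hol_id].
    + apply H1, Hn, Hz.
  - intros z Hz Hne.
    assert (z - z0 <> 0)%C by (apply Cminus_eq_contra, Hne).
    rewrite H2.
    + replace (k * z + b - (k * z0 + b))%C with (k * (z - z0))%C by ring.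
      rewrite Cpow_mult_l. field. split; apply Cpow_nz; auto.
    + apply Hn, Hz.
    + intros E. apply H. apply Ceq_mult_l with k; auto. 
      replace (k * (z - z0))%C with ((k * z + b) - (k * z0 + b))%C by ring. rewrite E. ring.
Qed.

Lemma locally_R_imp (x : R) (P Q : R -> Prop) :
  (forall u : R, P u -> Q u) -> locally x P -> locally x Q.
Proof. exact (@filter_imp _ _ _ P Q). Qed.

Lemma locally_R_eps (x : R) (P : R -> Prop) (d : posreal) :
  (forall u : R, Rabs (u - x) < d -> P u) -> locally x P.
Proof. intros H. exists d. exact H. Qed.

Lemma exp_le x y : x <= y -> exp x <= exp y.
Proof. intros [H| ->]; [left; apply exp_increasing, H|lra]. Qed.

(** * Powers [x^(-s)] *)

Definition npow (x : R) (s : C) : C := Cexp (- s * RtoC (ln x)).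

Lemma Cmod_npow x s : Cmod (npow x s) = exp (- Re s * ln x).
Proof. unfold npow. rewrite Cmod_Cexp, re_scal_r, re_opp. reflexivity. Qed.

Lemma npow_mult x y s : 0 < x -> 0 < y -> npow (x * y) s = (npow x s * npow y s)%C.
Proof.
  intros Hx Hy. unfold npow. rewrite ln_mult, RtoC_plus, <- Cexp_plus by auto. f_equal. ring.
Qed.

Lemma npow_plus x s t : npow x (s + t) = (npow x s * npow x t)%C.
Proof. unfold npow. rewrite <- Cexp_plus. f_equal. ring. Qed.

Lemma npow_1 s : npow 1 s = 1.
Proof. unfold npow. rewrite ln_1, Cmult_0_r. apply Cexp_0. Qed.

Lemma npow_0 x : npow x 0 = 1.
Proof. unfold npow. replace (- RtoC 0 * RtoC (ln x))%C with (RtoC 0) by ring. apply Cexp_0. Qed.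

Lemma npow_neq_0 x s : npow x s <> 0.
Proof. apply Cexp_neq_0. Qed.

Lemma npow_RtoC x r : npow x (RtoC r) = RtoC (exp (- r * ln x)).
Proof. unfold npow. rewrite <- RtoC_opp, <- RtoC_mult. apply Cexp_RtoC. Qed.

Lemma npow_one x : 0 < x -> npow x 1 = RtoC (/ x).
Proof.
  intros Hx. rewrite npow_RtoC. f_equal. replace (- (1) * ln x) with (- ln x) by ring.
  rewrite exp_Ropp, exp_ln; auto.
Qed.

Lemma npow_mone x : 0 < x -> npow x (- RtoC 1) = RtoC x.
Proof.
  intros Hx. rewrite <- RtoC_opp, npow_RtoC. f_equal. replace (- - (1) * ln x) with (ln x) by ring.
  apply exp_ln; auto.
Qed.

Lemma npow_pow x s k : npow x (RtoC (INR k) * s) = (npow x s ^ k)%C.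
Proof.
  induction k as [|k IH].
  - simpl INR. rewrite Cmult_0_l, npow_0. reflexivity.
  - rewrite S_INR, RtoC_plus, Cmult_plus_distr_r, npow_plus, IH, Cmult_1_l, Cpow_S. ring.
Qed.

Lemma hol_npow x s : hol (fun s => npow x s) s.
Proof.
  apply hol_exp. apply hol_mult; [|apply hol_const]. apply hol_opp, hol_id.
Qed.

Lemma rderiv_npow s x : 0 < x -> rderiv (fun x => npow x s) x (- s * npow x (s + 1))%C.
Proof.
  intros Hx. unfold npow at 1.
  rewrite npow_plus, npow_one by auto.
  replace (- s * (npow x s * RtoC (/ x)))%C with (npow x s * (- s * RtoC (/ x)))%C by ring.
  apply (rderiv_comp Cexp (fun x => - s * RtoC (ln x))%C); [apply cderiv_Cexp|].
  apply rderiv_ext with (fun x => 0 + - s * RtoC (ln x))%C; [intros; ring|].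
  apply (rderiv_scal 0 (- s)%C (fun x => RtoC (ln x))).
  pose proof (is_derive_ln x Hx) as Hd.
  exists (fun u => RtoC (if Req_EM_T u x then / x else (ln u - ln x) / (u - x))). split; [|split].
  - apply Ccont_eps. intros e He. apply is_derive_Reals in Hd.
    destruct (Hd e He) as [d Hd'].
    apply (locally_R_eps x _ d). intros u Hu. destruct (Req_EM_T x x) as [_|]; [|lra].
    destruct (Req_EM_T u x) as [->|Hne].
    + replace (RtoC (/ x) - RtoC (/ x))%C with (RtoC 0) by ring. rewrite Cmod_0. auto.
    + rewrite <- RtoC_minus, Cmod_R. 
      specialize (Hd' (u - x)). replace (x + (u - x)) with u in Hd' by ring.
      apply Hd'; [lra|]. exact Hu.
  - destruct (Req_EM_T x x); [auto|lra].
  - apply filter_forall. intros u'. set (u := u' : R). rewrite <- RtoC_mult, <- RtoC_plus. f_equal.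
    destruct (Req_EM_T u x) as [->|Hne]; [ring|]. field. lra.
Qed.

(** * The alternating zeta function *)

(** The [m]-th forward difference of [x^(-s)], with sign [(-1)^m]. *)
Fixpoint Dl (m : nat) (x : R) (s : C) : C :=
  match m with O => npow x s | S m => (Dl m x s - Dl m (x + 1) s)%C end.

Lemma Dl_S m x s : Dl (S m) x s = (Dl m x s - Dl m (x + 1) s)%C.
Proof. reflexivity. Qed.

Lemma hol_Dl m x s : hol (fun s => Dl m x s) s.
Proof.
  revert x. induction m as [|m IH]; intros x; simpl; [apply hol_npow|]. apply hol_minus; apply IH.
Qed.

Lemma rderiv_Dl m s x : 0 < x -> rderiv (fun x => Dl m x s) x (- s * Dl m x (s + 1))%C.
Proof.
  revert x. induction m as [|m IH]; intros x Hx; [apply rderiv_npow; auto|]. simpl.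
  eapply rderiv_eq; [|apply rderiv_ext with (fun u => Dl m u s + (0 + - RtoC 1 * Dl m (u + 1) s))%C].
  2: { intros u. ring. }
  2: { apply rderiv_plus; [apply IH, Hx|].
    apply (rderiv_scal 0 (- RtoC 1)%C (fun u => Dl m (u + 1) s)).
    destruct (IH (x + 1) ltac:(lra)) as [p [H1 [H2 H3]]].
    assert (K : filterlim (fun u => u + 1) (locally x) (locally (x + 1))).
    { apply (@continuous_plus R_UniformSpace R_AbsRing R_NormedModule (fun u => u) (fun _ => 1)).
      - apply continuous_id.
      - apply continuous_const. }
    exists (fun u => p (u + 1)). split; [|split].
    - exact (continuous_comp (fun u => u + 1) p x K H1).
    - exact H2.
    - generalize (K _ H3). unfold filtermap. apply locally_R_imp. intros u Hu. rewrite Hu. do 3 f_equal. ring. }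
  ring.
Qed.

(** A difference is the integral of a derivative, and that derivative is again a difference with
    [s + 1] in place of [s]; each step gains a power of [x] at the cost of a factor of size
    [|s|]. *)
Lemma Dl_bound m : forall s x, 1 <= x -> 0 <= Re s + INR m ->
  Cmod (Dl m x s) <= (Cmod s + INR m) ^ m * exp (- (Re s + INR m) * ln x).
Proof.
  induction m as [|m IH]; intros s x Hx Hs.
  - simpl. rewrite Cmod_npow, Rplus_0_r. lra.
  - simpl Dl. rewrite Cmod_minus_sym.
    rewrite <- (CI_FTC (fun x => Dl m x s) (fun x => - s * Dl m x (s + 1))%C x (x + 1)); try lra.
    2: { intros t Ht. apply rderiv_Dl. lra. }
    2: { intros t Ht. apply Ccont_mult; [apply Ccont_const|]. eapply rderiv_cont, rderiv_Dl. lra. }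
    rewrite S_INR in *. pose proof (pos_INR m). pose proof (Cmod_ge_0 s).
    assert (Hln : 0 <= ln x) by (rewrite <- ln_1; apply ln_le; lra).
    eapply Rle_trans; [apply CI_norm with (M := (Cmod s + (INR m + 1)) ^ S m * exp (- (Re s + (INR m + 1)) * ln x))|]; try lra.
    + intros t Ht. apply Ccont_mult; [apply Ccont_const|]. eapply rderiv_cont, rderiv_Dl. lra.
    + intros t Ht. rewrite Cmod_mult, Cmod_opp. simpl pow. rewrite Rmult_assoc.
      apply Rmult_le_compat; try apply Cmod_ge_0; [lra|].
      eapply Rle_trans; [apply IH|]; try lra.
      { rewrite re_plus. simpl. lra. }
      apply Rmult_le_compat.
      * apply pow_le. pose proof (Cmod_ge_0 (s + 1)). lra.
      * left; apply exp_pos.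
      * apply pow_incr. split; [pose proof (Cmod_ge_0 (s + 1)); lra|].
        pose proof (Cmod_triangle s 1) as Q. rewrite Cmod_1 in Q. lra.
      * rewrite re_plus. simpl Re. 
        assert (ln x <= ln t) by (apply ln_le; lra).
        apply exp_le. replace (Re s + 1 + INR m) with (Re s + (INR m + 1)) by ring. nra.
Qed.

Lemma summable_of_bounded b B : (forall n, 0 <= b n) -> (forall N, rsum b N <= B) -> exists S, summable b S /\ S <= B.
Proof.
  intros H0 HB. destruct (ex_finite_lim_seq_incr (rsum b) B) as [S HS]; auto.
  - intros n. simpl. pose proof (H0 n). lra.
  - exists S. split; [split; auto|].
    apply (is_lim_seq_le (rsum b) (fun _ => B) S B); auto. apply is_lim_seq_const.
Qed.

Lemma ln_succ_ge n : 0 < n -> / (n + 1) <= ln (n + 1) - ln n.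
Proof.
  intros Hn. rewrite <- ln_div by lra.
  assert (E : ln ((n + 1) / n) = - ln (n / (n + 1))).
  { rewrite <- ln_Rinv by (apply Rdiv_lt_0_compat; lra). f_equal. field. lra. }
  rewrite E.
  assert (Hp : 0 < n / (n + 1)) by (apply Rdiv_lt_0_compat; lra).
  pose proof (exp_ineq1_le (ln (n / (n + 1)))) as Q. rewrite exp_ln in Q by auto.
  assert (n / (n + 1) = 1 - / (n + 1)) by (field; lra). lra.
Qed.

(* For [t > 0], [t (n+1)^(-1-t) <= n^(-t) - (n+1)^(-t)], so the sum telescopes. *)
Lemma power_tail_step t n : 0 < t -> 0 < n ->
  t * exp (- (1 + t) * ln (n + 1)) <= exp (- t * ln n) - exp (- t * ln (n + 1)).
Proof.
  intros Ht Hn. pose proof (ln_succ_ge n Hn) as Q.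
  replace (- t * ln n) with (- t * ln (n + 1) + t * (ln (n + 1) - ln n)) by ring.
  replace (- (1 + t) * ln (n + 1)) with (- t * ln (n + 1) + - ln (n + 1)) by ring.
  rewrite !exp_plus, exp_Ropp, exp_ln by lra.
  pose proof (exp_ineq1_le (t * (ln (n + 1) - ln n))).
  pose proof (exp_pos (- t * ln (n + 1))).
  assert (t * / (n + 1) <= t * (ln (n + 1) - ln n)) by (apply Rmult_le_compat_l; lra).
  nra.
Qed.

Lemma power_sum_bound t N : 0 < t ->
  t * rsum (fun n => exp (- (1 + t) * ln (INR n + 2))) N <= 1 - exp (- t * ln (INR N + 1)).
Proof.
  intros Ht. induction N as [|N IH].
  - simpl. rewrite Rplus_0_l, ln_1, !Rmult_0_r, exp_0. lra.
  - simpl rsum. rewrite S_INR. pose proof (pos_INR N).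
    pose proof (power_tail_step t (INR N + 1) Ht ltac:(lra)) as Q.
    replace (INR N + 1 + 1) with (INR N + 2) in * by ring. lra.
Qed.

Lemma power_summable2 t : 0 < t -> exists S,
  summable (fun n => exp (- (1 + t) * ln (INR n + 2))) S /\ S <= / t.
Proof.
  intros Ht. apply summable_of_bounded.
  - intros n. left. apply exp_pos.
  - intros N. pose proof (power_sum_bound t N Ht). pose proof (exp_pos (- t * ln (INR N + 1))).
    apply Rmult_le_reg_l with t; auto. rewrite Rinv_r by lra. lra.
Qed.

Lemma rsum_ext a b N : (forall n, (n < N)%nat -> a n = b n) -> rsum a N = rsum b N.
Proof. induction N as [|N IH]; simpl; intros H; auto. rewrite IH, H; auto. Qed.

Lemma rsum_S_l b N : rsum b (S N) = b O + rsum (fun n => b (S n)) N.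
Proof. induction N as [|N IH]; [simpl; ring|]. simpl rsum in *. rewrite IH. ring. Qed.

Lemma csum_S_l b N : csum b (S N) = (b O + csum (fun n => b (S n)) N)%C.
Proof. induction N as [|N IH]; [simpl; ring|]. simpl csum in *. rewrite IH. ring. Qed.

Lemma power_summable a : 1 < a -> exists B, summable (fun n => exp (- a * ln (INR (S n)))) B.
Proof.
  intros Ha. destruct (power_summable2 (a - 1)) as [S [HS _]]; [lra|].
  destruct (summable_of_bounded (fun n => exp (- a * ln (INR (Datatypes.S n)))) (1 + S)) as [S' [H _]].
  - intros n. left. apply exp_pos.
  - intros N. apply Rle_trans with (rsum (fun n => exp (- a * ln (INR (Datatypes.S n)))) (Datatypes.S N)).
    + simpl. pose proof (exp_pos (- a * ln (INR (Datatypes.S N)))). simpl in *. lra.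
    + rewrite rsum_S_l. simpl INR at 1. rewrite ln_1, Rmult_0_r, exp_0. apply Rplus_le_compat_l.
      pose proof (summable_le _ _ N HS) as Q. eapply Rle_trans; [|exact Q]. right.
      apply rsum_ext. intros n _. rewrite !S_INR. do 2 f_equal; [ring|f_equal; ring].
  - exists S'. exact H.
Qed.

Definition sgn (n : nat) : C := RtoC ((-1) ^ n).

Lemma Cmod_sgn n : Cmod (sgn n) = 1.
Proof. unfold sgn. rewrite Cmod_R. apply pow_1_abs. Qed.

Lemma sgn_S n : sgn (S n) = (- sgn n)%C.
Proof. unfold sgn. rewrite <- RtoC_opp. f_equal. simpl. ring. Qed.

Definition alt (m : nat) (s : C) (n : nat) : C := (sgn n * Dl m (INR (S n)) s)%C.

(* Nine steps give convergence for [Re s > -7], which contains the discs of radius 9 about [3 + iT] used to count zeros. *)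
Definition euler_m : nat := 9.

(* Euler's transformation of [sum (-1)^n (n+1)^(-s)], applied [euler_m] times. *)
Definition eta (s : C) : C :=
  (csum (fun i => Dl i 1 s / RtoC 2 ^ S i) euler_m + Clim (csum (alt euler_m s)) / RtoC 2 ^ euler_m)%C.

Lemma alt_bound m s n : 0 <= Re s + INR m ->
  Cmod (alt m s n) <= (Cmod s + INR m) ^ m * exp (- (Re s + INR m) * ln (INR (S n))).
Proof.
  intros H. unfold alt. rewrite Cmod_mult, Cmod_sgn, Rmult_1_l. apply Dl_bound; auto.
  rewrite S_INR. pose proof (pos_INR n). lra.
Qed.

(** For [Re s > -7] nine differences leave an exponent above 2, so the series is dominated by a
    multiple of the sum of [n^(-2)]. *)
Lemma eta_lim s : -7 < Re s -> is_clim (csum (alt euler_m s)) (Clim (csum (alt euler_m s))).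
Proof.
  intros H. destruct (power_summable 2) as [S HS]; [lra|].
  assert (H9 : INR euler_m = 9) by (unfold euler_m; simpl; ring).
  destruct (series_Mtest (alt euler_m s) (fun n => (Cmod s + 9) ^ euler_m * exp (- (2) * ln (INR (Datatypes.S n)))) ((Cmod s + 9) ^ euler_m * S)) as [l [Hl _]].
  - apply summable_scal; auto. apply pow_le. pose proof (Cmod_ge_0 s). lra.
  - intros n. eapply Rle_trans; [apply alt_bound; lra|]. rewrite H9.
    apply Rmult_le_compat_l; [apply pow_le; pose proof (Cmod_ge_0 s); lra|].
    apply exp_le. assert (0 <= ln (INR (Datatypes.S n))); [|nra].
    rewrite <- ln_1. apply ln_le; [lra|]. rewrite S_INR. pose proof (pos_INR n). lra.
  - rewrite (is_clim_Clim _ _ Hl). exact Hl.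
Qed.

Lemma hol_eta s : -7 < Re s -> hol eta s.
Proof.
  intros Hs. unfold eta. apply hol_plus.
  - apply (hol_csum (fun i s => Dl i 1 s / RtoC 2 ^ S i)%C). intros i.
    apply hol_mult; [apply hol_Dl|apply hol_const].
  - apply hol_mult; [|apply hol_const].
    destruct (power_summable 2) as [S HS]; [lra|].
    assert (H9 : INR euler_m = 9) by (unfold euler_m; simpl; ring).
    set (K := (Cmod s + 1 + 9) ^ euler_m).
    assert (HK : 0 <= K) by (apply pow_le; pose proof (Cmod_ge_0 s); lra).
    assert (Hr : forall z, Cmod (z - s) < Rmin 1 (Re s + 7) -> -7 < Re z /\ Cmod z <= Cmod s + 1).
    { intros z Hz. pose proof (Rmin_l 1 (Re s + 7)). pose proof (Rmin_r 1 (Re s + 7)).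
      pose proof (re_le_Cmod (z - s)) as Q. apply Rabs_le_between in Q.
      unfold Cminus in Q. rewrite re_plus, re_opp in Q. split; [unfold Cminus in *; lra|].
      replace z with ((z - s) + s)%C by ring. eapply Rle_trans; [apply Cmod_triangle|]. lra. }
    apply (hol_series (fun n z => alt euler_m z n) (fun z => Clim (csum (alt euler_m z)))
       (fun n => K * exp (- (2) * ln (INR (Datatypes.S n)))) (K * S) s (Rmin 1 (Re s + 7))).
    + apply Rmin_pos; lra.
    + apply summable_scal; auto.
    + intros n z Hz. destruct (Hr z Hz) as [H1 H2]. split.
      * apply hol_mult; [apply hol_const|apply hol_Dl].
      * eapply Rle_trans; [apply alt_bound; lra|]. rewrite H9. apply Rmult_le_compat.
        -- apply pow_le. pose proof (Cmod_ge_0 z). lra.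
        -- left; apply exp_pos.
        -- apply pow_incr. pose proof (Cmod_ge_0 z). lra.
        -- apply exp_le. assert (0 <= ln (INR (Datatypes.S n))); [|nra].
           rewrite <- ln_1. apply ln_le; [lra|]. rewrite S_INR. pose proof (pos_INR n). lra.
    + intros z Hz. apply eta_lim, Hr, Hz.
Qed.

(** For the finitely many leading terms of [eta] no decay is required: a difference of order [m] is
    a sum of [2^m] powers. *)
Lemma Dl_crude m s x : 1 <= x -> -7 <= Re s -> Cmod (Dl m x s) <= 2 ^ m * exp (7 * ln (x + INR m)).
Proof.
  intros Hx Hs. revert x Hx. induction m as [|m IH]; intros x Hx.
  - simpl. rewrite Cmod_npow, Rplus_0_r, Rmult_1_l.
    assert (0 <= ln x) by (rewrite <- ln_1; apply ln_le; lra).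
    apply exp_le. nra.
  - simpl Dl. rewrite S_INR. pose proof (pos_INR m).
    unfold Cminus. eapply Rle_trans; [apply Cmod_triangle|]. rewrite Cmod_opp.
    pose proof (IH x Hx) as Q1. pose proof (IH (x + 1) ltac:(lra)) as Q2.
    replace (x + 1 + INR m) with (x + (INR m + 1)) in Q2 by ring.
    assert (exp (7 * ln (x + INR m)) <= exp (7 * ln (x + (INR m + 1)))).
    { apply exp_le. apply Rmult_le_compat_l; [lra|]. apply ln_le; lra. }
    assert (0 < 2 ^ m) by (apply pow_lt; lra).
    simpl pow. nra.
Qed.

Lemma Cmod_csum_le f b N : (forall n, (n < N)%nat -> Cmod (f n) <= b) -> Cmod (csum f N) <= INR N * b.
Proof.
  induction N as [|N IH]; intros H.
  - simpl. rewrite Cmod_0. lra.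
  - simpl csum. rewrite S_INR. eapply Rle_trans; [apply Cmod_triangle|].
    pose proof (H N ltac:(lia)). pose proof (IH ltac:(auto)). lra.
Qed.

(** The degree 9 is the number of differences, each costing a factor of size [|s|]; the leading
    terms are bounded uniformly through [10^7]. *)
Lemma eta_growth : exists K, 0 < K /\ forall s, -7 < Re s -> Cmod (eta s) <= K * (Cmod s + 10) ^ 9.
Proof.
  destruct (power_summable 2) as [S HS]; [lra|].
  assert (H9 : INR euler_m = 9) by (unfold euler_m; simpl; ring).
  assert (HS0 : 0 <= S) by (exact (summable_le _ _ 0 HS)).
  set (E0 := exp (7 * ln 10)). assert (HE0 : 0 < E0) by apply exp_pos.
  exists (9 * E0 + S + 1). split; [lra|].
  intros s Hs. pose proof (Cmod_ge_0 s) as Hs0.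
  assert (H2 : forall k, 1 <= 2 ^ k) by (intros k; apply pow_R1_Rle; lra).
  assert (Hpow : forall k, Cmod (RtoC 2 ^ k) = 2 ^ k).
  { intros k. rewrite <- RtoC_pow, Cmod_R_pos; auto. pose proof (H2 k). lra. }
  assert (Hnz : forall k, (RtoC 2 ^ k)%C <> 0).
  { intros k. apply C_nz. rewrite Hpow. pose proof (H2 k). lra. }
  assert (B1 : Cmod (csum (fun i => Dl i 1 s / RtoC 2 ^ Datatypes.S i)%C euler_m) <= 9 * E0).
  { rewrite <- H9. apply Cmod_csum_le. intros n Hn.
    rewrite Cmod_div, Hpow by auto.
    pose proof (Dl_crude n s 1 ltac:(lra) ltac:(lra)) as Q.
    assert (exp (7 * ln (1 + INR n)) <= E0).
    { apply exp_le. apply Rmult_le_compat_l; [lra|]. pose proof (pos_INR n). apply ln_le; [lra|].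
      assert (INR n <= 9); [|lra]. rewrite <- H9. apply le_INR. lia. }
    pose proof (H2 n).
    apply Rmult_le_reg_r with (2 ^ Datatypes.S n); [simpl; lra|].
    unfold Rdiv. rewrite Rmult_assoc, Rinv_l by (simpl; lra). simpl. nra. }
  destruct (series_Mtest (alt euler_m s) (fun n => (Cmod s + 9) ^ euler_m * exp (- (2) * ln (INR (Datatypes.S n)))) ((Cmod s + 9) ^ euler_m * S)) as [l [Hl Hl']].
  - apply summable_scal; auto. apply pow_le. lra.
  - intros n. eapply Rle_trans; [apply alt_bound; lra|]. rewrite H9.
    apply Rmult_le_compat_l; [apply pow_le; lra|].
    apply exp_le. assert (0 <= ln (INR (Datatypes.S n))); [|nra].
    rewrite <- ln_1. apply ln_le; [lra|]. rewrite S_INR. pose proof (pos_INR n). lra.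
  - unfold eta. rewrite (is_clim_Clim _ _ Hl).
    specialize (Hl' 0%nat). simpl rsum in Hl'. simpl csum in Hl'.
    replace (l - 0)%C with l in Hl' by ring. rewrite Rminus_0_r in Hl'.
    eapply Rle_trans; [apply Cmod_triangle|].
    assert (B2 : Cmod (l / RtoC 2 ^ euler_m) <= (Cmod s + 9) ^ euler_m * S).
    { rewrite Cmod_div, Hpow by auto. pose proof (H2 euler_m). pose proof (Cmod_ge_0 l).
      apply Rle_trans with (Cmod l); auto.
      apply Rmult_le_reg_r with (2 ^ euler_m); [lra|].
      unfold Rdiv. rewrite Rmult_assoc, Rinv_l by lra. nra. }
    assert (B3 : (Cmod s + 9) ^ euler_m <= (Cmod s + 10) ^ 9) by (apply pow_incr; lra).
    assert (B4 : 1 <= (Cmod s + 10) ^ 9) by (apply pow_R1_Rle; lra).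
    nra.
Qed.

Lemma csum_scal c f N : csum (fun n => (c * f n)%C) N = (c * csum f N)%C.
Proof. induction N as [|N IH]; simpl; [ring|]. rewrite IH. ring. Qed.

Lemma csum_plus f g N : csum (fun n => (f n + g n)%C) N = (csum f N + csum g N)%C.
Proof. induction N as [|N IH]; simpl; [ring|]. rewrite IH. ring. Qed.

Lemma csum_ext f g N : (forall n, (n < N)%nat -> f n = g n) -> csum f N = csum g N.
Proof. induction N as [|N IH]; simpl; intros H; auto. rewrite IH, H; auto. Qed.

(** * The zeta function in [Re s > 1] and its continuation *)

Lemma zeta_abs s : 1 < Re s -> exists B, summable (fun n => Cmod (npow (INR (S n)) s)) B.
Proof.
  intros Hs. destruct (power_summable (Re s) Hs) as [S HS].
  exists S. destruct HS as [H0 HS]. split; [intros; apply Cmod_ge_0|].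
  revert HS. apply is_lim_seq_ext. intros n. apply rsum_ext. intros k _. symmetry. apply Cmod_npow.
Qed.

Lemma zeta_cv s : 1 < Re s -> exists l, is_clim (csum (fun n => npow (INR (S n)) s)) l.
Proof.
  intros Hs. destruct (zeta_abs s Hs) as [S HS].
  destruct (series_Mtest _ _ S HS (fun n => Rle_refl _)) as [l [Hl _]]. exists l. exact Hl.
Qed.

(** Summation by parts. In the limit the alternating sum of [a] is half of [a 0] plus half of the
    alternating sum of the differences, which is one step of Euler's transformation. *)
Lemma alt_euler_step a N : csum (fun n => (sgn n * (a n - a (S n)))%C) N =
  (RtoC 2 * csum (fun n => (sgn n * a n)%C) N - a O + sgn N * a N)%C.
Proof.
  induction N as [|N IH]; simpl csum.
  - unfold sgn. simpl. ring.
  - rewrite IH, sgn_S. ring.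
Qed.

Lemma Dl_tends_0 s m : 0 < Re s -> is_clim (fun N => (sgn N * Dl m (INR (S N)) s)%C) 0.
Proof.
  intros Hs. induction m as [|m IH].
  - simpl Dl. intros e He.
    assert (Hl : is_lim_seq (fun n => ln (INR (S n))) p_infty).
    { apply (is_lim_comp_seq ln (fun n => INR (S n)) p_infty p_infty is_lim_ln_p).
      - exists O. intros n _. discriminate.
      - apply (is_lim_seq_incr_1 INR). apply is_lim_seq_INR. }
    apply is_lim_seq_spec in Hl. destruct (Hl (- ln e / Re s)) as [N HN]. exists N. intros n Hn.
    specialize (HN n Hn).
    assert (HN' : - Re s * ln (INR (S n)) < ln e).
    { apply Rmult_lt_compat_l with (r := Re s) in HN; auto.
      replace (Re s * (- ln e / Re s)) with (- ln e) in HN by (field; lra). lra. }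
    assert (E : Cmod (sgn n * npow (INR (S n)) s - 0) < e); [|exact E].
    replace (sgn n * npow (INR (S n)) s - 0)%C with (sgn n * npow (INR (S n)) s)%C by ring.
    rewrite Cmod_mult, Cmod_sgn, Cmod_npow, Rmult_1_l.
    rewrite <- (exp_ln e) by auto. apply exp_increasing, HN'.
  - apply is_clim_ext with (fun N => (sgn N * Dl m (INR (S N)) s + sgn (S N) * Dl m (INR (S (S N))) s)%C).
    + intros n. rewrite Dl_S, sgn_S, <- (S_INR (S n)). ring.
    + replace (RtoC 0) with (RtoC 0 + RtoC 0)%C by ring. apply is_clim_plus; auto.
      apply (is_clim_ext (fun n => (sgn (n + 1) * Dl m (INR (S (n + 1))) s)%C)).
      * intros n. rewrite Nat.add_1_r. reflexivity.
      * apply (is_clim_incr_n (fun n => (sgn n * Dl m (INR (S n)) s)%C) 0 1). exact IH.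
Qed.

Lemma alt_cv s m l : 0 < Re s -> is_clim (csum (alt 0 s)) l ->
  exists l', is_clim (csum (alt m s)) l' /\
    l = (csum (fun i => Dl i 1 s / RtoC 2 ^ S i) m + l' / RtoC 2 ^ m)%C.
Proof.
  intros Hs Hl. induction m as [|m [l' [H1 H2]]].
  - exists l. split; auto. simpl. field.
  - exists (RtoC 2 * l' - Dl m 1 s + 0)%C. split.
    + apply is_clim_ext with (fun N => (RtoC 2 * csum (alt m s) N - Dl m 1 s + sgn N * Dl m (INR (S N)) s)%C).
      * intros N. change (Dl m 1 s) with (Dl m (INR 1) s).
        rewrite <- (alt_euler_step (fun n => Dl m (INR (S n)) s)).
        apply csum_ext. intros n _. unfold alt. rewrite (S_INR (S n)). reflexivity.
      * apply is_clim_plus; [|apply Dl_tends_0; auto].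
        apply is_clim_plus; [apply is_clim_scal; auto|]. apply is_clim_const.
    + rewrite H2. simpl csum. simpl Cpow. field.
      apply Cpow_nz. apply C_nz. rewrite Cmod_R_pos; lra.
Qed.

Lemma csum_alt_even b N :
  csum (fun n => (sgn n * b n)%C) (2 * N) = (csum b (2 * N) - RtoC 2 * csum (fun k => b (2 * k + 1)%nat) N)%C.
Proof.
  induction N as [|N IH]; [simpl; ring|].
  replace (2 * S N)%nat with (S (S (2 * N))) by lia. simpl csum. simpl csum in IH.
  change (N + (N + 0))%nat with (2 * N)%nat in *.
  rewrite IH, sgn_S.
  assert (E : sgn (2 * N) = 1).
  { unfold sgn. rewrite pow_1_even. reflexivity. }
  rewrite E. replace (2 * N + 1)%nat with (S (2 * N)) by lia. ring.
Qed.

(** Along even lengths the alternating sum is the full sum minus twice the terms at even integers,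
    and these are [2^(-s)] times a sum of half the length. *)
Lemma eta_zeta s l : 1 < Re s -> is_clim (csum (fun n => npow (INR (S n)) s)) l ->
  eta s = ((1 - RtoC 2 * npow 2 s) * l)%C.
Proof.
  intros Hs Hl.
  destruct (zeta_abs s Hs) as [S HS].
  destruct (series_Mtest (alt 0 s) _ S HS) as [l0 [Hl0 _]].
  { intros n. unfold alt. rewrite Cmod_mult, Cmod_sgn. simpl. lra. }
  assert (E0 : l0 = ((1 - RtoC 2 * npow 2 s) * l)%C).
  { assert (Hsub : forall u v, is_clim u v -> is_clim (fun N => u (2 * N)%nat) v).
    { intros u v H e He. destruct (H e He) as [N HN]. exists N. intros n Hn. apply HN. lia. }
    apply (is_clim_unique (fun N => csum (alt 0 s) (2 * N))); [apply Hsub; auto|].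
    apply is_clim_ext with (fun N => csum (fun n => npow (INR (Datatypes.S n)) s) (2 * N) +
       - (RtoC 2 * npow 2 s) * csum (fun n => npow (INR (Datatypes.S n)) s) N)%C.
    - intros N. change (alt 0 s) with (fun n => (sgn n * npow (INR (Datatypes.S n)) s)%C).
      rewrite (csum_alt_even (fun n => npow (INR (Datatypes.S n)) s)).
      rewrite (csum_ext (fun k => npow (INR (Datatypes.S (2 * k + 1))) s) (fun k => npow 2 s * npow (INR (Datatypes.S k)) s)%C).
      + rewrite csum_scal. ring.
      + intros n _. rewrite <- npow_mult; [|lra|apply lt_0_INR; lia]. f_equal.
        rewrite !S_INR, plus_INR, mult_INR. simpl. ring.
    - replace ((1 - RtoC 2 * npow 2 s) * l)%C with (l + - (RtoC 2 * npow 2 s) * l)%C by ring.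
      apply is_clim_plus; [apply Hsub; auto|]. apply is_clim_scal; auto. }
  destruct (alt_cv s euler_m l0 ltac:(lra) Hl0) as [l' [H1 H2]].
  unfold eta. rewrite (is_clim_Clim _ _ H1), <- H2. exact E0.
Qed.

Definition den2 (s : C) : C := (1 - RtoC 2 * npow 2 s)%C.

Lemma hol_den2 s : hol den2 s.
Proof. apply hol_minus; [apply hol_const|]. apply hol_mult; [apply hol_const|apply hol_npow]. Qed.

Lemma Cmod_2npow2 s : Cmod (RtoC 2 * npow 2 s) = exp ((1 - Re s) * ln 2).
Proof.
  rewrite Cmod_mult, Cmod_npow, Cmod_R_pos by lra.
  rewrite <- (exp_ln 2) at 1 by lra. rewrite <- exp_plus. f_equal. ring.
Qed.

Lemma ln2_pos : 0 < ln 2.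
Proof. rewrite <- ln_1. apply ln_increasing; lra. Qed.

Lemma den2_neq_0 s : 1 < Re s -> den2 s <> 0.
Proof.
  intros Hs E. unfold den2 in E. apply Ceq_minus in E.
  pose proof (Cmod_2npow2 s) as Q. rewrite <- E, Cmod_1 in Q.
  pose proof ln2_pos. assert (exp ((1 - Re s) * ln 2) < exp 0) by (apply exp_increasing; nra).
  rewrite exp_0 in *. lra.
Qed.

(* [zeta_i] is [/ zeta_c] written as a quotient of functions holomorphic on [Re s > -7]. *)
Definition zeta_c (s : C) : C := (eta s / den2 s)%C.
Definition zeta_i (s : C) : C := (den2 s / eta s)%C.
(** Off the zeros of this one function both [zeta_c] and [zeta_i] are holomorphic and nonzero, so
    counting its zeros controls the zeros and poles of zeta at once. *)
Definition Phi (s : C) : C := (eta s * den2 s)%C.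

Lemma zeta_c_lim s : 1 < Re s -> is_clim (csum (fun n => npow (INR (S n)) s)) (zeta_c s).
Proof.
  intros Hs. destruct (zeta_cv s Hs) as [l Hl].
  unfold zeta_c. rewrite (eta_zeta s l Hs Hl). fold (den2 s).
  replace (den2 s * l / den2 s)%C with l; auto. field. apply den2_neq_0, Hs.
Qed.

Lemma hol_Phi s : -7 < Re s -> hol Phi s.
Proof. intros Hs. apply hol_mult; [apply hol_eta, Hs|apply hol_den2]. Qed.

Lemma den2_right s : 3 <= Re s -> 1 / 2 <= Cmod (den2 s).
Proof.
  intros Hs. unfold den2.
  pose proof (Cmod_rev 1 (- (RtoC 2 * npow 2 s))) as Q. rewrite Cmod_1, Cmod_opp, Cmod_2npow2 in Q.
  assert (exp ((1 - Re s) * ln 2) <= / 2); [|unfold Cminus; lra].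
  rewrite <- (exp_ln 2) at 2 by lra. rewrite <- exp_Ropp. apply exp_le. pose proof ln2_pos. nra.
Qed.

(** The alternating series starts with 1, and the other terms sum to at most 1/2. With [den2_right]
    this makes [Phi] nonzero at the centres [3 + iT] of the counting discs. *)
Lemma eta_right s : 3 <= Re s -> 1 / 2 <= Cmod (eta s).
Proof.
  intros Hs.
  destruct (zeta_abs s ltac:(lra)) as [S HS].
  destruct (series_Mtest (alt 0 s) _ S HS) as [l0 [Hl0 _]].
  { intros n. unfold alt. rewrite Cmod_mult, Cmod_sgn. simpl. lra. }
  destruct (alt_cv s euler_m l0 ltac:(lra) Hl0) as [l' [H1 H2]].
  assert (E : eta s = l0) by (unfold eta; rewrite (is_clim_Clim _ _ H1), <- H2; reflexivity).
  rewrite E.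
  assert (Hb : Cmod (l0 - 1) <= / 2).
  (* With [t = 2] the bound [/ t] says that the sum of [n^(-3)] over [n >= 2] is at most 1/2. *)
  { destruct (power_summable2 2) as [S2 [HS2 HS2']]; [lra|].
    apply (is_clim_le (fun N => csum (alt 0 s) (N + 1) - 1)%C).
    - apply is_clim_plus; [|apply is_clim_const]. exact (proj1 (is_clim_incr_n _ _ 1) Hl0).
    - exists O. intros N _. rewrite Nat.add_1_r, csum_S_l.
      replace (alt 0 s 0) with (RtoC 1).
      2: { unfold alt, sgn. simpl. rewrite npow_1. ring. }
      replace (1 + csum (fun n => alt 0 s (Datatypes.S n)) N - 1)%C with (csum (fun n => alt 0 s (Datatypes.S n)) N) by ring.
      eapply Rle_trans; [|apply HS2'].
      eapply Rle_trans; [|apply (summable_le _ _ N HS2)].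
      pose proof (csum_diff_bound (fun n => alt 0 s (Datatypes.S n)) (fun n => exp (- (1 + 2) * ln (INR n + 2))) 0 N) as Q.
      simpl csum in Q. simpl rsum in Q. rewrite Rminus_0_r in Q.
      replace (csum (fun n => alt 0 s (Datatypes.S n)) N - 0)%C with (csum (fun n => alt 0 s (Datatypes.S n)) N) in Q by ring.
      apply Q; [|lia]. intros n. unfold alt. rewrite Cmod_mult, Cmod_sgn, Rmult_1_l.
      change (Dl 0 (INR (Datatypes.S (Datatypes.S n))) s) with (npow (INR (Datatypes.S (Datatypes.S n))) s).
      rewrite Cmod_npow. apply exp_le. rewrite !S_INR. replace (INR n + 1 + 1) with (INR n + 2) by ring.
      assert (0 <= ln (INR n + 2)); [|nra].
      rewrite <- ln_1. pose proof (pos_INR n). apply ln_le; lra. }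
  pose proof (Cmod_rev 1 (l0 - 1)) as Q. rewrite Cmod_1 in Q.
  replace (1 + (l0 - 1))%C with l0 in Q by ring. lra.
Qed.

Lemma re_minus a b : Re (a - b) = Re a - Re b.
Proof. reflexivity. Qed.

Lemma im_minus a b : Im (a - b) = Im a - Im b.
Proof. reflexivity. Qed.

Lemma Re_near z c d : Cmod (z - c) < d -> Re c - d < Re z < Re c + d.
Proof.
  intros H. pose proof (re_le_Cmod (z - c)) as Q. rewrite re_minus in Q.
  apply Rabs_le_between in Q. lra.
Qed.

Lemma Phi_right s : 3 <= Re s -> 1 / 4 <= Cmod (Phi s).
Proof.
  intros Hs. unfold Phi. rewrite Cmod_mult.
  pose proof (eta_right s Hs). pose proof (den2_right s Hs). nra.
Qed.

Lemma Phi_growth : exists K, 0 < K /\ forall s, -7 < Re s -> Cmod (Phi s) <= K * (Cmod s + 10) ^ 9.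
Proof.
  destruct eta_growth as [K [HK H]]. set (D := 1 + exp (8 * ln 2)).
  assert (HD : 0 < D) by (pose proof (exp_pos (8 * ln 2)); unfold D; lra).
  exists (K * D). split; [apply Rmult_lt_0_compat; auto|].
  intros s Hs. unfold Phi. rewrite Cmod_mult.
  assert (Cmod (den2 s) <= D).
  { unfold den2, Cminus. eapply Rle_trans; [apply Cmod_triangle|].
    rewrite Cmod_1, Cmod_opp, Cmod_2npow2. apply Rplus_le_compat_l. apply exp_le.
    pose proof ln2_pos. nra. }
  pose proof (H s Hs). replace (K * D * (Cmod s + 10) ^ 9) with (K * (Cmod s + 10) ^ 9 * D) by ring.
  apply Rmult_le_compat; auto; apply Cmod_ge_0.
Qed.

Lemma Cmod_le_of_parts z a b : Rabs (Re z) <= a -> Rabs (Im z) <= b -> Cmod z <= sqrt (a * a + b * b).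
Proof.
  intros Ha Hb. unfold Cmod. apply sqrt_le_1_alt.
  change (fst z) with (Re z). change (snd z) with (Im z).
  rewrite <- (pow2_abs (Re z)), <- (pow2_abs (Im z)).
  pose proof (Rabs_pos (Re z)). pose proof (Rabs_pos (Im z)). simpl. nra.
Qed.

(** Zeros of [Phi] have [Re < 3], so those of the box lie within [sqrt (16 + 1/4) < 41/10] of
    [3 + iT]. The circle of radius 9 stays in [Re s > -7], and there [|s| + 10 <= 22 (|T| + 1)]. The
    count yields [(49/41)^n] on the left, which Bernoulli's inequality makes linear in [n]. *)
Lemma box_count : exists K, 0 < K /\ forall (T : R) (l : list C), NoDup l ->
  (forall a, In a l -> -1 <= Re a /\ Rabs (Im a - T) <= 1 / 2 /\ Phi a = 0) ->
  INR (length l) <= K * (Rabs T + 1) ^ 9.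
Proof.
  destruct Phi_growth as [K [HK HP]].
  exists (4 * K * 22 ^ 9 * 6). split; [nra|].
  intros T l Hnd Hl. set (c := (3, T) : C).
  assert (HT : 0 <= Rabs T) by apply Rabs_pos.
  assert (Hc : Cmod c <= 3 + Rabs T).
  { unfold c. eapply Rle_trans; [apply Cmod_le_abs|]. rewrite (Rabs_pos_eq 3); lra. }
  set (M := K * (22 * (Rabs T + 1)) ^ 9).
  assert (HR : 0 < 41 / 10 /\ 2 * (41 / 10) < 9 /\ 9 < 95 / 10) by lra.
  assert (Q : Cmod (Phi c) * (9 - 41 / 10) ^ length l <= M * (41 / 10) ^ length l).
  { apply (count_zeros Phi c 9 (95 / 10) (41 / 10) M); auto.
    - intros z Hz. apply hol_Phi. apply Re_near in Hz. simpl in Hz. lra.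
    - intros v _. set (z := (c + RtoC 9 * unit_circ v)%C).
      assert (Hz : Cmod (z - c) = 9) by (apply Cmod_circ; lra).
      assert (Hz' : Cmod (z - c) < 91 / 10) by lra. apply Re_near in Hz'. assert (Hrc : Re c = 3) by reflexivity.
      eapply Rle_trans; [apply HP; lra|]. apply Rmult_le_compat_l; [lra|].
      apply pow_incr. split; [pose proof (Cmod_ge_0 z); lra|].
      assert (Cmod z <= 9 + Cmod c).
      { rewrite <- Hz. replace z with ((z - c) + c)%C at 1 by ring. apply Cmod_triangle. }
      lra.
    - intros a Ha. destruct (Hl a Ha) as [H1 [H2 H3]]. split; auto.
      assert (Re a < 3).
      { apply Rnot_le_lt. intros H. pose proof (Phi_right a H) as Q. rewrite H3, Cmod_0 in Q. lra. }
      eapply Rle_trans; [apply (Cmod_le_of_parts _ 4 (1 / 2))|].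
      + rewrite re_minus. simpl. apply Rabs_le. lra.
      + rewrite im_minus. exact H2.
      + rewrite <- (sqrt_square (41 / 10)) by lra. apply sqrt_le_1_alt. lra. }
  pose proof (Phi_right c ltac:(simpl; lra)) as Hc4.
  set (n := length l) in *.
  assert (E : (9 - 41 / 10) ^ n = (49 / 41) ^ n * (41 / 10) ^ n).
  { rewrite <- Rpow_mult_distr. f_equal. lra. }
  assert (Hp : 0 < (41 / 10) ^ n) by (apply pow_lt; lra).
  rewrite E, <- Rmult_assoc in Q. apply Rmult_le_reg_r in Q; auto.
  pose proof (poly n (8 / 41) ltac:(lra)) as B. replace (1 + 8 / 41) with (49 / 41) in B by lra.
  pose proof (pos_INR n).
  assert (Q2 : 1 / 4 * (49 / 41) ^ n <= M).
  { eapply Rle_trans; [|exact Q]. apply Rmult_le_compat_r; auto. apply pow_le. lra. }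
  assert (HM : M = K * 22 ^ 9 * (Rabs T + 1) ^ 9) by (unfold M; rewrite Rpow_mult_distr; ring).
  assert (0 < (Rabs T + 1) ^ 9) by (apply pow_lt; lra).
  rewrite HM in Q2.
  assert (INR n * (8 / 41) <= 4 * (K * 22 ^ 9 * (Rabs T + 1) ^ 9)) by lra.
  replace (4 * K * 22 ^ 9 * 6 * (Rabs T + 1) ^ 9) with (6 * (4 * (K * 22 ^ 9 * (Rabs T + 1) ^ 9))) by ring.
  lra.
Qed.

Lemma filter_length_split {A} (f : A -> bool) (l : list A) :
  length l = (length (filter f l) + length (filter (fun x => negb (f x)) l))%nat.
Proof. induction l as [|a l IH]; simpl; auto. destruct (f a); simpl; lia. Qed.

(** About [2T] boxes of height 1 cover the range of heights, which raises the degree from 9 to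
    10. *)
Lemma total_count : exists K, 0 < K /\ forall (T : R) (l : list C), 0 <= T -> NoDup l ->
  (forall a, In a l -> -1 <= Re a /\ Rabs (Im a) <= T /\ Phi a = 0) ->
  INR (length l) <= K * (T + 1) ^ 10.
Proof.
  destruct box_count as [K [HK H]].
  exists (K * 2 ^ 9 * 2). split; [lra|].
  intros T l HT Hnd Hl.
  set (B := K * (T + 2) ^ 9).
  assert (HB : 0 <= B) by (apply Rmult_le_pos; [lra|apply pow_le; lra]).
  (* Induction on the number of unit layers above [-T]; for [J = 0] only the height [-T] itself is
     left, and one box takes care of it. *)
  assert (G : forall J l, NoDup l -> INR J <= 2 * T + 1 ->
     (forall a, In a l -> -1 <= Re a /\ - T <= Im a <= - T + INR J /\ Phi a = 0) -> INR (length l) <= INR J * B + B).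
  { clear l Hnd Hl. induction J as [|J IH]; intros l Hnd HJ Hl.
    - simpl INR. rewrite Rmult_0_l, Rplus_0_l.
      eapply Rle_trans; [apply (H (- T) l Hnd)|].
      + intros a Ha. destruct (Hl a Ha) as [H1 [H2 H3]]. simpl in H2. split; auto. split; auto.
        apply Rabs_le. lra.
      + apply Rmult_le_compat_l; [lra|]. apply pow_incr. rewrite Rabs_Ropp, Rabs_pos_eq; lra.
    - rewrite S_INR in *.
      set (f := fun a : C => if Rle_dec (Im a) (- T + INR J) then true else false).
      rewrite (filter_length_split f), plus_INR.
      assert (H1 : INR (length (filter f l)) <= INR J * B + B).
      { apply IH; [apply NoDup_filter, Hnd|lra|].
        intros a Ha. apply filter_In in Ha. destruct Ha as [Ha Hfa]. unfold f in Hfa.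
        destruct (Rle_dec (Im a) (- T + INR J)); [|discriminate].
        destruct (Hl a Ha) as [H1 [H2 H3]]. split; auto. split; auto. lra. }
      assert (H2 : INR (length (filter (fun x => negb (f x)) l)) <= B).
      { eapply Rle_trans; [apply (H (- T + INR J + 1 / 2))|].
        - apply NoDup_filter, Hnd.
        - intros a Ha. apply filter_In in Ha. destruct Ha as [Ha Hfa]. unfold f in Hfa.
          destruct (Rle_dec (Im a) (- T + INR J)); [discriminate|].
          destruct (Hl a Ha) as [H1' [H2 H3]]. split; auto. split; auto. apply Rabs_le. lra.
        - apply Rmult_le_compat_l; [lra|]. apply pow_incr. split; [pose proof (Rabs_pos (- T + INR J + 1 / 2)); lra|].
          pose proof (pos_INR J). assert (Rabs (- T + INR J + 1 / 2) <= T + 1); [|lra].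
          apply Rabs_le. lra. }
      lra. }
  destruct (archimed (2 * T)) as [U1 U2].
  set (J := Z.to_nat (up (2 * T))).
  assert (HJ : INR J = IZR (up (2 * T))).
  { unfold J. rewrite INR_IZR_INZ, Z2Nat.id; auto. apply le_IZR. lra. }
  eapply Rle_trans; [apply (G J l Hnd)|].
  - lra.
  - intros a Ha. destruct (Hl a Ha) as [H1 [H2 H3]]. split; auto. split; auto.
    apply Rabs_le_between in H2. lra.
  - assert (INR J * B + B <= (2 * T + 2) * B) by nra.
    eapply Rle_trans; [eassumption|]. unfold B.
    assert ((T + 2) ^ 9 <= (2 * (T + 1)) ^ 9) by (apply pow_incr; lra).
    rewrite Rpow_mult_distr in *.
    assert (0 < (T + 1) ^ 9) by (apply pow_lt; lra).
    replace (K * 2 ^ 9 * 2 * (T + 1) ^ 10) with ((2 * T + 2) * (K * (2 ^ 9 * (T + 1) ^ 9))) by ring.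
    apply Rmult_le_compat_l; [lra|]. apply Rmult_le_compat_l; lra.
Qed.

(** A point where [f] does not vanish is at hand: [a] itself when [3 <= Re a], and otherwise
    [3 + i Im a], at distance at most 4, whose disc of radius 9 stays in [Re s > -7]. *)
Lemma mero_inv_right (f : C -> C) (a : C) : (forall s, -7 < Re s -> hol f s) ->
  (forall s, 3 <= Re s -> f s <> 0) -> -1 <= Re a -> mero (fun z => (/ f z)%C) a.
Proof.
  intros Hf Hnz Ha. destruct (Rle_dec 3 (Re a)) as [H3|H3].
  - apply (mero_inv f a 1 3 a); auto.
    + intros z Hz. apply Hf. apply Re_near in Hz. lra.
    + lra.
    + replace (a - a)%C with (RtoC 0) by ring. rewrite Cmod_0. lra.
  - apply (mero_inv f (3, Im a) 4 9 a).
    + intros z Hz. apply Hf. apply Re_near in Hz. simpl in Hz. lra.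
    + lra.
    + apply Hnz. simpl. lra.
    + eapply Rle_trans; [apply (Cmod_le_of_parts _ 4 0)|].
      * rewrite re_minus. simpl. apply Rabs_le. lra.
      * rewrite im_minus. simpl. rewrite Rminus_diag_eq, Rabs_R0 by reflexivity. lra.
      * right. replace (4 * 4 + 0 * 0) with (4 * 4) by ring. apply sqrt_square. lra.
Qed.

Lemma mero_hol_right (f : C -> C) (a : C) : (forall s, -7 < Re s -> hol f s) -> -1 <= Re a -> mero f a.
Proof.
  intros Hf Ha. apply (mero_hol f a 1); [lra|]. intros z Hz. apply Hf. apply Re_near in Hz. lra.
Qed.

Lemma mero_zeta_c a : -1 <= Re a -> mero zeta_c a.
Proof.
  intros Ha. apply (mero_mult eta (fun s => / den2 s)%C).
  - apply mero_hol_right; auto. apply hol_eta.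
  - apply mero_inv_right; auto.
    + intros; apply hol_den2.
    + intros s Hs. apply C_nz. pose proof (den2_right s Hs). lra.
Qed.

Lemma mero_zeta_i a : -1 <= Re a -> mero zeta_i a.
Proof.
  intros Ha. apply (mero_mult den2 (fun s => / eta s)%C).
  - apply mero_hol_right; auto. intros; apply hol_den2.
  - apply mero_inv_right; auto.
    + apply hol_eta.
    + intros s Hs. apply C_nz. pose proof (eta_right s Hs). lra.
Qed.

Lemma Phi_factors s : Phi s <> 0 -> eta s <> 0 /\ den2 s <> 0.
Proof. unfold Phi. intros H. split; intros E; apply H; rewrite E; ring. Qed.

Lemma zeta_c_good s : -7 < Re s -> Phi s <> 0 -> hol zeta_c s /\ zeta_c s <> 0.
Proof.
  intros Hs H. destruct (Phi_factors s H) as [H1 H2]. split.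
  - apply hol_div; auto; [apply hol_eta, Hs|apply hol_den2].
  - unfold zeta_c, Cdiv. apply Cmult_neq_0; auto. apply C_nz. rewrite Cmod_inv by auto.
    apply Rinv_0_lt_compat, Cmod_gt_0, H2.
Qed.

Lemma zeta_i_good s : -7 < Re s -> Phi s <> 0 -> hol zeta_i s /\ zeta_i s <> 0.
Proof.
  intros Hs H. destruct (Phi_factors s H) as [H1 H2]. split.
  - apply hol_div; auto; [apply hol_den2|apply hol_eta, Hs].
  - unfold zeta_i, Cdiv. apply Cmult_neq_0; auto. apply C_nz. rewrite Cmod_inv by auto.
    apply Rinv_0_lt_compat, Cmod_gt_0, H1.
Qed.

(** * Factoring [1 + 2X] *)

(** Polynomials with integer coefficients, seen as functions. Integrality is what lets a coefficient
    serve as an exponent in [factor_step]. *)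
Inductive int_poly : (C -> C) -> Prop :=
| int_poly_const (a : Z) : int_poly (fun _ => RtoC (IZR a))
| int_poly_X : int_poly (fun X => X)
| int_poly_plus f g : int_poly f -> int_poly g -> int_poly (fun X => f X + g X)%C
| int_poly_mult f g : int_poly f -> int_poly g -> int_poly (fun X => f X * g X)%C.

Lemma int_poly_pow f n : int_poly f -> int_poly (fun X => f X ^ n)%C.
Proof.
  intros H. induction n as [|n IH]; simpl; [apply (int_poly_const 1)|]. apply int_poly_mult; auto.
Qed.

Lemma int_poly_Xn n : int_poly (fun X => X ^ n)%C.
Proof. apply (int_poly_pow (fun X => X)), int_poly_X. Qed.

Lemma int_poly_split g : int_poly g -> exists (a : Z) g1, int_poly g1 /\ forall X, g X = (RtoC (IZR a) + X * g1 X)%C.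
Proof.
  induction 1 as [a| |f g _ [a [f1 [Hf Ef]]] _ [b [g1 [Hg Eg]]]|f g _ [a [f1 [Hf Ef]]] _ [b [g1 [Hg Eg]]]].
  - exists a, (fun _ => RtoC (IZR 0)). split; [apply int_poly_const|]. intros X. ring.
  - exists 0%Z, (fun _ => RtoC (IZR 1)). split; [apply int_poly_const|]. intros X. ring.
  - exists (a + b)%Z, (fun X => f1 X + g1 X)%C. split; [apply int_poly_plus; auto|].
    intros X. rewrite Ef, Eg, plus_IZR, RtoC_plus. ring.
  - exists (a * b)%Z, (fun X => RtoC (IZR a) * g1 X + (RtoC (IZR b) * f1 X + X * (f1 X * g1 X)))%C. split.
    + repeat first [apply int_poly_plus | apply int_poly_mult]; auto using int_poly_const, int_poly_X.
    + intros X. rewrite Ef, Eg, mult_IZR, RtoC_mult. ring.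
Qed.

Lemma int_poly_bounded g : int_poly g -> exists B, 0 <= B /\ forall X, Cmod X <= 1 -> Cmod (g X) <= B.
Proof.
  induction 1 as [a| |f g _ [a [Ha Ba]] _ [b [Hb Bb]]|f g _ [a [Ha Ba]] _ [b [Hb Bb]]].
  - eexists. split; [apply Rabs_pos|]. intros X _. rewrite Cmod_R. apply Rle_refl.
  - exists 1. split; [lra|auto].
  - exists (a + b). split; [lra|]. intros X HX. eapply Rle_trans; [apply Cmod_triangle|].
    pose proof (Ba X HX). pose proof (Bb X HX). lra.
  - exists (a * b). split; [apply Rmult_le_pos; auto|]. intros X HX. rewrite Cmod_mult.
    apply Rmult_le_compat; try apply Cmod_ge_0; auto.
Qed.

Lemma int_poly_binom (e : Z) (k n : nat) : exists r, int_poly r /\ forall X,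
  ((1 + RtoC (IZR e) * X ^ S k) ^ n = 1 + X ^ S k * (RtoC (IZR (e * Z.of_nat n)) + X * r X))%C.
Proof.
  induction n as [|n [r [Hr E]]].
  - exists (fun _ => RtoC (IZR 0)). split; [apply int_poly_const|]. intros X. rewrite Z.mul_0_r. simpl Cpow. ring.
  - exists (fun X => RtoC (IZR (e * (e * Z.of_nat n))) * X ^ k + (r X + RtoC (IZR e) * (X ^ S k * r X)))%C. split.
    + repeat first [apply int_poly_plus | apply int_poly_mult]; auto using int_poly_const, int_poly_Xn, int_poly_X.
    + intros X. rewrite Cpow_S, E. replace (e * Z.of_nat (S n))%Z with (e + e * Z.of_nat n)%Z by lia.
      rewrite plus_IZR, RtoC_plus. rewrite (mult_IZR e (e * _)), RtoC_mult. rewrite (Cpow_S X k). ring.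
Qed.

(* Powers of [1 + X^(k+1)] instead of negative powers of [1 - X^(k+1)] keep everything polynomial. *)
Definition qfac (ap an k : nat) (X : C) : C := ((1 - X ^ S k) ^ ap * (1 + X ^ S k) ^ an)%C.

(** The coefficient [a] of [X^(k+1)] is cancelled by [(1 - X^(k+1))^a] when [a] is positive and by
    [(1 + X^(k+1))^(-a)] otherwise; at least one of the two exponents is 0. *)
Lemma factor_step (k : nat) g : int_poly g -> exists (ap an : nat) g', int_poly g' /\
  forall X, ((1 + X ^ S k * g X) * qfac ap an k X = 1 + X ^ S (S k) * g' X)%C.
Proof.
  intros Hg. destruct (int_poly_split g Hg) as [a [g1 [Hg1 Eg]]].
  set (ap := Z.to_nat a). set (an := Z.to_nat (- a)).
  destruct (int_poly_binom (-1) k ap) as [r [Hr Er]]. destruct (int_poly_binom 1 k an) as [t [Ht Et]].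
  set (b := (-1 * Z.of_nat ap)%Z) in *. set (c := (1 * Z.of_nat an)%Z) in *.
  (* The sum [a + b + c] is the coefficient of [X^(k+1)] in the product. *)
  assert (Habc : (a + b + c = 0)%Z) by (unfold b, c, ap, an; lia).
  exists ap, an.
  exists (fun X => (g1 X + (r X + t X)) + (X ^ k * (g X * (RtoC (IZR b) + X * r X) + (g X * (RtoC (IZR c) + X * t X) +
     (RtoC (IZR b) + X * r X) * (RtoC (IZR c) + X * t X))) +
     X ^ k * (X ^ S k * (g X * ((RtoC (IZR b) + X * r X) * (RtoC (IZR c) + X * t X))))))%C. split.
  - repeat first [apply int_poly_plus | apply int_poly_mult]; auto using int_poly_const, int_poly_Xn, int_poly_X.
  - intros X. unfold qfac.
    replace (1 - X ^ S k)%C with (1 + RtoC (IZR (-1)) * X ^ S k)%C by ring.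
    replace (1 + X ^ S k)%C with (1 + RtoC (IZR 1) * X ^ S k)%C by ring.
    rewrite Er, Et, Eg.
    assert (Ha : RtoC (IZR a) = (- RtoC (IZR b) - RtoC (IZR c))%C).
    { replace a with (- b - c)%Z by lia. rewrite minus_IZR, opp_IZR, RtoC_minus, RtoC_opp. reflexivity. }
    rewrite Ha. rewrite !(Cpow_S X). ring.
Qed.

Lemma factor_seq : exists (ap an : nat -> nat) (g : nat -> C -> C), (forall k, int_poly (g k)) /\
  forall k X, ((1 + RtoC 2 * X) * cprod (fun j => qfac (ap j) (an j) j X) k = 1 + X ^ S k * g k X)%C.
Proof.
  set (T := {g : C -> C | int_poly g}).
  assert (St : forall kg : nat * T, exists r : nat * nat * T, let '(ap, an, g') := r in
    forall X, ((1 + X ^ S (fst kg) * proj1_sig (snd kg) X) * qfac ap an (fst kg) X = 1 + X ^ S (S (fst kg)) * proj1_sig g' X)%C).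
  { intros [k [g Hg]]. destruct (factor_step k g Hg) as [ap [an [g' [Hg' E]]]].
    exists (ap, an, exist _ g' Hg'). exact E. }
  destruct (choice _ St) as [nxt Hnxt].
  set (G := fix G k : T := match k with O => exist _ _ (int_poly_const 2) | S k => snd (nxt (k, G k)) end).
  exists (fun k => fst (fst (nxt (k, G k)))), (fun k => snd (fst (nxt (k, G k)))), (fun k => proj1_sig (G k)).
  split.
  - intros k. destruct (G k). auto.
  - induction k as [|k IH]; intros X.
    + simpl. ring.
    + simpl cprod. rewrite Cmult_assoc, IH. specialize (Hnxt (k, G k)). simpl in Hnxt.
      simpl G. destruct (nxt (k, G k)) as [[ap an] g']. simpl. apply Hnxt.
Qed.

(** * Dirichlet series and the sieve of Eratosthenes *)

Definition dterm (f : nat -> R) (s : C) (n : nat) : C := (RtoC (f (S n)) * npow (INR (S n)) s)%C.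
Definition dabs (f : nat -> R) (s : C) : Prop := exists B, summable (fun n => Cmod (dterm f s n)) B.
Definition dsum (f : nat -> R) (s : C) : C := Clim (csum (dterm f s)).

Lemma dsum_lim f s : dabs f s -> is_clim (csum (dterm f s)) (dsum f s).
Proof.
  intros [B HB]. destruct (series_Mtest _ _ B HB (fun n => Rle_refl _)) as [l [Hl _]].
  unfold dsum. rewrite (is_clim_Clim _ _ Hl). exact Hl.
Qed.

Lemma dsum_eq f s l : is_clim (csum (dterm f s)) l -> dsum f s = l.
Proof. apply is_clim_Clim. Qed.

Lemma dabs_plus f g s : dabs f s -> dabs g s -> dabs (fun n => f n + g n) s.
Proof.
  intros [B HB] [B' HB'].
  destruct (summable_comparison (fun n => Cmod (dterm (fun n => f n + g n) s n)) _ _ (summable_plus _ _ _ _ HB HB')) as [S HS].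
  - intros n. split; [apply Cmod_ge_0|]. unfold dterm. rewrite RtoC_plus, Cmult_plus_distr_r. apply Cmod_triangle.
  - exists S. exact HS.
Qed.

Lemma dabs_scal c f s : dabs f s -> dabs (fun n => c * f n) s.
Proof.
  intros [B HB]. exists (Rabs c * B).
  pose proof (summable_scal (Rabs c) _ _ (Rabs_pos c) HB) as [H0 H].
  split; [intros; apply Cmod_ge_0|]. revert H. apply is_lim_seq_ext. intros n. apply rsum_ext.
  intros k _. unfold dterm. rewrite RtoC_mult, <- Cmult_assoc, (Cmod_mult (RtoC c)), Cmod_R. reflexivity.
Qed.

Lemma dsum_plus f g s : dabs f s -> dabs g s -> dsum (fun n => f n + g n) s = (dsum f s + dsum g s)%C.
Proof.
  intros Hf Hg. apply dsum_eq.
  apply is_clim_ext with (fun N => csum (dterm f s) N + csum (dterm g s) N)%C.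
  - intros N. rewrite <- csum_plus. apply csum_ext. intros n _. unfold dterm. rewrite RtoC_plus. ring.
  - apply is_clim_plus; apply dsum_lim; auto.
Qed.

Lemma dsum_scal c f s : dabs f s -> dsum (fun n => c * f n) s = (RtoC c * dsum f s)%C.
Proof.
  intros Hf. apply dsum_eq.
  apply is_clim_ext with (fun N => RtoC c * csum (dterm f s) N)%C.
  - intros N. rewrite <- csum_scal. apply csum_ext. intros n _. unfold dterm. rewrite RtoC_mult. ring.
  - apply is_clim_scal, dsum_lim, Hf.
Qed.

Lemma dsum_ext f g s : (forall n, (1 <= n)%nat -> f n = g n) -> dsum f s = dsum g s.
Proof.
  intros H. unfold dsum, Clim.
  assert (E : csum (dterm f s) = csum (dterm g s)); [|rewrite E; reflexivity].
  apply FunctionalExtensionality.functional_extensionality. intros N. apply csum_ext.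
  intros n _. unfold dterm. rewrite H by lia. reflexivity.
Qed.

(* Multiplication of the Dirichlet series by [p^(-s)]. *)
Definition Sh (p : nat) (f : nat -> R) (n : nat) : R :=
  if (n mod p =? 0)%nat then f (n / p)%nat else 0.

(** The index [n] stands for the integer [n + 1], so multiples of [p] sit at the end of each block
    of [p] indices. *)
Lemma csum_blocks (h v : nat -> C) (p N : nat) : (1 <= p)%nat ->
  (forall k j, (j < p - 1)%nat -> h (p * k + j)%nat = 0) ->
  (forall k, h (p * k + (p - 1))%nat = v k) ->
  csum h (p * N) = csum v N.
Proof.
  intros Hp H0 Hv. induction N as [|N IH]; [rewrite Nat.mul_0_r; reflexivity|].
  replace (p * S N)%nat with (S (p * N + (p - 1))) by lia.
  change (csum h (S (p * N + (p - 1)))) with (csum h (p * N + (p - 1)) + h (p * N + (p - 1))%nat)%C.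
  rewrite Hv. simpl csum. f_equal. rewrite <- IH.
  assert (G : forall j, (j <= p - 1)%nat -> csum h (p * N + j) = csum h (p * N)).
  { induction j as [|j IHj]; intros Hj; [f_equal; lia|].
    replace (p * N + S j)%nat with (S (p * N + j)) by lia.
    change (csum h (S (p * N + j))) with (csum h (p * N + j) + h (p * N + j)%nat)%C.
    rewrite IHj, H0 by lia. ring. }
  apply G. lia.
Qed.

Lemma csum_RtoC b N : csum (fun n => RtoC (b n)) N = RtoC (rsum b N).
Proof. induction N as [|N IH]; simpl; auto. rewrite IH, RtoC_plus. reflexivity. Qed.

Lemma Sh_block p f s : (1 <= p)%nat ->
  (forall k j, (j < p - 1)%nat -> dterm (Sh p f) s (p * k + j) = 0) /\
  (forall k, dterm (Sh p f) s (p * k + (p - 1)) = (npow (INR p) s * dterm f s k)%C).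
Proof.
  intros Hp. split.
  - intros k j Hj. unfold dterm, Sh.
    replace (S (p * k + j)) with (S j + k * p)%nat by lia.
    rewrite Nat.Div0.mod_add, Nat.mod_small by lia. simpl. ring.
  - intros k. unfold dterm, Sh.
    replace (S (p * k + (p - 1))) with (S k * p)%nat by lia.
    rewrite Nat.Div0.mod_mul, Nat.div_mul by lia. simpl Nat.eqb. cbv iota.
    rewrite mult_INR, npow_mult; [ring|apply lt_0_INR; lia|apply lt_0_INR; lia].
Qed.

Lemma dabs_Sh p f s : (1 <= p)%nat -> dabs f s -> dabs (Sh p f) s.
Proof.
  intros Hp [B HB]. destruct (Sh_block p f s Hp) as [H0 H1].
  destruct (summable_of_bounded (fun n => Cmod (dterm (Sh p f) s n)) (Cmod (npow (INR p) s) * B)) as [S [HS _]].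
  - intros n. apply Cmod_ge_0.
  - intros N. apply Rle_trans with (rsum (fun n => Cmod (dterm (Sh p f) s n)) (p * N)).
    + apply rsum_mono; [intros; apply Cmod_ge_0|nia].
    + assert (E : rsum (fun n => Cmod (dterm (Sh p f) s n)) (p * N) =
        rsum (fun k => Cmod (npow (INR p) s) * Cmod (dterm f s k)) N).
      { apply RtoC_inj. rewrite <- !csum_RtoC. apply csum_blocks; auto.
        - intros k j Hj. rewrite H0, Cmod_0; auto.
        - intros k. rewrite H1, Cmod_mult. reflexivity. }
      rewrite E. apply (summable_le _ _ N (summable_scal _ _ _ (Cmod_ge_0 _) HB)).
  - exists S. exact HS.
Qed.

Lemma dsum_Sh p f s : (1 <= p)%nat -> dabs f s -> dsum (Sh p f) s = (npow (INR p) s * dsum f s)%C.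
Proof.
  intros Hp Hf. destruct (Sh_block p f s Hp) as [H0 H1].
  apply (is_clim_unique (fun N => csum (dterm (Sh p f) s) (p * N))).
  - pose proof (dsum_lim _ _ (dabs_Sh p f s Hp Hf)) as H. intros e He. destruct (H e He) as [N HN].
    exists N. intros n Hn. apply HN. nia.
  - apply is_clim_ext with (fun N => npow (INR p) s * csum (dterm f s) N)%C.
    + intros N. rewrite <- csum_scal. symmetry. apply csum_blocks; auto.
    + apply is_clim_scal, dsum_lim, Hf.
Qed.

Definition strip (p : nat) (f : nat -> R) (n : nat) : R := if (n mod p =? 0)%nat then 0 else f n.

Fixpoint rough (P : nat) (f : nat -> R) : nat -> R :=
  match P with
  | O => f
  | S P' => if primeb (S P') then strip (S P') (rough P' f) else rough P' f
  end.

(** Multiplicativity at the single prime [p]. This local form survives the stripping of other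
    primes, which full multiplicativity in terms of products would make awkward. *)
Definition fac_at (t : nat -> R) (p : nat) (f : nat -> R) : Prop :=
  forall k m, (1 <= m)%nat -> ~ Nat.divide p m -> f (p ^ k * m)%nat = t k * f m.

Lemma mod_divide_eqb n p : (1 <= p)%nat -> (n mod p =? 0)%nat = true <-> Nat.divide p n.
Proof. intros Hp. rewrite Nat.eqb_eq. apply Nat.Lcm0.mod_divide. Qed.

Lemma prime_dvd_pow p q k : primeb p = true -> primeb q = true -> Nat.divide p (q ^ k) -> p = q.
Proof.
  intros Hp Hq. induction k as [|k IH]; simpl; intros H.
  - apply Nat.divide_1_r in H. pose proof (primeb_ge2 p Hp). lia.
  - apply (primeb_mul p) in H; auto. destruct H as [H|H]; auto. apply primeb_dvd_prime; auto.
Qed.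

Lemma strip_fac_at t p q f : primeb p = true -> primeb q = true -> p <> q ->
  fac_at t p f -> fac_at t p (strip q f).
Proof.
  intros Hp Hq Hpq H k m Hm Hpm. unfold strip. pose proof (primeb_ge2 q Hq).
  destruct (m mod q =? 0)%nat eqn:E1; destruct (p ^ k * m mod q =? 0)%nat eqn:E2; auto; try ring.
  - apply mod_divide_eqb in E1; [|lia]. exfalso.
    assert (Nat.divide q (p ^ k * m)) by (apply Nat.divide_mul_r, E1).
    apply mod_divide_eqb in H1; [congruence|lia].
  - apply mod_divide_eqb in E2; [|lia]. exfalso.
    apply primeb_mul in E2; auto. destruct E2 as [E2|E2].
    + apply prime_dvd_pow in E2; auto.
    + apply mod_divide_eqb in E2; [congruence|lia].
Qed.

Lemma rough_fac_at t p f P : primeb p = true -> (P < p)%nat -> fac_at t p f -> fac_at t p (rough P f).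
Proof.
  intros Hp. induction P as [|P IH]; simpl; intros HP H; auto.
  destruct (primeb (S P)) eqn:E; [|apply IH; auto; lia].
  apply strip_fac_at; auto; [lia|]. apply IH; auto. lia.
Qed.

Lemma rough_le P f n : Rabs (rough P f n) <= Rabs (f n).
Proof.
  induction P as [|P IH]; simpl; [lra|]. destruct (primeb (S P)); auto.
  unfold strip. destruct (n mod S P =? 0)%nat; auto. rewrite Rabs_R0. apply Rabs_pos.
Qed.

Lemma rough_1 P f : rough P f 1 = f 1%nat.
Proof.
  induction P as [|P IH]; simpl; auto. destruct (primeb (S P)) eqn:E; auto.
  pose proof (primeb_ge2 _ E). unfold strip. rewrite Nat.mod_small by lia. simpl. exact IH.
Qed.

Lemma rough_dvd P f n p : primeb p = true -> (p <= P)%nat -> Nat.divide p n -> rough P f n = 0.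
Proof.
  intros Hp HP Hd. induction P as [|P IH]; [pose proof (primeb_ge2 p Hp); lia|]. simpl.
  destruct (Nat.eq_dec p (S P)) as [->|Hne].
  - rewrite Hp. unfold strip. apply mod_divide_eqb in Hd; [|lia]. rewrite Hd. reflexivity.
  - destruct (primeb (S P)); [|apply IH; lia]. unfold strip. rewrite IH by lia.
    destruct (n mod S P =? 0)%nat; auto.
Qed.

Lemma dabs_le f g s : (forall n, Rabs (g n) <= Rabs (f n)) -> dabs f s -> dabs g s.
Proof.
  intros H [B HB]. destruct (summable_comparison (fun n => Cmod (dterm g s n)) _ _ HB) as [S HS].
  - intros n. split; [apply Cmod_ge_0|]. unfold dterm. rewrite !Cmod_mult, !Cmod_R.
    apply Rmult_le_compat_r; auto. apply Cmod_ge_0.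
  - exists S. exact HS.
Qed.

(** Once the primes up to [P] are stripped, only 1 and integers above [P] survive, so the distance
    to [f 1] is a tail of an absolutely convergent series. *)
Lemma rough_dsum_lim f s : dabs f s -> is_clim (fun P => dsum (rough P f) s) (RtoC (f 1%nat)).
Proof.
  intros Hf. pose proof Hf as [B HB].
  assert (K : forall P, Cmod (dsum (rough P f) s - RtoC (f 1%nat)) <= B - rsum (fun n => Cmod (dterm f s n)) P).
  { intros P.
    assert (HP : dabs (rough P f) s) by (apply dabs_le with f; auto; intros; apply rough_le).
    destruct P as [|P].
    { pose proof (dsum_lim _ _ HP) as HL.
      apply (is_clim_le (fun N => csum (dterm (rough 0 f) s) N - RtoC (f 1%nat))%C).
      - apply is_clim_plus; auto. apply is_clim_const.
      - exists 1%nat. intros N HN. destruct N as [|N]; [lia|]. rewrite csum_S_l. unfold dterm at 1.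
        simpl INR at 1. rewrite npow_1. simpl rough at 1.
        replace (RtoC (f 1%nat) * 1 + csum (fun n => dterm (rough 0 f) s (S n)) N - RtoC (f 1%nat))%C
          with (csum (fun n => dterm f s (S n)) N - csum (fun n => dterm f s (S n)) 0)%C by (simpl; ring).
        eapply Rle_trans; [apply (csum_diff_bound _ (fun n => Cmod (dterm f s (S n)))); [intros; lra|lia]|].
        simpl rsum. rewrite !Rminus_0_r. pose proof (summable_le _ _ (S N) HB) as Q. rewrite rsum_S_l in Q.
        pose proof (Cmod_ge_0 (dterm f s 0)). lra. }
    pose proof (dsum_lim _ _ HP) as HL.
    apply (is_clim_le (fun N => csum (dterm (rough (S P) f) s) N - RtoC (f 1%nat))%C).
    - apply is_clim_plus; auto. apply is_clim_const.
    - exists (S P). intros N HN.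
      assert (E : csum (dterm (rough (S P) f) s) (S P) = RtoC (f 1%nat)).
      { rewrite csum_S_l. unfold dterm at 1. rewrite rough_1. simpl INR at 1. rewrite npow_1.
        assert (Z : forall M, (M <= P)%nat -> csum (fun n => dterm (rough (S P) f) s (S n)) M = 0).
        { induction M as [|M IHM]; intros HM; auto.
          change (csum (fun n => dterm (rough (S P) f) s (S n)) (S M)) with
            (csum (fun n => dterm (rough (S P) f) s (S n)) M + dterm (rough (S P) f) s (S M))%C.
          rewrite IHM by lia. unfold dterm.
          destruct (primeb_factor (S (S M)) ltac:(lia)) as [p [Hp Hd]].
          rewrite (rough_dvd (S P) f (S (S M)) p); auto; [ring|].
          apply Nat.divide_pos_le in Hd; lia. }
        rewrite Z by lia. ring. }
      rewrite <- E.
      eapply Rle_trans; [apply (csum_diff_bound _ (fun n => Cmod (dterm f s n))); auto|].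
      + intros n. unfold dterm. rewrite !Cmod_mult, !Cmod_R. apply Rmult_le_compat_r; [apply Cmod_ge_0|apply rough_le].
      + pose proof (summable_le _ _ N HB). lra. }
  intros e He. destruct (summable_tail_small _ B (e / 2) HB) as [N HN]; [lra|].
  exists N. intros n Hn. eapply Rle_lt_trans; [apply K|].
  pose proof (rsum_mono (fun n => Cmod (dterm f s n)) N n (fun n => Cmod_ge_0 _) Hn). lra.
Qed.

(** Because of the shift by one, the product of the first [P] values runs over the primes up to
    [P]. *)
Definition at_prime (a : nat -> C) (n : nat) : C := if primeb (S n) then a (S n) else RtoC 1.

(** One prime is stripped at a time; the function left by the smaller primes still factors at the
    next one. Keeping [a] and [b] on opposite sides avoids any division. *)
Lemma sieve (t : nat -> nat -> R) (a b : nat -> C) f s : dabs f s ->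
  (forall p, primeb p = true -> fac_at (t p) p f) ->
  (forall p g, primeb p = true -> fac_at (t p) p g -> dabs g s -> (a p * dsum g s = b p * dsum (strip p g) s)%C) ->
  forall P, (cprod (at_prime a) P * dsum f s = cprod (at_prime b) P * dsum (rough P f) s)%C.
Proof.
  intros Hf Ht Hab P. induction P as [|P IH]; [reflexivity|].
  simpl cprod. unfold at_prime at 2 4. simpl rough. destruct (primeb (S P)) eqn:E.
  - replace (cprod (at_prime a) P * a (S P) * dsum f s)%C with (a (S P) * (cprod (at_prime a) P * dsum f s))%C by ring.
    rewrite IH, <- (Cmult_assoc _ (b (S P))), <- (Hab (S P) (rough P f)); auto; [ring| |].
    + apply rough_fac_at; auto.
    + apply dabs_le with f; auto. intros; apply rough_le.
  - rewrite !Cmult_1_r. exact IH.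
Qed.

Lemma p_part p n : (2 <= p)%nat -> (1 <= n)%nat -> exists k m, n = (p ^ k * m)%nat /\ (1 <= m)%nat /\ ~ Nat.divide p m.
Proof.
  intros Hp. induction n as [n IH] using lt_wf_ind. intros Hn.
  destruct (Nat.eq_dec (n mod p) 0) as [E|E].
  - apply Nat.Lcm0.mod_divide in E. destruct E as [q Hq]. 
    destruct (IH q) as [k [m [H1 [H2 H3]]]]; [nia|nia|].
    exists (S k), m. split; auto. rewrite Hq, H1. simpl. ring.
  - exists 0%nat, n. split; [simpl; lia|]. split; auto. intros H. apply E, Nat.Lcm0.mod_divide, H.
Qed.

Lemma Sh_mul p f n : (1 <= p)%nat -> Sh p f (p * n) = f n.
Proof.
  intros Hp. unfold Sh. rewrite Nat.mul_comm, Nat.Div0.mod_mul, Nat.div_mul by lia. reflexivity.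
Qed.

Lemma Sh_ndvd p f n : (1 <= p)%nat -> ~ Nat.divide p n -> Sh p f n = 0.
Proof.
  intros Hp H. unfold Sh. destruct (n mod p =? 0)%nat eqn:E; auto.
  apply mod_divide_eqb in E; [contradiction|auto].
Qed.

Lemma strip_mul p f n : (1 <= p)%nat -> strip p f (p * n) = 0.
Proof.
  intros Hp. unfold strip. rewrite Nat.mul_comm, Nat.Div0.mod_mul. reflexivity.
Qed.

Lemma strip_ndvd p f n : (1 <= p)%nat -> ~ Nat.divide p n -> strip p f n = f n.
Proof.
  intros Hp H. unfold strip. destruct (n mod p =? 0)%nat eqn:E; auto.
  apply mod_divide_eqb in E; [contradiction|auto].
Qed.

Lemma dabs_strip p f s : dabs f s -> dabs (strip p f) s.
Proof.
  apply dabs_le. intros n. unfold strip. destruct (n mod p =? 0)%nat; [|lra].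
  rewrite Rabs_R0. apply Rabs_pos.
Qed.

Lemma zeta_local p g s : (2 <= p)%nat -> fac_at (fun _ => 1) p g -> dabs g s ->
  ((1 - npow (INR p) s) * dsum g s = dsum (strip p g) s)%C.
Proof.
  intros Hp Hg Ha.
  replace ((1 - npow (INR p) s) * dsum g s)%C with (dsum g s + RtoC (-1) * (npow (INR p) s * dsum g s))%C by ring.
  rewrite <- dsum_Sh, <- dsum_scal, <- dsum_plus; auto; try apply dabs_scal; try apply dabs_Sh; try lia; auto.
  apply dsum_ext. intros n Hn. destruct (p_part p n Hp Hn) as [k [m [-> [Hm Hpm]]]].
  destruct k as [|k].
  - simpl. rewrite Nat.add_0_r, Sh_ndvd, strip_ndvd by (auto; lia). ring.
  - replace (p ^ S k * m)%nat with (p * (p ^ k * m))%nat by (simpl; ring).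
    rewrite Sh_mul, strip_mul by lia.
    replace (p * (p ^ k * m))%nat with (p ^ S k * m)%nat by (simpl; ring).
    rewrite !Hg by auto. ring.
Qed.

(** The limit 1 for zeta times the finite products is the form that yields at once that zeta has no
    zero in [Re w > 1]. *)
Lemma zeta_euler w : 1 < Re w ->
  is_clim (fun P => zeta_c w * cprod (at_prime (fun p => 1 - npow (INR p) w)%C) P)%C 1.
Proof.
  intros Hw.
  assert (Ha : dabs (fun _ => 1) w).
  { destruct (zeta_abs w Hw) as [B [H0 H]]. exists B. split; [intros; apply Cmod_ge_0|].
    revert H. apply is_lim_seq_ext. intros n. apply rsum_ext. intros k _. unfold dterm.
    rewrite Cmult_1_l. reflexivity. }
  assert (E : dsum (fun _ => 1) w = zeta_c w).
  { apply dsum_eq. apply is_clim_ext with (csum (fun n => npow (INR (S n)) w)).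
    - intros N. apply csum_ext. intros n _. unfold dterm. rewrite Cmult_1_l. reflexivity.
    - apply zeta_c_lim, Hw. }
  apply is_clim_ext with (fun P => dsum (rough P (fun _ => 1)) w).
  - intros P. rewrite <- E.
    pose proof (sieve (fun _ _ => 1) (fun p => 1 - npow (INR p) w)%C (fun _ => RtoC 1) (fun _ => 1) w Ha) as Q.
    rewrite Cmult_comm, Q.
    + replace (cprod (at_prime (fun _ => RtoC 1)) P) with (RtoC 1); [ring|].
      induction P as [|P IH]; simpl; auto. rewrite <- IH. unfold at_prime. destruct (primeb _); ring.
    + intros p Hp k m _ _. ring.
    + intros p g Hp Hg Hga. rewrite Cmult_1_l. apply zeta_local; auto. apply primeb_ge2, Hp.
  - apply rough_dsum_lim, Ha.
Qed.

Lemma zeta_c_neq_0 w : 1 < Re w -> zeta_c w <> 0.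
Proof.
  intros Hw E. pose proof (zeta_euler w Hw) as H. rewrite E in H.
  assert (RtoC 0 = RtoC 1).
  { apply (is_clim_unique (fun P => 0 * cprod (at_prime (fun p => 1 - npow (INR p) w)%C) P)%C); auto.
    apply is_clim_ext with (fun _ => RtoC 0); [intros; ring|]. apply is_clim_const. }
  apply RtoC_inj in H0. lra.
Qed.

Lemma zeta_i_inv w : 1 < Re w -> (zeta_i w * zeta_c w)%C = 1.
Proof.
  intros Hw. pose proof (zeta_c_neq_0 w Hw) as H. pose proof (den2_neq_0 w Hw) as H2.
  assert (eta w <> 0).
  { intros E. apply H. unfold zeta_c. rewrite E. unfold Cdiv. ring. }
  unfold zeta_i, zeta_c. field. auto.
Qed.

(* This is [(sigma(p^k)^3 - sigma(p^(k-1))^3) / p^k], the number of orbits of length [p^k] of the cube. *)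
Definition cubic_t (p k : nat) : R :=
  ((INR p ^ S k - 1) ^ 3 - (INR p ^ k - 1) ^ 3) / ((INR p - 1) ^ 3 * INR p ^ k).

Definition hfac (p : nat) (s : C) : C :=
  (1 + (RtoC 2 + RtoC 2 * RtoC (INR p)) * npow (INR p) s + RtoC (INR p) * npow (INR p) s ^ 2)%C.

Definition dfac (p : nat) (s : C) : C :=
  ((1 - npow (INR p) s) * (1 - npow (INR p) (s - 1)) * (1 - npow (INR p) (s - 2)))%C.

Lemma npow_minus_INR p s : (1 <= p)%nat -> npow (INR p) (s - 1) = (RtoC (INR p) * npow (INR p) s)%C.
Proof.
  intros Hp. unfold Cminus. rewrite npow_plus, npow_mone; [ring|]. apply lt_0_INR. lia.
Qed.

(** [cubic_t p k] is a combination of [1], [p^k] and [p^(2k)], so its generating series in [p^(-s)]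
    has denominator [dfac]. Comparing coefficients at [p^k m] gives a recurrence of order three,
    with separate cases [k = 0, 1, 2]. *)
Lemma cubic_local p g s : primeb p = true -> fac_at (cubic_t p) p g -> dabs g s ->
  (dfac p s * dsum g s = hfac p s * dsum (strip p g) s)%C.
Proof.
  intros Hpr Hg Ha. pose proof (primeb_ge2 p Hpr) as Hp2. assert (Hp : (1 <= p)%nat) by lia.
  set (q := INR p). assert (Hq : 2 <= q) by (apply (le_INR 2); auto).
  set (x := npow q s). set (S1 := Sh p). set (h := strip p g).
  assert (Hh : dabs h s) by (apply dabs_strip; auto).
  assert (A1 : dabs (S1 g) s) by (apply dabs_Sh; auto).
  assert (A2 : dabs (S1 (S1 g)) s) by (apply dabs_Sh; auto).
  assert (A3 : dabs (S1 (S1 (S1 g))) s) by (apply dabs_Sh; auto).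
  assert (B1 : dabs (S1 h) s) by (apply dabs_Sh; auto).
  assert (B2 : dabs (S1 (S1 h)) s) by (apply dabs_Sh; auto).
  set (L := fun n => g n + (- (1 + q + q ^ 2) * S1 g n + ((q + q ^ 2 + q ^ 3) * S1 (S1 g) n + - q ^ 3 * S1 (S1 (S1 g)) n))).
  set (R := fun n => h n + ((2 + 2 * q) * S1 h n + q * S1 (S1 h) n)).
  assert (EL : dsum L s = (dfac p s * dsum g s)%C).
  { unfold L. rewrite !dsum_plus, !dsum_scal; repeat apply dabs_plus; repeat apply dabs_scal; auto.
    unfold S1. rewrite !dsum_Sh; auto. fold q. fold x. unfold dfac.
    replace (s - 2)%C with (s - 1 - 1)%C by ring.
    rewrite !npow_minus_INR by auto. fold q. fold x. rewrite RtoC_opp, !RtoC_plus, RtoC_opp, !RtoC_pow. ring. }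
  assert (ER : dsum R s = (hfac p s * dsum h s)%C).
  { unfold R. rewrite !dsum_plus, !dsum_scal; repeat apply dabs_plus; repeat apply dabs_scal; auto.
    unfold S1. rewrite !dsum_Sh; auto. unfold hfac. fold q. fold x. rewrite !RtoC_plus, RtoC_mult. ring. }
  rewrite <- EL, <- ER. apply dsum_ext. intros n Hn.
  destruct (p_part p n Hp2 Hn) as [k [m [-> [Hm Hpm]]]].
  assert (St : forall f j, S1 f (p ^ S j * m)%nat = f (p ^ j * m)%nat).
  { intros f j. unfold S1. replace (p ^ S j * m)%nat with (p * (p ^ j * m))%nat by (simpl; ring). apply Sh_mul, Hp. }
  assert (S0 : forall f, S1 f (p ^ 0 * m)%nat = 0).
  { intros f. unfold S1. apply Sh_ndvd; auto. simpl. rewrite Nat.add_0_r. exact Hpm. }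
  assert (Hst : forall j, h (p ^ S j * m)%nat = 0).
  { intros j. unfold h. replace (p ^ S j * m)%nat with (p * (p ^ j * m))%nat by (simpl; ring). apply strip_mul, Hp. }
  assert (Hs0 : h (p ^ 0 * m)%nat = g m).
  { unfold h. simpl. rewrite Nat.add_0_r. apply strip_ndvd; auto. }
  unfold L, R. destruct k as [|[|[|k]]]; rewrite ?St, ?S0, ?Hst, ?Hs0, ?(Hg _ m Hm Hpm); unfold cubic_t; fold q.
  - simpl. field. lra.
  - simpl. field. lra.
  - simpl. field. lra.
  - assert (q ^ k <> 0) by (apply pow_nonzero; lra). simpl. field. repeat split; auto; lra.
Qed.

Lemma cubic_euler f s : dabs f s -> f 1%nat = 1 -> (forall p, primeb p = true -> fac_at (cubic_t p) p f) ->
  exists e : nat -> C, is_clim e 1 /\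
    forall P, (cprod (at_prime (fun p => dfac p s)) P * dsum f s = cprod (at_prime (fun p => hfac p s)) P * e P)%C.
Proof.
  intros Ha H1 Hf. exists (fun P => dsum (rough P f) s). split.
  - rewrite <- H1. apply rough_dsum_lim, Ha.
  - apply (sieve cubic_t); auto. intros p g Hp Hg Hga. apply cubic_local; auto.
Qed.

(** * Multiplicativity of the orbit counts *)

Definition divsum (F : nat -> nat) (n : nat) : nat := list_sum (map F (divs n)).

Lemma list_sum_perm l l' : Permutation l l' -> list_sum l = list_sum l'.
Proof. induction 1; simpl; lia. Qed.

Lemma dvd_prime_power p k d m : primeb p = true -> ~ Nat.divide p d ->
  Nat.divide d (p ^ k * m) -> Nat.divide d m.
Proof.
  intros Hp Hd. pose proof (primeb_ge2 p Hp). induction k as [|k IH]; simpl; intros H1.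
  - rewrite Nat.add_0_r in H1. exact H1.
  - apply IH. destruct H1 as [q Hq].
    assert (Hpq : Nat.divide p (q * d)) by (rewrite <- Hq; exists (p ^ k * m)%nat; ring).
    apply primeb_mul in Hpq; auto. destruct Hpq as [[q' ->]|Hpq]; [|contradiction].
    exists q'. nia.
Qed.

Lemma pow_dvd_bound p j k m : primeb p = true -> ~ Nat.divide p m ->
  Nat.divide (p ^ j) (p ^ k * m) -> (j <= k)%nat.
Proof.
  intros Hp Hm H. pose proof (primeb_ge2 p Hp). destruct (Nat.le_gt_cases j k) as [|Hlt]; auto. exfalso.
  apply Hm. destruct H as [q Hq]. exists (q * p ^ (j - k - 1))%nat.
  replace j with (k + S (j - k - 1))%nat in Hq by lia. rewrite Nat.pow_add_r in Hq. simpl in Hq.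
  assert (p ^ k <> 0)%nat by (apply Nat.pow_nonzero; lia). nia.
Qed.

Lemma divs_split p k m : primeb p = true -> (1 <= m)%nat -> ~ Nat.divide p m ->
  Permutation (divs (p ^ S k * m)) (divs (p ^ k * m) ++ map (fun d => p ^ S k * d)%nat (divs m)).
Proof.
  intros Hp Hm Hpm. pose proof (primeb_ge2 p Hp) as Hp2.
  assert (Hpk : forall j, (1 <= p ^ j)%nat).
  { intros j. assert (p ^ j <> 0)%nat by (apply Nat.pow_nonzero; lia). lia. }
  pose proof (Hpk k). pose proof (Hpk (S k)).
  apply NoDup_Permutation.
  - apply divs_NoDup.
  - apply NoDup_app; [apply divs_NoDup| |].
    + apply FinFun.Injective_map_NoDup; [|apply divs_NoDup]. intros x y E. nia.
    + intros d H1 H2. apply in_map_iff in H2. destruct H2 as [e [<- He]].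
      apply divs_spec in H1; [|nia]. destruct H1 as [H1 _].
      assert (S k <= k)%nat; [|lia]. apply (pow_dvd_bound p _ _ m); auto.
      eapply Nat.divide_trans; [|exact H1]. exists e. ring.
  - intros d. rewrite in_app_iff, in_map_iff, !divs_spec by nia. split.
    + intros [H1 H2]. destruct (p_part p d Hp2 H2) as [j [e [-> [He Hpe]]]].
      assert (Hem : Nat.divide e m).
      { apply (dvd_prime_power p (S k)); auto. eapply Nat.divide_trans; [|exact H1]. exists (p ^ j)%nat. ring. }
      assert (Hj : (j <= S k)%nat).
      { apply (pow_dvd_bound p _ _ m); auto. eapply Nat.divide_trans; [|exact H1]. exists e. ring. }
      destruct (Nat.eq_dec j (S k)) as [->|Hne].
      * right. exists e. split; auto. apply divs_spec; auto.
      * left. split; auto. apply Nat.mul_divide_mono_l with (p := (p ^ j)%nat) in Hem.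
        eapply Nat.divide_trans; [exact Hem|]. exists (p ^ (k - j))%nat.
        replace k with (k - j + j)%nat at 1 by lia. rewrite Nat.pow_add_r. ring.
    + intros [[H1 H2]|[e [<- He]]].
      * split; auto. eapply Nat.divide_trans; [exact H1|]. exists p. simpl. ring.
      * apply divs_spec in He; auto. destruct He as [[q ->] He]. split; [exists q; ring|nia].
Qed.

Lemma divsum_split F p k m : primeb p = true -> (1 <= m)%nat -> ~ Nat.divide p m ->
  divsum F (p ^ S k * m) = (divsum F (p ^ k * m) + divsum (fun d => F (p ^ S k * d)) m)%nat.
Proof.
  intros Hp Hm Hpm. unfold divsum.
  rewrite (list_sum_perm _ _ (Permutation_map F (divs_split p k m Hp Hm Hpm))).
  rewrite map_app, list_sum_app, map_map. reflexivity.
Qed.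

Lemma divsum_last m : (1 <= m)%nat -> exists l,
  (forall d, In d l -> (1 <= d < m)%nat /\ Nat.divide d m) /\
  forall F, divsum F m = (list_sum (map F l) + F m)%nat.
Proof.
  intros Hm. destruct m as [|m]; [lia|].
  exists (filter (fun d => (S m mod d =? 0)%nat) (seq 1 m)). split.
  - intros d Hd. apply filter_In in Hd. destruct Hd as [H1 H2]. apply in_seq in H1.
    apply mod_divide_eqb in H2; [|lia]. split; [lia|exact H2].
  - intros F'. unfold divsum, divs. rewrite seq_S, filter_app, map_app, list_sum_app. f_equal.
    change (1 + m)%nat with (S m). cbn [filter]. rewrite Nat.Div0.mod_same, Nat.eqb_refl. cbn. lia.
Qed.

Lemma divsum_id_mult p k m : primeb p = true -> (1 <= m)%nat -> ~ Nat.divide p m ->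
  INR (divsum (fun d => d) (p ^ k * m)) * (INR p - 1) = (INR p ^ S k - 1) * INR (divsum (fun d => d) m).
Proof.
  intros Hp Hm Hpm. induction k as [|k IH].
  - simpl. rewrite Nat.add_0_r. ring.
  - rewrite (divsum_split _ p k m) by auto.
    assert (E : divsum (fun d => p ^ S k * d)%nat m = (p ^ S k * divsum (fun d => d) m)%nat).
    { unfold divsum. generalize (p ^ S k)%nat. intros q. induction (divs m) as [|a l IHl]; [simpl; ring|]. simpl map. simpl list_sum. rewrite IHl. ring. }
    rewrite E, plus_INR, mult_INR, pow_INR, Rmult_plus_distr_r, IH. simpl pow. ring.
Qed.

Section cubic.
Variable oc : nat -> nat.
Hypothesis Hoc : forall n, (1 <= n)%nat -> divsum (fun d => d * oc d)%nat n = (divsum (fun d => d) n ^ 3)%nat.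

(** Instead of Möbius inversion: subtracting the divisor sums at [p^k m] from those at [p^(k+1) m]
    leaves a sum over the divisors [d] of [m]. The terms with [d < m] agree by strong induction,
    hence so does the term [d = m]. *)
Lemma oc_mult p k m : primeb p = true -> (1 <= m)%nat -> ~ Nat.divide p m ->
  INR (p ^ S k * m * oc (p ^ S k * m)) * (INR p - 1) ^ 3 =
  ((INR p ^ S (S k) - 1) ^ 3 - (INR p ^ S k - 1) ^ 3) * INR (m * oc m).
Proof.
  intros Hp. pose proof (primeb_ge2 p Hp) as Hp2. set (W := fun d => (d * oc d)%nat).
  change (p ^ S k * m * oc (p ^ S k * m))%nat with (W (p ^ S k * m)%nat). change (m * oc m)%nat with (W m).
  set (tau := (INR p ^ S (S k) - 1) ^ 3 - (INR p ^ S k - 1) ^ 3).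
  assert (Hpk : forall j, (1 <= p ^ j)%nat).
  { intros j. assert (p ^ j <> 0)%nat by (apply Nat.pow_nonzero; lia). lia. }
  induction m as [m IH] using lt_wf_ind. intros Hm Hpm.
  assert (E : INR (divsum (fun d => W (p ^ S k * d)%nat) m) * (INR p - 1) ^ 3 = tau * INR (divsum W m)).
  { pose proof (divsum_split W p k m Hp Hm Hpm) as Q. apply (f_equal INR) in Q. rewrite plus_INR in Q.
    pose proof (Hpk k). pose proof (Hpk (S k)).
    unfold W in Q at 1 2. rewrite !Hoc in Q by nia. unfold W in Q. fold W in Q.
    rewrite !pow_INR in Q.
    pose proof (divsum_id_mult p (S k) m Hp Hm Hpm) as S1. pose proof (divsum_id_mult p k m Hp Hm Hpm) as S0.
    unfold W at 2. rewrite Hoc, pow_INR by auto.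
    replace (INR (divsum (fun d => W (p ^ S k * d)%nat) m)) with
      (INR (divsum (fun d => d) (p ^ S k * m)) ^ 3 - INR (divsum (fun d => d) (p ^ k * m)) ^ 3) by (unfold W; lra).
    rewrite Rmult_minus_distr_r, <- !Rpow_mult_distr, S1, S0. unfold tau. rewrite !Rpow_mult_distr. ring. }
  destruct (divsum_last m Hm) as [l [Hl El]]. rewrite !El, !plus_INR in E.
  assert (E' : INR (list_sum (map (fun d => W (p ^ S k * d)%nat) l)) * (INR p - 1) ^ 3 = tau * INR (list_sum (map W l))).
  { assert (G : forall d, In d l -> INR (W (p ^ S k * d)%nat) * (INR p - 1) ^ 3 = tau * INR (W d)).
    { intros d Hd. destruct (Hl d Hd) as [H1 H2]. apply IH; try lia.
      intros H. apply Hpm. eapply Nat.divide_trans; eauto. }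
    clear -G. revert G. generalize (p ^ S k)%nat. intros q G. induction l as [|a l IHl]; [simpl; ring|].
    simpl map. simpl list_sum. rewrite !plus_INR, Rmult_plus_distr_r, IHl, G; [ring|left; auto|].
    intros d Hd. apply G. right; auto. }
  lra.
Qed.

Lemma oc_fac_at p : primeb p = true -> fac_at (cubic_t p) p (fun n => INR (oc n)).
Proof.
  intros Hp [|k] m Hm Hpm; pose proof (primeb_ge2 p Hp) as Hp2; assert (2 <= INR p) by (apply (le_INR 2); auto).
  - unfold cubic_t. simpl. rewrite Nat.add_0_r. field. lra.
  - pose proof (oc_mult p k m Hp Hm Hpm) as E. rewrite !mult_INR, pow_INR in E. unfold cubic_t.
    assert (0 < INR m) by (apply lt_0_INR; lia).
    assert (0 < INR p ^ S k) by (apply pow_lt; lra).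
    apply Rmult_eq_reg_r with (INR p ^ S k * INR m * (INR p - 1) ^ 3).
    + replace (INR (oc (p ^ S k * m)) * (INR p ^ S k * INR m * (INR p - 1) ^ 3)) with
        (INR p ^ S k * INR m * INR (oc (p ^ S k * m)) * (INR p - 1) ^ 3) by ring.
      rewrite E. field. split; lra.
    + apply Rmult_integral_contrapositive_currified; [nra|]. apply pow_nonzero. lra.
Qed.

Lemma oc_1 : oc 1 = 1%nat.
Proof. pose proof (Hoc 1 (Nat.le_refl 1)) as H. unfold divsum, divs in H. simpl in H. lia. Qed.

End cubic.

(** * Upper bounds for the orbit counts and absolute convergence for [Re s > 3] *)

Fixpoint rlsum (F : nat -> R) (l : list nat) : R :=
  match l with nil => 0 | d :: l => F d + rlsum F l end.

Lemma rlsum_perm F l l' : Permutation l l' -> rlsum F l = rlsum F l'.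
Proof. induction 1; simpl; lra. Qed.

Lemma INR_list_sum l : INR (list_sum l) = rlsum INR l.
Proof. induction l as [|a l IH]; simpl; auto. rewrite plus_INR, IH. reflexivity. Qed.

Lemma rlsum_filter F f l : (forall d, In d l -> 0 <= F d) -> rlsum F (filter f l) <= rlsum F l.
Proof.
  induction l as [|a l IH]; simpl; intros H; [lra|].
  pose proof (IH (fun d Hd => H d (or_intror Hd))). pose proof (H a (or_introl eq_refl)).
  destruct (f a); simpl; lra.
Qed.

Lemma harmonic_bound n : (1 <= n)%nat -> rlsum (fun d => / INR d) (seq 1 n) <= 1 + ln (INR n).
Proof.
  induction n as [|n IH]; [lia|]. intros _. destruct n as [|n].
  - simpl. rewrite ln_1. lra.
  - rewrite seq_S.
    assert (Happ : forall F l x, rlsum F (l ++ x :: nil) = rlsum F l + F x).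
    { intros F l x. induction l as [|a l IHl]; simpl; [ring|]. rewrite IHl. ring. }
    rewrite Happ. specialize (IH ltac:(lia)).
    change (1 + S n)%nat with (S (S n)). rewrite (S_INR (S n)).
    pose proof (ln_succ_ge (INR (S n)) ltac:(apply lt_0_INR; lia)). lra.
Qed.

(** The involution [d -> n / d] turns the sum of divisors into [n] times a part of the harmonic
    sum. *)
Lemma divsum_id_bound n : (1 <= n)%nat -> INR (divsum (fun d => d) n) <= INR n * (1 + ln (INR n)).
Proof.
  intros Hn. unfold divsum. rewrite map_id, INR_list_sum.
  assert (Hdiv : forall d, In d (divs n) -> (1 <= d)%nat /\ exists q, n = (q * d)%nat /\ (n / d)%nat = q /\ (1 <= q)%nat).
  { intros d Hd. apply divs_spec in Hd; auto. destruct Hd as [[q Hq] Hd]. split; auto.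
    exists q. split; auto. split; [rewrite Hq; apply Nat.div_mul; lia|]. destruct q; lia. }
  assert (HP : Permutation (divs n) (map (fun d => n / d)%nat (divs n))).
  { assert (HP0 : forall d, In d (divs n) -> (n / (n / d))%nat = d /\ In (n / d)%nat (divs n)).
    { intros d Hd. destruct (Hdiv d Hd) as [H1 [q [E1 [E2 E3]]]]. rewrite E2. split.
      - rewrite E1, Nat.mul_comm. apply Nat.div_mul. lia.
      - apply divs_spec; auto. split; auto. exists d. rewrite E1. ring. }
    apply NoDup_Permutation; [apply divs_NoDup| |].
    - apply NoDup_map_NoDup_ForallPairs; [|apply divs_NoDup].
      intros x y Hx Hy E. destruct (HP0 x Hx) as [<- _]. destruct (HP0 y Hy) as [<- _]. rewrite E. reflexivity.
    - intros d. rewrite in_map_iff. split.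
      + intros Hd. exists (n / d)%nat. apply HP0, Hd.
      + intros [e [<- He]]. apply HP0, He. }
  rewrite (rlsum_perm _ _ _ HP).
  assert (E : rlsum INR (map (fun d => n / d)%nat (divs n)) = INR n * rlsum (fun d => / INR d) (divs n)).
  { revert Hdiv. clear. generalize (divs n). induction l as [|a l IH]; intros H; [simpl; ring|].
    simpl. rewrite IH by (intros d Hd; apply H; right; auto).
    destruct (H a (or_introl eq_refl)) as [H1 [q [E1 [E2 E3]]]]. rewrite E2.
    assert (0 < INR a) by (apply lt_0_INR; lia). rewrite Rmult_plus_distr_l. f_equal.
    rewrite E1, mult_INR. field. lra. }
  rewrite E. apply Rmult_le_compat_l; [apply pos_INR|].
  eapply Rle_trans; [|apply harmonic_bound, Hn]. apply rlsum_filter.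
  intros d Hd. apply in_seq in Hd. left. apply Rinv_0_lt_compat, lt_0_INR. lia.
Qed.

Lemma log_power_bound a n : 0 < a <= 1 -> (1 <= n)%nat -> 1 + ln (INR n) <= exp (a * ln (INR n)) / a.
Proof.
  intros Ha Hn. pose proof (exp_ineq1_le (a * ln (INR n))).
  apply Rmult_le_reg_r with a; [lra|]. unfold Rdiv. rewrite Rmult_assoc, Rinv_l, Rmult_1_r by lra. lra.
Qed.

(** [n * oc n] is one term of a divisor sum of nonnegative terms equal to the cube of the sum of
    divisors. *)
Lemma oc_upper (oc : nat -> nat) n : (1 <= n)%nat ->
  (forall n, (1 <= n)%nat -> divsum (fun d => d * oc d)%nat n = (divsum (fun d => d) n ^ 3)%nat) ->
  INR (oc n) <= INR n ^ 2 * (1 + ln (INR n)) ^ 3.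
Proof.
  intros Hn Hoc. assert (H0 : 0 < INR n) by (apply lt_0_INR; lia).
  assert (H1 : (n * oc n <= divsum (fun d => d) n ^ 3)%nat).
  { rewrite <- Hoc by auto. destruct (divsum_last n Hn) as [l [_ El]]. rewrite El. lia. }
  apply le_INR in H1. rewrite mult_INR, pow_INR in H1.
  pose proof (divsum_id_bound n Hn) as H2.
  assert (H3 : INR (divsum (fun d => d) n) ^ 3 <= (INR n * (1 + ln (INR n))) ^ 3) by (apply pow_incr; split; [apply pos_INR|auto]).
  apply Rmult_le_reg_l with (INR n); auto. rewrite Rpow_mult_distr in H3.
  replace (INR n * (INR n ^ 2 * (1 + ln (INR n)) ^ 3)) with (INR n ^ 3 * (1 + ln (INR n)) ^ 3) by ring. lra.
Qed.

Lemma oc_dabs (oc : nat -> nat) s :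
  (forall n, (1 <= n)%nat -> divsum (fun d => d * oc d)%nat n = (divsum (fun d => d) n ^ 3)%nat) ->
  3 < Re s -> dabs (fun n => INR (oc n)) s.
Proof.
  (* The cubed logarithm costs [3a <= (Re s - 3) / 2] in the exponent, so that [1 + (Re s - 3) / 2]
     remains. *)
  intros Hoc Hs. set (a := Rmin 1 ((Re s - 3) / 6)).
  assert (Ha : 0 < a <= 1) by (split; [apply Rmin_pos; lra|apply Rmin_l]).
  assert (Ha' : a <= (Re s - 3) / 6) by apply Rmin_r.
  destruct (power_summable (1 + (Re s - 3) / 2)) as [B HB]; [lra|].
  assert (Hc : 0 <= / a ^ 3) by (left; apply Rinv_0_lt_compat, pow_lt; lra).
  destruct (summable_comparison (fun n => Cmod (dterm (fun n => INR (oc n)) s n)) _ _ (summable_scal _ _ _ Hc HB)) as [S HS].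
  - intros n. split; [apply Cmod_ge_0|]. unfold dterm.
    rewrite Cmod_mult, Cmod_npow, Cmod_R_pos by apply pos_INR.
    set (x := INR (Datatypes.S n)). assert (Hx : 0 < x) by (apply lt_0_INR; lia).
    assert (Hl : 0 <= ln x).
    { rewrite <- ln_1. apply ln_le; [lra|]. unfold x. rewrite S_INR. pose proof (pos_INR n). lra. }
    pose proof (oc_upper oc (Datatypes.S n) ltac:(lia) Hoc) as U. fold x in U.
    pose proof (log_power_bound a (Datatypes.S n) Ha ltac:(lia)) as L. fold x in L.
    assert (L3 : (1 + ln x) ^ 3 <= (exp (a * ln x) / a) ^ 3) by (apply pow_incr; lra).
    assert (Ex2 : x ^ 2 = exp (2 * ln x)).
    { replace (2 * ln x) with (ln x + ln x) by ring. rewrite exp_plus, exp_ln by auto. ring. }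
    assert (Ee3 : (exp (a * ln x) / a) ^ 3 = exp (3 * a * ln x) * / a ^ 3).
    { replace (3 * a * ln x) with (a * ln x + a * ln x + a * ln x) by ring. rewrite !exp_plus. field. lra. }
    apply Rle_trans with (exp (2 * ln x) * (exp (3 * a * ln x) * / a ^ 3) * exp (- Re s * ln x)).
    + apply Rmult_le_compat_r; [left; apply exp_pos|]. eapply Rle_trans; [exact U|].
      rewrite Ex2. apply Rmult_le_compat_l; [left; apply exp_pos|]. lra.
    + replace (exp (2 * ln x) * (exp (3 * a * ln x) * / a ^ 3) * exp (- Re s * ln x)) with
        (/ a ^ 3 * (exp (2 * ln x) * exp (3 * a * ln x) * exp (- Re s * ln x))) by ring.
      apply Rmult_le_compat_l; auto. rewrite <- !exp_plus. apply exp_le. nra.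
  - exists S. exact HS.
Qed.

(** * Uniqueness of Dirichlet coefficients *)

(** A first nonzero coefficient would dominate as the real argument grows: relative to it, all later
    terms together become exponentially small. *)
Lemma dirichlet_unique (b : nat -> R) :
  (forall x : R, 2 <= x -> is_clim (csum (dterm b (RtoC x))) 0) -> forall n, (1 <= n)%nat -> b n = 0.
Proof.
  intros H.
  (* Convergence at 2 bounds the terms there, hence [b n] by a multiple of [n^2]. *)
  assert (HM : exists M, 0 <= M /\ forall n, Rabs (b (S n)) <= M * INR (S n) ^ 2).
  { destruct (is_clim_bounded _ _ (H 2 ltac:(lra))) as [M0 [N0 [HM0 HN0]]].
    assert (G : forall n, (N0 <= n)%nat -> Cmod (dterm b (RtoC 2) n) <= 2 * M0).
    { intros n Hn. pose proof (HN0 n Hn) as Q1. pose proof (HN0 (S n) ltac:(lia)) as Q2. simpl csum in Q2.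
      replace (dterm b 2 n) with ((csum (dterm b 2) n + dterm b 2 n) + - csum (dterm b 2) n)%C by ring.
      eapply Rle_trans; [apply Cmod_triangle|]. rewrite Cmod_opp. lra. }
    assert (G2 : exists M, 0 <= M /\ forall n, Cmod (dterm b (RtoC 2) n) <= M).
    { clear -G HM0. revert G. generalize (dterm b (RtoC 2)). intros u G.
      assert (K : forall N, exists M, 0 <= M /\ forall n, (n < N)%nat -> Cmod (u n) <= M).
      { induction N as [|N [M [HM IH]]]; [exists 0; split; [lra|intros; lia]|].
        exists (M + Cmod (u N)). pose proof (Cmod_ge_0 (u N)). split; [lra|]. intros n Hn.
        destruct (Nat.eq_dec n N) as [->|]; [lra|]. pose proof (IH n ltac:(lia)). lra. }
      destruct (K N0) as [M [HM HK]]. exists (M + 2 * M0). split; [lra|]. intros n.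
      destruct (Nat.lt_ge_cases n N0) as [Hlt|Hge]; [pose proof (HK n Hlt)|pose proof (G n Hge)]; lra. }
    destruct G2 as [M [HM G2]]. exists M. split; auto. intros n. specialize (G2 n). unfold dterm in G2.
    rewrite Cmod_mult, Cmod_R, Cmod_npow in G2. simpl Re in G2.
    assert (Hx : 0 < INR (S n)) by (apply lt_0_INR; lia).
    assert (E : exp (- (2) * ln (INR (S n))) * INR (S n) ^ 2 = 1).
    { replace (- (2) * ln (INR (S n))) with (- (ln (INR (S n)) + ln (INR (S n)))) by ring.
      rewrite exp_Ropp, exp_plus, exp_ln by auto. field. lra. }
    replace (Rabs (b (S n))) with (Rabs (b (S n)) * exp (- (2) * ln (INR (S n))) * INR (S n) ^ 2) by (rewrite Rmult_assoc, E; ring).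
    apply Rmult_le_compat_r; auto. apply pow_le. lra. }
  destruct HM as [M [HM0 HM]].
  destruct (power_summable 2) as [B HB]; [lra|].
  intros n Hn. induction n as [n IH] using lt_wf_ind. destruct n as [|n]; [lia|]. clear Hn.
  set (y := INR (S n)). assert (Hy : 0 < y) by (apply lt_0_INR; lia).
  assert (Hy1 : 1 <= y) by (unfold y; rewrite S_INR; pose proof (pos_INR n); lra).
  (* the tail beyond [n] is [O((n/(n+1))^N)] at [s = N + 4] *)
  assert (K : forall N : nat, Rabs (b (S n)) <= (M * exp (4 * ln y) * B) * (exp (ln y - ln (y + 1))) ^ N).
  { intros N. set (x := INR N + 4). assert (Hx : 4 <= x) by (unfold x; pose proof (pos_INR N); lra).
    assert (Hlny : 0 <= ln y) by (rewrite <- ln_1; apply ln_le; lra).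
    assert (Eexp : exp (ln y - ln (y + 1)) ^ N = exp (INR N * (ln y - ln (y + 1)))).
    { clear. induction N as [|N IH]; [simpl; rewrite Rmult_0_l, exp_0; auto|].
      rewrite S_INR, Rmult_plus_distr_r, exp_plus, <- IH. simpl. rewrite Rmult_1_l. ring. }
    rewrite Eexp.
    assert (Hprev : csum (dterm b (RtoC x)) n = 0).
    { assert (G : forall k, (k <= n)%nat -> csum (dterm b (RtoC x)) k = 0); [|apply G; lia].
      induction k as [|k IHk]; intros Hk; auto. simpl csum. rewrite IHk by lia. unfold dterm.
      rewrite (IH (S k)) by lia. ring. }
    pose proof (H x ltac:(lra)) as Hl.
    assert (Hb : Cmod (0 - csum (dterm b (RtoC x)) (S n)) <=
       M * exp (INR N * (ln y - ln (y + 1)) + 4 * ln y - x * ln y) * B).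
    { apply (is_clim_le (fun k => csum (dterm b (RtoC x)) k - csum (dterm b (RtoC x)) (S n))%C).
      { apply is_clim_plus; auto. apply is_clim_const. }
      exists (S n). intros k Hk.
      set (c := M * exp (INR N * (ln y - ln (y + 1)) + 4 * ln y - x * ln y)).
      assert (Hc : 0 <= c) by (apply Rmult_le_pos; auto; left; apply exp_pos).
      pose proof (summable_scal c _ _ Hc HB) as HcB.
      (* A majorant that keeps the first [n + 1] terms exact, so that they drop out of the
         difference of its partial sums. *)
      set (bb := fun j => if Nat.ltb j (S n) then Cmod (dterm b (RtoC x) j) else c * exp (- (2) * ln (INR (S j)))).
      assert (Hbb : forall j, Cmod (dterm b (RtoC x) j) <= bb j).
      { intros j. unfold bb. destruct (Nat.ltb_spec j (S n)) as [|Hj]; [lra|].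
        unfold dterm. rewrite Cmod_mult, Cmod_R, Cmod_npow. simpl Re.
        set (z := INR (S j)). assert (Hz : 0 < z) by (apply lt_0_INR; lia).
        assert (Hyz : y + 1 <= z) by (unfold y, z; rewrite <- S_INR; apply le_INR; lia).
        assert (Hlz : ln (y + 1) <= ln z) by (apply ln_le; lra).
        apply Rle_trans with (M * z ^ 2 * exp (- x * ln z)).
        - apply Rmult_le_compat_r; [left; apply exp_pos|apply HM].
        - assert (Ez : z ^ 2 = exp (2 * ln z)).
          { replace (2 * ln z) with (ln z + ln z) by ring. rewrite exp_plus, exp_ln by auto. ring. }
          rewrite Ez. unfold c. rewrite !Rmult_assoc, <- !exp_plus. apply Rmult_le_compat_l; auto. apply exp_le.
          unfold x. pose proof (pos_INR N).
          assert (INR N * ln (y + 1) <= INR N * ln z) by (apply Rmult_le_compat_l; auto). lra. }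
      eapply Rle_trans; [apply (csum_diff_bound _ bb); auto|].
      assert (Hd : rsum bb k - rsum bb (S n) <= rsum (fun j => c * exp (- (2) * ln (INR (S j)))) k).
      { clear -Hk Hc. induction Hk as [|k Hk IHk].
        - rewrite Rminus_diag_eq by reflexivity. pose proof (rsum_mono (fun j => c * exp (- (2) * ln (INR (S j)))) 0 (S n)) as Q.
          simpl rsum in Q at 1. apply Q; [|lia]. intros j. apply Rmult_le_pos; auto. left; apply exp_pos.
        - change (rsum bb (S k)) with (rsum bb k + bb k).
          change (rsum (fun j => c * exp (- (2) * ln (INR (S j)))) (S k)) with
            (rsum (fun j => c * exp (- (2) * ln (INR (S j)))) k + c * exp (- (2) * ln (INR (S k)))).
          replace (bb k) with (c * exp (- (2) * ln (INR (S k)))); [lra|].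
          unfold bb. destruct (Nat.ltb_spec k (S n)); [lia|reflexivity]. }
      eapply Rle_trans; [exact Hd|]. apply (summable_le _ _ k HcB). }
    simpl csum in Hb. rewrite Hprev in Hb.
    replace (0 - (0 + dterm b (RtoC x) n))%C with (- dterm b (RtoC x) n)%C in Hb by ring.
    rewrite Cmod_opp in Hb. unfold dterm in Hb. rewrite Cmod_mult, Cmod_R, Cmod_npow in Hb. simpl Re in Hb. fold y in Hb.
    apply Rmult_le_reg_r with (exp (- x * ln y)); [apply exp_pos|].
    eapply Rle_trans; [exact Hb|]. right.
    replace (INR N * (ln y - ln (y + 1)) + 4 * ln y - x * ln y) with
      (4 * ln y + (INR N * (ln y - ln (y + 1)) + - x * ln y)) by ring.
    rewrite !exp_plus. ring. }
  set (r := exp (ln y - ln (y + 1))) in *.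
  assert (Hr : 0 < r < 1).
  { split; [apply exp_pos|]. rewrite <- exp_0. apply exp_increasing.
    pose proof (ln_increasing y (y + 1) Hy ltac:(lra)). lra. }
  set (Q := M * exp (4 * ln y) * B) in *.
  destruct (Req_dec (b (S n)) 0) as [|Hne]; auto. exfalso.
  assert (Hpos : 0 < Rabs (b (S n))) by (apply Rabs_pos_lt, Hne).
  assert (HQ : 0 < Q).
  { pose proof (K 0%nat) as K0. simpl in K0. lra. }
  destruct (pow_lt_1_zero r) with (y := Rabs (b (S n)) / Q) as [N HN].
  { rewrite Rabs_pos_eq; lra. }
  { apply Rdiv_lt_0_compat; auto. }
  specialize (HN N (Nat.le_refl N)). rewrite Rabs_pos_eq in HN by (apply pow_le; lra).
  pose proof (K N) as KN.
  assert (Q * r ^ N < Q * (Rabs (b (S n)) / Q)) by (apply Rmult_lt_compat_l; auto).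
  replace (Q * (Rabs (b (S n)) / Q)) with (Rabs (b (S n))) in H0 by (field; lra). lra.
Qed.

Lemma is_clim_Re u l : is_clim u l -> is_lim_seq (fun n => Re (u n)) (Re l).
Proof.
  intros H. apply is_lim_seq_spec. intros e. destruct (H e (cond_pos e)) as [N HN].
  exists N. intros n Hn. rewrite <- re_minus. eapply Rle_lt_trans; [apply re_le_Cmod|]. apply HN, Hn.
Qed.

Lemma is_clim_Im u l : is_clim u l -> is_lim_seq (fun n => Im (u n)) (Im l).
Proof.
  intros H. apply is_lim_seq_spec. intros e. destruct (H e (cond_pos e)) as [N HN].
  exists N. intros n Hn. rewrite <- im_minus. eapply Rle_lt_trans; [apply Im_le_Cmod|]. apply HN, Hn.
Qed.

Lemma Re_csum f N : Re (csum f N) = rsum (fun n => Re (f n)) N.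
Proof. induction N as [|N IH]; auto. simpl. rewrite <- IH. reflexivity. Qed.

Lemma Im_csum f N : Im (csum f N) = rsum (fun n => Im (f n)) N.
Proof. induction N as [|N IH]; auto. simpl. rewrite <- IH. reflexivity. Qed.

Lemma zeta_zeta_c s : 1 < Re s -> zeta s = zeta_c s.
Proof.
  intros Hs. pose proof (zeta_c_lim s Hs) as H.
  assert (E : forall k, dirichlet_term (fun _ => 1) s (S k) = npow (INR (S k)) s).
  { intros k. unfold dirichlet_term, npow. ring. }
  unfold zeta. destruct (zeta_c s) as [x y] eqn:Ez. f_equal; apply is_series_unique, is_lim_rsum_series.
  - apply (is_lim_seq_ext (fun n => Re (csum (fun n => npow (INR (S n)) s) n))).
    + intros N. rewrite Re_csum. apply rsum_ext. intros n _. rewrite E. reflexivity.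
    + apply is_clim_Re in H. exact H.
  - apply (is_lim_seq_ext (fun n => Im (csum (fun n => npow (INR (S n)) s) n))).
    + intros N. rewrite Im_csum. apply rsum_ext. intros n _. rewrite E. reflexivity.
    + apply is_clim_Im in H. exact H.
Qed.

Lemma is_dirichlet_clim a s l : is_dirichlet a s l <-> is_clim (csum (dterm a s)) l.
Proof. symmetry. apply (is_clim_csum_series (fun k => dirichlet_term a s (S k)) l). Qed.

(** The hypothesis is about sums of series; uniqueness, applied to the coefficients minus 1, brings
    it back to orbits. *)
Lemma orbit_coeff_one {X : Type} (T : X -> X) :
  (forall s : C, 1 < Re s -> is_dirichlet (orbit_coeff T) s (zeta s)) ->
  forall n, (1 <= n)%nat -> orbit_count T n = 1%nat.
Proof.
  intros H n Hn. apply INR_eq. simpl. apply Rminus_diag_uniq.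
  apply (dirichlet_unique (fun n => orbit_coeff T n - 1)); auto.
  intros x Hx.
  assert (Hs : 1 < Re (RtoC x)) by (simpl; lra).
  pose proof (H _ Hs) as H1. apply is_dirichlet_clim in H1. rewrite zeta_zeta_c in H1 by auto.
  apply is_clim_ext with (fun N => csum (dterm (orbit_coeff T) (RtoC x)) N + - RtoC 1 * csum (fun n => npow (INR (S n)) (RtoC x)) N)%C.
  - intros N. rewrite <- csum_scal, <- csum_plus. apply csum_ext. intros k _. unfold dterm. rewrite RtoC_minus. ring.
  - replace (RtoC 0) with (zeta_c (RtoC x) + - RtoC 1 * zeta_c (RtoC x))%C by ring.
    apply is_clim_plus; auto. apply is_clim_scal. apply zeta_c_lim, Hs.
Qed.

(** * Meromorphic continuation of the Euler product to [Re s > 1] *)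

Definition Xp (p : nat) (s : C) : C := npow (INR p) (s - 1).

Lemma Xp_eq p s : (1 <= p)%nat -> Xp p s = (RtoC (INR p) * npow (INR p) s)%C.
Proof. intros Hp. apply npow_minus_INR, Hp. Qed.

Lemma Xp_pow p s k : (Xp p s ^ k)%C = npow (INR p) (RtoC (INR k) * (s - 1)).
Proof. unfold Xp. symmetry. apply npow_pow. Qed.

Lemma Cmod_Xp p s : Cmod (Xp p s) = exp (- (Re s - 1) * ln (INR p)).
Proof. unfold Xp. rewrite Cmod_npow, re_minus. reflexivity. Qed.

Lemma INR_ge2 p : (2 <= p)%nat -> 2 <= INR p.
Proof. apply (le_INR 2). Qed.

Lemma ln_INR_pos p : (2 <= p)%nat -> 0 < ln (INR p).
Proof. intros H. apply INR_ge2 in H. rewrite <- ln_1. apply ln_increasing; lra. Qed.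

Lemma ln_INR_ge0 p : (1 <= p)%nat -> 0 <= ln (INR p).
Proof. intros H. apply (le_INR 1) in H. simpl in H. rewrite <- ln_1. apply ln_le; lra. Qed.

Lemma exp_lt_1 x : x < 0 -> exp x < 1.
Proof. intros H. rewrite <- exp_0. apply exp_increasing, H. Qed.

Lemma exp_le_1 x : x <= 0 -> exp x <= 1.
Proof. intros H. rewrite <- exp_0. apply exp_le, H. Qed.

Lemma Cmod_Xp_lt1 p s : (2 <= p)%nat -> 1 < Re s -> Cmod (Xp p s) < 1.
Proof.
  intros Hp Hs. rewrite Cmod_Xp. apply exp_lt_1. pose proof (ln_INR_pos p Hp). nra.
Qed.

Lemma Re_scal r z : Re (RtoC r * z) = r * Re z.
Proof. apply re_scal_l. Qed.

Lemma at_prime_mult a b n : at_prime (fun p => (a p * b p)%C) n = (at_prime a n * at_prime b n)%C.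
Proof. unfold at_prime. destruct (primeb (S n)); [reflexivity|ring]. Qed.

Lemma cprod_at_prime_mult a b N : cprod (at_prime (fun p => (a p * b p)%C)) N =
  (cprod (at_prime a) N * cprod (at_prime b) N)%C.
Proof. rewrite <- cprod_mult. apply cprod_ext. intros n _. apply at_prime_mult. Qed.

Lemma cprod_at_prime_pow a k N : cprod (at_prime (fun p => (a p ^ k)%C)) N = (cprod (at_prime a) N ^ k)%C.
Proof.
  rewrite <- cprod_pow. apply cprod_ext. intros n _. unfold at_prime.
  destruct (primeb (S n)); [reflexivity|]. rewrite Cpow_1_l. reflexivity.
Qed.

Lemma cprod_at_prime_ext a b N : (forall p, primeb p = true -> a p = b p) ->
  cprod (at_prime a) N = cprod (at_prime b) N.
Proof.
  intros H. apply cprod_ext. intros n _. unfold at_prime.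
  destruct (primeb (S n)) eqn:E; [apply H, E|reflexivity].
Qed.

Lemma one_minus_neq_0 Y : Cmod Y < 1 -> (1 - Y)%C <> 0.
Proof.
  intros H E. apply Ceq_minus in E. rewrite <- E, Cmod_1 in H. lra.
Qed.

Lemma one_plus_neq_0 Y : Cmod Y < 1 -> (1 + Y)%C <> 0.
Proof.
  intros H. replace (1 + Y)%C with (1 - - Y)%C by ring. apply one_minus_neq_0. rewrite Cmod_opp. exact H.
Qed.

Lemma cprod_at_prime_neq_0 (a : nat -> C) N : (forall p, primeb p = true -> a p <> 0) -> cprod (at_prime a) N <> 0.
Proof.
  intros H. apply cprod_neq_0. intros n _. unfold at_prime. destruct (primeb (S n)) eqn:E; [apply H, E|].
  intros E'. apply RtoC_inj in E'. lra.
Qed.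

Section continuation.
Variables (ap an : nat -> nat) (gq : nat -> C -> C).
Hypothesis Hgq : forall k, int_poly (gq k).
Hypothesis Hfac : forall k X, ((1 + RtoC 2 * X) * cprod (fun j => qfac (ap j) (an j) j X) k = 1 + X ^ S k * gq k X)%C.

Definition Qp (K : nat) (X : C) : C := cprod (fun j => qfac (ap j) (an j) j X) K.
(** The Euler factor with the low powers of [X = p^(1-s)] removed: it is
    [1 + O(X^(K+1)) + O(p^(-s))]. *)
Definition hreg (K p : nat) (s : C) : C := (hfac p s * Qp K (Xp p s))%C.
Definition PiK (K : nat) (s : C) : C := Clim (cprod (at_prime (fun p => hreg K p s))).
Definition wk (k : nat) (s : C) : C := (RtoC (INR k) * (s - 1))%C.
(** Where the zeta series converge, this is the inverse of the product over all primes of [qfac] at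
    [X = p^(1-s)]. With [k = j + 1], the factor [1 + X^k] is [(1 - X^(2k)) / (1 - X^k)], whence the
    zeta values at [2k(s-1)] and [k(s-1)]. *)
Definition Bk (j : nat) (s : C) : C :=
  (zeta_c (wk (S j) s) ^ ap j * (zeta_c (wk (2 * S j) s) * zeta_i (wk (S j) s)) ^ an j)%C.
(* Continuation of the orbit Dirichlet series to [Re s > 1 + 1/(K+1)]. *)
Definition FK (K : nat) (s : C) : C :=
  (zeta_c s * zeta_c (s - 1) * zeta_c (s - 2) * (cprod (fun j => Bk j s) K * PiK K s))%C.
(** The first condition makes the sum of [p^(-s)] converge, the second that of [X^(K+1)]. *)
Definition okK (K : nat) (s : C) : Prop := 1 < Re s /\ 1 < INR (S K) * (Re s - 1).

(** With [x = p^(-s)] one has [hfac = (1 + 2X) + x (2 + X)]: [Qp] reduces the first part to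
    [1 + O(X^(K+1))], and the second is already of size [x]. *)
Lemma hreg_bound K : exists B, 0 <= B /\ forall p s, (1 <= p)%nat -> 1 <= Re s ->
  Cmod (hreg K p s - 1) <= B * (Cmod (Xp p s) ^ S K + Cmod (npow (INR p) s)).
Proof.
  assert (HQ : exists B, 0 <= B /\ forall X, Cmod X <= 1 -> Cmod (Qp K X) <= B).
  { unfold Qp. induction K as [|k [B [HB IH]]].
    - exists 1. split; [lra|]. intros X _. simpl. rewrite Cmod_1. lra.
    - exists (B * (2 ^ ap k * 2 ^ an k)).
      assert (H2 : forall m, 0 < 2 ^ m) by (intros; apply pow_lt; lra).
      pose proof (H2 (ap k)). pose proof (H2 (an k)). split; [apply Rmult_le_pos; nra|].
      intros X HX. simpl cprod. rewrite Cmod_mult. apply Rmult_le_compat; try apply Cmod_ge_0; auto.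
      unfold qfac. rewrite Cmod_mult, !Cmod_pow.
      assert (HXk : Cmod (X ^ S k) <= 1).
      { rewrite Cmod_pow. rewrite <- (pow1 (S k)). apply pow_incr. split; [apply Cmod_ge_0|auto]. }
      apply Rmult_le_compat; try (apply pow_le, Cmod_ge_0); apply pow_incr; (split; [apply Cmod_ge_0|]).
      + unfold Cminus. eapply Rle_trans; [apply Cmod_triangle|]. rewrite Cmod_1, Cmod_opp. lra.
      + eapply Rle_trans; [apply Cmod_triangle|]. rewrite Cmod_1. lra. }
  destruct HQ as [B [HB HQ]]. destruct (int_poly_bounded _ (Hgq K)) as [B' [HB' HG]].
  exists (B' + 3 * B). split; [lra|]. intros p s Hp Hs.
  set (X := Xp p s). set (x := npow (INR p) s).
  assert (HX : Cmod X <= 1).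
  { unfold X. rewrite Cmod_Xp. apply exp_le_1. pose proof (ln_INR_ge0 p Hp). nra. }
  assert (E : (hreg K p s - 1 = X ^ S K * gq K X + x * ((2 + X) * Qp K X))%C).
  { unfold hreg. fold X.
    replace (hfac p s) with ((1 + RtoC 2 * X) + x * (2 + X))%C.
    2: { unfold hfac, X. rewrite Xp_eq by auto. fold x. ring. }
    pose proof (Hfac K X) as Q. fold (Qp K X) in Q.
    replace (((1 + RtoC 2 * X) + x * (2 + X)) * Qp K X - 1)%C with
      ((1 + RtoC 2 * X) * Qp K X - 1 + x * (2 + X) * Qp K X)%C by ring.
    rewrite Q. ring. }
  rewrite E. eapply Rle_trans; [apply Cmod_triangle|]. rewrite !Cmod_mult, Cmod_pow.
  pose proof (HQ X HX). pose proof (HG X HX).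
  assert (Cmod (2 + X) <= 3).
  { eapply Rle_trans; [apply Cmod_triangle|]. rewrite Cmod_R_pos by lra. lra. }
  assert (0 <= Cmod X ^ S K) by (apply pow_le, Cmod_ge_0). pose proof (Cmod_ge_0 x).
  assert (Cmod X ^ S K * Cmod (gq K X) <= Cmod X ^ S K * B') by (apply Rmult_le_compat_l; auto).
  assert (Cmod (2 + X) * Cmod (Qp K X) <= 3 * B) by (apply Rmult_le_compat; auto; apply Cmod_ge_0).
  assert (Cmod x * (Cmod (2 + X) * Cmod (Qp K X)) <= Cmod x * (3 * B)) by (apply Rmult_le_compat_l; auto).
  nra.
Qed.

Lemma hreg_summable K s0 : okK K s0 -> exists r b B, 0 < r /\ summable b B /\
  forall n s, Cmod (s - s0) < r -> okK K s /\ Cmod (at_prime (fun p => hreg K p s) n - 1) <= b n.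
Proof.
  intros [H1 H2]. pose proof (lt_0_INR (S K) ltac:(lia)) as HK.
  (* Half the distance to the nearer of the lines [Re s = 1] and [Re s = 1 + 1/(K+1)]. *)
  set (r := Rmin ((Re s0 - 1) / 2) ((Re s0 - 1 - / INR (S K)) / 2)).
  assert (H3 : / INR (S K) < Re s0 - 1).
  { apply Rmult_lt_reg_l with (INR (S K)); auto. rewrite Rinv_r by lra. exact H2. }
  assert (Hr : 0 < r) by (apply Rmin_pos; lra).
  assert (Hr1 : r <= (Re s0 - 1) / 2) by apply Rmin_l.
  assert (Hr2 : r <= (Re s0 - 1 - / INR (S K)) / 2) by apply Rmin_r.
  set (d := Re s0 - 1 - r). assert (Hd : 0 < d) by (unfold d; lra).
  assert (Hd' : 1 < INR (S K) * d).
  { apply Rmult_lt_reg_l with (/ INR (S K)); [apply Rinv_0_lt_compat; auto|].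
    rewrite <- Rmult_assoc, Rinv_l by lra. unfold d. lra. }
  (* On the whole disc both exponents, [Re s] and [(K+1)(Re s - 1)], are at least [1 + th]. *)
  set (th := Rmin d (INR (S K) * d - 1)).
  assert (Hth : 0 < th) by (apply Rmin_pos; lra).
  assert (Hth1 : th <= d) by apply Rmin_l. assert (Hth2 : th <= INR (S K) * d - 1) by apply Rmin_r.
  destruct (power_summable (1 + th)) as [S0 HS]; [lra|].
  destruct (hreg_bound K) as [B [HB Hb]].
  exists r, (fun n => (B * 2) * exp (- (1 + th) * ln (INR (S n)))), ((B * 2) * S0).
  split; auto. split; [apply summable_scal; auto; lra|].
  intros n s Hs. apply Re_near in Hs.
  assert (Hs1 : d <= Re s - 1) by (unfold d; lra).
  assert (HsK : INR (S K) * d <= INR (S K) * (Re s - 1)) by (apply Rmult_le_compat_l; lra).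
  split; [split; lra|].
  unfold at_prime. destruct (primeb (S n)).
  2: { replace (1 - 1)%C with (RtoC 0) by ring. rewrite Cmod_0. apply Rmult_le_pos; [lra|left; apply exp_pos]. }
  eapply Rle_trans; [apply Hb; [lia|lra]|]. rewrite Rmult_assoc. apply Rmult_le_compat_l; auto.
  pose proof (ln_INR_ge0 (S n) ltac:(lia)) as Hl.
  rewrite Cmod_Xp, Cmod_npow.
  assert (E : exp (- (Re s - 1) * ln (INR (S n))) ^ S K = exp (- (INR (S K) * (Re s - 1)) * ln (INR (S n)))).
  { rewrite <- (Rpower_pow (S K)) by apply exp_pos. unfold Rpower. rewrite ln_exp. f_equal. ring. }
  rewrite E.
  assert (exp (- (INR (S K) * (Re s - 1)) * ln (INR (S n))) <= exp (- (1 + th) * ln (INR (S n)))).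
  { apply exp_le. apply Rmult_le_compat_r; auto. lra. }
  assert (exp (- Re s * ln (INR (S n))) <= exp (- (1 + th) * ln (INR (S n)))).
  { apply exp_le. apply Rmult_le_compat_r; auto. lra. }
  lra.
Qed.

Lemma plus_minus_1 (z : C) : (1 + (z - 1))%C = z.
Proof. ring. Qed.

Lemma cprod_at_prime_u a N : cprod (fun n => (1 + (at_prime a n - 1))%C) N = cprod (at_prime a) N.
Proof. apply cprod_ext. intros n _. apply plus_minus_1. Qed.

Lemma ball_center (s : C) r : 0 < r -> Cmod (s - s) < r.
Proof. intros. replace (s - s)%C with (RtoC 0) by ring. rewrite Cmod_0. auto. Qed.

Lemma PiK_lim K s : okK K s -> is_clim (cprod (at_prime (fun p => hreg K p s))) (PiK K s).
Proof.
  intros H. destruct (hreg_summable K s H) as [r [b [B [Hr [HB Hu]]]]].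
  destruct (product_converges (fun n => at_prime (fun p => hreg K p s) n - 1)%C b B HB) as [l [Hl _]].
  { intros n. apply Hu, ball_center, Hr. }
  assert (Hl' : is_clim (cprod (at_prime (fun p => hreg K p s))) l).
  { revert Hl. apply is_clim_ext. intros N. apply cprod_at_prime_u. }
  unfold PiK. rewrite (is_clim_Clim _ _ Hl'). exact Hl'.
Qed.

Lemma hol_Qp K X : hol (Qp K) X.
Proof.
  apply (hol_cprod (fun j X => qfac (ap j) (an j) j X)). intros j. unfold qfac.
  apply hol_mult; apply hol_pow; [apply hol_minus|apply hol_plus]; try apply hol_const; apply hol_pow, hol_id.
Qed.

Lemma hol_Xp p s : hol (Xp p) s.
Proof.
  apply (hol_comp (fun s => s - 1)%C (fun w => npow (INR p) w)).
  - apply hol_minus; [apply hol_id|apply hol_const].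
  - apply hol_npow.
Qed.

Lemma hol_hreg K p s : hol (hreg K p) s.
Proof.
  apply hol_mult.
  - unfold hfac. apply hol_plus; [apply hol_plus|]; try apply hol_const; apply hol_mult; try apply hol_const.
    + apply hol_npow.
    + apply hol_pow, hol_npow.
  - apply (hol_comp (Xp p) (Qp K)); [apply hol_Xp|apply hol_Qp].
Qed.

Lemma hol_PiK K s : okK K s -> hol (PiK K) s.
Proof.
  intros H. destruct (hreg_summable K s H) as [r [b [B [Hr [HB Hu]]]]].
  apply (hol_product (fun n z => at_prime (fun p => hreg K p z) n - 1)%C (PiK K) b B s r Hr HB).
  - intros n z Hz. split; [|apply Hu, Hz]. apply hol_minus; [|apply hol_const].
    unfold at_prime. destruct (primeb (S n)); [apply hol_hreg|apply hol_const].
  - intros z Hz. apply is_clim_ext with (cprod (at_prime (fun p => hreg K p z))).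
    + intros N. symmetry. apply (cprod_at_prime_u (fun p => hreg K p z)).
    + apply PiK_lim, (Hu 0%nat), Hz.
Qed.

Lemma Qp_neq_0 K X : Cmod X < 1 -> Qp K X <> 0.
Proof.
  intros HX. apply cprod_neq_0. intros j _. unfold qfac.
  assert (HXj : Cmod (X ^ S j) < 1).
  { rewrite Cmod_pow. simpl. pose proof (Cmod_ge_0 X).
    assert (Cmod X ^ j <= 1) by (rewrite <- (pow1 j); apply pow_incr; lra).
    pose proof (pow_le (Cmod X) j H). nra. }
  apply Cmult_neq_0; apply Cpow_nz; [apply one_minus_neq_0|apply one_plus_neq_0]; exact HXj.
Qed.

Lemma PiK_zero K s p : okK K s -> primeb p = true -> hfac p s = 0 -> PiK K s = 0.
Proof.
  intros H Hp Hh. apply (is_clim_unique (cprod (at_prime (fun p => hreg K p s)))); [apply PiK_lim, H|].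
  apply is_clim_ext_ev with (fun _ => RtoC 0); [|apply is_clim_const].
  exists p. intros n Hn. symmetry. pose proof (primeb_ge2 p Hp).
  apply (cprod_eq_0 _ n (p - 1)); [lia|]. unfold at_prime. replace (S (p - 1)) with p by lia.
  rewrite Hp. unfold hreg. rewrite Hh. ring.
Qed.

Lemma PiK_neq_0 K s : okK K s -> (forall p, primeb p = true -> hfac p s <> 0) -> PiK K s <> 0.
Proof.
  intros H Hh. destruct (hreg_summable K s H) as [r [b [B [Hr [HB Hu]]]]].
  apply (product_neq_0 (fun n => at_prime (fun p => hreg K p s) n - 1)%C b B); auto.
  - intros n. apply Hu, ball_center, Hr.
  - apply is_clim_ext with (cprod (at_prime (fun p => hreg K p s))); [|apply PiK_lim, H].
    intros N. symmetry. apply (cprod_at_prime_u (fun p => hreg K p s)).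
  - intros n. rewrite plus_minus_1. unfold at_prime. destruct (primeb (S n)) eqn:E.
    + apply Cmult_neq_0; [apply Hh, E|]. apply Qp_neq_0, Cmod_Xp_lt1; [apply primeb_ge2, E|apply H].
    + intros E'. apply RtoC_inj in E'. lra.
Qed.

Lemma Re_wk k s : Re (wk k s) = INR k * (Re s - 1).
Proof. unfold wk. rewrite Re_scal, re_minus. reflexivity. Qed.

Lemma Bk_lim j s : 1 < Re s -> 1 < INR (S j) * (Re s - 1) ->
  is_clim (fun P => cprod (at_prime (fun p => qfac (ap j) (an j) j (Xp p s))) P * Bk j s)%C 1.
Proof.
  intros Hs Hj. set (w := wk (S j) s). set (w2 := wk (2 * S j) s).
  assert (Hw : 1 < Re w) by (unfold w; rewrite Re_wk; exact Hj).
  assert (Hw2 : 1 < Re w2).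
  { unfold w2. rewrite Re_wk, mult_INR. change (INR 2) with 2. lra. }
  pose proof (zeta_euler w Hw) as E1. pose proof (zeta_euler w2 Hw2) as E2.
  set (e1 := fun P => (zeta_c w * cprod (at_prime (fun p => 1 - npow (INR p) w)) P)%C) in *.
  set (e2 := fun P => (zeta_c w2 * cprod (at_prime (fun p => 1 - npow (INR p) w2)) P)%C) in *.
  assert (Hne : forall P, cprod (at_prime (fun p => 1 - npow (INR p) w)%C) P <> 0).
  { intros P. apply cprod_at_prime_neq_0. intros p Hp. apply one_minus_neq_0.
    rewrite Cmod_npow. apply exp_lt_1. pose proof (ln_INR_pos p (primeb_ge2 p Hp)). nra. }
  assert (Ep : forall P, (cprod (at_prime (fun p => 1 + npow (INR p) w)%C) P * cprod (at_prime (fun p => 1 - npow (INR p) w)%C) P)%C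
     = cprod (at_prime (fun p => 1 - npow (INR p) w2)%C) P).
  { intros P. rewrite <- cprod_at_prime_mult. apply cprod_at_prime_ext. intros p Hp.
    replace (npow (INR p) w2) with (npow (INR p) w * npow (INR p) w)%C; [ring|].
    rewrite <- npow_plus. f_equal. unfold w2, w, wk. rewrite mult_INR, RtoC_mult.
    change (INR 2) with (1 + 1). rewrite RtoC_plus. ring. }
  (* Each of [e1] and [e2] tends to 1; their quotient [e2 / e1] carries the product of the factors
     [1 + X^(j+1)]. *)
  apply is_clim_ext with (fun P => e1 P ^ ap j * (e2 P * / e1 P) ^ an j)%C.
  - intros P.
    assert (Eq : cprod (at_prime (fun p => qfac (ap j) (an j) j (Xp p s))) P =
      (cprod (at_prime (fun p => 1 - npow (INR p) w)) P ^ ap j * cprod (at_prime (fun p => 1 + npow (INR p) w)) P ^ an j)%C).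
    { rewrite <- !cprod_at_prime_pow, <- cprod_at_prime_mult. apply cprod_at_prime_ext. intros p Hp.
      unfold qfac. rewrite Xp_pow. reflexivity. }
    rewrite Eq. unfold Bk, e1, e2. fold w w2. rewrite <- Ep.
    set (A1 := cprod (at_prime (fun p => 1 - npow (INR p) w)%C) P).
    set (A2 := cprod (at_prime (fun p => 1 + npow (INR p) w)%C) P).
    replace (zeta_c w2 * (A2 * A1) * / (zeta_c w * A1))%C with (A2 * (zeta_c w2 * zeta_i w))%C.
    + rewrite !Cpow_mult_l. ring.
    + pose proof (zeta_i_inv w Hw) as Hi. pose proof (zeta_c_neq_0 w Hw) as Hz.
      assert (Ei : zeta_i w = (/ zeta_c w)%C).
      { apply (Ceq_mult_l (zeta_c w)); auto. rewrite (Cmult_comm _ (zeta_i w)), Hi. field. auto. }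
      rewrite Ei. field. split; auto. apply (Hne P).
  - replace (RtoC 1) with (1 ^ ap j * (1 * / 1) ^ an j)%C.
    + apply is_clim_mult; apply is_clim_pow; auto. apply is_clim_mult; auto. apply is_clim_inv; auto.
      intros E. apply RtoC_inj in E. lra.
    + replace (1 * / 1)%C with (RtoC 1) by field. rewrite !Cpow_1_l. ring.
Qed.

Lemma okK_S K s : okK K s -> okK (S K) s.
Proof. intros [H1 H2]. split; auto. rewrite S_INR. nra. Qed.

(** Raising [K] multiplies every Euler factor of [PiK] by one more [qfac], and the new [Bk] is the
    inverse of the product of these. *)
Lemma FK_S K s : okK K s -> FK (S K) s = FK K s.
Proof.
  intros H. unfold FK. f_equal. simpl cprod. rewrite <- Cmult_assoc. f_equal.
  apply (is_clim_unique (fun P => cprod (at_prime (fun p => hreg (S K) p s)) P * Bk K s)%C).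
  - rewrite (Cmult_comm (Bk K s)). apply is_clim_mult; [apply PiK_lim, okK_S, H|apply is_clim_const].
  - replace (PiK K s) with (PiK K s * 1)%C by ring.
    apply is_clim_ext with (fun P => cprod (at_prime (fun p => hreg K p s)) P *
      (cprod (at_prime (fun p => qfac (ap K) (an K) K (Xp p s))) P * Bk K s))%C.
    + intros P. rewrite Cmult_assoc, <- cprod_at_prime_mult. f_equal. apply cprod_at_prime_ext. intros p _.
      unfold hreg, Qp. simpl cprod. ring.
    + apply is_clim_mult; [apply PiK_lim, H|]. apply Bk_lim; apply H.
Qed.

Lemma FK_le K K' s : (K <= K')%nat -> okK K s -> okK K' s /\ FK K' s = FK K s.
Proof.
  intros HK H. induction HK as [|K' HK [IH1 IH2]]; auto. split; [apply okK_S, IH1|].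
  rewrite FK_S; auto.
Qed.

Lemma FK_indep K K' s : okK K s -> okK K' s -> FK K s = FK K' s.
Proof.
  intros H H'. destruct (Nat.le_ge_cases K K') as [Hl|Hl].
  - symmetry. apply FK_le; auto.
  - apply FK_le; auto.
Qed.

Definition Kof (s : C) : nat := Z.to_nat (up (/ (Re s - 1))).

Lemma Kof_ok s : 1 < Re s -> okK (Kof s) s.
Proof.
  intros Hs. split; auto. unfold Kof. destruct (archimed (/ (Re s - 1))) as [H _].
  assert (Hp : 0 < / (Re s - 1)) by (apply Rinv_0_lt_compat; lra).
  rewrite S_INR, INR_IZR_INZ, Z2Nat.id by (apply le_IZR; lra).
  assert (/ (Re s - 1) * (Re s - 1) = 1) by (apply Rinv_l; lra). nra.
Qed.

(** The index depends on the point, but by [FK_indep] the function agrees near any point with [FK K]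
    for one fixed [K]. *)
Definition Fext (s : C) : C := FK (Kof s) s.

Lemma Fext_FK K s : okK K s -> Fext s = FK K s.
Proof. intros H. apply FK_indep; auto. apply Kof_ok, H. Qed.

Lemma Fext_near K s : okK K s -> exists r, 0 < r /\ forall z, Cmod (z - s) < r -> okK K z /\ Fext z = FK K z.
Proof.
  intros H. destruct (hreg_summable K s H) as [r [b [B [Hr [_ Hu]]]]].
  exists r. split; auto. intros z Hz. destruct (Hu 0%nat z Hz) as [Hz' _]. split; auto. apply Fext_FK, Hz'.
Qed.

Lemma is_clim_cprod (u : nat -> nat -> C) (l : nat -> C) K : (forall j, is_clim (u j) (l j)) ->
  is_clim (fun P => cprod (fun j => u j P) K) (cprod l K).
Proof.
  intros H. induction K as [|K IH]; simpl; [apply is_clim_const|]. apply is_clim_mult; auto.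
Qed.

Lemma cprod_one K : cprod (fun _ => RtoC 1) K = 1.
Proof. induction K as [|K IH]; simpl; auto. rewrite IH. ring. Qed.

Lemma dfac_lim s : 3 < Re s ->
  is_clim (fun P => zeta_c s * zeta_c (s - 1) * zeta_c (s - 2) * cprod (at_prime (fun p => dfac p s)) P)%C 1.
Proof.
  intros Hs.
  apply is_clim_ext with (fun P => (zeta_c s * cprod (at_prime (fun p => 1 - npow (INR p) s)) P) *
    (zeta_c (s - 1) * cprod (at_prime (fun p => 1 - npow (INR p) (s - 1))) P) *
    (zeta_c (s - 2) * cprod (at_prime (fun p => 1 - npow (INR p) (s - 2))) P))%C.
  - intros P. unfold dfac. rewrite !cprod_at_prime_mult. ring.
  - apply (is_clim_eq _ (1 * 1 * 1)%C); [ring|].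
    apply is_clim_mult; [apply is_clim_mult|]; apply zeta_euler; rewrite ?re_minus; simpl; lra.
Qed.

(** One expression in [P] has two limits: with the zeta values cancelling [dfac] it tends to the
    Dirichlet sum, and after the sieve has traded that sum for the factors [hfac] it tends to
    [FK]. *)
Lemma Fext_dsum f s : 3 < Re s -> dabs f s -> f 1%nat = 1 ->
  (forall p, primeb p = true -> fac_at (cubic_t p) p f) -> Fext s = dsum f s.
Proof.
  intros Hs Ha H1 Hf1. destruct (cubic_euler f s Ha H1 Hf1) as [e [He E]].
  set (K := Kof s). assert (HK : okK K s) by (apply Kof_ok; lra).
  set (Z3 := (zeta_c s * zeta_c (s - 1) * zeta_c (s - 2))%C).
  set (qq := fun P => cprod (fun j => cprod (at_prime (fun p => qfac (ap j) (an j) j (Xp p s))) P * Bk j s)%C K).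
  assert (Hqq : is_clim qq 1).
  { rewrite <- (cprod_one K).
    apply (is_clim_cprod (fun j P => cprod (at_prime (fun p => qfac (ap j) (an j) j (Xp p s))) P * Bk j s)%C (fun _ => RtoC 1)).
    intros j. apply Bk_lim; [lra|]. rewrite S_INR. pose proof (pos_INR j). nra. }
  assert (L1 : is_clim (fun P => (Z3 * cprod (at_prime (fun p => dfac p s)) P) * dsum f s * qq P)%C (1 * dsum f s * 1)%C).
  { apply is_clim_mult; auto. apply is_clim_mult; [apply dfac_lim, Hs|apply is_clim_const]. }
  assert (Eqq : forall P, (cprod (at_prime (fun p => hfac p s)) P * qq P = cprod (at_prime (fun p => hreg K p s)) P * cprod (fun j => Bk j s) K)%C).
  { intros P. unfold qq. rewrite cprod_mult. rewrite Cmult_assoc. f_equal.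
    unfold hreg. rewrite cprod_at_prime_mult. f_equal. unfold Qp. generalize K. clear. induction K as [|K IH].
    - simpl. symmetry. transitivity (cprod (fun _ => RtoC 1) P); [|apply cprod_one].
      apply cprod_ext. intros n _. unfold at_prime. destruct (primeb _); reflexivity.
    - simpl cprod. rewrite IH, <- cprod_at_prime_mult. reflexivity. }
  assert (L2 : is_clim (fun P => (Z3 * cprod (at_prime (fun p => dfac p s)) P) * dsum f s * qq P)%C (Z3 * (PiK K s * cprod (fun j => Bk j s) K) * 1)%C).
  { apply is_clim_ext with (fun P => Z3 * (cprod (at_prime (fun p => hreg K p s)) P * cprod (fun j => Bk j s) K) * e P)%C.
    - intros P. rewrite <- Eqq.
      replace (Z3 * cprod (at_prime (fun p => dfac p s)) P * dsum f s * qq P)%C with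
        (Z3 * (cprod (at_prime (fun p => dfac p s)) P * dsum f s) * qq P)%C by ring.
      rewrite E. ring.
    - apply is_clim_mult; auto. apply is_clim_mult; [apply is_clim_const|].
      apply is_clim_mult; [apply PiK_lim, HK|apply is_clim_const]. }
  pose proof (is_clim_unique _ _ _ L1 L2) as Q. unfold Fext, FK. fold K Z3.
  replace (dsum f s) with (1 * dsum f s * 1)%C by ring. rewrite Q. ring.
Qed.

Lemma mero_zeta_c_affine k b z : (k <> 0)%R -> -1 <= k * Re z + Re b -> mero (fun s => zeta_c (RtoC k * s + b)%C) z.
Proof.
  intros Hk H. apply (mero_comp_affine zeta_c (RtoC k) b z).
  - intros E. apply RtoC_inj in E. lra.
  - apply mero_zeta_c. rewrite re_plus, Re_scal. exact H.
Qed.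

Lemma mero_zeta_i_affine k b z : (k <> 0)%R -> -1 <= k * Re z + Re b -> mero (fun s => zeta_i (RtoC k * s + b)%C) z.
Proof.
  intros Hk H. apply (mero_comp_affine zeta_i (RtoC k) b z).
  - intros E. apply RtoC_inj in E. lra.
  - apply mero_zeta_i. rewrite re_plus, Re_scal. exact H.
Qed.

Lemma wk_affine k s : (RtoC (INR k) * s + RtoC (- INR k) = wk k s)%C.
Proof. unfold wk. rewrite RtoC_opp. ring. Qed.

Lemma mero_zeta_c_wk k z : (1 <= k)%nat -> 1 < Re z -> mero (fun s => zeta_c (wk k s)) z.
Proof.
  intros Hk Hz. assert (0 < INR k) by (apply lt_0_INR; lia).
  apply (mero_ext (fun s => zeta_c (RtoC (INR k) * s + RtoC (- INR k))%C) _ z 1); [lra| |].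
  - intros s _. rewrite wk_affine. reflexivity.
  - apply mero_zeta_c_affine; [lra|]. simpl Re. nra.
Qed.

Lemma mero_zeta_i_wk k z : (1 <= k)%nat -> 1 < Re z -> mero (fun s => zeta_i (wk k s)) z.
Proof.
  intros Hk Hz. assert (0 < INR k) by (apply lt_0_INR; lia).
  apply (mero_ext (fun s => zeta_i (RtoC (INR k) * s + RtoC (- INR k))%C) _ z 1); [lra| |].
  - intros s _. rewrite wk_affine. reflexivity.
  - apply mero_zeta_i_affine; [lra|]. simpl Re. nra.
Qed.

Lemma mero_zeta_c_shift b z : -1 <= Re z - b -> mero (fun s => zeta_c (s - RtoC b)%C) z.
Proof.
  intros H. apply (mero_ext (fun s => zeta_c (RtoC 1 * s + RtoC (- b))%C) _ z 1); [lra| |].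
  - intros s _. f_equal. rewrite RtoC_opp. ring.
  - apply mero_zeta_c_affine; [lra|]. simpl Re. lra.
Qed.

Lemma mero_cprod (u : nat -> C -> C) K z : (forall j, mero (u j) z) -> mero (fun s => cprod (fun j => u j s) K) z.
Proof. intros H. induction K as [|K IH]; simpl; [apply mero_const|]. apply mero_mult; auto. Qed.

Lemma mero_Fext z : 1 < Re z -> mero Fext z.
Proof.
  intros Hz. set (K := Kof z). assert (HK : okK K z) by (apply Kof_ok, Hz).
  destruct (Fext_near K z HK) as [r [Hr HF]].
  apply (mero_ext (FK K) _ z r Hr).
  { intros s Hs. symmetry. apply HF, Hs. }
  unfold FK. apply mero_mult; [apply mero_mult; [apply mero_mult|]|apply mero_mult].
  - apply mero_zeta_c. lra.
  - apply (mero_zeta_c_shift 1). lra.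
  - apply (mero_zeta_c_shift 2). lra.
  - apply mero_cprod. intros j. unfold Bk. apply mero_mult; apply mero_pow.
    + apply mero_zeta_c_wk; [lia|auto].
    + apply mero_mult; [apply mero_zeta_c_wk|apply mero_zeta_i_wk]; auto; lia.
  - apply (mero_hol _ z r Hr). intros s Hs. apply hol_PiK, HF, Hs.
Qed.

(** At such points no zeta factor of [FK K] has a zero or a pole, so the vanishing of [Fext] is
    decided by the Euler factors alone. The range goes to [2 * K] because of the values at
    [wk (2 * S j) s] in [Bk]. *)
Definition goodK (K : nat) (s : C) : Prop :=
  okK K s /\ Phi s <> 0 /\ Phi (s - 1) <> 0 /\ Phi (s - 2) <> 0 /\
  forall k, (1 <= k <= 2 * K)%nat -> Phi (wk k s) <> 0.

Lemma goodK_FK K s : goodK K s -> Ccont Fext s /\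
  (forall p, primeb p = true -> hfac p s = 0 -> Fext s = 0) /\
  ((forall p, primeb p = true -> hfac p s <> 0) -> Fext s <> 0).
Proof.
  intros [HK [G0 [G1 [G2 Gk]]]]. pose proof (proj1 HK) as Hs.
  destruct (zeta_c_good s ltac:(lra) G0) as [Z0 N0].
  destruct (zeta_c_good (s - 1)%C ltac:(rewrite re_minus; simpl; lra) G1) as [Z1 N1].
  destruct (zeta_c_good (s - 2)%C ltac:(rewrite re_minus; simpl; lra) G2) as [Z2 N2].
  assert (Zw : forall k, (1 <= k <= 2 * K)%nat -> (Ccont (fun s => zeta_c (wk k s)) s /\ zeta_c (wk k s) <> 0) /\
     (Ccont (fun s => zeta_i (wk k s)) s /\ zeta_i (wk k s) <> 0)).
  { intros k Hk. assert (Hwk : -7 < Re (wk k s)).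
    { rewrite Re_wk. pose proof (pos_INR k). nra. }
    assert (Hc : Ccont (wk k) s).
    { unfold wk. apply Ccont_mult; [apply Ccont_const|]. apply Ccont_minus; [apply Ccont_id|apply Ccont_const]. }
    destruct (zeta_c_good _ Hwk (Gk k Hk)) as [A1 A2]. destruct (zeta_i_good _ Hwk (Gk k Hk)) as [B1 B2].
    split; split; auto.
    - apply (Ccont_comp (wk k) zeta_c); auto. apply hol_cont, A1.
    - apply (Ccont_comp (wk k) zeta_i); auto. apply hol_cont, B1. }
  assert (HB : forall M, (M <= K)%nat -> Ccont (fun s => cprod (fun j => Bk j s) M) s /\ cprod (fun j => Bk j s) M <> 0).
  { induction M as [|M IH]; intros HM.
    - split; [apply Ccont_const|]. simpl. intros E. apply RtoC_inj in E. lra.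
    - destruct (IH ltac:(lia)) as [I1 I2]. simpl cprod.
      destruct (Zw (S M) ltac:(lia)) as [[A1 A2] [B1 B2]]. destruct (Zw (2 * S M)%nat ltac:(lia)) as [[A3 A4] _].
      split.
      + apply Ccont_mult; auto. unfold Bk. apply Ccont_mult; apply Ccont_pow; auto. apply Ccont_mult; auto.
      + apply Cmult_neq_0; auto. unfold Bk. apply Cmult_neq_0; apply Cpow_nz; auto. apply Cmult_neq_0; auto. }
  destruct (HB K (Nat.le_refl K)) as [HB1 HB2].
  destruct (Fext_near K s HK) as [r [Hr HF]].
  destruct (HF s (ball_center s r Hr)) as [_ EF].
  split; [|split].
  - apply Ccont_ext_loc with (FK K).
    + apply locally_C_eps. exists r. split; auto. intros w Hw. symmetry. apply HF, Hw.
    + unfold FK. apply Ccont_mult; [apply Ccont_mult; [apply Ccont_mult|]|apply Ccont_mult]; auto.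
      * apply hol_cont, Z0.
      * apply (Ccont_comp (fun s => s - 1)%C zeta_c); [|apply hol_cont, Z1].
        apply Ccont_minus; [apply Ccont_id|apply Ccont_const].
      * apply (Ccont_comp (fun s => s - 2)%C zeta_c); [|apply hol_cont, Z2].
        apply Ccont_minus; [apply Ccont_id|apply Ccont_const].
      * apply hol_cont, hol_PiK, HK.
  - intros p Hp Hh. rewrite EF. unfold FK. rewrite (PiK_zero K s p); auto. ring.
  - intros Hh. rewrite EF. unfold FK. apply Cmult_neq_0.
    + apply Cmult_neq_0; [apply Cmult_neq_0|]; assumption.
    + apply Cmult_neq_0; [assumption|]. apply PiK_neq_0; auto.
Qed.

End continuation.

(** * The zeros of the Euler factors *)

(* [hfac p s] is a quadratic polynomial in [X = p^(1-s)], with roots [-1/yp p] and [-p yp p]. *)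
Definition yp (p : nat) : R := 1 + / INR p + sqrt (1 + / INR p + (/ INR p) ^ 2).

Lemma yp_eq p : (1 <= p)%nat -> yp p ^ 2 - 2 * (1 + / INR p) * yp p + / INR p = 0.
Proof.
  intros Hp. unfold yp. assert (0 < / INR p) by (apply Rinv_0_lt_compat, lt_0_INR; lia).
  set (e := / INR p) in *. assert (He : 0 <= 1 + e + e ^ 2) by nra.
  pose proof (sqrt_sqrt _ He) as Q. set (q := sqrt _) in *. simpl in *. nra.
Qed.

Lemma yp_bounds p : (2 <= p)%nat -> 2 < yp p < 4.
Proof.
  intros Hp. pose proof (INR_ge2 p Hp). unfold yp.
  assert (H1 : 0 < / INR p) by (apply Rinv_0_lt_compat; lra).
  assert (H2 : / INR p <= / 2) by (apply Rinv_le_contravar; lra).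
  set (e := / INR p) in *. split.
  - assert (1 <= sqrt (1 + e + e ^ 2)); [|lra].
    rewrite <- sqrt_1 at 1. apply sqrt_le_1_alt. nra.
  - assert (sqrt (1 + e + e ^ 2) <= 2); [|lra].
    rewrite <- (sqrt_square 2) by lra. apply sqrt_le_1_alt. nra.
Qed.

Lemma yp_decr p q : (1 <= p < q)%nat -> yp q < yp p.
Proof.
  intros H. assert (Hp : 0 < INR p) by (apply lt_0_INR; lia). assert (Hq : INR p < INR q) by (apply lt_INR; lia).
  assert (He : / INR q < / INR p) by (apply Rinv_lt_contravar; nra).
  assert (H0 : 0 < / INR q) by (apply Rinv_0_lt_compat; lra).
  unfold yp. set (e := / INR p) in *. set (f := / INR q) in *.
  assert (sqrt (1 + f + f ^ 2) <= sqrt (1 + e + e ^ 2)) by (apply sqrt_le_1_alt; nra). lra.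
Qed.

Lemma hfac_factor p s : (2 <= p)%nat ->
  hfac p s = (RtoC (/ INR p) * (Xp p s + RtoC (/ yp p)) * (Xp p s + RtoC (INR p * yp p)))%C.
Proof.
  intros Hp. pose proof (INR_ge2 p Hp) as Hp2. pose proof (yp_bounds p Hp) as Hy. pose proof (yp_eq p ltac:(lia)) as E.
  unfold hfac. rewrite Xp_eq by lia. set (x := npow (INR p) s). set (q := INR p) in *. set (y := yp p) in *.
  assert (E1 : / y + q * y = 2 * q + 2).
  { apply Rmult_eq_reg_l with (y / q); [|apply Rmult_integral_contrapositive_currified; [lra|apply Rinv_neq_0_compat; lra]].
    replace (y / q * (/ y + q * y)) with (y ^ 2 + / q) by (field; lra).
    replace (y / q * (2 * q + 2)) with (2 * (1 + / q) * y) by (field; lra). lra. }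
  assert (E2 : / q * (/ y * (q * y)) = 1) by (field; lra).
  assert (E3 : / q * q = 1) by (field; lra).
  replace (RtoC (/ q) * (RtoC q * x + RtoC (/ y)) * (RtoC q * x + RtoC (q * y)))%C with
    (RtoC (/ q * q) * RtoC q * x ^ 2 + RtoC (/ q * q) * RtoC (/ y + q * y) * x + RtoC (/ q * (/ y * (q * y))))%C.
  - rewrite E1, E2, E3. rewrite RtoC_plus, RtoC_mult. ring.
  - rewrite !RtoC_mult, RtoC_plus. rewrite (RtoC_mult q y). ring.
Qed.

(** The other root of the quadratic has modulus above 1, whereas [|Xp p s| < 1] to the right of the
    line. *)
Lemma hfac_zero_Xp p s : (2 <= p)%nat -> 1 < Re s -> hfac p s = 0 -> Xp p s = (- RtoC (/ yp p))%C.
Proof.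
  intros Hp Hs H. pose proof (INR_ge2 p Hp) as Hp2. pose proof (yp_bounds p Hp) as Hy.
  rewrite hfac_factor in H by auto.
  destruct (Ceq_dec (Xp p s) (- RtoC (/ yp p))%C) as [|Hne]; auto. exfalso. revert H. apply Cmult_neq_0.
  - apply Cmult_neq_0.
    + intros E. apply RtoC_inj in E. pose proof (Rinv_0_lt_compat (INR p) ltac:(lra)). lra.
    + intros E. apply Hne. replace (Xp p s) with ((Xp p s + RtoC (/ yp p)) - RtoC (/ yp p))%C by ring. rewrite E. ring.
  - apply C_nz. rewrite Cplus_comm. pose proof (Cmod_rev (RtoC (INR p * yp p)) (Xp p s)) as Q.
    rewrite Cmod_R_pos in Q by nra. pose proof (Cmod_Xp_lt1 p s Hp Hs). nra.
Qed.

Lemma Xp_hfac_zero p s : (2 <= p)%nat -> Xp p s = (- RtoC (/ yp p))%C -> hfac p s = 0.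
Proof. intros Hp H. rewrite hfac_factor, H by auto. ring. Qed.

(* [theta t0 p] is an odd multiple of [PI] within [PI] of [t0 ln p], so [zp t0 p] is a zero of [hfac p] close to [1 + i t0]. *)
Definition odd_m (t0 : R) (p : nat) : Z := (up (t0 * ln (INR p) / (2 * PI)) - 1)%Z.
Definition theta (t0 : R) (p : nat) : R := PI * (2 * IZR (odd_m t0 p) + 1).
Definition zp (t0 : R) (p : nat) : C := (1 + ln (yp p) / ln (INR p), theta t0 p / ln (INR p)).

Lemma theta_near t0 p : Rabs (theta t0 p - t0 * ln (INR p)) <= PI.
Proof.
  pose proof PI_RGT_0. unfold theta, odd_m. rewrite minus_IZR.
  set (v := t0 * ln (INR p) / (2 * PI)). destruct (archimed v) as [H1 H2].
  replace (t0 * ln (INR p)) with (2 * PI * v) by (unfold v; field; lra).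
  apply Rabs_le. nra.
Qed.

Lemma cos_sin_theta t0 p : cos (theta t0 p) = -1 /\ sin (theta t0 p) = 0.
Proof.
  unfold theta. replace (PI * (2 * IZR (odd_m t0 p) + 1)) with (2 * (IZR (odd_m t0 p) * PI) + PI) by ring.
  assert (Hs : sin (IZR (odd_m t0 p) * PI) = 0) by (apply sin_eq_0_1; eexists; reflexivity).
  rewrite neg_cos, neg_sin, cos_2a_sin, sin_2a, Hs. split; ring.
Qed.

Lemma zp_zero t0 p : (2 <= p)%nat -> hfac p (zp t0 p) = 0.
Proof.
  intros Hp. apply Xp_hfac_zero; auto. pose proof (yp_bounds p Hp). pose proof (ln_INR_pos p Hp).
  destruct (cos_sin_theta t0 p) as [Hc Hs].
  unfold Xp, npow.
  replace (- (zp t0 p - 1) * RtoC (ln (INR p)))%C with ((- ln (yp p), - theta t0 p) : C).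
  2: { unfold zp, Cminus, Cplus, Copp, Cmult, RtoC; simpl. f_equal; field; lra. }
  unfold Cexp. simpl. rewrite cos_neg, sin_neg, Hc, Hs, exp_Ropp, exp_ln by lra.
  unfold RtoC, Copp; simpl. f_equal; ring.
Qed.

Lemma ln_yp_pos p : (2 <= p)%nat -> 0 < ln (yp p).
Proof. intros Hp. pose proof (yp_bounds p Hp). rewrite <- ln_1. apply ln_increasing; lra. Qed.

Lemma Re_zp t0 p : Re (zp t0 p) - 1 = ln (yp p) / ln (INR p).
Proof. unfold zp. simpl. ring. Qed.

Lemma Re_zp_gt t0 p : (2 <= p)%nat -> 1 < Re (zp t0 p).
Proof.
  intros Hp. pose proof (Re_zp t0 p). pose proof (ln_yp_pos p Hp). pose proof (ln_INR_pos p Hp).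
  assert (0 < ln (yp p) / ln (INR p)) by (apply Rdiv_lt_0_compat; auto). lra.
Qed.

(** The real parts are strictly decreasing in [p], since [yp] decreases and the logarithm
    increases. *)
Lemma zp_inj t0 p q : (2 <= p)%nat -> (2 <= q)%nat -> zp t0 p = zp t0 q -> p = q.
Proof.
  assert (G : forall p q, (2 <= p < q)%nat -> zp t0 p = zp t0 q -> False).
  { intros p' q' H E. apply (f_equal Re) in E.
    pose proof (Re_zp t0 p') as E1. pose proof (Re_zp t0 q') as E2. rewrite E, E2 in E1.
    pose proof (ln_yp_pos q' ltac:(lia)) as Hq. pose proof (ln_INR_pos p' ltac:(lia)) as Hlp.
    pose proof (yp_bounds q' ltac:(lia)).
    assert (Hy : ln (yp q') < ln (yp p')) by (apply ln_increasing; [lra|apply yp_decr; lia]).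
    assert (Hl : ln (INR p') < ln (INR q')) by (apply ln_increasing; [apply lt_0_INR; lia|apply lt_INR; lia]).
    assert (ln (yp q') / ln (INR q') < ln (yp p') / ln (INR p')); [|lra].
    apply Rlt_trans with (ln (yp p') / ln (INR q')).
    - apply Rmult_lt_compat_r; auto. apply Rinv_0_lt_compat. lra.
    - apply Rmult_lt_compat_l; [lra|]. apply Rinv_lt_contravar; nra. }
  intros Hp Hq E. destruct (Nat.lt_trichotomy p q) as [H|[H|H]]; auto; exfalso.
  - apply (G p q); auto.
  - apply (G q p); auto.
Qed.

Lemma ln4_le : ln 4 <= 2.
Proof.
  rewrite <- (ln_exp 2). apply ln_le; [lra|]. replace 2 with (1 + 1) by ring. rewrite exp_plus.
  pose proof (exp_ineq1_le 1). nra.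
Qed.

Lemma zp_near t0 p : (2 <= p)%nat -> Cmod (zp t0 p - (1, t0)) <= 6 / ln (INR p).
Proof.
  intros Hp. pose proof (ln_INR_pos p Hp) as Hl. pose proof (theta_near t0 p) as Ht.
  pose proof (ln_yp_pos p Hp). pose proof (yp_bounds p Hp).
  replace (zp t0 p - (1, t0))%C with ((ln (yp p) / ln (INR p), (theta t0 p - t0 * ln (INR p)) / ln (INR p)) : C).
  2: { unfold zp, Cminus, Cplus, Copp; simpl. f_equal; field; lra. }
  eapply Rle_trans; [apply Cmod_le_abs|]. unfold Rdiv. rewrite !Rabs_mult, (Rabs_pos_eq (/ ln (INR p))) by (left; apply Rinv_0_lt_compat; auto).
  rewrite <- Rmult_plus_distr_r. apply Rmult_le_compat_r; [left; apply Rinv_0_lt_compat; auto|].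
  (* The 6 is made of [PI <= 4] for the imaginary part and [ln 4 <= 2] for the real part. *)
  rewrite Rabs_pos_eq by lra. pose proof PI_4. pose proof ln4_le.
  assert (ln (yp p) <= ln 4) by (apply ln_le; lra). lra.
Qed.

(** * Most zeros of Euler factors are not cancelled *)

(** From [1 + ln x <= 24 x^(1/24)] comes [(1 + ln x)^12 <= 24^12 sqrt x]. If the primes were too
    few, Chebyshev's bound would give [sqrt x <= R0], so any [x] above [R0^2] does. *)
Lemma primes_beat_polylog (Q : R) (N0 : nat) : 0 <= Q -> exists n, (N0 <= n)%nat /\ (1 <= n)%nat /\
  Q * (1 + ln (INR (2 * n))) ^ 11 < INR (length (filter primeb (seq 1 (2 * n)))).
Proof.
  intros HQ.
  set (R0 := 2 * (Q * 24 ^ 12) / ln 2).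
  pose proof ln2_pos as Hl2.
  assert (HR0 : 0 <= R0).
  { apply Rdiv_le_0_compat; auto. apply Rmult_le_pos; [lra|]. apply Rmult_le_pos; auto. apply pow_le; lra. }
  destruct (INR_unbounded (R0 ^ 2)) as [n1 Hn1].
  set (n := (max 1 (max N0 n1))). exists n. split; [lia|]. split; [lia|].
  assert (Hn : (1 <= n)%nat) by lia.
  set (x := INR (2 * n)).
  assert (Hx : 2 <= x) by (apply INR_ge2; lia).
  assert (Hlx : 0 < ln x) by (apply ln_INR_pos; lia).
  assert (HxR : R0 ^ 2 < x).
  { eapply Rlt_le_trans; [exact Hn1|]. apply le_INR. lia. }
  set (pi := INR (length (filter primeb (seq 1 (2 * n))))).
  assert (Cheb : INR n * ln 2 <= pi * ln x).
  { pose proof (chebyshev n Hn) as C. apply le_INR in C. rewrite !pow_INR in C.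
    change (INR 2) with 2 in C. fold x in C. apply ln_le in C; [|apply pow_lt; lra].
    rewrite !ln_pow in C by lra. exact C. }
  assert (HL : 1 + ln x <= exp (/ 24 * ln x) / / 24).
  { pose proof (exp_ineq1_le (/ 24 * ln x)). unfold Rdiv. rewrite Rinv_inv. lra. }
  assert (HL12 : (1 + ln x) ^ 12 <= 24 ^ 12 * sqrt x).
  { eapply Rle_trans; [apply pow_incr; split; [lra|exact HL]|].
    replace (exp (/ 24 * ln x) / / 24) with (24 * exp (/ 24 * ln x)) by (field).
    rewrite Rpow_mult_distr. apply Rmult_le_compat_l; [apply pow_le; lra|]. right.
    rewrite <- Rpower_sqrt by lra. unfold Rpower.
    rewrite <- (Rpower_pow 12) by apply exp_pos. unfold Rpower. rewrite ln_exp. f_equal. simpl. field. }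
  apply Rnot_le_lt. intros Hle. fold x in Hle. fold pi in Hle.
  assert (K : INR n * ln 2 <= Q * (24 ^ 12 * sqrt x)).
  { eapply Rle_trans; [exact Cheb|].
    apply Rle_trans with (Q * (1 + ln x) ^ 11 * (1 + ln x)).
    - apply Rmult_le_compat; try lra. apply pos_INR.
    - replace (Q * (1 + ln x) ^ 11 * (1 + ln x)) with (Q * (1 + ln x) ^ 12) by ring.
      apply Rmult_le_compat_l; auto. }
  assert (Hnx : INR n = x / 2) by (unfold x; rewrite mult_INR; change (INR 2) with 2; field).
  assert (Hsq : sqrt x * sqrt x = x) by (apply sqrt_sqrt; lra).
  assert (Hs0 : 0 < sqrt x) by (apply sqrt_lt_R0; lra).
  rewrite Hnx, <- Hsq in K.
  assert (K2 : sqrt x * ln 2 <= 2 * (Q * 24 ^ 12)).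
  { apply Rmult_le_reg_r with (sqrt x); auto. 
    replace (sqrt x * ln 2 * sqrt x) with (2 * (sqrt x * sqrt x / 2 * ln 2)) by field. 
    replace (sqrt (sqrt x * sqrt x)) with (sqrt x) in K by (rewrite Hsq; reflexivity). lra. }
  assert (K3 : sqrt x <= R0).
  { unfold R0. apply Rmult_le_reg_r with (ln 2); auto. unfold Rdiv. rewrite Rmult_assoc, Rinv_l by lra. lra. }
  assert (x <= R0 ^ 2) by (rewrite <- Hsq; simpl; nra). lra.
Qed.

Lemma pigeonhole_bound {A : Type} (Bad : nat -> A -> Prop) (M : R) (I : nat) : 0 <= M ->
  forall l : list A, (forall x, In x l -> exists i, (i < I)%nat /\ Bad i x) ->
  NoDup l ->
  (forall i l', (i < I)%nat -> NoDup l' -> (forall x, In x l' -> In x l /\ Bad i x) -> INR (length l') <= M) ->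
  INR (length l) <= INR I * M.
Proof.
  intros HM. induction I as [|I IH]; intros l Hl Hnd Hc.
  - destruct l as [|a l]; [simpl; lra|]. destruct (Hl a (or_introl eq_refl)) as [i [Hi _]]. lia.
  - set (f := fun x => if excluded_middle_informative (Bad I x) then true else false).
    rewrite (filter_length_split f), plus_INR, S_INR.
    assert (H1 : INR (length (filter f l)) <= M).
    { apply (Hc I); [lia|apply NoDup_filter, Hnd|].
      intros x Hx. apply filter_In in Hx. destruct Hx as [Hx Hfx]. split; auto. unfold f in Hfx.
      destruct (excluded_middle_informative (Bad I x)); [auto|discriminate]. }
    assert (H2 : INR (length (filter (fun x => negb (f x)) l)) <= INR I * M).
    { apply IH.
      - intros x Hx. apply filter_In in Hx. destruct Hx as [Hx Hfx]. unfold f in Hfx.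
        destruct (excluded_middle_informative (Bad I x)); [discriminate|].
        destruct (Hl x Hx) as [i [Hi Hb]]. exists i. split; auto.
        assert (i <> I) by congruence. lia.
      - apply NoDup_filter, Hnd.
      - intros i l' Hi Hnd' Hl'. apply (Hc i); auto.
        intros x Hx. destruct (Hl' x Hx) as [H3 H4]. split; auto. apply filter_In in H3. tauto. }
    lra.
Qed.

(** The arguments at which zeta enters [FK K], in one numbering: [wk k s] has index [k + 2], so
    those with [k <= 2K] and the three shifts fill the indices below [2K + 3]. *)
Definition psi (i : nat) (s : C) : C :=
  match i with O => s | 1%nat => (s - 1)%C | 2%nat => (s - 2)%C | S (S (S k)) => wk (S k) s end.

Lemma wk_inj k s s' : wk (S k) s = wk (S k) s' -> s = s'.
Proof.
  unfold wk. intros E. apply Ceq_mult_l in E.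
  - replace s with ((s - 1) + 1)%C by ring. rewrite E. ring.
  - intros E'. apply RtoC_inj in E'. pose proof (lt_0_INR (S k) ltac:(lia)). lra.
Qed.

Lemma psi_inj i s s' : psi i s = psi i s' -> s = s'.
Proof.
  destruct i as [|[|[|k]]]; simpl; auto; intros E.
  - replace s with ((s - 1) + 1)%C by ring. rewrite E. ring.
  - replace s with ((s - 2) + 2)%C by ring. rewrite E. ring.
  - apply (wk_inj k), E.
Qed.

(** A single [K], chosen from [ln (2n)], serves for all primes up to [2n]. If all those beyond [P0]
    were bad, then for each map [psi i] injectivity would turn the primes spoilt by it into distinct
    zeros of [Phi], at heights linear in [ln (2n)]. Counting these for every [i] contradicts
    [primes_beat_polylog]. *)
Lemma good_zeros (t0 : R) (P0 : nat) : exists p K, primeb p = true /\ (P0 < p)%nat /\ goodK K (zp t0 p).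
Proof.
  apply NNPP. intros Hno.
  destruct total_count as [Kc [HKc Htc]].
  (* A bound for the heights of all [zp t0 p], as [6 / ln p <= 12] for [p >= 2]. *)
  set (U := Rabs t0 + 16). assert (HU : 16 <= U) by (pose proof (Rabs_pos t0); unfold U; lra).
  pose proof ln2_pos as Hl2. pose proof ln_lt_2 as Hl2'.
  (* all constants absorbed so that the number of bad primes up to [2n] is at most [Q (1 + ln 2n)^11] *)
  set (Q := INR P0 + 13 * (Kc * (9 * U) ^ 10)).
  assert (HU10 : 0 < (9 * U) ^ 10) by (apply pow_lt; lra).
  assert (HQ : 0 <= Q).
  { unfold Q. pose proof (pos_INR P0). assert (0 < Kc * (9 * U) ^ 10) by (apply Rmult_lt_0_compat; auto). lra. }
  destruct (primes_beat_polylog Q 1 HQ) as [n [Hn [_ Hlt]]].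
  set (x := INR (2 * n)) in *. assert (Hx : 2 <= x) by (apply INR_ge2; lia).
  set (L := 1 + ln x) in *. assert (HlL : 1 <= L) by (unfold L; assert (0 < ln x) by (apply ln_INR_pos; lia); lra).
  (* For [p <= x] the real part of [zp t0 p] exceeds 1 by at least [ln 2 / ln x], so this [K] puts
     all these zeros in the domain [okK K]. *)
  set (K := Z.to_nat (up (ln x / ln 2))).
  destruct (archimed (ln x / ln 2)) as [A1 A2].
  assert (Hlx : 0 < ln x) by (apply ln_INR_pos; lia).
  assert (Hq : 0 < ln x / ln 2) by (apply Rdiv_lt_0_compat; auto).
  assert (HK : INR K = IZR (up (ln x / ln 2))).
  { unfold K. rewrite INR_IZR_INZ, Z2Nat.id; auto. apply le_IZR. lra. }
  assert (HKlo : ln x / ln 2 < INR K) by lra.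
  assert (HKhi : INR K <= 2 * L).
  { assert (ln x / ln 2 <= 2 * ln x); [|unfold L; lra].
    apply Rmult_le_reg_r with (ln 2); auto. unfold Rdiv. rewrite Rmult_assoc, Rinv_l by lra. nra. }
  assert (HK1 : (1 <= K)%nat).
  { apply INR_le. simpl. rewrite HK. apply (IZR_le 1). apply Z.lt_succ_r. 
    assert (0 < up (ln x / ln 2))%Z by (apply lt_IZR; lra). lia. }
  set (T := 2 * INR K * U).
  assert (HT : U <= T).
  { unfold T. apply (le_INR 1) in HK1. simpl in HK1. nra. }
  set (M := Kc * (T + 1) ^ 10).
  assert (HM : 0 <= M) by (apply Rmult_le_pos; [lra|apply pow_le; lra]).
  set (l := filter (fun p => andb (primeb p) (Nat.ltb P0 p)) (seq 1 (2 * n))).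
  assert (Hl : forall p, In p l -> (2 <= p)%nat /\ (p <= 2 * n)%nat /\ primeb p = true /\ (P0 < p)%nat).
  { intros p Hp. apply filter_In in Hp. destruct Hp as [H1 H2]. apply in_seq in H1.
    apply andb_prop in H2. destruct H2 as [H2 H3]. apply Nat.ltb_lt in H3.
    pose proof (primeb_ge2 p H2). repeat split; auto; lia. }
  assert (Hnd : NoDup l) by apply NoDup_filter, seq_NoDup.
  assert (Hok : forall p, In p l -> okK K (zp t0 p)).
  { intros p Hp. destruct (Hl p Hp) as [H1 [H2 [H3 H4]]]. split; [apply Re_zp_gt, H1|].
    rewrite Re_zp, S_INR. pose proof (yp_bounds p H1). pose proof (ln_INR_pos p H1) as Hlp.
    assert (B1 : ln 2 < ln (yp p)) by (apply ln_increasing; lra).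
    assert (B2 : ln (INR p) <= ln x) by (apply ln_le; [apply lt_0_INR; lia|apply le_INR; lia]).
    assert (B3 : ln 2 / ln x <= ln (yp p) / ln (INR p)).
    { apply Rmult_le_compat; try lra; [left; apply Rinv_0_lt_compat; auto|apply Rinv_le_contravar; auto]. }
    assert (B4 : 1 < INR K * (ln 2 / ln x)).
    { apply Rmult_lt_compat_r with (r := ln 2 / ln x) in HKlo; [|apply Rdiv_lt_0_compat; auto].
      replace (ln x / ln 2 * (ln 2 / ln x)) with 1 in HKlo by (field; lra). exact HKlo. }
    assert (0 < ln 2 / ln x) by (apply Rdiv_lt_0_compat; auto).
    pose proof (pos_INR K). nra. }
  assert (HIm : forall p, In p l -> Rabs (Im (zp t0 p)) <= U).
  { intros p Hp. destruct (Hl p Hp) as [H1 _]. pose proof (zp_near t0 p H1) as Hz.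
    pose proof (Im_le_Cmod (zp t0 p - (1, t0))) as Hi. rewrite im_minus in Hi. simpl Im in Hi at 2.
    assert (6 / ln (INR p) <= 12).
    { assert (ln 2 <= ln (INR p)) by (apply ln_le; [lra|apply INR_ge2, H1]).
      apply Rmult_le_reg_r with (ln (INR p)); [lra|]. unfold Rdiv. rewrite Rmult_assoc, Rinv_l by lra. lra. }
    pose proof (Rabs_triang (Im (zp t0 p) - t0) t0) as Ht.
    replace (Im (zp t0 p) - t0 + t0) with (Im (zp t0 p)) in Ht by ring. unfold U. lra. }
  assert (Hcount : INR (length l) <= INR (2 * K + 3) * M).
  { apply (pigeonhole_bound (fun i p => Phi (psi i (zp t0 p)) = 0) M (2 * K + 3) HM l); auto.
    - intros p Hp. destruct (Hl p Hp) as [H1 [H2 [H3 H4]]].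
      apply NNPP. intros Hb. apply Hno. exists p, K. split; auto. split; auto.
      assert (Hb' : forall i, (i < 2 * K + 3)%nat -> Phi (psi i (zp t0 p)) <> 0).
      { intros i Hi E. apply Hb. exists i. split; auto. }
      split; [apply Hok, Hp|]. split; [apply (Hb' 0%nat); lia|]. split; [apply (Hb' 1%nat); lia|].
      split; [apply (Hb' 2%nat); lia|]. intros k Hk. destruct k as [|k]; [lia|].
      apply (Hb' (S (S (S k)))). lia.
    - intros i l' Hi Hnd' Hl'.
      rewrite <- (length_map (fun p => psi i (zp t0 p)) l'). apply Htc; [lra| |].
      + apply NoDup_map_NoDup_ForallPairs; auto. intros p q Hp Hq' E. apply psi_inj in E.
        destruct (Hl' p Hp) as [Hp' _]. destruct (Hl' q Hq') as [Hq'' _].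
        apply (zp_inj t0); auto; [apply Hl, Hp'|apply Hl, Hq''].
      + intros w Hw. apply in_map_iff in Hw. destruct Hw as [p [<- Hp]].
        destruct (Hl' p Hp) as [Hp' Hphi]. destruct (Hok p Hp') as [O1 O2]. pose proof (HIm p Hp') as O3.
        destruct i as [|[|[|k]]]; cbn [psi] in *.
        * split; [lra|]. split; auto. lra.
        * rewrite re_minus, im_minus. simpl Re at 2. simpl Im at 2. rewrite Rminus_0_r. split; [lra|]. split; auto. lra.
        * rewrite re_minus, im_minus. simpl Re at 2. simpl Im at 2. rewrite Rminus_0_r. split; [lra|]. split; auto. lra.
        * rewrite Re_wk. split; [pose proof (pos_INR (S k)); nra|]. split; auto.
          unfold wk. rewrite im_scal_l, im_minus. simpl Im at 2. rewrite Rminus_0_r, Rabs_mult, Rabs_pos_eq by apply pos_INR.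
          unfold T. apply Rmult_le_compat; auto; [apply pos_INR|apply Rabs_pos|].
          change 2 with (INR 2). rewrite <- mult_INR. apply le_INR. lia. }
  assert (Hpi : INR (length (filter primeb (seq 1 (2 * n)))) <= INR P0 + INR (length l)).
  { rewrite <- plus_INR. apply le_INR.
    rewrite (filter_length_split (fun p => Nat.ltb P0 p) (filter primeb (seq 1 (2 * n)))).
    assert (E1 : (length (filter (fun p => Nat.ltb P0 p) (filter primeb (seq 1 (2 * n)))) <= length l)%nat).
    { apply NoDup_incl_length; [apply NoDup_filter, NoDup_filter, seq_NoDup|].
      intros p Hp. apply filter_In in Hp. destruct Hp as [Hp H2]. apply filter_In in Hp. destruct Hp as [H0 H1].
      apply filter_In. split; auto. apply andb_true_intro. split; auto. }
    assert (E2 : (length (filter (fun p => negb (Nat.ltb P0 p)) (filter primeb (seq 1 (2 * n)))) <= P0)%nat).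
    { apply Nat.le_trans with (length (seq 1 P0)); [|rewrite length_seq; lia].
      apply NoDup_incl_length; [apply NoDup_filter, NoDup_filter, seq_NoDup|].
      intros p Hp. apply filter_In in Hp. destruct Hp as [Hp H2]. apply filter_In in Hp. destruct Hp as [H0 H1].
      apply in_seq in H0. apply Bool.negb_true_iff, Nat.ltb_ge in H2. apply in_seq. lia. }
    lia. }
  (* As [K <= 2 L], both [T + 1] and [2K + 3] are linear in [L]: ten powers come from the count of
     zeros and one from the number of maps. *)
  assert (HMb : INR (2 * K + 3) * M <= 13 * (Kc * (9 * U) ^ 10) * L ^ 11).
  { assert (HT1 : T + 1 <= 9 * U * L) by (unfold T; nra).
    assert (HT10 : (T + 1) ^ 10 <= (9 * U) ^ 10 * L ^ 10).
    { rewrite <- Rpow_mult_distr. apply pow_incr. lra. }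
    assert (H2K : INR (2 * K + 3) <= 13 * L).
    { assert (E3 : INR 3 = 3) by (simpl; ring). rewrite plus_INR, mult_INR, E3. change (INR 2) with 2. lra. }
    unfold M.
    replace (13 * (Kc * (9 * U) ^ 10) * L ^ 11) with (13 * L * (Kc * ((9 * U) ^ 10 * L ^ 10))) by ring.
    apply Rmult_le_compat; auto; [apply pos_INR|]. apply Rmult_le_compat_l; lra. }
  assert (HL11 : 1 <= L ^ 11) by (apply pow_R1_Rle; lra).
  assert (INR P0 <= INR P0 * L ^ 11) by (pose proof (pos_INR P0); nra).
  unfold Q in Hlt. lra.
Qed.

(** * Divergence to the left of the abscissa *)

Lemma csum_block_lower (f : nat -> C) (om : C) (b : R) (M J : nat) :
  (forall j, (j < J)%nat -> b <= Re (om * f (M + j)%nat)) ->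
  INR J * b <= Re (om * (csum f (M + J) - csum f M)).
Proof.
  induction J as [|J IH]; intros H.
  - rewrite Nat.add_0_r. replace (om * (csum f M - csum f M))%C with (RtoC 0) by ring. simpl. lra.
  - rewrite Nat.add_succ_r. simpl csum.
    replace (om * (csum f (M + J) + f (M + J)%nat - csum f M))%C with
      (om * (csum f (M + J) - csum f M) + om * f (M + J)%nat)%C by ring.
    rewrite re_plus, S_INR. pose proof (IH ltac:(auto)). pose proof (H J ltac:(lia)). lra.
Qed.

(* On a block [M < n <= (1+c) M] the argument of [n^(-s)] is nearly constant, so nothing cancels. *)
Lemma dirichlet_diverges (f : nat -> R) (s l : C) : (forall n, (1 <= n)%nat -> INR n ^ 2 <= f n) ->
  Re s < 3 -> ~ is_clim (csum (dterm f s)) l.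
Proof.
  intros Hf Hs Hl. destruct s as [sg t]. simpl in Hs.
  (* The terms are at least [n^(-a)] in modulus with [0 <= a < 1], so a block of length proportional
     to [m] contributes on the order of [m^(1-a)]. *)
  set (a := Rmax 0 (sg - 2)). assert (Ha0 : 0 <= a) by apply Rmax_l. assert (Ha1 : sg - 2 <= a) by apply Rmax_r.
  assert (Ha : a < 1) by (apply Rmax_lub_lt; lra).
  (* Over a block of ratio [1 + c] the argument turns by at most [|t| c <= 1/3], where the cosine is
     at least 2/3. *)
  set (c := / (3 * (Rabs t + 1))). pose proof (Rabs_pos t) as Ht.
  assert (Hc : 0 < c) by (apply Rinv_0_lt_compat; lra).
  assert (Hct : Rabs t * c <= / 3).
  { apply Rmult_le_reg_r with (3 * (Rabs t + 1)); [lra|]. unfold c. rewrite Rmult_assoc, Rinv_l by lra. lra. }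
  assert (Hc1 : c <= 1).
  { unfold c. rewrite <- Rinv_1. apply Rinv_le_contravar; lra. }
  destruct (Hl (1 / 2)) as [N0 HN0]; [lra|].
  (* This value makes [c W / 6] equal to 2, above the bound 1 that convergence imposes on a
     block. *)
  set (W := 12 / c). assert (HW : 0 < W) by (apply Rdiv_lt_0_compat; lra).
  destruct (INR_unbounded (Rmax (2 / c) (exp (ln W / (1 - a))))) as [n1 Hn1].
  set (M := max N0 n1). set (m := INR (S M)).
  assert (Hm : INR n1 < m).
  { unfold m. rewrite S_INR. assert (INR n1 <= INR M) by (apply le_INR; unfold M; lia). lra. }
  assert (Hm1 : 2 / c < m) by (eapply Rle_lt_trans; [apply Rmax_l|eapply Rlt_trans; eauto]).
  assert (Hm2 : exp (ln W / (1 - a)) < m) by (eapply Rle_lt_trans; [apply Rmax_r|eapply Rlt_trans; eauto]).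
  assert (Hm0 : 0 < m) by (apply lt_0_INR; lia).
  assert (Hmone : 1 <= m) by (unfold m; rewrite S_INR; pose proof (pos_INR M); lra).
  destruct (archimed (c * m)) as [A1 A2].
  set (J := Z.to_nat (up (c * m) - 1)).
  assert (Hcm : 2 < c * m).
  { apply Rmult_lt_compat_l with (r := c) in Hm1; auto. replace (c * (2 / c)) with 2 in Hm1 by (field; lra). exact Hm1. }
  assert (HJ : INR J = IZR (up (c * m)) - 1).
  { unfold J. rewrite INR_IZR_INZ, Z2Nat.id, minus_IZR; [reflexivity|]. apply le_IZR. rewrite minus_IZR. lra. }
  assert (HJ1 : INR J <= c * m) by lra. assert (HJ2 : c * m / 2 <= INR J) by lra.
  (* The rotation by [m^(it)], which makes the first term of the block real and positive. *)
  set (om := Cexp (RtoC (t * ln m) * Ci)).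
  assert (Hom : Cmod om = 1).
  { unfold om. rewrite Cmod_Cexp, re_mult_Ci. simpl. rewrite Ropp_0. apply exp_0. }
  set (b := 2 / 3 * exp (- a * ln (2 * m))).
  assert (Hblock : INR J * b <= Re (om * (csum (dterm f (sg, t)) (M + J) - csum (dterm f (sg, t)) M))).
  { apply csum_block_lower. intros j Hj. unfold dterm.
    set (x := INR (S (M + j))). assert (Hx : x = m + INR j) by (unfold x, m; rewrite !S_INR, plus_INR; ring).
    pose proof (pos_INR j) as Hj0. assert (HjJ : INR j <= INR J) by (apply le_INR; lia).
    assert (Hx0 : 0 < x) by lra. assert (Hx2 : x <= 2 * m) by nra.
    assert (Hlx : 0 <= ln x) by (rewrite <- ln_1; apply ln_le; lra).
    set (d := ln x - ln m).
    assert (Hd : 0 <= d <= c).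
    { unfold d. split; [assert (ln m <= ln x) by (apply ln_le; lra); lra|].
      rewrite <- ln_div by lra. pose proof (exp_ineq1_le (ln (x / m))) as Q.
      rewrite exp_ln in Q by (apply Rdiv_lt_0_compat; lra).
      assert (x / m <= 1 + c); [|lra]. apply Rmult_le_reg_r with m; auto. unfold Rdiv. rewrite Rmult_assoc, Rinv_l by lra. lra. }
    assert (E : (om * (RtoC (f (S (M + j))) * npow x (sg, t)))%C =
       (RtoC (f (S (M + j)) * exp (- sg * ln x)) * (cos (t * d), (- sin (t * d))%R))%C).
    { replace (om * (RtoC (f (S (M + j))) * npow x (sg, t)))%C with
        (RtoC (f (S (M + j))) * (om * npow x (sg, t)))%C by ring.
      rewrite RtoC_mult, <- Cmult_assoc. f_equal. unfold om, npow. rewrite <- Cexp_plus.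
      replace (RtoC (t * ln m) * Ci + - (sg, t) * RtoC (ln x))%C with ((- sg * ln x, - (t * d)) : C).
      2: { unfold d, Ci, RtoC, Cplus, Cmult, Copp; simpl. f_equal; ring. }
      unfold Cexp. simpl. rewrite cos_neg, sin_neg. unfold RtoC, Cmult; simpl. f_equal; ring. }
    rewrite E, re_scal_l. simpl Re.
    assert (Hcos : 2 / 3 <= cos (t * d)).
    { assert (Htd : Rabs (t * d) <= / 3).
      { rewrite Rabs_mult, (Rabs_pos_eq d) by lra. eapply Rle_trans; [|apply Hct]. apply Rmult_le_compat_l; lra. }
      pose proof (cos_sq_bound (t * d) ltac:(lra)) as Q. rewrite <- (pow2_abs (t * d)) in Q.
      apply Rabs_le_between in Q. pose proof (Rabs_pos (t * d)). nra. }
    assert (Hcoef : exp (- a * ln (2 * m)) <= f (S (M + j)) * exp (- sg * ln x)).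
    { apply Rle_trans with (x ^ 2 * exp (- sg * ln x)).
      - replace (x ^ 2) with (exp (2 * ln x)).
        2: { replace (2 * ln x) with (ln x + ln x) by ring. rewrite exp_plus, exp_ln by auto. ring. }
        rewrite <- exp_plus. apply exp_le.
        assert (ln x <= ln (2 * m)) by (apply ln_le; lra). nra.
      - apply Rmult_le_compat_r; [left; apply exp_pos|]. apply Hf. lia. }
    unfold b. pose proof (exp_pos (- a * ln (2 * m))). nra. }
  assert (Hup : Re (om * (csum (dterm f (sg, t)) (M + J) - csum (dterm f (sg, t)) M)) < 1).
  { eapply Rle_lt_trans; [apply Rle_abs|]. eapply Rle_lt_trans; [apply re_le_Cmod|]. rewrite Cmod_mult, Hom, Rmult_1_l.
    pose proof (HN0 (M + J)%nat ltac:(unfold M; lia)) as Q1. pose proof (HN0 M ltac:(unfold M; lia)) as Q2.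
    replace (csum (dterm f (sg, t)) (M + J) - csum (dterm f (sg, t)) M)%C with
      ((csum (dterm f (sg, t)) (M + J) - l) + - (csum (dterm f (sg, t)) M - l))%C by ring.
    eapply Rle_lt_trans; [apply Cmod_triangle|]. rewrite Cmod_opp. lra. }
  (* the lower bound is [c m / 3 * (2m)^(-a) >= c m^(1-a) / 6 > 2] *)
  assert (Hbig : W < exp ((1 - a) * ln m)).
  { rewrite <- (exp_ln W) at 1 by auto. apply exp_increasing.
    assert (ln W / (1 - a) < ln m).
    { rewrite <- (ln_exp (ln W / (1 - a))). apply ln_increasing; auto. apply exp_pos. }
    apply Rmult_lt_compat_l with (r := 1 - a) in H; [|lra].
    replace ((1 - a) * (ln W / (1 - a))) with (ln W) in H by (field; lra). exact H. }
  assert (Hb : exp ((1 - a) * ln m) <= m * (2 * exp (- a * ln (2 * m)))).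
  { rewrite ln_mult by lra. 
    replace (- a * (ln 2 + ln m)) with (- a * ln 2 + - a * ln m) by ring.
    replace ((1 - a) * ln m) with (ln m + - a * ln m) by ring.
    rewrite !exp_plus, exp_ln by auto.
    assert (1 <= 2 * exp (- a * ln 2)).
    { rewrite <- (exp_ln 2) at 1 by lra. rewrite <- exp_plus. rewrite <- exp_0 at 1. apply exp_le.
      pose proof ln2_pos. nra. }
    pose proof (exp_pos (- a * ln m)). 
    replace (m * (2 * (exp (- a * ln 2) * exp (- a * ln m)))) with (m * exp (- a * ln m) * (2 * exp (- a * ln 2))) by ring.
    assert (0 < m * exp (- a * ln m)) by (apply Rmult_lt_0_compat; auto). nra. }
  assert (Hfin : c * W / 6 < INR J * b).
  { apply Rlt_le_trans with (c * m / 2 * b).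
    - unfold b. apply Rlt_le_trans with (c / 6 * (m * (2 * exp (- a * ln (2 * m))))).
      + replace (c * W / 6) with (c / 6 * W) by field. apply Rmult_lt_compat_l; lra.
      + right. field.
    - apply Rmult_le_compat_r; auto. unfold b. pose proof (exp_pos (- a * ln (2 * m))). lra. }
  assert (c * W / 6 = 2) by (unfold W; field; lra). lra.
Qed.

(** * The natural boundary *)

Lemma eq_by_continuity (h : C -> C) (z : C) : Ccont h z ->
  @locally' C_UniformSpace z (fun w => h w = 0) -> h z = 0.
Proof.
  intros Hc Hl. apply locally'_C_eps in Hl. destruct Hl as [d [Hd Hl]].
  apply Cmod_eq_0. destruct (Req_dec (Cmod (h z)) 0) as [|Hne]; auto. exfalso.
  assert (Hp : 0 < Cmod (h z)) by (pose proof (Cmod_ge_0 (h z)); lra).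
  rewrite Ccont_eps in Hc. specialize (Hc _ Hp). apply locally_C_eps in Hc. destruct Hc as [e [He Hc]].
  set (r := Rmin d e / 2). assert (Hr : 0 < r) by (apply Rdiv_lt_0_compat; [apply Rmin_pos; auto|lra]).
  assert (r < d) by (pose proof (Rmin_l d e); unfold r in *; lra).
  assert (r < e) by (pose proof (Rmin_r d e); unfold r in *; lra).
  assert (Hw : Cmod (z + RtoC r - z) = r).
  { replace (z + RtoC r - z)%C with (RtoC r) by ring. apply Cmod_R_pos. lra. }
  assert (Hwz : (z + RtoC r)%C <> z).
  { intros E. rewrite E in Hw. replace (z - z)%C with (RtoC 0) in Hw by ring. rewrite Cmod_0 in Hw. lra. }
  specialize (Hl (z + RtoC r)%C ltac:(lra) Hwz). specialize (Hc (z + RtoC r)%C ltac:(lra)).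
  rewrite Hl in Hc. replace (0 - h z)%C with (- h z)%C in Hc by ring. rewrite Cmod_opp in Hc. lra.
Qed.

(** A vertical move keeps [|Xp p s|] and only rotates [Xp p s]; it leads from a zero to nearby
    points where no Euler factor vanishes. *)
Definition vshift (s : C) (t : R) : C := (s + RtoC t * Ci)%C.

Lemma Re_vshift s t : Re (vshift s t) = Re s.
Proof. unfold vshift. rewrite re_plus, re_scal_l. simpl. ring. Qed.

Lemma vshift_near s t : 0 <= t -> Cmod (vshift s t - s) = t.
Proof.
  intros Ht. unfold vshift. replace (s + RtoC t * Ci - s)%C with (RtoC t * Ci)%C by ring.
  rewrite Cmod_mult, Cmod_Ci, Cmod_R_pos by auto. ring.
Qed.

(** The two values differ by a rotation through an angle strictly between 0 and [PI], whose sine is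
    not 0. *)
Lemma Xp_vshift_inj p s t1 t2 : (2 <= p)%nat -> t2 < t1 -> (t1 - t2) * ln (INR p) < PI ->
  Xp p (vshift s t1) = Xp p (vshift s t2) -> False.
Proof.
  intros Hp Ht Hpi E. pose proof (ln_INR_pos p Hp) as Hl.
  set (u := ((t1 - t2) * ln (INR p))).
  assert (Hu : 0 < u) by (apply Rmult_lt_0_compat; lra).
  assert (E1 : Xp p (vshift s t1) = (Xp p (vshift s t2) * Cexp (0, (- u)%R))%C).
  { unfold Xp, npow. rewrite <- Cexp_plus. f_equal. unfold vshift, u, Cplus, Cminus, Copp, Cmult, RtoC, Ci. destruct s. simpl. f_equal; ring. }
  assert (E2 : Cexp (0, - u) = 1).
  { apply (Ceq_mult_l (Xp p (vshift s t2))); [apply npow_neq_0|]. rewrite <- E1, E. ring. }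
  apply (f_equal Im) in E2. unfold Cexp in E2. simpl in E2. rewrite exp_0, sin_neg in E2.
  pose proof (sin_gt_0 u Hu Hpi). lra.
Qed.

(** At every zero [Xp] takes the same value [-1 / yp p], so a segment of length [PI / ln p] contains
    at most one zero. *)
Lemma hfac_vshift_neq_0 p s : (2 <= p)%nat -> 1 < Re s ->
  exists d, 0 < d /\ forall t, 0 < t < d -> hfac p (vshift s t) <> 0.
Proof.
  intros Hp Hs. pose proof (ln_INR_pos p Hp) as Hl. pose proof PI_RGT_0 as Hpi.
  assert (G : forall t1 t2, 0 < t2 < t1 -> t1 < PI / ln (INR p) ->
    hfac p (vshift s t1) = 0 -> hfac p (vshift s t2) = 0 -> False).
  { intros t1 t2 H12 H1 Z1 Z2. apply (Xp_vshift_inj p s t1 t2); auto; [lra| |].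
    - apply Rlt_trans with (t1 * ln (INR p)); [apply Rmult_lt_compat_r; lra|].
      apply Rmult_lt_compat_r with (r := ln (INR p)) in H1; auto. unfold Rdiv in H1.
      rewrite Rmult_assoc, Rinv_l in H1 by lra. lra.
    - rewrite !hfac_zero_Xp; auto; rewrite Re_vshift; auto. }
  destruct (classic (exists t1, 0 < t1 < PI / ln (INR p) /\ hfac p (vshift s t1) = 0)) as [[t1 [H1 Z1]]|Hno].
  - exists t1. split; [lra|]. intros t Ht Z. apply (G t1 t); auto; lra.
  - exists (PI / ln (INR p)). split; [apply Rdiv_lt_0_compat; auto|].
    intros t Ht Z. apply Hno. exists t. auto.
Qed.

(** For large [p] the modulus of [Xp], the same for all [t], is below 1/4, while at a zero it is
    [1 / yp p > 1/4]. Only finitely many primes then need a bound on [t]. *)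
Lemma hfac_large_neq_0 s : 1 < Re s -> exists P, forall p t, (P <= p)%nat -> (2 <= p)%nat -> hfac p (vshift s t) <> 0.
Proof.
  intros Hs. destruct (INR_unbounded (exp (2 / (Re s - 1)))) as [P HP]. exists P. intros p t Hp H2 Z.
  apply hfac_zero_Xp in Z; auto; [|rewrite Re_vshift; auto].
  pose proof (yp_bounds p H2). apply (f_equal Cmod) in Z.
  rewrite Cmod_opp, Cmod_Xp, Re_vshift, Cmod_R_pos in Z by (left; apply Rinv_0_lt_compat; lra).
  assert (Hlp : 2 / (Re s - 1) < ln (INR p)).
  { rewrite <- (ln_exp (2 / (Re s - 1))). apply ln_increasing; [apply exp_pos|].
    eapply Rlt_le_trans; [exact HP|]. apply le_INR, Hp. }
  assert (Hlt : exp (- (Re s - 1) * ln (INR p)) < exp (- (2))).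
  { apply exp_increasing. apply Rmult_lt_compat_l with (r := Re s - 1) in Hlp; [|lra].
    replace ((Re s - 1) * (2 / (Re s - 1))) with 2 in Hlp by (field; lra). lra. }
  assert (He : exp (- (2)) <= / 4).
  { rewrite exp_Ropp. apply Rinv_le_contravar; [lra|]. replace 2 with (1 + 1) by ring. rewrite exp_plus.
    pose proof (exp_ineq1_le 1). nra. }
  assert (/ 4 < / yp p) by (apply Rinv_lt_contravar; lra). lra.
Qed.

Lemma hfac_all_neq_0 s : 1 < Re s -> exists d, 0 < d /\ forall t p, 0 < t < d -> primeb p = true -> hfac p (vshift s t) <> 0.
Proof.
  intros Hs. destruct (hfac_large_neq_0 s Hs) as [P HP].
  assert (G : forall Q, exists d, 0 < d /\ forall t p, 0 < t < d -> (2 <= p < Q)%nat -> hfac p (vshift s t) <> 0).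
  { induction Q as [|Q [d [Hd IH]]]; [exists 1; split; [lra|intros; lia]|].
    destruct (le_lt_dec 2 Q) as [H2|H2].
    - destruct (hfac_vshift_neq_0 Q s H2 Hs) as [e [He H]]. exists (Rmin d e). split; [apply Rmin_pos; auto|].
      intros t p Ht Hp. pose proof (Rmin_l d e). pose proof (Rmin_r d e).
      destruct (Nat.eq_dec p Q) as [->|]; [apply H; lra|apply IH; [lra|lia]].
    - exists d. split; auto. intros t p Ht Hp. lia. }
  destruct (G P) as [d [Hd H]]. exists d. split; auto. intros t p Ht Hp. pose proof (primeb_ge2 p Hp).
  destruct (le_lt_dec P p); [apply HP; auto|apply H; auto].
Qed.

Lemma goodK_open K s : goodK K s -> exists d, 0 < d /\ forall w, Cmod (w - s) < d -> goodK K w.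
Proof.
  intros [HK [G0 [G1 [G2 Gk]]]].
  assert (NZ : forall (k b : R), -7 < k * Re s + b -> Phi (RtoC k * s + RtoC b)%C <> 0 ->
     exists d, 0 < d /\ forall w, Cmod (w - s) < d -> Phi (RtoC k * w + RtoC b)%C <> 0).
  { intros k b Hr Hn. apply (hol_neq_0_near (fun w => Phi (RtoC k * w + RtoC b)%C) s); auto.
    apply (Ccont_comp (fun w => RtoC k * w + RtoC b)%C Phi).
    - apply Ccont_plus; [|apply Ccont_const]. apply Ccont_mult; [apply Ccont_const|apply Ccont_id].
    - apply hol_cont, hol_Phi. rewrite re_plus, re_scal_l. exact Hr. }
  assert (Hs : 1 < Re s) by apply HK.
  assert (E1 : forall b w, (RtoC 1 * w + RtoC (- b) = w - RtoC b)%C) by (intros; rewrite RtoC_opp; ring).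
  assert (NZ1 : forall b : R, b <= 2 -> Phi (s - RtoC b)%C <> 0 ->
     exists d, 0 < d /\ forall w, Cmod (w - s) < d -> Phi (w - RtoC b)%C <> 0).
  { intros b Hb Hn. rewrite <- E1 in Hn. destruct (NZ 1 (Ropp b)) as [d [Hd H]]; auto; [lra|].
    exists d. split; auto. intros w Hw. rewrite <- E1. apply H, Hw. }
  assert (E0 : forall w : C, (w - RtoC 0)%C = w) by (intros; ring).
  destruct (NZ1 0) as [d0 [Hd0 H0]]; [lra|rewrite E0; auto|].
  destruct (NZ1 1) as [d1 [Hd1 H1]]; [lra|auto|].
  destruct (NZ1 2) as [d2 [Hd2 H2]]; [lra|auto|].
  assert (HM : forall m, (m <= 2 * K)%nat -> exists d, 0 < d /\ forall w, Cmod (w - s) < d -> forall k, (1 <= k <= m)%nat -> Phi (wk k w) <> 0).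
  { induction m as [|m IH]; intros Hm; [exists 1; split; [lra|intros; lia]|].
    destruct (IH ltac:(lia)) as [d [Hd H]].
    destruct (NZ (INR (S m)) (- INR (S m))) as [e [He H']].
    - pose proof (pos_INR (S m)). nra.
    - rewrite wk_affine. apply Gk. lia.
    - exists (Rmin d e). split; [apply Rmin_pos; auto|]. intros w Hw k Hk.
      pose proof (Rmin_l d e). pose proof (Rmin_r d e).
      destruct (Nat.eq_dec k (S m)) as [->|]; [rewrite <- wk_affine; apply H'; lra|apply H; [lra|lia]]. }
  destruct (HM (2 * K)%nat (Nat.le_refl _)) as [dm [Hdm Hm]].
  assert (Hok : exists d, 0 < d /\ forall w, Cmod (w - s) < d -> okK K w).
  { destruct HK as [K1 K2]. pose proof (lt_0_INR (S K) ltac:(lia)) as HS.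
    exists (Rmin (Re s - 1) ((INR (S K) * (Re s - 1) - 1) / INR (S K))). split.
    { apply Rmin_pos; [lra|]. apply Rdiv_lt_0_compat; lra. }
    intros w Hw. pose proof (Rmin_l (Re s - 1) ((INR (S K) * (Re s - 1) - 1) / INR (S K))).
    pose proof (Rmin_r (Re s - 1) ((INR (S K) * (Re s - 1) - 1) / INR (S K))) as Hmin.
    set (r := Rmin _ _) in *. apply Re_near in Hw. split; [lra|].
    apply Rmult_le_compat_l with (r := INR (S K)) in Hmin; [|lra].
    replace (INR (S K) * ((INR (S K) * (Re s - 1) - 1) / INR (S K))) with (INR (S K) * (Re s - 1) - 1) in Hmin by (field; lra).
    assert (INR (S K) * (Re s - r) < INR (S K) * Re w) by (apply Rmult_lt_compat_l; lra). lra. }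
  destruct Hok as [dk [Hdk Hk]].
  exists (Rmin (Rmin (Rmin d0 d1) (Rmin d2 dm)) dk). split; [repeat apply Rmin_pos; auto|].
  intros w Hw.
  pose proof (Rmin_l (Rmin (Rmin d0 d1) (Rmin d2 dm)) dk). pose proof (Rmin_r (Rmin (Rmin d0 d1) (Rmin d2 dm)) dk).
  pose proof (Rmin_l (Rmin d0 d1) (Rmin d2 dm)). pose proof (Rmin_r (Rmin d0 d1) (Rmin d2 dm)).
  pose proof (Rmin_l d0 d1). pose proof (Rmin_r d0 d1). pose proof (Rmin_l d2 dm). pose proof (Rmin_r d2 dm).
  split; [apply Hk; lra|]. split; [|split; [|split]].
  - rewrite <- (E0 w). apply H0. lra.
  - apply H1. lra.
  - apply H2. lra.
  - apply Hm. lra.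
Qed.

Section boundary.
Variables (ap an : nat -> nat) (gq : nat -> C -> C).
Hypothesis Hgq : forall k, int_poly (gq k).
Hypothesis Hfac : forall k X, ((1 + RtoC 2 * X) * cprod (fun j => qfac (ap j) (an j) j X) k = 1 + X ^ S k * gq k X)%C.

Lemma Fext_natural_boundary : natural_boundary_at 1 (Fext ap an).
Proof.
  intros z0 Hz0 [V [G [HV [HVz [HG HFG]]]]].
  set (F := Fext ap an) in *.
  pose proof (HG z0 HVz) as Hm. apply meromorphic_at_mero in Hm.
  destruct Hm as [n [g [rho1 [Hrho1 [Hg HGg]]]]].
  pose proof (HV z0 HVz) as HVl. apply locally_C_eps in HVl. destruct HVl as [rho2 [Hrho2 HVb]].
  set (rho := Rmin rho1 rho2). assert (Hrho : 0 < rho) by (apply Rmin_pos; auto).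
  assert (Hr1 : rho <= rho1) by apply Rmin_l. assert (Hr2 : rho <= rho2) by apply Rmin_r.
  (* The hypothesis on [G] gives equality on punctured neighbourhoods only; at good points both
     sides are continuous, so it extends to the point itself. *)
  assert (Hbase : forall K s, goodK K s -> Cmod (s - z0) < rho -> g s = (F s * (s - z0) ^ n)%C).
  { intros K s Hgood Hs. destruct (goodK_FK ap an gq Hgq Hfac K s Hgood) as [HcF _].
    assert (Hs1 : 1 < Re s) by apply Hgood.
    assert (Hsz : s <> z0) by (intros ->; lra).
    symmetry. apply Ceq_minus.
    apply (eq_by_continuity (fun w => F w * (w - z0) ^ n - g w)%C).
    - apply Ccont_minus; [|apply hol_cont, Hg; lra]. apply Ccont_mult; auto. apply Ccont_pow.
      apply Ccont_minus; [apply Ccont_id|apply Ccont_const].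
    - pose proof (HFG s (conj (HVb s ltac:(lra)) Hs1)) as Hl. apply locally'_C_eps in Hl.
      destruct Hl as [d [Hd Hl]]. apply locally'_C_eps.
      exists (Rmin d (Rmin (rho - Cmod (s - z0)) (Cmod (s - z0)))).
      assert (Hp : 0 < Cmod (s - z0)) by (apply Cmod_gt_0, Cminus_eq_contra, Hsz).
      split; [repeat apply Rmin_pos; lra|]. intros w Hw Hne.
      pose proof (Rmin_l d (Rmin (rho - Cmod (s - z0)) (Cmod (s - z0)))).
      pose proof (Rmin_r d (Rmin (rho - Cmod (s - z0)) (Cmod (s - z0)))).
      pose proof (Rmin_l (rho - Cmod (s - z0)) (Cmod (s - z0))). pose proof (Rmin_r (rho - Cmod (s - z0)) (Cmod (s - z0))).
      assert (Hwz : w <> z0).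
      { intros ->. rewrite Cmod_minus_sym in Hw. lra. }
      rewrite Hl, HGg; auto; try lra.
      + assert ((w - z0) ^ n <> 0)%C by (apply Cpow_nz, Cminus_eq_contra, Hwz). field. auto.
      + replace (w - z0)%C with ((w - s) + (s - z0))%C by ring. eapply Rle_lt_trans; [apply Cmod_triangle|]. lra. }
  set (t0 := Im z0).
  assert (Ez0 : z0 = (1, t0)) by (unfold t0; rewrite <- Hz0; apply surjective_pairing).
  (* Beyond [P1] the distance [6 / ln p] of [zp_near] is below [rho / 8]. *)
  destruct (INR_unbounded (exp (48 / rho))) as [P1 HP1].
  assert (Hclose : forall p, (2 <= p)%nat -> (P1 <= p)%nat -> Cmod (zp t0 p - z0) < rho / 8).
  { intros p H2 Hp. rewrite Ez0. eapply Rle_lt_trans; [apply zp_near, H2|].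
    assert (Hlp : 48 / rho < ln (INR p)).
    { rewrite <- (ln_exp (48 / rho)). apply ln_increasing; [apply exp_pos|].
      eapply Rlt_le_trans; [exact HP1|]. apply le_INR, Hp. }
    assert (Hq : 0 < 48 / rho) by (apply Rdiv_lt_0_compat; lra).
    apply Rlt_le_trans with (6 / (48 / rho)); [|right; field; lra].
    apply Rmult_lt_compat_l; [lra|]. apply Rinv_lt_contravar; [apply Rmult_lt_0_compat; lra|lra]. }
  assert (Hzeros : forall P, exists p, (P < p)%nat /\ (2 <= p)%nat /\ Cmod (zp t0 p - z0) < rho / 8 /\ g (zp t0 p) = 0).
  { intros P. destruct (good_zeros t0 (max P P1)) as [p [K [Hp [HPp Hgood]]]].
    pose proof (primeb_ge2 p Hp) as H2.
    assert (Hcl : Cmod (zp t0 p - z0) < rho / 8) by (apply Hclose; auto; lia).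
    exists p. split; [lia|]. split; auto. split; auto.
    rewrite (Hbase K); auto; [|lra].
    destruct (goodK_FK ap an gq Hgq Hfac K _ Hgood) as [_ [HF0 _]].
    unfold F. rewrite (HF0 p Hp (zp_zero t0 p H2)). ring. }
  (* A nonzero value of [g] near [z0]: move up slightly from a good zero, keeping the point good and
     every Euler factor nonzero. *)
  assert (Hq : exists q, Cmod (q - z0) < rho / 8 /\ g q <> 0).
  { destruct (good_zeros t0 P1) as [p [K [Hp [HPp Hgood]]]].
    pose proof (primeb_ge2 p Hp) as H2.
    assert (Hcl : Cmod (zp t0 p - z0) < rho / 8) by (apply Hclose; auto; lia).
    set (s := zp t0 p) in *. assert (Hs : 1 < Re s) by apply Hgood.
    destruct (goodK_open K s Hgood) as [d1 [Hd1 H1]]. destruct (hfac_all_neq_0 s Hs) as [d2 [Hd2 Hh]].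
    set (t := Rmin (Rmin d1 d2) (rho / 8 - Cmod (s - z0)) / 2).
    assert (Hmin : 0 < Rmin (Rmin d1 d2) (rho / 8 - Cmod (s - z0))) by (repeat apply Rmin_pos; lra).
    pose proof (Rmin_l (Rmin d1 d2) (rho / 8 - Cmod (s - z0))). pose proof (Rmin_r (Rmin d1 d2) (rho / 8 - Cmod (s - z0))).
    pose proof (Rmin_l d1 d2). pose proof (Rmin_r d1 d2).
    assert (Ht : 0 < t) by (unfold t; lra).
    pose proof (vshift_near s t ltac:(lra)) as Hv.
    assert (Hgq' : goodK K (vshift s t)) by (apply H1; rewrite Hv; unfold t; lra).
    assert (Hvz : Cmod (vshift s t - z0) < rho / 8).
    { replace (vshift s t - z0)%C with ((vshift s t - s) + (s - z0))%C by ring.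
      eapply Rle_lt_trans; [apply Cmod_triangle|]. rewrite Hv. unfold t. lra. }
    exists (vshift s t). split; auto. rewrite (Hbase K); auto; [|lra].
    destruct (goodK_FK ap an gq Hgq Hfac K _ Hgq') as [_ [_ HFn]].
    apply Cmult_neq_0.
    - apply HFn. intros p' Hp'. apply Hh; auto. split; auto. unfold t. lra.
    - apply Cpow_nz, Cminus_eq_contra. intros E. pose proof (Re_vshift s t) as Q. rewrite E, Hz0 in Q. lra. }
  destruct Hq as [q [Hqz Hgq0]].
  (* The zeros and [q] lie within [rho / 8] of [z0], hence within [rho / 4] of each other, and the
     disc of radius [7 rho / 8] about [q] stays in the domain of [g]. *)
  destruct (zeros_finite g q (rho / 4) (7 * rho / 8)) as [N HN].
  { intros z Hz. apply Hg. replace (z - z0)%C with ((z - q) + (q - z0))%C by ring.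
    eapply Rle_lt_trans; [apply Cmod_triangle|]. lra. }
  { lra. }
  { exact Hgq0. }
  assert (Hlist : forall m, exists l, NoDup l /\ length l = m /\
    forall p, In p l -> (2 <= p)%nat /\ Cmod (zp t0 p - z0) < rho / 8 /\ g (zp t0 p) = 0).
  { induction m as [|m [l [H1 [H2 H3]]]].
    - exists nil. split; [constructor|]. split; auto. intros p [].
    (* A prime above all those in the list is a new one. *)
    - destruct (Hzeros (list_max l)) as [p [Hp Hp']].
      exists (p :: l). split; [|split; [simpl; lia|]].
      + constructor; auto. intros Hin.
        pose proof (proj1 (list_max_le l (list_max l)) (Nat.le_refl _)) as Hmax.
        rewrite Forall_forall in Hmax. specialize (Hmax p Hin). lia.
      + intros p' [<-|Hin]; auto. }
  destruct (Hlist (S N)) as [l [H1 [H2 H3]]].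
  assert (length (map (zp t0) l) <= N)%nat; [|rewrite length_map in *; lia].
  apply HN.
  - apply NoDup_map_NoDup_ForallPairs; auto. intros p p' Hp Hp' E. apply (zp_inj t0); auto; apply H3; auto.
  - intros a Ha. apply in_map_iff in Ha. destruct Ha as [p [<- Hp]]. destruct (H3 p Hp) as [_ [Hc Hz]]. split; auto.
    replace (zp t0 p - q)%C with ((zp t0 p - z0) + - (q - z0))%C by ring.
    eapply Rle_trans; [apply Cmod_triangle|]. rewrite Cmod_opp. lra.
Qed.

End boundary.

Theorem theorem4p1 (X : Type) (T : X -> X)
  (Tfin : finitely_many_orbits T)
  (Tzeta : forall s : C, 1 < Re s -> is_dirichlet (orbit_coeff T) s (zeta s)) :
  is_abscissa_of_convergence (orbit_coeff (cube_map T)) 3 /\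
  exists F : C -> C,
    meromorphic_on (half_plane 1) F /\
    (forall s : C, 3 < Re s -> is_dirichlet (orbit_coeff (cube_map T)) s (F s)) /\
    natural_boundary_at 1 F.
Proof.
  pose proof (orbit_coeff_one T Tzeta) as Tone.
  set (oc := orbit_count (cube_map T)).
  assert (Hoc : forall n, (1 <= n)%nat -> divsum (fun d => d * oc d)%nat n = (divsum (fun d => d) n ^ 3)%nat).
  { intros n Hn. unfold divsum. rewrite map_id. apply (cube_orbit_count_sum T Tfin Tone n Hn). }
  assert (Hlow : forall n, (1 <= n)%nat -> INR n ^ 2 <= orbit_coeff (cube_map T) n).
  { intros n Hn. pose proof (cube_orbit_count_lower T Tfin Tone n Hn) as H. apply le_INR in H.
    rewrite mult_INR in H. unfold orbit_coeff. simpl. lra. }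
  destruct factor_seq as [ap [an [gq [Hgq Hfac]]]].
  assert (Hsum : forall s : C, 3 < Re s -> is_dirichlet (orbit_coeff (cube_map T)) s (Fext ap an s)).
  { intros s Hs. pose proof (oc_dabs oc s Hoc Hs) as Ha. apply is_dirichlet_clim.
    rewrite (Fext_dsum ap an gq Hgq Hfac (orbit_coeff (cube_map T)) s Hs Ha).
    - apply dsum_lim, Ha.
    - unfold orbit_coeff. fold oc. rewrite (oc_1 oc Hoc). reflexivity.
    - intros p Hp. apply (oc_fac_at oc Hoc p Hp). }
  split; [split|].
  - intros s Hs. exists (Fext ap an s). apply Hsum, Hs.
  - intros s Hs [l Hl]. apply is_dirichlet_clim in Hl. revert Hl. apply dirichlet_diverges; auto.
  - exists (Fext ap an). split; [|split; auto].
    + intros z Hz. apply meromorphic_at_mero. apply (mero_Fext ap an gq Hgq Hfac z Hz).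
    + apply (Fext_natural_boundary ap an gq Hgq Hfac).
Qed.
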